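(* Let $E_0\in BV(\Omega,\{0,1\})$ be nonempty and bounded, let $\beta\in L^\infty(\partial\Omega)$ be such that $-1\le\beta\le1-2\kappa$ $\mathcal H^n$-a.e. on $\partial\Omega$ for some $\kappa\in(0,\frac12]$, and let $\lambda\ge1$. Then the minimum problem $$\inf_{E\in BV(\Omega,\{0,1\})}\mathcal A_\beta(E,E_0,\lambda)$$ has a solution $E_\lambda$. Moreover, any minimizer is contained in $C_{R_0}^H=\hat B_{R_0}\times(0,H)$.
   Context: Let $n\ge1$, $\Omega=\mathbb R^n\times(0,+\infty)\subset\mathbb R^{n+1}$, and identify $\partial\Omega$ with $\mathbb R^n$. $BV(\Omega,\{0,1\})$ is the collection of measurable $E\subseteq\Omega$ with $\chi_E\in BV(\Omega)$, $P(E,\Omega)=\int_\Omega|D\chi_E|$, $P(E)=P(E,\mathbb R^{n+1})$. Each set is identified with its set of points of Lebesgue density one. On $\partial\Omega$, $\chi_E$ denotes the trace of $E$. Capillary functional: $\mathcal C_\beta(E,\Omega)=P(E,\Omega)-\int_{\partial\Omega}\beta\chi_E\,d\mathcal H^n$. For $F\subseteq\Omega$, $d_F(x)=\mathrm{dist}(x,\Omega\cap\partial F)$, and $\mathcal A_\beta(E,E_0,\lambda)=\mathcal C_\beta(E,\Omega)+\lambda\int_{E\Delta E_0}d_{E_0}\,dx$. $\hat B_\rho\subset\mathbb R^n$ is the open ball of radius $\rho$ centered at the origin. $H=1+\max\{x_{n+1}:x\in\overline{E_0}\}$, and $D>0$ is such that $E_0\subseteq\hat B_D\times(0,H)$. Finally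 $$R_0=D+1+\max\Big\{8^{n^2+n+1}\Big(\frac{P(E_0)}\kappa\Big)^{\frac{n+1}n},\,4\mu(\kappa,n)\Big\},\qquad\mu(\kappa,n)=\Big(\frac1\kappa+2\Big)^{\frac{n+1}n}.$$ *)

(* Defs.v *)
From HB Require Import structures.
From mathcomp Require Import all_boot all_order all_algebra.
From mathcomp Require Import all_classical all_reals all_analysis.
From mathcomp Require Import measurable_realfun.
Set Implicit Arguments.
Unset Strict Implicit.
Unset Printing Implicit Defensive.
Import Order.TTheory GRing.Theory Num.Theory.
Import numFieldNormedType.Exports.
Local Open Scope classical_set_scope.
Local Open Scope ring_scope.

(** R^m is ['rV[R]_m]. Its library norm is the sup norm, which gives the usual
    topology; distances and balls below are Euclidean. *)

Fact borel_display : measure_display. Proof. exact: default_measure_display. Qed.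

Section borel_rV.
Context (R : realType) (m : nat).
Let B : set (set 'rV[R]_m) := <<s @open 'rV[R]_m >>.
Let B0 : B set0. Proof. exact: sigma_algebra0. Qed.
Let BC A : B A -> B (~` A). Proof. exact: sigma_algebraC. Qed.
Let BU (F : (set 'rV[R]_m)^nat) :
  (forall i, B (F i)) -> B (\bigcup_i F i).
Proof. exact: sigma_algebra_bigcup. Qed.
HB.instance Definition _ := isMeasurable.Build borel_display 'rV[R]_m B0 BC BU.
End borel_rV.

Section coordinates.
Context {R : realType} {m : nat}.

(** R^(m+1) = R^m x R, the second factor being the last coordinate. *)
Definition rcons_rV (y : 'rV[R]_m) (t : R) : 'rV[R]_m.+1 :=
  \row_j oapp (y 0) t (unlift ord_max j).
Definition horiz (x : 'rV[R]_m.+1) : 'rV[R]_m := \row_i x 0 (lift ord_max i).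
Definition height (x : 'rV[R]_m.+1) : R := x 0 ord_max.

Lemma horizK y t : horiz (rcons_rV y t) = y.
Proof. by apply/rowP => i; rewrite !mxE liftK. Qed.

Lemma heightK y t : height (rcons_rV y t) = t.
Proof. by rewrite /height mxE unlift_none. Qed.

Lemma open_measurable_rV k (U : set 'rV[R]_k) : open U -> measurable U.
Proof. exact: sub_sigma_algebra. Qed.

Lemma measurable_rcons_rV :
  measurable_fun setT
    (fun p : 'rV[R]_m * measurableTypeR R => rcons_rV p.1 p.2).
Proof.
apply: (@measurability _ _ _ _ _ _ (@open 'rV[R]_m.+1)) => //.
move=> _ [U oU <-]; rewrite setTI.
pose V (q : 'rV[rat]_m * rat) (k : nat) : set ('rV[R]_m * measurableTypeR R) :=
  ball (map_mx ratr q.1 : 'rV[R]_m) k.+1%:R^-1 `*` ball (ratr q.2 : R) k.+1%:R^-1.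
pose W (i : ('rV[rat]_m * rat) * nat) : set ('rV[R]_m * measurableTypeR R) :=
  if `[< V i.1 i.2 `<=` [set p | U (rcons_rV p.1 p.2)] >] then V i.1 i.2
  else set0.
suff -> : (fun p : 'rV[R]_m * measurableTypeR R => rcons_rV p.1 p.2) @^-1` U
    = \bigcup_i W i.
  apply: countable_bigcupT_measurable => [|i]; first exact: countableP.
  rewrite /W; case: asboolP => // _; rewrite /V; apply: measurableX.
  - by apply: open_measurable_rV; exact: ball_open.
  - exact: measurable_ball.
apply/seteqP; split => [[y t] /= Uyt|[y t] [i _]]; last first.
  by rewrite /W; case: asboolP => // VU /VU.
have [e /= e0 eU] : nbhs_ball (rcons_rV y t) U.
  by apply/nbhs_ballP; exact: open_nbhs_nbhs.
have [k _ /(_ k (leqnn k)) ke] : \forall k \near \oo, k.+1%:R^-1 < e / 2 :> R.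
  by near=> k; near: k; exact: near_infty_natSinv_lt (PosNum (divr_gt0 e0 (ltr0n _ 2))).
have k0 : 0 < k.+1%:R^-1 :> R by rewrite invr_gt0.
have ratP (s : R) : exists q : rat, ball (ratr q : R) k.+1%:R^-1 s.
  have /rat_in_itvoo[q] : s - k.+1%:R^-1 < s + k.+1%:R^-1 by rewrite ltrD2l gtrN.
  rewrite in_itv/= => /andP[q1 q2]; exists q.
  by rewrite /ball/= ltr_distl q1 q2.
have [q qy] : exists q : 'rV[rat]_m, forall j, ball (ratr (q 0 j) : R) k.+1%:R^-1 (y 0 j).
  have [f fP] := choice (fun j => ratP (y 0 j)).
  by exists (\row_j f j) => j; rewrite mxE.
have [s st] := ratP t.
have Vyt : V (q, s) k (y, t).
  by split=> //=; split=> // i j; rewrite mxE ord1.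
exists ((q, s), k) => //; rewrite /W /=; case: asboolP => // nV; exfalso.
apply: nV => -[y' t'] [[_ /= qy'] /= st']; apply: eU; split => // i j.
have hb (a b c : R) : ball a k.+1%:R^-1 b -> ball a k.+1%:R^-1 c -> ball b e c.
  move=> ab ac; apply: (@le_ball _ _ b (k.+1%:R^-1 + k.+1%:R^-1)); first by rewrite [leRHS]splitr lerD ?ltW.
  by apply: ball_triangle ac; exact: ball_sym.
rewrite ord1 !mxE; case: unliftP => [j' _|_] /=; last exact: hb st st'.
by apply: hb (qy j') _; have := qy' 0 j'; rewrite mxE.
Unshelve. all: by end_near. Qed.

Lemma continuous_horiz : continuous horiz.
Proof.
move=> x A /nbhs_ballP[e /= e0 eA]; apply/nbhs_ballP; exists e => //= z [_ xz].
by apply: eA; split=> // i j; rewrite !mxE; exact: xz.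
Qed.

Lemma measurable_horiz : measurable_fun setT horiz.
Proof.
apply: (@measurability _ _ _ _ _ _ (@open 'rV[R]_m)) => // _ [U oU <-].
rewrite setTI; apply: open_measurable_rV.
by apply: open_comp oU => x _; exact: continuous_horiz.
Qed.

Lemma measurable_height :
  measurable_fun setT (height : _ -> measurableTypeR R).
Proof.
apply: (@measurability _ _ _ (measurableTypeR R) setT height (@RGenOpens.G R)).
  exact: RGenOpens.measurableE.
move=> _ [_ [a [b ->]] <-]; rewrite setTI; apply: open_measurable_rV.
by apply: open_comp (@itv_open _ _ a b) => x _; exact: coord_continuous.
Qed.

End coordinates.

Section lebesgue_rV.
Context {R : realType}.
Local Open Scope ereal_scope.

Section step.
Context (m : nat) (mu : {sigma_finite_measure set 'rV[R]_m -> \bar R}).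

Let f (p : 'rV[R]_m * measurableTypeR R) := rcons_rV p.1 p.2.

Definition lebesgue_rV_step : set 'rV[R]_m.+1 -> \bar R :=
  pushforward (mu \x @lebesgue_measure R) f.

Let mf A : measurable A -> measurable (f @^-1` A).
Proof. by move=> mA; rewrite -[X in measurable X]setTI; exact: measurable_rcons_rV. Qed.

Let step0 : lebesgue_rV_step set0 = 0.
Proof. by rewrite /lebesgue_rV_step /pushforward preimage_set0 measure0. Qed.

Let step_ge0 A : 0 <= lebesgue_rV_step A.
Proof. by rewrite /lebesgue_rV_step /pushforward; exact: measure_ge0. Qed.

Let step_sigma_additive : semi_sigma_additive lebesgue_rV_step.
Proof.
move=> F mF tF mUF; rewrite /lebesgue_rV_step /pushforward preimage_bigcup.
apply: measure_semi_sigma_additive => [n||]; first exact: mf.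
- apply/trivIsetP => /= i j _ _ ij; rewrite -preimage_setI.
  by move/trivIsetP : tF => /(_ _ _ _ _ ij) -> //; rewrite preimage_set0.
- by rewrite -preimage_bigcup; exact: mf.
Qed.

HB.instance Definition _ := isMeasure.Build _ _ _ lebesgue_rV_step
  step0 step_ge0 step_sigma_additive.

Let step_sigma_finite : sigma_finite setT lebesgue_rV_step.
Proof.
have /sigma_finiteP[F [TF ndF Foo]] := sigma_finiteT mu.
have /sigma_finiteP[G [TG ndG Goo]] := sigma_finiteT (@lebesgue_measure R).
pose g (x : 'rV[R]_m.+1) : 'rV[R]_m * measurableTypeR R := (horiz x, height x).
have fK p : g (f p) = p by case: p => y t; rewrite /g /f/= horizK heightK.
have mg : measurable_fun setT g.
  by apply: measurable_fun_pair; [exact: measurable_horiz|exact: measurable_height].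
exists (fun k => g @^-1` (F k `*` G k)).
  apply/esym; rewrite -subTset => x _.
  have [i _ Fi] : (\bigcup_k F k) (horiz x) by rewrite -TF.
  have [j _ Gj] : (\bigcup_k G k) (height x) by rewrite -TG.
  exists (maxn i j) => //; split => /=.
  - by move: Fi; exact/subsetPset/ndF/leq_maxl.
  - by move: Gj; exact/subsetPset/ndG/leq_maxr.
move=> k; have [mF Fk] := Foo k; have [mG Gk] := Goo k; split.
  by rewrite -[X in measurable X]setTI; apply: mg => //; exact: measurableX.
rewrite /lebesgue_rV_step /pushforward.
have -> : f @^-1` (g @^-1` (F k `*` G k)) = F k `*` G k.
  by apply/seteqP; split => p; rewrite /preimage/= !horizK !heightK.
by rewrite product_measure1E// lte_mul_pinfty// ge0_fin_numE.
Qed.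

HB.instance Definition _ := Measure_isSigmaFinite.Build _ _ _ lebesgue_rV_step
  step_sigma_finite.

End step.

Fixpoint lebesgue_rV (m : nat) : {sigma_finite_measure set 'rV[R]_m -> \bar R} :=
  match m with
  | 0%N => [the {sigma_finite_measure set _ -> \bar R} of
              \d_(0%R : 'rV[R]_0)]
  | k.+1 => lebesgue_rV_step (lebesgue_rV k)
  end.

End lebesgue_rV.

Section euclidean.
Context {R : realType} {m : nat}.
Implicit Types (x y : 'rV[R]_m) (A : set 'rV[R]_m).

Definition enorm x : R := Num.sqrt (\sum_i x 0 i ^+ 2).

Definition eball x (r : R) : set 'rV[R]_m := [set y | enorm (y - x) < r].

Definition edist x A : R := inf [set enorm (x - y) | y in A].

Definition frontier A : set 'rV[R]_m := closure A `\` A°.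

Definition density_points A : set 'rV[R]_m :=
  [set x | (fun r => fine (lebesgue_rV m (A `&` eball x r)) /
                     fine (lebesgue_rV m (eball x r))) @ 0^'+ --> (1 : R)].

End euclidean.

Section bounded_variation.
Context {R : realType} {m : nat}.
Implicit Types (U E : set 'rV[R]_m) (u : 'rV[R]_m -> R).

Definition divergence (phi : 'rV[R]_m -> 'rV[R]_m) (x : 'rV[R]_m) : R :=
  \sum_i ('D_(delta_mx 0 i) phi x) 0 i.

(** C^1 vector fields with compact support in [U] and |phi| <= 1 pointwise *)
Definition test_fields U : set ('rV[R]_m -> 'rV[R]_m) :=
  [set phi | [/\ forall i, (forall x, derivable phi x (delta_mx 0 i)) /\
                           continuous ('D_(delta_mx 0 i) phi),
                 compact (closure [set x | phi x != 0]),
                 closure [set x | phi x != 0] `<=` U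
               & forall x, enorm (phi x) <= 1]].

(** the total variation of the distributional gradient of [u] on the open
    set [U] *)
Definition gradient_variation u U : \bar R :=
  ereal_sup [set (\int[lebesgue_rV m]_(x in U) (u x * divergence phi x)%:E)%E
            | phi in test_fields U].

Definition BV U : set ('rV[R]_m -> R) :=
  [set u | (lebesgue_rV m).-integrable U (EFin \o u) /\ (gradient_variation u U < +oo)%E].

Definition perimeter E U : \bar R := gradient_variation (\1_E) U.

(** Sets are identified with their set of density-one points, so each class of
    Lebesgue measurable sets modulo null sets is represented by that set, which
    is Borel; hence Borel measurability loses no generality here. *)
Definition BVset U : set (set 'rV[R]_m) :=
  [set E | [/\ measurable E, E `<=` U, BV U (\1_E) & density_points E = E]].

End bounded_variation.

Section capillary.
Context {R : realType} {n : nat}.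
Implicit Types (E F : set 'rV[R]_n.+1) (beta : 'rV[R]_n -> R).

Definition halfspace : set 'rV[R]_n.+1 := [set x | 0 < height x].

(** The boundary of the half-space is identified with R^n, on which H^n is the
    Lebesgue measure. The trace of a BV function [u] is defined at almost every
    boundary point [y] by the vanishing of the rescaled L^1 distance from [u] to
    the constant [l] on small half-balls; such an [l] is unique, and [get]
    returns a dummy value when there is none. *)
Definition trace (u : 'rV[R]_n.+1 -> R) (y : 'rV[R]_n) : R :=
  get [set l : R |
    (fun r => r ^- n.+1 *
       \int[lebesgue_rV n.+1]_(x in halfspace `&` eball (rcons_rV y 0) r)
         `|u x - l|) @ 0^'+ --> (0 : R)].

Definition capillary beta E : \bar R :=
  (perimeter E halfspace
   - \int[lebesgue_rV n]_y (beta y * trace (\1_E) y)%:E)%E.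

Definition dist_bdry F (x : 'rV[R]_n.+1) : R :=
  edist x (halfspace `&` frontier F).

Definition Afun beta E (E0 : set 'rV[R]_n.+1) (lambda : R) : \bar R :=
  (capillary beta E
   + lambda%:E * \int[lebesgue_rV n.+1]_(x in E `+` E0) (dist_bdry E0 x)%:E)%E.

Definition is_minimizer beta (E0 : set 'rV[R]_n.+1) (lambda : R) E :=
  BVset halfspace E /\
  forall F, BVset halfspace F -> (Afun beta E E0 lambda <= Afun beta F E0 lambda)%E.

Definition cylinder (rho h : R) : set 'rV[R]_n.+1 :=
  [set x | eball 0 rho (horiz x) /\ 0 < height x < h].

(** [sup] is a maximum for nonempty bounded [E0]. *)
Definition H_of (E0 : set 'rV[R]_n.+1) : R := 1 + sup [set height x | x in closure E0].

Definition mu_of (kappa : R) : R := (kappa^-1 + 2) `^ (n.+1%:R / n%:R).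

(** The perimeter of [E0] in R^(n+1) is finite for bounded [E0] in
    [BVset halfspace]. *)
Definition R0_of (kappa D : R) (E0 : set 'rV[R]_n.+1) : R :=
  D + 1 + Num.max
    (8 ^+ (n ^ 2 + n + 1) *
       (fine (perimeter E0 setT) / kappa) `^ (n.+1%:R / n%:R))
    (4 * mu_of kappa).

End capillary.
Arguments mu_of {R} n kappa.

(* Main.v *)
(* Mollifying one of the two sets in the pairing of a set with a test field gives
   lower semicontinuity, submodularity, and the cut and translation estimates for
   the perimeter without any structure theory of sets of finite perimeter. The
   trace of [E] is read off the short vertical segments above the boundary, so
   that the capillary energy is the limit of energies [J_s] on [{height > s}],
   which inherit submodularity.
   Existence: along a minimizing sequence, submodularity makes the intersections
   and unions of its tails almost minimal, and they converge monotonically.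
   Height: cutting [E] at the top of [E0] does not increase the capillary energy
   and strictly decreases the penalty.
   Width: with [g r = |E \ tube r|^(1/(n+1))], cutting at radius [r] and the
   isoperimetric inequality in the half-space, whose constant is spoilt by
   the boundary by a factor [kappa] only, give a differential inequality that forces
   [g] to vanish within a distance controlled by [P(E0) / kappa]. *)
Require Import Defs.
From mathcomp Require Import all_boot all_order all_algebra.
From mathcomp Require Import all_classical all_reals all_analysis.
From mathcomp Require Import measurable_realfun lra.
Set Implicit Arguments.
Unset Strict Implicit.
Unset Printing Implicit Defensive.
Import Order.TTheory GRing.Theory Num.Theory.
Import numFieldNormedType.Exports.
Local Open Scope classical_set_scope.
Local Open Scope ring_scope.

(** The trace is not continuous under convergence in volume. The remedy is an inequality: replacing
    the trace integral by an average over a strip of height [s] costs at most the perimeter in the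
    slab of height [2 * s], and [capS s] leaves this slab out. Hence [capS s] lies below the energy
    and tends to it, so estimates for perimeters and volume integrals transfer to the energy:
    submodularity, cuts, lower semicontinuity, invariance under null sets. No coarea formula selects
    good radii for lateral cuts. At each radius, either the volume outside the tube drops fast over
    all short annuli, or there are arbitrarily short annuli with little volume, and a smooth cutoff
    across them makes a cheap cut. Minimality, coercivity and the isoperimetric inequality exclude
    the latter; the former, at every radius, is a Dini differential inequality. The constants are
    crude: the cutoff has slope about 2/e where a sharp cut would need 1/e, and the isoperimetric
    inequality comes from averaging over translations. [numeric] checks that [8 ^+ (n ^ 2 + n + 1)]
    covers the loss. *)

Section rV_measurability.
Context {R : realType}.

Lemma rcons_rVK m (x : 'rV[R]_m.+1) : rcons_rV (horiz x) (height x) = x.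
Proof.
apply/rowP => j; rewrite mxE; case: unliftP => [j' ->|->] /=; last by [].
by rewrite mxE.
Qed.

Lemma measurable_fun_rV d (T : measurableType d) m (f : T -> 'rV[R]_m) :
  (forall j, measurable_fun setT (fun t => f t 0 j)) -> measurable_fun setT f.
Proof.
elim: m f => [|m IH] f mf.
  rewrite (_ : f = cst 0); first exact: measurable_cst.
  by apply/funext => t; rewrite thinmx0.
have -> : f = (fun p => rcons_rV p.1 p.2) \o (fun t => (horiz (f t), height (f t))).
  by apply/funext => t /=; rewrite rcons_rVK.
apply: measurableT_comp; first exact: measurable_rcons_rV.
apply: measurable_fun_pair; last exact: mf.
apply: IH => j; apply: eq_measurable_fun (mf (lift ord_max j)) => t _.
by rewrite mxE.
Qed.

Lemma continuous_measurable_rV m (f : 'rV[R]_m -> R) :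
  continuous f -> measurable_fun setT f.
Proof.
move=> cf.
apply: (@measurability _ _ _ (measurableTypeR R) setT f (@RGenOpens.G R)).
  exact: RGenOpens.measurableE.
move=> _ [_ [a [b ->]] <-]; rewrite setTI; apply: open_measurable_rV.
by apply: open_comp (@itv_open _ _ a b) => x _; exact: cf.
Qed.

Lemma measurable_coord m (j : 'I_m) :
  measurable_fun setT (fun x : 'rV[R]_m => x 0 j).
Proof. by apply: continuous_measurable_rV => x; exact: coord_continuous. Qed.

Lemma measurable_addrV d (T : measurableType d) m (f g : T -> 'rV[R]_m) :
  measurable_fun setT f -> measurable_fun setT g ->
  measurable_fun setT (fun t => f t + g t).
Proof.
move=> mf mg; apply: measurable_fun_rV => j.
under eq_fun do rewrite mxE.
apply: measurable_funD.
- exact: (measurableT_comp (measurable_coord j) mf).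
- exact: (measurableT_comp (measurable_coord j) mg).
Qed.

Lemma measurable_scalerV d (T : measurableType d) m (a : T -> R) (f : T -> 'rV[R]_m) :
  measurable_fun setT a -> measurable_fun setT f ->
  measurable_fun setT (fun t => a t *: f t).
Proof.
move=> ma mf; apply: measurable_fun_rV => j.
under eq_fun do rewrite mxE.
apply: measurable_funM => //.
exact: (measurableT_comp (measurable_coord j) mf).
Qed.

Lemma measurable_opprV d (T : measurableType d) m (f : T -> 'rV[R]_m) :
  measurable_fun setT f -> measurable_fun setT (fun t => - f t).
Proof.
move=> mf; under eq_fun do rewrite -scaleN1r.
by apply: measurable_scalerV.
Qed.

Lemma measurable_subrV d (T : measurableType d) m (f g : T -> 'rV[R]_m) :
  measurable_fun setT f -> measurable_fun setT g ->
  measurable_fun setT (fun t => f t - g t).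
Proof. by move=> mf mg; apply: measurable_addrV => //; exact: measurable_opprV. Qed.

End rV_measurability.

(** * Lebesgue measure on row vectors: translations, cubes, iterated integrals *)

Section lebesgue_translation.
Context {R : realType}.
Local Open Scope ereal_scope.

Lemma lebesgue_measure_shift (a : R) (A : set R) : measurable A ->
  lebesgue_measure ((fun t => (t + a)%R) @^-1` A) = lebesgue_measure A.
Proof.
move=> mA.
have ms : measurable_fun setT (fun t : R => (t + a)%R) by exact: measurable_funD.
rewrite -[LHS]/(pushforward lebesgue_measure (fun t : measurableTypeR R => (t + a)%R) A).
apply/esym/(@lebesgue_measure_unique _ (pushforward lebesgue_measure
  (mfun_Sub (mem_set ms : (fun t : measurableTypeR R => (t + a)%R : measurableTypeR R) \in mfun)))) => // X.
move=> [[b c] /= _ <-]; rewrite /pushforward.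
rewrite (_ : _ @^-1` _ = `](b - a)%R, (c - a)%R]%classic); last first.
  by apply/seteqP; split=> t /=; rewrite !in_itv/= ltrBlDr lerBrDr.
rewrite !lebesgue_measure_itv /= !lte_fin ltrD2r; case: ifPn => // _.
by rewrite -!EFinB; congr EFin; lra.
Qed.

End lebesgue_translation.

Section lebesgue_rV_theory.
Context {R : realType}.
Local Open Scope ereal_scope.

Lemma ball_rVP m (x y : 'rV[R]_m) r :
  ball x r y <-> (0 < r)%R /\ forall j, (`|x 0%R j - y 0%R j| < r)%R.
Proof.
split => [[r0 h]|[r0 h]]; split=> //.
  by move=> j; exact: (h 0%R j).
by move=> i j; rewrite ord1; exact: h.
Qed.

Lemma rcons_rVD m (x y : 'rV[R]_m) (s t : R) :
  rcons_rV (x + y)%R (s + t)%R = (rcons_rV x s + rcons_rV y t)%R.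
Proof. by apply/rowP => j; rewrite !mxE; case: unliftP => //= *; rewrite mxE. Qed.

Lemma lebesgue_rVS m (A : set 'rV[R]_m.+1) : lebesgue_rV m.+1 A =
  (lebesgue_rV m \x @lebesgue_measure R)
    ((fun p : 'rV[R]_m * measurableTypeR R => rcons_rV p.1 p.2) @^-1` A).
Proof. by []. Qed.

Lemma measurable_preimage d d' (T : measurableType d) (T' : measurableType d')
  (f : T -> T') A : measurable_fun setT f -> measurable A -> measurable (f @^-1` A).
Proof. by move=> mf mA; rewrite -[X in measurable X]setTI; exact: mf. Qed.

(** By induction on the dimension, the image measure agrees with the product measure on rectangles,
    and rectangles determine it. *)
Lemma lebesgue_rV_shift m (a : 'rV[R]_m) A : measurable A ->
  lebesgue_rV m ((fun x => (x + a)%R) @^-1` A) = lebesgue_rV m A.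
Proof.
elim: m a A => [|m IH] a A mA.
  by congr (lebesgue_rV 0 _); apply/seteqP; split => x /=; rewrite !thinmx0.
rewrite !lebesgue_rVS.
set f := fun p : 'rV[R]_m * measurableTypeR R => rcons_rV p.1 p.2.
have mf : measurable_fun setT f by exact: measurable_rcons_rV.
pose g (p : 'rV[R]_m * measurableTypeR R) : 'rV[R]_m * measurableTypeR R :=
  ((p.1 + horiz a)%R, (p.2 + height a)%R).
have mg : measurable_fun setT g.
  apply: measurable_fun_pair.
    by apply: measurable_addrV => //; exact: measurable_fst.
  by apply: measurable_funD => //; exact: measurable_snd.
have -> : f @^-1` ((fun x => (x + a)%R) @^-1` A) = g @^-1` (f @^-1` A).
  apply/seteqP; split=> -[y t]; rewrite /f /g /preimage/=;
    by rewrite rcons_rVD rcons_rVK.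
rewrite -[LHS]/(pushforward (lebesgue_rV m \x @lebesgue_measure R) g (f @^-1` A)).
apply/esym/(@product_measure_unique _ _ _ _ _ _ _
  (pushforward (lebesgue_rV m \x @lebesgue_measure R) (mfun_Sub (mem_set mg : g \in mfun)))).
- move=> B C mB mC; rewrite /pushforward.
  have E : g @^-1` (B `*` C) = ((fun x => (x + horiz a)%R) @^-1` B) `*`
     ((fun t : R => (t + height a)%R) @^-1` C) by apply/seteqP; split=> -[].
  transitivity ((lebesgue_rV m \x @lebesgue_measure R) (g @^-1` (B `*` C))); first by [].
  rewrite E.
  rewrite product_measure1E//=; last first.
  - by apply: measurable_preimage => //; exact: measurable_funD.
  - by apply: measurable_preimage => //; exact: measurable_addrV.
  by rewrite IH// lebesgue_measure_shift.
- exact: measurable_preimage.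
Qed.

(** [ball] is a ball of the sup norm, that is a cube, so its volume is exact. For this reason the
    covering and density arguments run on cubes and reach [eball] only at the end. *)
Lemma lebesgue_rV_ball m (x : 'rV[R]_m) r : (0 < r)%R ->
  lebesgue_rV m (ball x r) = ((r *+ 2) ^+ m)%:E.
Proof.
move=> r0; elim: m x => [|m IH] x.
  by rewrite expr0 /lebesgue_rV /= diracE mem_set//; apply/ball_rVP; split=> // -[].
rewrite lebesgue_rVS.
rewrite (_ : _ @^-1` _ = ball (horiz x) r `*` (ball (height x) r : set (measurableTypeR R))).
  rewrite product_measure1E//; last 2 first.
  - by apply: open_measurable_rV; exact: ball_open.
  - exact: measurable_ball.
  rewrite [X in X * _](IH (horiz x)) [X in _ * X]lebesgue_measure_ball ?ltW//.
  by rewrite -EFinM exprSr.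
apply/seteqP; split=> -[y t]; rewrite /preimage/=.
  move=> /ball_rVP[_ h]; split=> /=.
    apply/ball_rVP; split=> // j; move: (h (lift ord_max j)).
    by rewrite !mxE liftK.
  by move: (h ord_max); rewrite mxE unlift_none.
move=> [/= /ball_rVP[_ h1] h2]; apply/ball_rVP; split=> // j.
rewrite mxE; case: unliftP => [k ->|->] /=; last exact: h2.
by move: (h1 k); rewrite mxE.
Qed.

Lemma integral_rVS m (f : 'rV[R]_m.+1 -> \bar R) :
  (lebesgue_rV m.+1).-integrable setT f ->
  \int[lebesgue_rV m.+1]_x f x =
  \int[lebesgue_rV m]_y \int[@lebesgue_measure R]_t f (rcons_rV y t).
Proof.
move=> intf; have /integrableP[mf foo] := intf.
have intg : (lebesgue_rV m \x @lebesgue_measure R).-integrable setT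
   (fun p => f (rcons_rV p.1 p.2)).
  apply/integrableP; split.
    by apply: measurableT_comp => //; exact: measurable_rcons_rV.
  rewrite (le_lt_trans _ foo)// -[X in _ <= X]/(integral (pushforward _ _) _ _).
  rewrite ge0_integral_pushforward//; first exact: measurable_rcons_rV.
  exact: measurableT_comp.
transitivity (\int[lebesgue_rV m \x @lebesgue_measure R]_p f (rcons_rV p.1 p.2)).
  rewrite -[LHS]/(integral (pushforward _ _) _ _).
  by rewrite integral_pushforward//; exact: measurable_rcons_rV.
by rewrite -(integral12_prod_meas1 intg).
Qed.

Lemma measurable_shift m (a : 'rV[R]_m) : 
  measurable_fun setT (fun x : 'rV[R]_m => (x + a)%R).
Proof. exact: measurable_addrV. Qed.

Lemma ge0_integral_shift m (a : 'rV[R]_m) (f : 'rV[R]_m -> \bar R) :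
  measurable_fun setT f -> (forall x, 0 <= f x) ->
  \int[lebesgue_rV m]_x f (x + a)%R = \int[lebesgue_rV m]_x f x.
Proof.
move=> mf f0; rewrite -(@ge0_integral_pushforward _ _ _ _ _ _ (measurable_shift a)
  (lebesgue_rV m) setT f)//.
apply: eq_measure_integral => [|mphi A mA _]; first exact: measurable_shift.
exact: lebesgue_rV_shift.
Qed.

Lemma integrable_shift m (a : 'rV[R]_m) (f : 'rV[R]_m -> \bar R) :
  (lebesgue_rV m).-integrable setT f ->
  (lebesgue_rV m).-integrable setT (fun x => f (x + a)%R).
Proof.
move=> /integrableP[mf foo]; apply/integrableP; split.
  by apply: measurableT_comp => //; exact: measurable_shift.
rewrite (ge0_integral_shift a (f := fun x => `|f x|))//.
exact: measurableT_comp.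
Qed.

Lemma integral_shift m (a : 'rV[R]_m) (f : 'rV[R]_m -> \bar R) :
  measurable_fun setT f ->
  \int[lebesgue_rV m]_x f (x + a)%R = \int[lebesgue_rV m]_x f x.
Proof.
move=> mf; rewrite [LHS]integralE [RHS]integralE.
congr (_ - _).
- rewrite -[RHS](ge0_integral_shift a)//; first by apply: eq_integral => x _; rewrite ?funeposE ?funenegE.
  exact: measurable_funepos.
- rewrite -[RHS](ge0_integral_shift a)//; first by apply: eq_integral => x _; rewrite ?funeposE ?funenegE.
  exact: measurable_funeneg.
Qed.

End lebesgue_rV_theory.

(** * Vitali covering, the weak-type inequality and the density theorem *)

Section density_theorem.
Context {R : realType} {m : nat}.
Local Notation mu := (lebesgue_rV m : set 'rV[R]_m -> \bar R).
Local Notation V := 'rV[R]_m.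

Lemma seq_argmax (T : eqType) (f : T -> R) (s : seq T) : s != [::] ->
  exists2 x, x \in s & forall y, y \in s -> f y <= f x.
Proof.
elim: s => // a [|b s] IH _.
  by exists a => [|y]; rewrite mem_seq1 // => /eqP ->.
have [x xs xmax] := IH isT.
have [fax|fxa] := leP (f a) (f x).
  exists x; first by rewrite inE xs orbT.
  by move=> y; rewrite inE => /predU1P[->//|/xmax].
exists a; first by rewrite inE eqxx.
move=> y; rewrite inE => /predU1P[->//|/xmax yx].
exact: le_trans yx (ltW fxa).
Qed.

Lemma measurable_ball_rV (x : V) r : measurable (ball x r).
Proof. by apply: open_measurable_rV; exact: ball_open. Qed.

Lemma bigsetU_ball_measurable (s : seq (V * R)) :
  measurable (\big[setU/set0]_(p <- s) ball p.1 p.2).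
Proof. by apply: bigsetU_measurable => p _; exact: measurable_ball_rV. Qed.

(** Greedy selection: the largest cube, enlarged threefold, covers every cube that meets it. The
    remaining cubes satisfy the hypothesis with [B] minus the largest cube, so the induction carries
    a shrinking [B] in place of a disjoint subfamily. *)
Lemma vitali_rV (c : R) (s : seq (V * R)) (B : set V) : 0 <= c -> measurable B ->
  (forall p, p \in s -> 0 < p.2 /\
     (((p.2 *+ 2) ^+ m)%:E <= c%:E * mu (B `&` ball p.1 p.2))%E) ->
  (mu (\big[setU/set0]_(p <- s) ball p.1 p.2) <= (3 ^+ m * c)%:E * mu B)%E.
Proof.
move=> c0; have [k] := ubnP (size s).
elim: k s B => // k IH s B sk mB hs.
have [->|s0] := eqVneq s [::].
  by rewrite big_nil measure0 mule_ge0// lee_fin mulr_ge0// exprn_ge0.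
have [p0 p0s p0max] := seq_argmax (fun p => p.2) s0.
have [r0 hp0] := hs _ p0s.
pose s' := [seq p <- s | `[< ball p.1 p.2 `&` ball p0.1 p0.2 = set0 >]].
have ss' : (size s' < size s)%N.
  rewrite size_filter -[ltnRHS](count_predC (fun p => `[< ball p.1 p.2 `&` ball p0.1 p0.2 = set0 >])).
  rewrite -[ltnLHS]addn0 ltn_add2l -has_count.
  apply/hasP; exists p0 => //=; apply/asboolP => /seteqP[/(_ p0.1) + _].
  by apply; split; exact: ballxx.
have mB0 : measurable (ball p0.1 p0.2) by exact: measurable_ball_rV.
have mB' : measurable (B `\` ball p0.1 p0.2) by exact: measurableD.
have /(IH s' _ (leq_trans ss' sk) mB') {}IH : forall p, p \in s' -> 0 < p.2 /\
     (((p.2 *+ 2) ^+ m)%:E <= c%:E * mu ((B `\` ball p0.1 p0.2) `&` ball p.1 p.2))%E.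
  move=> p; rewrite mem_filter => /andP[/asboolP pp0 ps].
  have [? hp] := hs _ ps; split=> //.
  rewrite (_ : _ `&` _ = B `&` ball p.1 p.2)//.
  apply/seteqP; split => y [] => [[]//|By py]; split=> //; split=> // p0y.
  by move/seteqP : pp0 => -[/(_ y) + _]; apply.
have sub : \big[setU/set0]_(p <- s) ball p.1 p.2 `<=`
    ball p0.1 (3 * p0.2) `|` \big[setU/set0]_(p <- s') ball p.1 p.2.
  rewrite -!bigcup_seq => y [p /= ps py].
  have [pp0|/eqP/set0P[z [pz p0z]]] :=
      pselect (ball p.1 p.2 `&` ball p0.1 p0.2 = set0).
    by right; exists p => //=; rewrite mem_filter ps andbT; exact/asboolP.
  left; have -> : 3 * p0.2 = p0.2 + (p0.2 + p0.2) by lra.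
  apply: ball_triangle p0z _; apply: ball_triangle.
    by apply: ball_sym; exact: le_ball (p0max _ ps) _ pz.
  exact: le_ball (p0max _ ps) _ py.
apply: (@le_trans _ _ (mu (ball p0.1 (3 * p0.2)) +
    mu (\big[setU/set0]_(p <- s') ball p.1 p.2))%E).
  apply: le_trans (measureU2 _ _ _).
  - apply: le_measure sub; rewrite inE; first exact: bigsetU_ball_measurable.
    by apply: measurableU; [exact: measurable_ball_rV|exact: bigsetU_ball_measurable].
  - exact: measurable_ball_rV.
  - exact: bigsetU_ball_measurable.
rewrite lebesgue_rV_ball ?mulr_gt0//.
apply: (@le_trans _ _ ((3 ^+ m * c)%:E * mu (B `&` ball p0.1 p0.2) +
   (3 ^+ m * c)%:E * mu (B `\` ball p0.1 p0.2))%E).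
  apply: leeD => //.
  rewrite -mulrnAr exprMn EFinM EFinM -muleA.
  by apply: lee_wpmul2l => //; rewrite lee_fin exprn_ge0.
rewrite -ge0_muleDr//.
by rewrite addeC -measureDI.
Qed.

Lemma rV_rat_near (x : V) (e : R) : 0 < e ->
  exists q : 'rV[rat]_m, ball (map_mx ratr q : V) e x.
Proof.
move=> e0.
have ratP (s : R) : exists q : rat, ball (ratr q : R) e s.
  have /rat_in_itvoo[q] : s - e < s + e by rewrite ltrD2l gtrN.
  rewrite in_itv/= => /andP[q1 q2]; exists q.
  by rewrite /ball/= ltr_distl q1 q2.
have [f fP] := choice (fun j => ratP (x 0 j)).
exists (\row_j f j); apply/ball_rVP; split=> // j; rewrite !mxE.
exact: fP.
Qed.

(** Cubes and a multiplicative bound, in place of the quotients over Euclidean balls in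
    [density_points]; [density_pointsE] reconciles the two. *)
Definition density0 (B : set V) (x : V) := forall d : R, 0 < d ->
  exists2 r0 : R, 0 < r0 & forall r : R, 0 < r < r0 ->
    (mu (B `&` ball x r) <= (d * (r *+ 2) ^+ m)%:E)%E.

(* The Vitali argument is run on cubes with rational centre and radius, so that
   only countably many of them are involved. *)
Lemma maximal_weak_type (B : set V) (d : R) : measurable B -> 0 < d ->
  exists G, [/\ measurable G, (mu G <= (6 ^+ m / d)%:E * mu B)%E &
   [set x | ~ forall r : R, 0 < r < 1 ->
      (mu (B `&` ball x r) <= (d * (r *+ 2) ^+ m)%:E)%E] `<=` G].
Proof.
move=> mB d0.
(* Rounding the radius [r] up to a rational below [2 * r] costs [2 ^+ m], and the covering lemma
   costs [3 ^+ m]; together they make [6 ^+ m / d]. *)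
pose c : R := 2 ^+ m / d.
have c0 : 0 <= c by rewrite divr_ge0// ?exprn_ge0// ltW.
pose bp (p : 'rV[rat]_m * rat) : V * R := (map_mx ratr p.1, ratr p.2).
pose good p := `[< 0 < (bp p).2 /\
  ((((bp p).2 *+ 2) ^+ m)%:E <= c%:E * mu (B `&` ball (bp p).1 (bp p).2))%E >].
pose L (n : nat) : seq (V * R) := if unpickle n is Some p then
  (if good p then [:: bp p] else [::]) else [::].
pose F n := \big[setU/set0]_(p <- L n) ball p.1 p.2.
have mF n : measurable (F n) by exact: bigsetU_ball_measurable.
exists (\bigcup_n F n); split.
- exact: bigcup_measurable.
- have H n : (mu (\big[setU/set0]_(i < n) F i) <= (6 ^+ m / d)%:E * mu B)%E.
    have -> : \big[setU/set0]_(i < n) F i =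
      \big[setU/set0]_(p <- flatten [seq L i | i <- iota 0 n]) ball p.1 p.2.
      rewrite big_flatten/= big_map.
      by rewrite -[LHS](big_mkord xpredT F) /index_iota subn0.
    have -> : 6 ^+ m / d = 3 ^+ m * c by rewrite /c mulrA -exprMn -natrM.
    apply: vitali_rV => // p /flattenP[_ /mapP[i _ ->]].
    rewrite /L; case: (unpickle i) => [q|//].
    by case: ifPn => // /asboolP hq; rewrite inE => /eqP ->.
  rewrite -bigcup_bigsetU_bigcup.
  have mU n : measurable (\big[setU/set0]_(i < n.+1) F i) by exact: bigsetU_measurable.
  have cv : mu (\big[setU/set0]_(i < n.+1) F i) @[n --> \oo] -->
      mu (\bigcup_n \big[setU/set0]_(i < n.+1) F i).
    apply: nondecreasing_cvg_mu => //; first exact: bigcup_measurable.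
    apply/nondecreasing_seqP => n.
    by apply/subsetPset; apply: subset_bigsetU; rewrite ltnS.
  rewrite -(cvg_lim _ cv)//; apply: lime_le; first by apply/cvg_ex; eexists; exact: cv.
  by apply: nearW => n; exact: H.
- move=> x /= /existsNP[r /not_implyP[/andP[r0 r1]] /negP]; rewrite -ltNge => hr.
  (* The room between [r] and [3 / 2 * r] absorbs the displacement of the centre by [r / 4]. *)
  have [rho] : exists rho : rat, ratr rho \in `]((3 / 2 : R) * r), (2 * r)[.
    by apply: rat_in_itvoo; rewrite ltr_pM2r//; lra.
  rewrite in_itv/= => /andP[rho1 rho2].
  have [q qx] := rV_rat_near x (divr_gt0 r0 (ltr0n R 4)).
  have sub : ball x r `<=` ball (map_mx ratr q : V) (ratr rho).
    move=> y xy; apply: (@le_ball _ _ _ (r / 4 + r)); first by lra.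
    exact: ball_triangle qx xy.
  exists (pickle (q, rho)) => //; rewrite /F /L pickleK ifT.
    rewrite big_seq1/=; apply: sub; exact: ballxx.
  apply/asboolP; rewrite /bp/=; split; first by lra.
  apply: (@le_trans _ _ (c * (d * (r *+ 2) ^+ m))%:E).
    rewrite lee_fin /c !mulrA divfK ?gt_eqF// -exprMn.
    by apply: lerXn2r; rewrite ?nnegrE; lra.
  rewrite EFinM; apply: lee_wpmul2l; first by rewrite lee_fin.
  apply: (le_trans (ltW hr)); apply: le_measure; rewrite ?inE.
  - by apply: measurableI => //; exact: measurable_ball_rV.
  - by apply: measurableI => //; exact: measurable_ball_rV.
  - exact: setIS.
Qed.

End density_theorem.

Section density_theorem.
Context {R : realType} {m : nat}.
Local Notation mu := (lebesgue_rV m : set 'rV[R]_m -> \bar R).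
Local Notation V := 'rV[R]_m.

(** The set lies in every shell between [rho] and [rho + e k], whose volume is a difference of two
    cube volumes and tends to 0. *)
Lemma sphere_negligible (q : V) (rho : R) : 0 < rho ->
  (lebesgue_rV m).-negligible [set x : V | ~ ball q rho x /\
     forall e, 0 < e -> ball q (rho + e) x].
Proof.
move=> rho0; pose e (k : nat) : R := k.+1%:R^-1.
have e0 k : 0 < e k by rewrite invr_gt0.
pose S := \bigcap_k (ball q (rho + e k) `\` ball q rho).
have mS k : measurable (ball q (rho + e k) `\` ball q rho).
  by apply: measurableD; exact: measurable_ball_rV.
exists S; split.
- exact: bigcapT_measurable.
- have cvg1 : ((((rho + e k) *+ 2) ^+ m)%:E - ((rho *+ 2) ^+ m)%:E)%E @[k --> \oo] --> (0 : \bar R)%E.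
    rewrite -[X in _ --> X](_ : ((((rho + 0) *+ 2) ^+ m - (rho *+ 2) ^+ m)%:E) = 0%E).
      under eq_fun do rewrite -EFinB.
      apply: cvg_EFin; first exact: nearW.
      apply: cvgB; last exact: cvg_cst.
      apply: (@continuous_cvg _ R^o R^o \oo _ (fun k => (rho + e k) *+ 2) (fun x => x ^+ m)).
        exact: exprn_continuous.
      apply: cvgMn; apply: cvgD; [exact: cvg_cst|exact: cvg_harmonic].
    by rewrite addr0 subrr.
  apply/eqP; rewrite -measure_le0 -(cvg_lim _ cvg1)//.
  apply: lime_ge; first by apply/cvg_ex; eexists; exact: cvg1.
  apply: nearW => k.
  have sub : ball q rho `<=` ball q (rho + e k) by apply: le_ball; rewrite lerDl ltW.
  rewrite -!(@lebesgue_rV_ball _ _ q)//; last by rewrite addr_gt0.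
  rewrite -[X in (_ <= _ - mu X)%E](setIidr sub).
  rewrite -measureD.
  + by apply: le_measure; rewrite ?inE//; [exact: bigcapT_measurable|exact: bigcap_inf].
  + exact: measurable_ball_rV.
  + exact: measurable_ball_rV.
  + by rewrite [ltLHS]lebesgue_rV_ball ?addr_gt0// ltry.
- by move=> x [nq h] k _; split => //; exact: h.
Qed.

Lemma density0S (A B : set V) x : measurable A -> measurable B -> A `<=` B ->
  density0 B x -> density0 A x.
Proof.
move=> mA mB AB dB d d0; have [r0 r00 h] := dB _ d0.
exists r0 => // r hr; apply: le_trans (h _ hr).
apply: le_measure; rewrite ?inE; last exact: setSI.
- by apply: measurableI => //; exact: measurable_ball_rV.
- by apply: measurableI => //; exact: measurable_ball_rV.
Qed.

Lemma density0U (A B : set V) x : measurable A -> measurable B ->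
  density0 A x -> density0 B x -> density0 (A `|` B) x.
Proof.
move=> mA mB dA dB d d0.
have [r1 r10 h1] := dA _ (divr_gt0 d0 (ltr0n R 2)).
have [r2 r20 h2] := dB _ (divr_gt0 d0 (ltr0n R 2)).
exists (Num.min r1 r2); first by rewrite lt_min r10.
move=> r /andP[r0]; rewrite lt_min => /andP[rr1 rr2].
rewrite setIUl; apply: (le_trans (measureU2 _ _ _)).
- by apply: measurableI => //; exact: measurable_ball_rV.
- by apply: measurableI => //; exact: measurable_ball_rV.
have -> : d * (r *+ 2) ^+ m = d / 2 * (r *+ 2) ^+ m + d / 2 * (r *+ 2) ^+ m.
  by rewrite -mulrDl -splitr.
by rewrite EFinD; apply: leeD; [apply: h1; rewrite r0|apply: h2; rewrite r0].
Qed.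

Lemma density0_set0 x : density0 (set0 : set V) x.
Proof.
move=> d d0; exists 1 => // r /andP[r0 _]; rewrite set0I measure0 lee_fin.
by rewrite mulr_ge0 ?exprn_ge0 ?mulrn_wge0// ltW.
Qed.

(** Symmetric in [A] and its complement, so that the sets with this property form a class closed
    under complement, as the generation argument in [density_theorem] requires. *)
Definition density_ok (A : set V) := (lebesgue_rV m).-negligible
  [set x | ~ ((A x -> density0 (~` A) x) /\ (~ A x -> density0 A x))].

Lemma density_okC A : density_ok A -> density_ok (~` A).
Proof.
apply: negligibleS => x /= h1 [h2 h3]; apply: h1; split=> hx.
  by rewrite setCK; exact: h3.
by apply: h2; exact: contrapT.
Qed.

(** Off the union, a finite partial union has density 0 because each of its members has. The tail
    has small measure, and by the weak-type inequality it can have density above [d] only on a set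
    of measure at most [6 ^+ m / d] times that of the tail, which tends to 0. *)
Lemma density_ok_bigcup (A : (set V)^nat) : (forall k, measurable (A k)) ->
  (forall k, density_ok (A k)) -> density_ok (\bigcup_k A k).
Proof.
move=> mA okA; set U := \bigcup_k A k.
have mU : measurable U by exact: bigcup_measurable.
pose good x := forall k, (A k x -> density0 (~` A k) x) /\ (~ A k x -> density0 (A k) x).
pose P n := \big[setU/set0]_(i < n) A i.
have mP n : measurable (P n) by exact: bigsetU_measurable.
have PU n : P n `<=` U by rewrite /P -bigcup_mkord => x [k _ Akx]; exists k.
pose T (M j : nat) := [set x : V | [/\ ball 0 M.+1%:R x, ~ U x, good x &
   ~ exists2 r0 : R, 0 < r0 & forall r : R, 0 < r < r0 ->
    (mu (U `&` ball x r) <= (j.+1%:R^-1 * (r *+ 2) ^+ m)%:E)%E]].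
have nT M j : (lebesgue_rV m).-negligible (T M j).
  (* Localising makes the tails finite, so that their measures decrease to 0. A cube of radius below
     1 about a point of [ball 0 M.+1%:R] stays inside [ball 0 M.+2%:R]. *)
  pose B n := (U `\` P n) `&` ball 0 M.+2%:R.
  have mB n : measurable (B n).
    by apply: measurableI; [exact: measurableD|exact: measurable_ball_rV].
  pose d : R := j.+1%:R^-1 / 2.
  have d0 : 0 < d by rewrite divr_gt0// invr_gt0.
  have /choice[G hG] := fun n => maximal_weak_type (mB n) d0.
  have mG n : measurable (G n) by have [] := hG n.
  exists (\bigcap_n G n); split; first exact: bigcapT_measurable.
  - have Bcvg : mu (B n) @[n --> \oo] --> mu (\bigcap_n B n).
      apply: nonincreasing_cvg_mu => //.
      + apply: (@le_lt_trans _ _ (mu (ball 0 M.+2%:R))).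
          apply: le_measure; rewrite ?inE; [exact: mB|exact: measurable_ball_rV|].
          exact: subIsetr.
        by rewrite [ltLHS]lebesgue_rV_ball ?ltry// ltr0Sn.
      + exact: bigcapT_measurable.
      + apply/nonincreasing_seqP => n; apply/subsetPset => x [[Ux nPx] bx].
        split=> //; split=> //; apply: contra_not nPx.
        by rewrite /P big_ord_recr/= => ?; left.
    have B0 : \bigcap_n B n = set0.
      rewrite -subset0 => x Bx.
      have [[[k _ Akx] _] _] := Bx 0%N I.
      have [[_ nP] _] := Bx k.+1 I; apply: nP.
      by rewrite /P big_ord_recr/=; right.
    rewrite B0 measure0 in Bcvg.
    have {}Bcvg : ((6 ^+ m / d)%:E * mu (B n))%E @[n --> \oo] --> 0%E.
      by rewrite -(mule0 (6 ^+ m / d)%:E); apply: cvgeZl.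
    apply/eqP; rewrite -measure_le0 -(cvg_lim _ Bcvg)//.
    apply: lime_ge; first by apply/cvg_ex; eexists; exact: Bcvg.
    apply: nearW => n; have [_ + _] := hG n; apply: le_trans.
    apply: le_measure; rewrite ?inE//; first exact: bigcapT_measurable.
    exact: bigcap_inf.
  - move=> x [bx nUx gx nh] n _; have [_ _ sG] := hG n; apply: sG => /= hB; apply: nh.
    have dP : density0 (P n) x.
      rewrite /P; elim: n {hB} => [|k IH].
        by rewrite big_ord0; exact: density0_set0.
      rewrite big_ord_recr/=; apply: density0U => //.
          exact: bigsetU_measurable.
        by have [_] := gx k; apply => Akx; apply: nUx; exists k.
    have [r0 r00 hr0] := dP _ d0.
    exists (Num.min r0 1); first by rewrite lt_min r00 ltr01.
    move=> r /andP[rp]; rewrite lt_min => /andP[rr0 r1].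
    have sub : U `&` ball x r `<=` (P n `&` ball x r) `|` (B n `&` ball x r).
      move=> y [Uy xy]; have [Py|nPy] := pselect (P n y); first by left.
      right; split=> //; split=> //.
      rewrite -[M.+2]addn1 natrD; apply: ball_triangle bx _.
      exact: le_ball (ltW r1) _ xy.
    have mPb : measurable (P n `&` ball x r).
      by apply: measurableI => //; exact: measurable_ball_rV.
    have mBb : measurable (B n `&` ball x r).
      by apply: measurableI => //; exact: measurable_ball_rV.
    apply: (@le_trans _ _ (mu (P n `&` ball x r) + mu (B n `&` ball x r))%E).
      apply: le_trans (measureU2 _ mPb mBb); apply: le_measure sub; rewrite inE.
        by apply: measurableI => //; exact: measurable_ball_rV.
      exact: measurableU.
    have -> : j.+1%:R^-1 * (r *+ 2) ^+ m = d * (r *+ 2) ^+ m + d * (r *+ 2) ^+ m.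
      by rewrite -mulrDl -splitr.
    by rewrite EFinD; apply: leeD; [apply: hr0; rewrite rp|apply: hB; rewrite rp].
have : (lebesgue_rV m).-negligible ((\bigcup_k [set x | ~ ((A k x -> density0 (~` A k) x)
    /\ (~ A k x -> density0 (A k) x))]) `|` \bigcup_M \bigcup_j T M j).
  apply: negligibleU; first by apply: negligible_bigcup => k; exact: okA.
  by apply: negligible_bigcup => M; apply: negligible_bigcup => j; exact: nT.
apply: negligibleS => x /= hx.
have [gx|ngx] := pselect (good x); last first.
  by left; move/existsNP : ngx => [k hk]; exists k.
have nUx : ~ U x.
  move=> [k _ Akx]; apply: hx; split=> [_|]; last by case; exists k.
  apply: density0S (_ : ~` U `<=` ~` A k) _.
  - exact: measurableC.
  - exact: measurableC.
  - by move=> y nUy Aky; apply: nUy; exists k.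
  - by have [+ _] := gx k; exact.
right.
have [M hM] : exists M : nat, ball 0 M.+1%:R x.
  exists (Num.truncn `|x|); rewrite -ball_normE /= sub0r normrN.
  exact: truncnS_gt.
exists M => //.
apply: contrapT => hT; apply: hx; split=> // _ d d0.
have [j jd] : exists j : nat, j.+1%:R^-1 <= d.
  exists (Num.truncn d^-1); rewrite invf_ple ?posrE//.
  exact: ltW (truncnS_gt _).
have : ~ T M j x by move=> h; apply: hT; exists j.
move=> hTj; apply: contrapT => nh; apply: hTj; split=> // -[r0 r00 h]; apply: nh.
exists r0 => // r rr0; apply: (le_trans (h _ rr0)); rewrite lee_fin ler_wpM2r//.
by rewrite exprn_ge0// mulrn_wge0// ltW//; case/andP: rr0.
Qed.

Lemma density_ok_ball (q : V) (rho : R) : 0 < rho -> density_ok (ball q rho).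
Proof.
move=> rho0; apply: negligibleS (sphere_negligible q rho0) => x /= hx.
have nb : ~ ball q rho x.
  move=> bx; apply: hx; split=> // _ d d0.
  have : open (ball q rho) by exact: ball_open.
  rewrite openE => /(_ x bx) /nbhs_ballP[r0 /= r00 sub].
  exists r0 => // r /andP[rp rr0].
  rewrite (_ : _ `&` _ = set0) ?measure0 ?lee_fin.
    by rewrite mulr_ge0 ?exprn_ge0 ?mulrn_wge0 ?ltW.
  by rewrite -subset0 => y [nby /(le_ball (ltW rr0)) /sub].
split=> // e e0; apply: contrapT => nbe; apply: hx; split=> // _ d d0.
exists e => // r /andP[rp re].
rewrite (_ : _ `&` _ = set0) ?measure0 ?lee_fin.
  by rewrite mulr_ge0 ?exprn_ge0 ?mulrn_wge0 ?ltW.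
rewrite -subset0 => y [qy xy]; apply: nbe.
by apply: ball_triangle qy _; apply: ball_sym; exact: le_ball (ltW re) _ xy.
Qed.

(** The class [C] is a sigma-algebra. An open set is a countable union of cubes with rational
    centres, and for a cube only the points of its boundary are exceptional. *)
Lemma density_theorem A : measurable A -> density_ok A.
Proof.
move=> mA; pose C := [set A : set V | measurable A /\ density_ok A].
suff: C A by case.
move: A mA; apply: smallest_sub.
  split.
  - split=> //; apply: negligibleS (negligible_set0 (lebesgue_rV m)) => x /=; apply.
    by split=> // _; exact: density0_set0.
  - move=> A [mA okA]; rewrite setTD; split; first exact: measurableC.
    exact: density_okC.
  - move=> A hA; split.
      by apply: bigcup_measurable => k _; have [] := hA k.
    by apply: density_ok_bigcup => k; have [] := hA k.
move=> U oU; split; first exact: open_measurable_rV.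
pose F (n : nat) : set V :=
  if unpickle n is Some (q, k) then
    let B := ball (map_mx ratr (q : 'rV[rat]_m) : V) (k : nat).+1%:R^-1 in
    if `[< B `<=` U >] then B else set0 else set0.
have -> : U = \bigcup_n F n.
  apply/seteqP; split=> [x Ux|x [n _]]; last first.
    by rewrite /F; case: unpickle => [[q k]|//] /=; case: asboolP => // sub /sub.
  move: oU; rewrite openE => /(_ x Ux) /nbhs_ballP[e /= e0 sub].
  have [k ke] : exists k : nat, k.+1%:R^-1 <= e / 2.
    exists (Num.truncn (e / 2)^-1); rewrite invf_ple ?posrE ?divr_gt0//.
    exact: ltW (truncnS_gt _).
  have k0 : 0 < k.+1%:R^-1 :> R by rewrite invr_gt0.
  have [q qx] := rV_rat_near x k0.
  exists (pickle (q, k)) => //; rewrite /F pickleK /= asboolT//.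
  move=> y qy; apply: sub; rewrite (splitr e).
  apply: le_ball (lerD ke ke) _ _; apply: ball_triangle qy.
  exact: ball_sym.
apply: density_ok_bigcup => n; rewrite /F; case: unpickle => [[q k]|] //=.
- by case: asboolP => // _; exact: measurable_ball_rV.
- case: asboolP => // _; first by apply: density_ok_ball; rewrite invr_gt0.
  apply: negligibleS (negligible_set0 (lebesgue_rV m)) => x /=; apply.
  by split=> // _; exact: density0_set0.
- apply: negligibleS (negligible_set0 (lebesgue_rV m)) => x /=; apply.
  by split=> // _; exact: density0_set0.
Qed.

End density_theorem.

(** * The Euclidean norm and density points *)

Section euclidean_norm.
Context {R : realType} {m : nat}.
Implicit Types x y : 'rV[R]_m.

Definition dotr x y : R := \sum_i x 0 i * y 0 i.

Lemma dotrC x y : dotr x y = dotr y x.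
Proof. by apply: eq_bigr => i _; rewrite mulrC. Qed.

Lemma dotrDl x y z : dotr (x + y) z = dotr x z + dotr y z.
Proof. by rewrite -big_split /=; apply: eq_bigr => i _; rewrite mxE mulrDl. Qed.

Lemma dotrZl a x y : dotr (a *: x) y = a * dotr x y.
Proof. by rewrite mulr_sumr; apply: eq_bigr => i _; rewrite mxE mulrA. Qed.

Lemma dotrDr x y z : dotr x (y + z) = dotr x y + dotr x z.
Proof. by rewrite dotrC dotrDl dotrC (dotrC z). Qed.

Lemma dotrZr a x y : dotr x (a *: y) = a * dotr x y.
Proof. by rewrite dotrC dotrZl dotrC. Qed.

Lemma dotrNl x y : dotr (- x) y = - dotr x y.
Proof. by rewrite -scaleN1r dotrZl mulN1r. Qed.

Lemma dotrNr x y : dotr x (- y) = - dotr x y.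
Proof. by rewrite dotrC dotrNl dotrC. Qed.

Lemma dotr_ge0 x : 0 <= dotr x x.
Proof. by apply: sumr_ge0 => i _; rewrite -expr2 sqr_ge0. Qed.

Lemma enormE x : enorm x = Num.sqrt (dotr x x).
Proof. by congr Num.sqrt; apply: eq_bigr => i _; rewrite expr2. Qed.

Lemma sqr_enorm x : enorm x ^+ 2 = dotr x x.
Proof. by rewrite enormE sqr_sqrtr ?dotr_ge0. Qed.

Lemma enorm_ge0 x : 0 <= enorm x. Proof. exact: sqrtr_ge0. Qed.

Lemma enorm0 : enorm (0 : 'rV[R]_m) = 0.
Proof. by rewrite /enorm big1 ?sqrtr0// => i _; rewrite mxE expr0n. Qed.

Lemma enormZ a x : enorm (a *: x) = `|a| * enorm x.
Proof.
by rewrite !enormE dotrZl dotrZr mulrA -expr2 sqrtrM ?sqr_ge0// sqrtr_sqr.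
Qed.

Lemma enormN x : enorm (- x) = enorm x.
Proof. by rewrite -scaleN1r enormZ normrN1 mul1r. Qed.

Lemma enorm_coord x i : `|x 0 i| <= enorm x.
Proof.
rewrite -sqrtr_sqr ler_sqrt; last by apply: sumr_ge0 => j _; exact: sqr_ge0.
by rewrite (bigD1 i)//= lerDl; apply: sumr_ge0 => j _; exact: sqr_ge0.
Qed.

Lemma norm_le_enorm x : `|x| <= enorm x.
Proof.
rewrite [`|x|]mx_normrE; apply: bigmax_le => [|[i j] _ /=]; first exact: enorm_ge0.
by rewrite (ord1 i); exact: enorm_coord.
Qed.

Lemma enorm_le x (r : R) : 0 <= r -> (forall i, `|x 0 i| <= r) ->
  enorm x <= Num.sqrt m%:R * r.
Proof.
move=> r0 h; rewrite -[leRHS]ger0_norm ?mulr_ge0 ?sqrtr_ge0//.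
rewrite -sqrtr_sqr ler_sqrt ?sqr_ge0// exprMn sqr_sqrtr ?ler0n//.
apply: (@le_trans _ _ (\sum_(i < m) r ^+ 2)).
  apply: ler_sum => i _; rewrite -(@real_normK _ (x 0 i)) ?num_real//.
  by rewrite lerXn2r ?nnegrE.
by rewrite sumr_const card_ord [leRHS]mulr_natl.
Qed.

Lemma enorm_eq0 x : enorm x = 0 -> x = 0.
Proof.
move=> x0; apply/rowP => i; rewrite mxE; apply/eqP.
by have := enorm_coord x i; rewrite x0 normr_le0.
Qed.

Lemma cauchy_schwarz x y : dotr x y <= enorm x * enorm y.
Proof.
have [x0|x0] := eqVneq (enorm x) 0.
  rewrite (enorm_eq0 x0) enorm0 mul0r.
  by rewrite /dotr big1// => i _; rewrite mxE mul0r.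
have [y0|y0] := eqVneq (enorm y) 0.
  rewrite (enorm_eq0 y0) enorm0 mulr0.
  by rewrite /dotr big1// => i _; rewrite mxE mulr0.
have px : 0 < enorm x by rewrite lt_neqAle eq_sym x0 enorm_ge0.
have py : 0 < enorm y by rewrite lt_neqAle eq_sym y0 enorm_ge0.
have := dotr_ge0 (enorm y *: x - enorm x *: y).
rewrite dotrDl !dotrDr !(dotrNl, dotrNr, dotrZl, dotrZr) -!sqr_enorm (dotrC y x).
move=> h.
have {}h : 0 <= (enorm x * enorm y) * (enorm x * enorm y - dotr x y) by nra.
by rewrite -subr_ge0 -(pmulr_rge0 _ (mulr_gt0 px py)).
Qed.

Lemma ler_enormD x y : enorm (x + y) <= enorm x + enorm y.
Proof.
rewrite -[leRHS]ger0_norm ?addr_ge0 ?enorm_ge0//.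
rewrite -sqrtr_sqr enormE ler_sqrt ?sqr_ge0//.
rewrite sqrrD !sqr_enorm dotrDl !dotrDr (dotrC y x).
by have := cauchy_schwarz x y; lra.
Qed.

Lemma enormB x y : enorm (x - y) = enorm (y - x).
Proof. by rewrite -enormN opprB. Qed.

Lemma enorm_convex (t : R) x y : 0 <= t <= 1 -> enorm x <= 1 -> enorm y <= 1 ->
  enorm (t *: x + (1 - t) *: y) <= 1.
Proof.
move=> /andP[t0 t1] hx hy; apply: (le_trans (ler_enormD _ _)).
rewrite !enormZ !ger0_norm ?subr_ge0//; nra.
Qed.

Lemma measurable_dotr d (T : measurableType d) (f g : T -> 'rV[R]_m) :
  measurable_fun setT f -> measurable_fun setT g ->
  measurable_fun setT (fun t => dotr (f t) (g t)).
Proof.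
move=> mf mg; apply: measurable_sum => i; apply: measurable_funM.
- exact: (measurableT_comp (measurable_coord i) mf).
- exact: (measurableT_comp (measurable_coord i) mg).
Qed.

Lemma measurable_enorm d (T : measurableType d) (f : T -> 'rV[R]_m) :
  measurable_fun setT f -> measurable_fun setT (fun t => enorm (f t)).
Proof.
move=> mf; under eq_fun do rewrite enormE.
apply: measurableT_comp; last exact: measurable_dotr.
by apply: continuous_measurable_fun; exact: sqrt_continuous.
Qed.

Lemma measurable_lt_set d (T : measurableType d) (f g : T -> R) :
  measurable_fun setT f -> measurable_fun setT g ->
  measurable [set t | f t < g t].
Proof.
move=> mf mg; rewrite (_ : [set t | _] = (fun t => f t < g t) @^-1` [set true]).
  by apply: measurable_preimage => //; exact: measurable_fun_ltr.
by apply/seteqP; split.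
Qed.

Lemma measurable_le_set d (T : measurableType d) (f g : T -> R) :
  measurable_fun setT f -> measurable_fun setT g ->
  measurable [set t | f t <= g t].
Proof.
move=> mf mg; rewrite (_ : [set t | _] = ~` [set t | g t < f t]).
  by apply: measurableC; exact: measurable_lt_set.
by apply/seteqP; split => t /= => [|/negP]; [rewrite leNgt => /negP|rewrite -leNgt].
Qed.

Lemma measurable_eball x r : measurable (eball x r).
Proof.
apply: measurable_lt_set => //; apply: measurable_enorm.
exact: measurable_addrV.
Qed.

Lemma eball_sub_ball x r : 0 < r -> eball x r `<=` ball x r.
Proof.
move=> r0 y xy; apply/ball_rVP; split=> // j.
rewrite distrC; have := enorm_coord (y - x) j; rewrite !mxE => h.
exact: le_lt_trans h xy.
Qed.

(** The factor [m.+1%:R] is cruder than a square root, but it is an integer and positive also for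
    [m = 0]; only the comparability of the two kinds of balls matters. *)
Lemma ball_sub_eball x r : 0 < r -> ball x r `<=` eball x (m.+1%:R * r).
Proof.
move=> r0 y /ball_rVP[_ h]; rewrite /eball/=.
apply: (@le_lt_trans _ _ (m%:R * r)); last by rewrite ltr_pM2r// ltr_nat.
have le : enorm (y - x) <= Num.sqrt m%:R * r.
  by apply: enorm_le; [exact: ltW|move=> i; rewrite !mxE distrC ltW].
apply: (le_trans le); rewrite ler_wpM2r ?(ltW r0)//.
rewrite -[leRHS]ger0_norm// -sqrtr_sqr ler_sqrt ?sqr_ge0// -natrX ler_nat.
by case: (m) => // k; rewrite expnS leq_pmulr// expn_gt0.
Qed.

End euclidean_norm.

Section density_points.
Context {R : realType} {m : nat}.
Local Notation mu := (lebesgue_rV m : set 'rV[R]_m -> \bar R).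
Local Notation V := 'rV[R]_m.
Implicit Types (A B : set V) (x : V).

Lemma lebesgue_eball_bounds x r : 0 < r ->
  (((r / m.+1%:R *+ 2) ^+ m)%:E <= mu (eball x r) <= ((r *+ 2) ^+ m)%:E)%E.
Proof.
move=> r0; apply/andP; split.
  rewrite -(@lebesgue_rV_ball _ _ x) ?divr_gt0//; apply: le_measure; rewrite ?inE.
  - exact: measurable_ball_rV.
  - exact: measurable_eball.
  - have -> : eball x r = eball x (m.+1%:R * (r / m.+1%:R)).
      by rewrite mulrC divfK.
    by apply: ball_sub_eball; rewrite divr_gt0.
rewrite -(@lebesgue_rV_ball _ _ x)//; apply: le_measure; rewrite ?inE.
- exact: measurable_eball.
- exact: measurable_ball_rV.
- exact: eball_sub_ball.
Qed.

Lemma fineK_bounded (B : set V) x r : measurable B ->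
  (fine (mu (B `&` eball x r)))%:E = mu (B `&` eball x r).
Proof.
move=> mB; rewrite fineK// ge0_fin_numE//.
have [r0|r0] := ltP 0 r; last first.
  rewrite (_ : _ `&` _ = set0) ?measure0// -subset0 => y [_].
  by rewrite /eball/= ltNge (le_trans r0)// enorm_ge0.
apply: (@le_lt_trans _ _ (mu (eball x r))).
  apply: le_measure; rewrite ?inE.
  - by apply: measurableI => //; exact: measurable_eball.
  - exact: measurable_eball.
  - exact: subIsetr.
by have /andP[_ h] := lebesgue_eball_bounds x r0; rewrite (le_lt_trans h)// ltry.
Qed.

Lemma density_ratio A x r : measurable A -> 0 < r ->
  1 - fine (mu (A `&` eball x r)) / fine (mu (eball x r)) =
  fine (mu (~` A `&` eball x r)) / fine (mu (eball x r)).
Proof.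
move=> mA r0.
have /andP[b1 b2] := lebesgue_eball_bounds x r0.
have bfin : (fine (mu (eball x r)))%:E = mu (eball x r).
  by rewrite -[eball x r]setTI fineK_bounded.
have b0 : 0 < fine (mu (eball x r)).
  rewrite -lte_fin bfin (lt_le_trans _ b1)// lte_fin exprn_gt0//.
  by rewrite pmulrn_lgt0// divr_gt0.
have H : fine (mu (eball x r)) =
   fine (mu (A `&` eball x r)) + fine (mu (~` A `&` eball x r)).
  apply/EFin_inj; rewrite EFinD !fineK_bounded//; last exact: measurableC.
  rewrite bfin (measureDI mu (measurable_eball x r) mA) addeC setIC.
  by congr (_ + mu _)%E; rewrite setDE setIC.
apply: (mulIf (lt0r_neq0 b0)).
rewrite mulrBl mul1r !divfK ?gt_eqF//.
by rewrite {1}H addrAC subrr add0r.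
Qed.

(** Cubes and Euclidean balls are nested up to a factor [m.+1%:R] in the radius, hence
    [m.+1%:R ^+ m] in volume, and this is absorbed in the arbitrary [d]. *)
Lemma density_pointsE A : measurable A ->
  density_points A = [set x | density0 (~` A) x].
Proof.
move=> mA; have mCA : measurable (~` A) by exact: measurableC.
have M0 : 0 < (m.+1%:R : R) by [].
have Mm0 : 0 < (m.+1%:R ^+ m : R) by rewrite exprn_gt0.
have b0 x r : 0 < r -> 0 < fine (mu (eball x r)).
  move=> r0; have /andP[b1 _] := lebesgue_eball_bounds x r0.
  have bfin : (fine (mu (eball x r)))%:E = mu (eball x r).
    by rewrite -[eball x r]setTI fineK_bounded.
  rewrite -lte_fin bfin (lt_le_trans _ b1)// lte_fin exprn_gt0//.
  by rewrite pmulrn_lgt0// divr_gt0.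
apply/seteqP; split => x /= hx.
- move=> d d0.
  move/cvgrPdist_lt : hx => /(_ (d / m.+1%:R ^+ m) (divr_gt0 d0 Mm0)) [e /= e0 he].
  exists (e / m.+1%:R); first by rewrite divr_gt0.
  move=> r /andP[r0 re].
  have s0 : 0 < m.+1%:R * r by rewrite mulr_gt0.
  have := he (m.+1%:R * r); rewrite /= sub0r normrN gtr0_norm//.
  rewrite mulrC -ltr_pdivlMr// mulrC => /(_ re s0).
  rewrite density_ratio// ger0_norm ?divr_ge0 ?fine_ge0//.
  rewrite ltr_pdivrMr ?b0// => h.
  apply: (@le_trans _ _ (mu (~` A `&` eball x (m.+1%:R * r)))).
    apply: le_measure; rewrite ?inE.
    - by apply: measurableI => //; exact: measurable_ball_rV.
    - by apply: measurableI => //; exact: measurable_eball.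
    - by apply: setIS; exact: ball_sub_eball.
  rewrite -fineK_bounded// lee_fin (le_trans (ltW h))//.
  have -> : d * (r *+ 2) ^+ m = d / m.+1%:R ^+ m * ((m.+1%:R * r *+ 2) ^+ m).
    by rewrite -mulrnAr exprMn mulrA divfK// gt_eqF.
  rewrite ler_wpM2l ?(ltW (divr_gt0 d0 Mm0))//.
  have /andP[_ b2] := lebesgue_eball_bounds x s0.
  rewrite -lee_fin -[eball x _]setTI fineK_bounded// setTI.
  exact: b2.
- apply/cvgrPdist_le => d d0.
  have [r0 r00 h] := hx (d / m.+1%:R ^+ m) (divr_gt0 d0 Mm0).
  exists r0 => // r /=; rewrite sub0r normrN => rr0 rp.
  rewrite gtr0_norm// in rr0.
  rewrite density_ratio// ger0_norm ?divr_ge0 ?fine_ge0//.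
  rewrite ler_pdivrMr ?b0//.
  have /andP[b1 _] := lebesgue_eball_bounds x rp.
  rewrite -lee_fin fineK_bounded//.
  apply: (@le_trans _ _ (mu (~` A `&` ball x r))).
    apply: le_measure; rewrite ?inE.
    - by apply: measurableI => //; exact: measurable_eball.
    - by apply: measurableI => //; exact: measurable_ball_rV.
    - by apply: setIS; exact: eball_sub_ball.
  have /h/le_trans : 0 < r < r0 by rewrite rp.
  apply.
  have -> : d / m.+1%:R ^+ m * (r *+ 2) ^+ m = d * ((r / m.+1%:R *+ 2) ^+ m).
    by rewrite -!mulrnAl exprMn exprVn mulrA mulrAC.
  rewrite lee_fin ler_wpM2l ?(ltW d0)//.
  by rewrite -lee_fin -[eball x r]setTI fineK_bounded// setTI.
Qed.

Lemma density0_disjoint A x : measurable A -> density0 A x ->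
  density0 (~` A) x -> False.
Proof.
move=> mA h1 h2.
have d0 : 0 < 1 / 4 :> R by lra.
have [r1 r10 k1] := h1 _ d0; have [r2 r20 k2] := h2 _ d0.
pose r := Num.min r1 r2 / 2.
have rm : 0 < Num.min r1 r2 by rewrite lt_min r10.
have r0 : 0 < r by rewrite divr_gt0.
have [rr1 rr2] : r < r1 /\ r < r2.
  have : r < Num.min r1 r2 by rewrite /r; lra.
  by rewrite lt_min => /andP.
have := lebesgue_rV_ball x r0.
rewrite (measureDI mu (measurable_ball_rV x r) mA) => E.
have B0 : 0 < (r *+ 2) ^+ m by rewrite exprn_gt0// pmulrn_lgt0.
have : (((r *+ 2) ^+ m)%:E <=
   (1 / 4 * (r *+ 2) ^+ m)%:E + (1 / 4 * (r *+ 2) ^+ m)%:E)%E.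
  rewrite -E; apply: leeD.
    by rewrite setDE setIC; apply: k2; rewrite r0.
  by rewrite setIC; apply: k1; rewrite r0.
rewrite -EFinD lee_fin => h.
by lra.
Qed.

Lemma density0_ae A B x : measurable A -> measurable B ->
  mu (B `\` A) = 0%E -> density0 A x -> density0 B x.
Proof.
move=> mA mB BA0 hA d d0; have [r0 r00 h] := hA _ d0.
exists r0 => // r hr; apply: le_trans (h _ hr).
have mb : measurable (ball x r) by exact: measurable_ball_rV.
apply: (@le_trans _ _ (mu ((A `&` ball x r) `|` (B `\` A)))).
  apply: le_measure; rewrite ?inE.
  - exact: measurableI.
  - by apply: measurableU; [exact: measurableI|exact: measurableD].
  - by move=> y [By by_]; have [Ay|nAy] := pselect (A y); [left|right].
apply: (le_trans (measureU2 mu _ _)); first exact: measurableI.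
  exact: measurableD.
by rewrite [X in (_ + X)%E]BA0 adde0.
Qed.

(** For a fixed radius the volume of [A] in the cube about [x] is measurable in [x], as a section of
    a product set. Rational radii suffice: between [r] and [2 * r] there is one, at the price of
    [2 ^+ m] in the constant. *)
Lemma measurable_density0 A : measurable A -> measurable [set x | density0 A x].
Proof.
move=> mA.
pose S (k : nat) (q : rat) := [set x | (mu (A `&` ball x (ratr q)) <=
   (k.+1%:R^-1 * (ratr q *+ 2) ^+ m)%:E)%E].
have mS k q : measurable (S k q).
  have [q0|q0] := ltP 0 (ratr q : R); last first.
    rewrite (_ : S k q = if (0%:E <= (k.+1%:R^-1 * (ratr q *+ 2) ^+ m)%:E :> \bar R)%E then setT else set0).
      by case: ifP.
    apply/seteqP; split => x; rewrite /S/= (_ : _ `&` _ = set0) ?measure0; try by case: ifP.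
    - by rewrite -subset0 => y [_ /ball_rVP[]]; rewrite ltNge q0.
    - by rewrite -subset0 => y [_ /ball_rVP[]]; rewrite ltNge q0.
  pose T := [set p : V * V | A p.2] `&`
     \bigcap_(j in [set: 'I_m]) [set p : V * V | `|p.1 0 j - p.2 0 j| < ratr q].
  have mT : measurable T.
    apply: measurableI.
      by apply: (measurable_preimage _ mA); exact: measurable_snd.
    apply: fin_bigcap_measurable => // j _.
    apply: measurable_lt_set => //; apply: measurableT_comp => //.
    apply: measurable_funB.
    - exact: (measurableT_comp (measurable_coord j) measurable_fst).
    - exact: (measurableT_comp (measurable_coord j) measurable_snd).
  have := measurable_fun_xsection (lebesgue_rV m : {sigma_finite_measure set V -> \bar R}) mT.
  move=> mf.
  rewrite (_ : S k q = (lebesgue_rV m \o xsection T) @^-1`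
     `]-oo, (k.+1%:R^-1 * (ratr q *+ 2) ^+ m)%:E]%classic).
    by apply: measurable_preimage mf _; exact: emeasurable_itv.
  have E x : xsection T x = A `&` ball x (ratr q).
    apply/seteqP; split => y; rewrite /xsection /T/= inE/=.
      by move=> [Ay h]; split=> //; apply/ball_rVP; split=> // j; exact: h.
    by move=> [Ay /ball_rVP[_ h]]; split=> // j _; exact: h.
  by apply/seteqP; split => x; rewrite /S /preimage/= in_itv/= E.
rewrite (_ : [set x | _] = \bigcap_k \bigcup_j \bigcap_(q in [set q : rat |
   0 < (ratr q : R) < j.+1%:R^-1]) S k q).
  apply: bigcapT_measurable => k; apply: bigcupT_measurable => j.
  rewrite -[X in measurable X]setCK setC_bigcap bigcup_mkcond.
  apply: measurableC; apply: countable_bigcupT_measurable => [|q].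
    exact: countableP.
  by case: ifP => // _; exact: measurableC.
apply/seteqP; split => x /=.
- move=> hx k _.
  have [r0 r00 h] := hx k.+1%:R^-1 ltac:(by rewrite invr_gt0).
  exists (Num.truncn r0^-1) => // q /= /andP[q0 qj]; apply: h.
  rewrite q0 (lt_le_trans qj)// invf_ple ?posrE//.
  exact: ltW (truncnS_gt _).
- move=> h d d0.
  have d'0 : 0 < d / 2 ^+ m by rewrite divr_gt0// exprn_gt0.
  pose k := Num.truncn (d / 2 ^+ m)^-1.
  have kd : k.+1%:R^-1 <= d / 2 ^+ m.
    by rewrite invf_ple ?posrE//; exact: ltW (truncnS_gt _).
  have [j _ hj] := h k I.
  have j0 : 0 < j.+1%:R^-1 :> R by rewrite invr_gt0.
  exists (j.+1%:R^-1 / 2); first by rewrite divr_gt0.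
  move=> r /andP[r0 rj].
  have [q] : exists q : rat, ratr q \in `]r, (2 * r)[.
    by apply: rat_in_itvoo; rewrite ltr_pMl// ltr1n.
  rewrite in_itv/= => /andP[q1 q2].
  have q0 : 0 < ratr q :> R by exact: lt_trans q1.
  have qj : ratr q < j.+1%:R^-1 :> R by rewrite (lt_trans q2)// mulrC -ltr_pdivlMr.
  have /= hq : S k q x by apply: hj; rewrite /= q0 qj.
  rewrite /S /= in hq.
  apply: (le_trans _ (le_trans hq _)).
    apply: le_measure; rewrite ?inE.
    - by apply: measurableI => //; exact: measurable_ball_rV.
    - by apply: measurableI => //; exact: measurable_ball_rV.
    - by apply: setIS; apply: le_ball; exact: ltW.
  rewrite lee_fin; apply: (@le_trans _ _ (d / 2 ^+ m * (2 * r *+ 2) ^+ m)).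
    apply: ler_pM => //.
    - by rewrite exprn_ge0// mulrn_wge0// ltW.
    - by apply: lerXn2r; rewrite ?nnegrE; lra.
  by rewrite -mulrnAr exprMn mulrA divfK// gt_eqF// exprn_gt0.
Qed.

Lemma measurable_density_points A : measurable A -> measurable (density_points A).
Proof.
move=> mA; rewrite density_pointsE//; apply: measurable_density0.
exact: measurableC.
Qed.

Lemma density_points_ae A : measurable A ->
  mu (A `\` density_points A) = 0%E /\ mu (density_points A `\` A) = 0%E.
Proof.
move=> mA; have mD := measurable_density_points mA.
have [N [mN N0 hN]] := density_theorem mA.
split; apply/eqP; rewrite -measure_le0 -N0; apply: le_measure; rewrite ?inE//.
- exact: measurableD.
- move=> x [Ax nDx]; apply: hN => /= -[h1 h2]; apply: nDx.
  by rewrite density_pointsE//; exact: h1.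
- exact: measurableD.
- move=> x [Dx nAx]; apply: hN => /= -[h1 h2].
  move: Dx; rewrite density_pointsE//= => Dx.
  exact: (density0_disjoint mA (h2 nAx) Dx).
Qed.

Lemma density_points_eq A B : measurable A -> measurable B ->
  mu (A `\` B) = 0%E -> mu (B `\` A) = 0%E -> density_points A = density_points B.
Proof.
move=> mA mB AB BA; have mCA := measurableC mA; have mCB := measurableC mB.
rewrite !density_pointsE//; apply/seteqP; split => x /=.
- by apply: density0_ae => //; rewrite setDE setCK setIC -setDE.
- by apply: density0_ae => //; rewrite setDE setCK setIC -setDE.
Qed.

Lemma density_pointsK A : measurable A ->
  density_points (density_points A) = density_points A.
Proof.
move=> mA; have [h1 h2] := density_points_ae mA.
by apply: density_points_eq => //; exact: measurable_density_points.
Qed.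

(* If [x] is a density point of [A], then [A] meets every cube next to [x]:
   below, the part of [ball x r] beyond a hyperplane still contains a cube of
   half the size. *)
Lemma density_points_meet A (x y : V) (c : R) : measurable A -> 0 < c ->
  (forall r : R, 0 < r < c -> mu (A `&` ball (x + r *: y) (r / 2)) = 0%E) ->
  `|y| <= 1 / 2 -> ~ density_points A x.
Proof.
(* The small cube fills the fraction [1 / 2 ^+ m] of [ball x r] and misses [A] up to a null set;
   half of this fraction already contradicts density one. *)
move=> mA c0 h y1; rewrite density_pointsE// => /(_ (1 / 2 ^+ m / 2)).
have M0 : 0 < (2 ^+ m : R) by rewrite exprn_gt0.
case; first by rewrite !divr_gt0.
move=> r0 r00 hr.
have rm : 0 < Num.min r0 c by rewrite lt_min r00.
have [r [rp rr0 rc]] : exists r : R, [/\ 0 < r, r < r0 & r < c].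
  exists (Num.min r0 c / 2); split; first by rewrite divr_gt0.
  - have : Num.min r0 c <= r0 by rewrite ge_min lexx.
    by lra.
  - have : Num.min r0 c <= c by rewrite ge_min lexx orbT.
    by lra.
have sub : ball (x + r *: y) (r / 2) `<=` ball x r.
  move=> z; rewrite -!ball_normE/= => hz.
  rewrite (_ : x - z = (x + r *: y - z) - r *: y); last first.
    by rewrite [RHS]addrAC addrK.
  apply: (le_lt_trans (ler_normB _ _)); rewrite normrZ gtr0_norm//.
  have : r * `|y| <= r * (1 / 2) by rewrite ler_pM2l.
  by move: hz; lra.
have r20 : 0 < r / 2 by rewrite divr_gt0.
have := lebesgue_rV_ball (x + r *: y) r20.
have mb : measurable (ball (x + r *: y) (r / 2)) by exact: measurable_ball_rV.
rewrite (measureDI mu mb mA) [X in (_ + X)%E](_ : _ = 0%E); last first.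
  by rewrite setIC; apply: h; rewrite rp.
rewrite adde0 => E.
have : (((r / 2 *+ 2) ^+ m)%:E <= (1 / 2 ^+ m / 2 * (r *+ 2) ^+ m)%:E)%E.
  rewrite -E; apply: (le_trans _ (hr r _)); last by rewrite rp.
  apply: le_measure; rewrite ?inE.
  - exact: measurableD.
  - by apply: measurableI; [exact: measurableC|exact: measurable_ball_rV].
  - by move=> z [hz nAz]; split => //; exact: sub.
have -> : r / 2 *+ 2 = r by lra.
have -> : r *+ 2 = 2 * r by lra.
have P0 : 0 < r ^+ m by rewrite exprn_gt0.
rewrite lee_fin exprMn.
have -> : 1 / 2 ^+ m / 2 * (2 ^+ m * r ^+ m) = r ^+ m / 2.
  by rewrite div1r (mulrC _ 2^-1) -mulrA mulKf ?gt_eqF// mulrC.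
by lra.
Qed.

End density_points.

(** * Continuously differentiable functions, test fields and pairings *)

Section C1_functions.
Context {R : realType} {m : nat}.
Local Notation V := 'rV[R]_m.
Local Notation e_ i := (delta_mx 0 i : V).
Implicit Types (f g : V -> R) (x y v : V).

Definition C1 f := forall i, (forall x, derivable f x (e_ i)) /\
  continuous ('D_(e_ i) f).

Lemma is_derive_line f x v (t : R) : derivable f (x + t *: v) v ->
  is_derive t 1 (fun s : R => f (x + s *: v)) ('D_v f (x + t *: v)).
Proof.
move=> df.
have E : (fun h : R => h^-1 *: ((f (x + (h *: 1 + t) *: v) : R^o) - f (x + t *: v))) =
         (fun h : R => h^-1 *: ((f (h *: v + (x + t *: v)) : R^o) - f (x + t *: v))).
  apply/funext => h; congr (_ *: (f _ - _)).
  by rewrite scalerDl [h *: 1]mulr1 addrCA.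
by apply: DeriveDef; rewrite /derivable /derive /= E.
Qed.

Lemma line_mean_value f x v (t : R) : (forall y, derivable f y v) ->
  exists s : R, `|s| <= `|t| /\ f (x + t *: v) - f x = t * 'D_v f (x + s *: v).
Proof.
move=> df.
have dline (s : R) : is_derive s 1 (fun s : R => f (x + s *: v)) ('D_v f (x + s *: v)).
  exact: is_derive_line.
have cline : continuous (fun s : R => f (x + s *: v)).
  move=> s; apply: differentiable_continuous.
  by apply/derivable1_diffP; have [] := dline s.
have x0 : f x = f (x + 0 *: v) by rewrite scale0r addr0.
have [t0|t0] := leP 0 t.
  have [s sI h] := @MVT_segment _ (fun s : R => f (x + s *: v))
     (fun s => 'D_v f (x + s *: v)) 0 t t0 (fun s _ => dline s)
     (continuous_subspaceT cline).
  exists s; move: sI; rewrite in_itv/= => /andP[s0 st].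
  by rewrite !ger0_norm// [in LHS]x0 h subr0 mulrC.
have [s sI h] := @MVT_segment _ (fun s : R => f (x + s *: v))
     (fun s => 'D_v f (x + s *: v)) t 0 (ltW t0) (fun s _ => dline s)
     (continuous_subspaceT cline).
exists s; move: sI; rewrite in_itv/= => /andP[ts s0].
rewrite !ler0_norm// ?(ltW t0)// lerN2; split=> //.
by rewrite [in LHS]x0 -opprB h sub0r mulrN opprK mulrC.
Qed.

(* Moving one coordinate at a time reduces continuity to the mean value
   theorem on segments parallel to the axes. *)
Lemma C1_continuous f : C1 f -> continuous f.
Proof.
move=> cf x.
have [M [d [M0 d0 hM]]] : exists M, exists d : R, [/\ 0 <= M, 0 < d &
    forall y, ball x d y -> forall i, `|'D_(e_ i) f y| <= M].
  have H i : exists p : R * R, [/\ 0 <= p.1, 0 < p.2 &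
     forall y, ball x p.2 y -> `|'D_(e_ i) f y| <= p.1].
    have [_ /(_ x)/cvgrPdist_lt/(_ 1 ltr01)/nbhs_ballP[d /= d0 hd]] := cf i.
    exists (`|'D_(e_ i) f x| + 1, d); split=> //=.
    move=> y /hd /= h.
    rewrite -[X in `|X|](subrK ('D_(e_ i) f x)) (le_trans (ler_normD _ _))//.
    by rewrite addrC lerD2l distrC ltW.
  have [p hp] := choice H.
  exists (\big[Num.max/0]_i (p i).1), (\big[Num.min/1]_i (p i).2); split.
  - exact: bigmax_ge_id.
  - by apply: lt_bigmin => // i _; have [] := hp i.
  - move=> y xy i; have [_ _ h] := hp i.
    apply: (le_trans (h y _)); last exact: le_bigmax.
    by apply: le_ball xy; exact: bigmin_le.
apply/(@cvgrPdist_le _ _ _ (nbhs x)) => e e0.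
apply/nbhs_ballP; exists (Num.min d (e / (m.+1%:R * (M + 1)))) => /=.
  by rewrite lt_min d0 divr_gt0// mulr_gt0// ltr_wpDl.
move=> y xy.
pose r := Num.min d (e / (m.+1%:R * (M + 1))).
have r0 : 0 < r by rewrite lt_min d0 divr_gt0// mulr_gt0// ltr_wpDl.
pose z (k : nat) : V := \row_j (if (j < k)%N then y 0 j else x 0 j).
have step (k : 'I_m) : `|f (z k.+1) - f (z k)| <= r * M.
  have zk : z k.+1 = z k + (y 0 k - x 0 k) *: e_ k.
    apply/rowP => j; rewrite !mxE eqxx/= ltnS leq_eqVlt.
    have [/val_inj ->|jk] := eqVneq (j : nat) k.
      by rewrite eqxx ltnn mulr1 addrC subrK.
    have /negPf-> : j != k by apply: contra_neq jk => ->.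
    by rewrite mulr0 addr0.
  rewrite zk; have [s [st ->]] := line_mean_value (z k) (y 0 k - x 0 k) (fun y => (cf k).1 y).
  have yx : `|y 0 k - x 0 k| <= r.
    by have /ball_rVP[_ /(_ k)] := xy; rewrite distrC => /ltW.
  rewrite normrM; apply: ler_pM => //.
  apply: hM; apply/ball_rVP; split=> // j; rewrite !mxE eqxx /=.
  have yx' i : `|x 0 i - y 0 i| < d.
    have /ball_rVP[_ /(_ i)/lt_le_trans] := xy; apply.
    by rewrite ge_min lexx.
  have [->|jk] := eqVneq j k.
    rewrite ltnn mulr1 opprD addrA subrr sub0r normrN.
    by rewrite (le_lt_trans st)// distrC.
  rewrite mulr0 addr0; case: ifP => // _.
  by rewrite subrr normr0.
have tele k : (k <= m)%N -> `|f (z k) - f (z 0)| <= k%:R * (r * M).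
  elim: k => [|k IH km]; first by rewrite subrr normr0 mul0r.
  rewrite -[X in `|X|](subrKA (f (z k))) (le_trans (ler_normD _ _))//.
  rewrite -natr1 mulrDl mul1r addrC; apply: lerD; first exact: (IH (ltnW km)).
  exact: (step (Ordinal km)).
have zm : z m = y by apply/rowP => j; rewrite mxE ltn_ord.
have z0 : z 0 = x by apply/rowP => j; rewrite mxE ltn0.
have := tele m (leqnn m); rewrite zm z0 distrC => /le_trans; apply.
apply: (@le_trans _ _ (m.+1%:R * (r * (M + 1)))).
  apply: ler_pM => //; first by rewrite mulr_ge0// ltW.
    by rewrite ler_nat.
  by rewrite ler_pM2l// lerDl.
rewrite mulrCA -ler_pdivlMr; last by rewrite mulr_gt0// ltr_wpDl.
by rewrite ge_min lexx orbT.
Qed.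

Lemma C1_measurable f : C1 f -> measurable_fun setT f.
Proof. by move=> /C1_continuous; exact: continuous_measurable_rV. Qed.

Lemma C1_cst (c : R) : C1 (cst c).
Proof.
move=> i; split=> [x|]; first exact: derivable_cst.
rewrite (_ : 'D_(e_ i) (cst c) = cst 0); first exact: cst_continuous.
by apply/funext => x; rewrite derive_cst.
Qed.

Lemma C1D f g : C1 f -> C1 g -> C1 (f \+ g).
Proof.
move=> cf cg i; have [df cdf] := cf i; have [dg cdg] := cg i.
split=> [x|]; first exact: derivableD.
rewrite (_ : 'D_(e_ i) (f \+ g) = 'D_(e_ i) f \+ 'D_(e_ i) g).
  by move=> x; apply: (@continuousD _ R^o); [exact: cdf|exact: cdg].
by apply/funext => x; rewrite [LHS]deriveD.
Qed.

Lemma C1M f g : C1 f -> C1 g -> C1 (f \* g).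
Proof.
move=> cf cg i; have [df cdf] := cf i; have [dg cdg] := cg i.
split=> [x|]; first exact: derivableM.
rewrite (_ : 'D_(e_ i) (f \* g) =
    (fun x => f x * 'D_(e_ i) g x + g x * 'D_(e_ i) f x)).
  move=> x; apply: (@continuousD _ R^o _ (f \* 'D_(e_ i) g) (g \* 'D_(e_ i) f));
    apply: continuousM.
  - exact: C1_continuous.
  - exact: cdg.
  - exact: C1_continuous.
  - exact: cdf.
by apply/funext => x; rewrite [LHS]deriveM.
Qed.

Lemma C1Z (c : R) f : C1 f -> C1 (fun x => c * f x).
Proof. by move=> cf; apply: (C1M (C1_cst c) cf). Qed.

Lemma C1N f : C1 f -> C1 (fun x => - f x).
Proof. by move=> cf; under eq_fun do rewrite -mulN1r; exact: C1Z. Qed.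

Lemma C1B f g : C1 f -> C1 g -> C1 (fun x => f x - g x).
Proof. by move=> cf cg; apply: (C1D cf (C1N cg)). Qed.

End C1_functions.

Lemma integrable_indic_lty d (T : measurableType d) (R : realType)
  (nu : {measure set T -> \bar R}) (A : set T) : measurable A ->
  (nu A < +oo)%E -> nu.-integrable setT (EFin \o \1_A).
Proof.
move=> mA Aoo; apply/integrableP; split; first exact/measurable_EFinP.
rewrite (eq_integral (fun x => (\1_A x)%:E)); last first.
  by move=> t _; rewrite gee0_abs// lee_fin.
by rewrite integral_indic// setIT.
Qed.

Section test_fields.
Context {R : realType} {m : nat}.
Local Notation mu := (lebesgue_rV m).
Local Notation V := 'rV[R]_m.
Local Notation e_ i := (delta_mx 0 i : V).
Implicit Types (f g : V -> R) (x y v : V) (phi psi : V -> V) (U E : set V).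

(** In finite dimension this stands for compactness of the closed support, and it passes to products
    and sums without topology. *)
Definition bsupp f := exists M : R, forall x, f x != 0 -> `|x| <= M.

Lemma bsuppW f g : (forall x, f x = 0 -> g x = 0) -> bsupp f -> bsupp g.
Proof.
move=> fg [M h]; exists M => x gx; apply: h; apply: contra_neq gx.
exact: fg.
Qed.

Lemma bsuppMl f g : bsupp f -> bsupp (fun x => f x * g x).
Proof. by apply: bsuppW => x ->; rewrite mul0r. Qed.

Lemma bsuppMr f g : bsupp f -> bsupp (fun x => g x * f x).
Proof. by apply: bsuppW => x ->; rewrite mulr0. Qed.

Lemma bsupp_sum (I : finType) (F : I -> V -> R) : (forall i, bsupp (F i)) ->
  bsupp (fun x => \sum_i F i x).
Proof.
move=> /choice[M hM]; exists (\big[Num.max/0]_i M i) => x h.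
have [i fi] : exists i, F i x != 0.
  apply: contrapT => nh; move/eqP : h; apply; apply: big1 => i _.
  by apply: contrapT => /eqP h; apply: nh; exists i.
by apply: (le_trans (hM i _ fi)); exact: le_bigmax.
Qed.

Lemma bounded_closed_ball_compact (M : R) : compact [set x : V | `|x| <= M].
Proof.
apply: bounded_closed_compact.
  by exists M; split; [exact: num_real|move=> N MN x /= /le_trans; apply; exact: ltW].
rewrite (_ : [set x | _] = (fun x : V => `|x|) @^-1` [set r | r <= M]); last by [].
by apply: closed_comp => [x _|]; [exact: norm_continuous|exact: closed_le].
Qed.

Lemma continuous_bsupp_bounded f : continuous f -> bsupp f ->
  exists2 C : R, 0 <= C & forall x, `|f x| <= C.
Proof.
move=> cf [M hM].
pose A := [set x : V | `|x| <= Num.max 0 M].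
have A0 : A 0 by rewrite /A/= normr0 le_max lexx.
have cA : compact A by exact: bounded_closed_ball_compact.
have [c _ hc] := @EVT_max_rV _ _ (fun x => `|f x|) A (ex_intro _ _ A0) cA
  (continuous_subspaceT (fun x => continuous_comp (cf x) (@norm_continuous _ R^o _))).
exists `|f c| => // x.
have [->|fx] := eqVneq (f x) 0; first by rewrite normr0.
by apply: hc; rewrite inE /A/= le_max hM ?orbT.
Qed.

Lemma lebesgue_rV_bounded_lty (M : R) : (mu [set x : V | (`|x| <= M)%R] < +oo)%E.
Proof.
apply: (@le_lt_trans _ _ (mu (ball (0 : V) (Num.max 0 M + 1)%R))).
  apply: le_measure; rewrite ?inE.
  - by apply: measurable_le_set => //; apply: continuous_measurable_rV => x; exact: norm_continuous.
  - exact: measurable_ball_rV.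
  - move=> x /= xM; rewrite -ball_normE/= sub0r normrN ltr_pwDr//.
    by rewrite le_max xM orbT.
by rewrite [ltLHS]lebesgue_rV_ball ?ltry// ltr_pwDr// le_max lexx.
Qed.

Lemma bounded_bsupp_integrable f (C : R) : measurable_fun setT f ->
  (forall x, `|f x| <= C) -> bsupp f -> mu.-integrable setT (EFin \o f).
Proof.
move=> mf fC [M hM].
pose A := [set x : V | `|x| <= M].
have mA : measurable A.
  by apply: measurable_le_set => //; apply: continuous_measurable_rV => x; exact: norm_continuous.
apply: (@le_integrable _ _ _ mu setT measurableT _
   (EFin \o (fun x => C * \1_A x))).
- exact/measurable_EFinP.
- move=> x _ /=; rewrite lee_fin.
  have [fx|fx] := eqVneq (f x) 0.
    by rewrite fx normr0.
  by rewrite indicE mem_set ?mulr1 ?(le_trans (fC x)) ?ler_norm//; exact: hM.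
- rewrite /comp; under eq_fun do rewrite EFinM.
  apply: integrableZl => //; apply: integrable_indic_lty => //.
  exact: lebesgue_rV_bounded_lty.
Qed.

Lemma C1_bsupp_derive f i : bsupp f -> bsupp ('D_(e_ i) f).
Proof.
move=> [M hM]; exists M => x; apply: contraTT; rewrite -ltNge => xM.
rewrite negbK; apply/eqP; rewrite (@near_eq_derive _ _ _ _ (cst 0)).
  by rewrite derive_cst.
have : nbhs x [set y : V | M < `|y|].
  apply: open_nbhs_nbhs; split=> //.
  rewrite (_ : [set y | _] = (fun y : V => `|y|) @^-1` [set r | M < r]); last by [].
  by apply: open_comp => [y _|]; [exact: norm_continuous|exact: open_gt].
apply: filterS => y /= My; apply/eqP; apply: contraTT My => /hM.
by rewrite leNgt.
Qed.

Lemma continuous_bsupp_integrable f : continuous f -> bsupp f ->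
  mu.-integrable setT (EFin \o f).
Proof.
move=> cf bf; have [C _ fC] := continuous_bsupp_bounded cf bf.
apply: bounded_bsupp_integrable fC bf.
exact: continuous_measurable_rV.
Qed.

(** [test_fields] coordinate by coordinate. Compact support in [U] becomes a bounded support with a
    uniform distance [d] to the complement of [U], a form that survives convex combination and
    mollification with explicit constants; [test_fieldsE] is the equivalence for open [U]. *)
Definition tfield U phi := [/\ forall j, C1 (fun x => phi x 0 j),
  exists M : R, forall x, phi x != 0 -> `|x| <= M,
  exists2 d : R, 0 < d & forall x, phi x != 0 -> ball x d `<=` U &
  forall x, enorm (phi x) <= 1].

Lemma continuous_rV (T : topologicalType) k (F : T -> 'rV[R]_k) :
  (forall j, continuous (fun t : T => F t 0 j)) -> continuous F.
Proof.
move=> cF x; apply/(@cvgrPdist_le _ _ _ (nbhs x)) => e e0; near=> y.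
rewrite [leLHS]mx_normrE (bigmax_le _ (ltW e0))//= => -[i j] _.
rewrite !mxE/= (ord1 i).
move: j; near: y; apply: filter_forall => /= j.
exact: ((cvgrPdist_le _ _).1 (cF j x)).
Unshelve. all: by end_near. Qed.

Lemma derive_row phi v x : (forall j, derivable (fun y => phi y 0 j) x v) ->
  forall j, ('D_v phi x) 0 j = 'D_v (fun y => phi y 0 j) x.
Proof.
move=> h j; rewrite derive_mx ?mxE//.
by apply/derivable_mxP => i k; rewrite (ord1 i).
Qed.

Lemma divergenceE phi x : (forall j, C1 (fun x => phi x 0 j)) ->
  divergence phi x = \sum_i 'D_(e_ i) (fun y => phi y 0 i) x.
Proof.
move=> h; apply: eq_bigr => i _; rewrite derive_row// => j.
by have [] := h j i.
Qed.

Lemma compact_margin (K U : set V) : compact K -> open U -> K `<=` U ->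
  exists2 d : R, 0 < d & forall x, K x -> ball x d `<=` U.
Proof.
rewrite compact_near_coveringP => cK oU KU.
have [] := cK R (0^'+) (fun d x => ball x d `<=` U).
  move=> x Kx.
  have [r /= r0 hr] : nbhs_ball x U.
    by apply/nbhs_ballP; apply: open_nbhs_nbhs; split=> //; exact: KU.
  exists (ball x (r / 2), [set d | 0 < d < r / 2]) => /=.
    split; first by apply: nbhsx_ballx; rewrite divr_gt0.
    exists (r / 2) => /=; first by rewrite divr_gt0.
    by move=> d /=; rewrite sub0r normrN => h d0; rewrite d0 (le_lt_trans (ler_norm _) h).
  move=> [y d] [/= xy /andP[d0 dr]] z yz; apply: hr.
  rewrite (splitr r); apply: ball_triangle xy _.
  exact: le_ball (ltW dr) _ yz.
move=> e /= e0 he; exists (e / 2); first by rewrite divr_gt0.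
apply: he; last by rewrite divr_gt0.
by rewrite /= sub0r normrN gtr0_norm ?divr_gt0//; lra.
Qed.

Lemma test_fieldsE U phi : open U -> test_fields U phi <-> tfield U phi.
Proof.
move=> oU; split.
- move=> [dphi cK KU n1].
  have c1 j : C1 (fun x => phi x 0 j).
    move=> i; have [d1 d2] := dphi i.
    have dj x k : derivable (fun y => phi y 0 k) x (e_ i).
      by have /derivable_mxP := d1 x; apply.
    split=> // x.
    rewrite (_ : 'D_(e_ i) _ = (fun N : V => N 0 j) \o 'D_(e_ i) phi).
      by apply: continuous_comp; [exact: d2|exact: coord_continuous].
    by apply/funext => y /=; rewrite derive_row.
  split=> //.
  + have [M [Mr hM]] := compact_bounded cK.
    exists (M + 1) => x px; apply: hM; first by rewrite ltrDl.
    exact: subset_closure.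
  + have [d d0 hd] := compact_margin cK oU KU.
    by exists d => // x px; apply: hd; exact: subset_closure.
- move=> [c1 [M hM] [d d0 hd] n1].
  have clM : closure [set x | phi x != 0] `<=` [set x : V | `|x| <= M].
    have cl : closed [set x : V | `|x| <= M].
      apply: compact_closed; last exact: bounded_closed_ball_compact.
      exact: norm_hausdorff.
    rewrite [X in _ `<=` X]((closure_id _).1 cl).
    by apply: closure_subset => x; exact: hM.
  split=> //.
  + move=> i; split=> [x|].
      by apply/derivable_mxP => k j; rewrite (ord1 k); have [] := c1 j i.
    apply: continuous_rV => j.
    rewrite (_ : (fun x => _) = 'D_(e_ i) (fun y => phi y 0 j)).
      by have [] := c1 j i.
    by apply/funext => x; rewrite derive_row// => k; have [] := c1 k i.
  + apply: (@subclosed_compact _ _ [set x : V | `|x| <= M]) => //.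
      exact: closed_closure.
    exact: bounded_closed_ball_compact.
  + move=> x /(_ (ball x d) (nbhsx_ballx x d d0))[y [py xy]].
    by apply: hd py _ _; exact: ball_sym.
Qed.

Section properties.
Variables (U : set V) (phi : V -> V) (tphi : tfield U phi).

Let c1 : forall j, C1 (fun x => phi x 0 j). Proof. by case: tphi. Qed.

Lemma tfield_bsupp j : bsupp (fun x => phi x 0 j).
Proof.
have [_ [M hM] _ _] := tphi; exists M => x px; apply: hM.
by apply: contra_neq px => ->; rewrite mxE.
Qed.

Lemma divergence_continuous : continuous (divergence phi).
Proof.
rewrite (_ : divergence phi = fun x => \sum_i 'D_(e_ i) (fun y => phi y 0 i) x).
  apply: continuous_big => [|i _]; first exact: (@add_continuous R^o).
  by have [_] := c1 i i.
by apply/funext => x; rewrite divergenceE.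
Qed.

Lemma divergence_bsupp : bsupp (divergence phi).
Proof.
rewrite (_ : divergence phi = fun x => \sum_i 'D_(e_ i) (fun y => phi y 0 i) x).
  by apply: bsupp_sum => i; apply: C1_bsupp_derive; exact: tfield_bsupp.
by apply/funext => x; rewrite divergenceE.
Qed.

Lemma divergence_measurable : measurable_fun setT (divergence phi).
Proof. by apply: continuous_measurable_rV; exact: divergence_continuous. Qed.

Lemma divergence_integrable : mu.-integrable setT (EFin \o divergence phi).
Proof.
by apply: continuous_bsupp_integrable;
  [exact: divergence_continuous|exact: divergence_bsupp].
Qed.

Lemma divergence_out x : ~ U x -> divergence phi x = 0.
Proof.
move=> nUx; rewrite divergenceE//; apply: big1 => i _.
have [_ _ [d d0 hd] _] := tphi.
rewrite (@near_eq_derive _ _ _ _ (cst 0)) ?derive_cst//.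
apply/nbhs_ballP; exists d => //= y xy.
have [->|py] := eqVneq (phi y) 0; first by rewrite mxE.
by case: nUx; apply: (hd y py); exact: ball_sym.
Qed.

End properties.

(** The integral runs over all of [E]: the divergence of a field supported in [U] vanishes off [U],
    so one real number serves for every [U]. *)
Definition pairing E phi : R := \int[mu]_(x in E) divergence phi x.

Lemma pairingE U E phi : measurable U -> tfield U phi -> measurable E ->
  (\int[mu]_(x in U) (\1_E x * divergence phi x)%:E = (pairing E phi)%:E)%E.
Proof.
move=> mU tphi mE; rewrite /pairing /Rintegral fineK; last first.
  apply: integrable_fin_num => //.
  by apply: integrableS (divergence_integrable tphi).
rewrite [LHS]integral_mkcond [RHS]integral_mkcond; apply: eq_integral => x _.
rewrite !patchE indicE; have [xE|xE] := boolP (x \in E).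
  by case: ifPn => [|/negP xU]; [rewrite mul1r|rewrite (divergence_out tphi)// => ?; apply: xU; rewrite inE].
by case: ifP => //; rewrite mul0r.
Qed.

Lemma perimeter_leP U E (c : \bar R) : open U -> measurable E ->
  (perimeter E U <= c)%E <-> (forall phi, tfield U phi -> ((pairing E phi)%:E <= c)%E).
Proof.
move=> oU mE; have mU := open_measurable_rV oU; split=> [h phi tphi|h].
  apply: le_trans h; rewrite -(pairingE mU tphi mE); apply: ereal_sup_ubound.
  by exists phi => //; apply/test_fieldsE.
apply: ge_ereal_sup => _ [phi /(test_fieldsE _ oU) tphi <-].
by rewrite pairingE//; exact: h.
Qed.

Lemma tfield0 U : tfield U (fun=> 0).
Proof.
split.
- by move=> j; under eq_fun do rewrite mxE; exact: C1_cst.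
- by exists 0 => x; rewrite eqxx.
- by exists 1 => // x; rewrite eqxx.
- by move=> x; rewrite enorm0.
Qed.

Lemma pairing0 E : pairing E (fun=> 0) = 0.
Proof.
rewrite /pairing (_ : divergence _ = cst 0); first by rewrite /Rintegral integral0.
apply/funext => x; rewrite divergenceE; last first.
  by move=> j; under eq_fun do rewrite mxE; exact: C1_cst.
apply: big1 => i _; under [fun y => _]eq_fun do rewrite mxE.
by rewrite (derive_cst 0).
Qed.

Lemma perimeter_ge0 U E : open U -> measurable E -> (0 <= perimeter E U)%E.
Proof.
move=> oU mE; have := (perimeter_leP (perimeter E U) oU mE).1 (lexx _).
by move=> /(_ _ (tfield0 U)); rewrite pairing0.
Qed.

End test_fields.

(** * Dominated convergence, convolution and mollification *)

Section dominated_Rintegral.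
Context d (T : measurableType d) (R : realType) (mu : {measure set T -> \bar R}).
Variables (D : set T) (mD : measurable D).

Lemma dominated_cvg_Rintegral (f_ : (T -> R)^nat) (f g : T -> R) :
  (forall n, measurable_fun D (f_ n)) -> measurable_fun D f ->
  {ae mu, forall x, D x -> f_ n x @[n --> \oo] --> f x} ->
  mu.-integrable D (EFin \o g) -> (forall n x, D x -> `|f_ n x| <= g x) ->
  \int[mu]_(x in D) f_ n x @[n --> \oo] --> \int[mu]_(x in D) f x.
Proof.
move=> mf_ mf f_f ig fg.
have f_f' : {ae mu, forall x, D x -> (f_ n x)%:E @[n --> \oo] --> (f x)%:E}.
  by apply: filterS f_f => x h Dx; apply: cvg_EFin (h Dx); exact: nearW.
have fg' : {ae mu, forall x n, D x -> (`|(f_ n x)%:E| <= (g x)%:E)%E}.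
  by apply: aeW => x n Dx; rewrite lee_fin; exact: fg.
have [intf _ h] := @dominated_convergence _ _ _ mu D mD (fun n => EFin \o f_ n)
  (EFin \o f) (EFin \o g) (fun n => (measurable_EFinP _ _).2 (mf_ n))
  ((measurable_EFinP _ _).2 mf) f_f' ig fg'.
by apply: fine_cvg; rewrite fineK//; exact: integrable_fin_num.
Qed.

End dominated_Rintegral.

Section mollifier.
Context {R : realType} {m : nat}.
Local Notation mu := (lebesgue_rV m).
Local Notation V := 'rV[R]_m.
Local Notation e_ i := (delta_mx 0 i : V).
Implicit Types (f g k : V -> R) (x y v : V) (e : R).

(** The squared positive part has a Lipschitz derivative, so its Taylor remainder is quadratic even
    across the kink. The mollifier and the cutoff [step] are both built from it. *)
Lemma sqpos_bound (s h : R) :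
  `|Num.max 0 (s + h) ^+ 2 - Num.max 0 s ^+ 2 - 2 * h * Num.max 0 s| <= h ^+ 2.
Proof.
rewrite ler_norml.
have [s0|s0] := leP 0 s; have [sh|sh] := leP 0 (s + h); apply/andP; split; nra.
Qed.

Lemma is_derive_quadratic f x v (df K : R) :
  (forall h : R, `|h| <= 1 -> `|f (x + h *: v) - f x - h * df| <= K * h ^+ 2) ->
  is_derive x v f df.
Proof.
move=> H.
have K0 : 0 <= K.
  by have := H 1; rewrite normr1 expr1n mulr1 => /(_ (lexx _)); exact: le_trans.
have cv : (fun h : R => h^-1 *: ((f (h *: v + x) : R^o) - f x)) @ 0^' --> df.
  apply/cvgrPdist_le => e e0.
  have d0 : 0 < Num.min 1 (e / (K + 1)) by rewrite lt_min ltr01 divr_gt0// ltr_wpDl.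
  exists (Num.min 1 (e / (K + 1))) => // h /=; rewrite sub0r normrN => hd h0.
  rewrite lt_min in hd; case/andP: hd => h1 he.
  rewrite distrC [h *: v + x]addrC.
  have -> : h^-1 *: (f (x + h *: v) - f x : R^o) - df =
            h^-1 * (f (x + h *: v) - f x - h * df).
    by rewrite [RHS]mulrBr mulKf.
  rewrite normrM normfV ler_pdivrMl ?normr_gt0//.
  apply: (le_trans (H h (ltW h1))).
  rewrite -(@real_normK _ h) ?num_real// expr2 mulrA mulrC.
  rewrite ler_pM2l ?normr_gt0//.
  apply: (@le_trans _ _ (K * (e / (K + 1)))); first by rewrite ler_wpM2l// ltW.
  rewrite mulrCA ler_piMr ?(ltW e0)// ler_pdivrMr ?ltr_wpDl// mul1r.
  by rewrite lerDl.
by apply: DeriveDef; [apply/cvg_ex; exists df|exact: cvg_lim cv].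
Qed.

(** A polynomial bump suffices because test fields are only [C1]; its derivative [dkern] is explicit
    and odd. *)
Definition kern e x : R := Num.max 0 (1 - dotr x x / e ^+ 2) ^+ 2.

Definition dkern e v x : R :=
  - (4 / e ^+ 2) * Num.max 0 (1 - dotr x x / e ^+ 2) * dotr x v.

Lemma is_derive_kern e x v : is_derive x v (kern e) (dkern e v x).
Proof.
pose c := dotr v v / e ^+ 2; pose b := - (2 * dotr x v / e ^+ 2).
pose u := Num.max 0 (1 - dotr x x / e ^+ 2).
have c0 : 0 <= c by rewrite divr_ge0 ?dotr_ge0 ?sqr_ge0.
have u0 : 0 <= u by rewrite le_max lexx.
apply: (@is_derive_quadratic _ _ _ _ ((`|b| + c) ^+ 2 + 2 * c * u)) => h h1.
have E : 1 - dotr (x + h *: v) (x + h *: v) / e ^+ 2 =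
    1 - dotr x x / e ^+ 2 + (b * h - c * h ^+ 2).
  rewrite dotrDl !dotrDr !(dotrZl, dotrZr) (dotrC v x) /b /c.
  by lra.
rewrite /kern E /dkern.
have := sqpos_bound (1 - dotr x x / e ^+ 2) (b * h - c * h ^+ 2).
rewrite -/u; set A := _ ^+ 2 - _ => hA.
have -> : A - h * (- (4 / e ^+ 2) * u * dotr x v) =
    (A - 2 * (b * h - c * h ^+ 2) * u) - 2 * c * u * h ^+ 2 by rewrite /b; lra.
apply: (le_trans (ler_normB _ _)); rewrite [leRHS]mulrDl.
apply: lerD; last by rewrite ger0_norm//; apply: mulr_ge0; [nra|exact: sqr_ge0].
apply: (le_trans hA).
rewrite -[leLHS]real_normK ?num_real//.
have -> : (`|b| + c) ^+ 2 * h ^+ 2 = ((`|b| + c) * `|h|) ^+ 2.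
  by rewrite exprMn real_normK ?num_real.
rewrite lerXn2r ?nnegrE ?mulr_ge0 ?addr_ge0//.
rewrite (_ : b * h - c * h ^+ 2 = (b - c * h) * h); last by lra.
rewrite normrM ler_wpM2r//.
apply: (le_trans (ler_normB _ _)); rewrite lerD2l normrM (ger0_norm c0).
by rewrite ler_piMr.
Qed.

Lemma kern_ge0 e x : 0 <= kern e x. Proof. exact: sqr_ge0. Qed.

Lemma kern_le1 e x : kern e x <= 1.
Proof.
rewrite /kern exprn_ile1// ?le_max ?lexx// ge_max ler01/=.
by rewrite gerBl divr_ge0 ?dotr_ge0 ?sqr_ge0.
Qed.

Lemma kernN e x : kern e (- x) = kern e x.
Proof. by rewrite /kern dotrNl dotrNr opprK. Qed.

Lemma dkernN e v x : dkern e v (- x) = - dkern e v x.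
Proof. by rewrite /dkern !dotrNl dotrNr opprK mulrN. Qed.

Lemma kern_pos e x : 0 < e -> Num.max 0 (1 - dotr x x / e ^+ 2) != 0 -> enorm x < e.
Proof.
move=> e0; apply: contra_neqT; rewrite -leNgt => ex.
apply/max_idPl; rewrite subr_le0 ler_pdivlMr ?exprn_gt0// mul1r.
by rewrite -sqr_enorm lerXn2r ?nnegrE ?enorm_ge0// ltW.
Qed.

Lemma kern_supp e x : 0 < e -> kern e x != 0 -> ball 0 e x.
Proof.
move=> e0; rewrite /kern sqrf_eq0 => /(kern_pos e0) ex.
rewrite -ball_normE/= sub0r normrN.
exact: le_lt_trans (norm_le_enorm x) ex.
Qed.

Lemma dkern_bound e v x : 0 < e -> `|dkern e v x| <= 4 / e * enorm v.
Proof.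
move=> e0; rewrite /dkern; set u := Num.max 0 _.
have [->|u0] := eqVneq u 0.
  by rewrite mulr0 mul0r normr0 mulr_ge0 ?divr_ge0 ?enorm_ge0// ltW.
have xe := kern_pos e0 u0.
have u1 : 0 <= u <= 1.
  rewrite le_max lexx/= ge_max ler01/=.
  by rewrite gerBl divr_ge0 ?dotr_ge0 ?sqr_ge0.
have hd : `|dotr x v| <= e * enorm v.
  rewrite ler_norml; apply/andP; split.
  - rewrite lerNl -dotrNl (le_trans (cauchy_schwarz _ _))// enormN.
    by rewrite ler_wpM2r ?enorm_ge0// ltW.
  - rewrite (le_trans (cauchy_schwarz _ _))//.
    by rewrite ler_wpM2r ?enorm_ge0// ltW.
have e2 : 0 <= 4 / e ^+ 2 by rewrite divr_ge0// sqr_ge0.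
rewrite 2!normrM normrN (ger0_norm e2) (ger0_norm (andP u1).1).
apply: (@le_trans _ _ (4 / e ^+ 2 * 1 * (e * enorm v))).
  apply: ler_pM => //; first by rewrite mulr_ge0// ?divr_ge0 ?sqr_ge0//; case/andP: u1.
  by rewrite ler_wpM2l ?divr_ge0 ?sqr_ge0//; case/andP: u1.
rewrite mulr1 expr2 invfM !mulrA -(mulrA _ e^-1 e) mulVf ?mulr1// gt_eqF//.
Qed.

Lemma dotr_continuous v : continuous (fun x => dotr x v).
Proof.
apply: continuous_big => [|i _]; first exact: (@add_continuous R^o).
move=> x; apply: continuousM; [exact: coord_continuous|exact: cst_continuous].
Qed.

Lemma sqdotr_continuous : continuous (fun x => dotr x x).
Proof.
apply: continuous_big => [|i _]; first exact: (@add_continuous R^o).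
by move=> x; apply: continuousM; exact: coord_continuous.
Qed.

Lemma kern0_continuous e : continuous (fun x => Num.max 0 (1 - dotr x x / e ^+ 2)).
Proof.
move=> x; apply: (@continuous_max _ _ (cst 0) (fun x => 1 - dotr x x / e ^+ 2)).
  exact: cst_continuous.
apply: (@continuousB _ R^o); first exact: cst_continuous.
by apply: continuousM; [exact: sqdotr_continuous|exact: cst_continuous].
Qed.

Lemma kern_continuous e : continuous (kern e).
Proof.
move=> x; apply: (@continuous_comp _ _ _ (fun x => Num.max 0 (1 - dotr x x / e ^+ 2))
  (fun s : R => s ^+ 2)); first exact: kern0_continuous.
exact: exprn_continuous.
Qed.

Lemma dkern_continuous e v : continuous (dkern e v).
Proof.
pose u x := Num.max 0 (1 - dotr x x / e ^+ 2).
move=> x; apply: (@continuousM _ _ (cst (- (4 / e ^+ 2)) \* u) (fun x => dotr x v)).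
  by apply: continuousM; [exact: cst_continuous|exact: kern0_continuous].
exact: dotr_continuous.
Qed.

End mollifier.

Section integrability.
Context d (T : measurableType d) (R : realType) (nu : {measure set T -> \bar R}).
Variables (D : set T) (mD : measurable D).

Lemma integrable_measurable (f : T -> R) :
  nu.-integrable D (EFin \o f) -> measurable_fun D f.
Proof. by move=> /integrableP[/measurable_EFinP]. Qed.

Lemma integrable_EFinZ (c : R) (f : T -> R) : nu.-integrable D (EFin \o f) ->
  nu.-integrable D (EFin \o (fun x => c * f x)).
Proof. by move=> fi; rewrite /comp; under eq_fun do rewrite EFinM; exact: integrableZl. Qed.

Lemma integrable_bounded_mul (h g : T -> R) (C : R) :
  measurable_fun D h -> (forall x, D x -> `|h x| <= C) ->
  nu.-integrable D (EFin \o g) -> nu.-integrable D (EFin \o (fun x => h x * g x)).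
Proof.
move=> mh hC ig; have mg := integrable_measurable ig.
have iG : nu.-integrable D (EFin \o (fun x => C * `|g x|)).
  by apply: integrable_EFinZ => //; exact: integrable_norm.
apply: le_integrable iG => //; first by apply/measurable_EFinP; exact: measurable_funM.
move=> x Dx /=; rewrite lee_fin normrM.
apply: le_trans (ler_norm _); rewrite ler_wpM2r//; exact: hC.
Qed.

Lemma integrable_EFinD (f g : T -> R) : nu.-integrable D (EFin \o f) ->
  nu.-integrable D (EFin \o g) -> nu.-integrable D (EFin \o (fun x => f x + g x)).
Proof. by move=> fi gi; rewrite /comp; under eq_fun do rewrite EFinD; exact: integrableD. Qed.

Lemma integrable_EFinB (f g : T -> R) : nu.-integrable D (EFin \o f) ->
  nu.-integrable D (EFin \o g) -> nu.-integrable D (EFin \o (fun x => f x - g x)).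
Proof. by move=> fi gi; rewrite /comp; under eq_fun do rewrite EFinB; exact: integrableB. Qed.

Lemma integrable_EFin_sum (I : Type) (s : seq I) (F : I -> T -> R) :
  (forall i, nu.-integrable D (EFin \o F i)) ->
  nu.-integrable D (EFin \o (fun x => \sum_(i <- s) F i x)).
Proof.
move=> iF; elim: s => [|a s IH].
  by rewrite /comp; under eq_fun do rewrite big_nil; exact: integrable0.
rewrite /comp; under eq_fun do rewrite big_cons.
exact: integrable_EFinD.
Qed.

Lemma Rintegral_sum (I : Type) (s : seq I) (F : I -> T -> R) :
  (forall i, nu.-integrable D (EFin \o F i)) ->
  \int[nu]_(x in D) (\sum_(i <- s) F i x) = \sum_(i <- s) \int[nu]_(x in D) F i x.
Proof.
move=> iF; elim: s => [|a s IH].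
  rewrite big_nil; under eq_Rintegral do rewrite big_nil.
  by rewrite /Rintegral integral0.
under eq_Rintegral do rewrite big_cons.
rewrite RintegralD// ?IH ?big_cons//.
exact: integrable_EFin_sum.
Qed.

End integrability.

Section convolution.
Context {R : realType} {m : nat}.
Local Notation mu := (lebesgue_rV m).
Local Notation V := 'rV[R]_m.
Local Notation e_ i := (delta_mx 0 i : V).
Implicit Types (f g k w : V -> R) (x y v : V) (e : R).

(** Reduces continuity to sequences, along which dominated convergence applies. *)
Lemma seq_continuous_at (F : V -> R) x :
  (forall u : nat -> V, u n @[n --> \oo] --> x -> F (u n) @[n --> \oo] --> F x) ->
  {for x, continuous F}.
Proof.
move=> H; apply/(@cvgrPdist_lt _ _ _ (nbhs x)) => e e0; apply: contrapT => nF.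
have hu (n : nat) : exists y, ball x n.+1%:R^-1 y /\ e <= `|F x - F y|.
  apply: contrapT => /forallNP h; apply: nF; apply/nbhs_ballP.
  exists n.+1%:R^-1 => /=; first by rewrite invr_gt0.
  move=> y xy; rewrite ltNge; apply/negP => ey; exact: (h y).
have [u uP] := choice hu.
have : u n @[n --> \oo] --> x.
  apply/cvg_ballP => d d0.
  near=> n; apply: (@le_ball _ _ _ n.+1%:R^-1); last by have [] := uP n.
  by apply/ltW; near: n; exact: (near_infty_natSinv_lt (PosNum d0)).
move=> /H /cvgrPdist_lt /(_ _ e0) [N _ /(_ N (leqnn N))].
by have [_] := uP N; rewrite leNgt => /negP.
Unshelve. all: by end_near. Qed.

Definition conv k g x : R := \int[mu]_y (k (x - y) * g y).

Section conv_lemmas.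
Variables (k g : V -> R) (C : R).
Hypotheses (ck : continuous k) (kC : forall x, `|k x| <= C)
  (ig : mu.-integrable setT (EFin \o g)).

Let mk : measurable_fun setT k. Proof. exact: continuous_measurable_rV. Qed.

Let mkx x : measurable_fun setT (fun y => k (x - y)).
Proof. by apply: measurableT_comp => //; apply: measurable_subrV. Qed.

Lemma conv_integrable x : mu.-integrable setT (EFin \o (fun y => k (x - y) * g y)).
Proof. by apply: integrable_bounded_mul ig => //; exact: mkx. Qed.

Lemma conv_continuous : continuous (conv k g).
Proof.
have mg := integrable_measurable ig.
move=> x; apply: seq_continuous_at => u ux.
apply: (@dominated_cvg_Rintegral _ _ _ mu setT measurableT
  (fun n y => k (u n - y) * g y) (fun y => k (x - y) * g y) (fun y => C * `|g y|)).
- by move=> n; apply: measurable_funM => //; exact: mkx.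
- by apply: measurable_funM => //; exact: mkx.
- apply: aeW => y _; apply: cvgM; last exact: cvg_cst.
  apply: (@continuous_cvg _ _ _ _ _ (fun n => u n - y) k); first exact: ck.
  by apply: cvgB => //; exact: cvg_cst.
- by apply: integrable_EFinZ => //; exact: integrable_norm.
- by move=> n y _; rewrite normrM ler_wpM2r.
Qed.

(** Reduction to one real variable: along the line through [x] in the direction [v] the derivative
    is taken under the integral sign, dominated by [C'] times the absolute value of [g]. *)
Lemma conv_is_derive (dk : V -> R) (C' : R) (v : V) :
  continuous dk -> (forall x, `|dk x| <= C') ->
  (forall x, is_derive x v k (dk x)) ->
  forall x, is_derive x v (conv k g) (conv dk g x).
Proof.
move=> cdk dkC hk x.
pose f (t : R) y := k (x + t *: v - y) * g y.
have line y (t : R) : is_derive t 1 (fun t : R => k (x + t *: v - y)) (dk (x + t *: v - y)).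
  have -> : (fun t : R => k (x + t *: v - y)) = (fun t : R => k ((x - y) + t *: v)).
    by apply/funext => s; rewrite addrAC.
  have -> : x + t *: v - y = x - y + t *: v by rewrite addrAC.
  have [dd <-] := hk (x - y + t *: v).
  exact: is_derive_line.
have linef y (t : R) : is_derive t 1 (f^~ y) (dk (x + t *: v - y) * g y).
  rewrite (_ : f^~ y = (fun t : R => k (x + t *: v - y)) * cst (g y)) //.
  have ly := line y t.
  by apply: is_derive_eq; rewrite scaler0 add0r [LHS]mulrC.
have int_f t : `]-1, 1[%classic t -> mu.-integrable setT (EFin \o f t).
  by move=> _; exact: conv_integrable.
have df t y : `]-1, 1[%classic t -> setT y -> derivable (f ^~ y) t 1.
  by move=> _ _; have [] := linef y t.
have d1 t y : partial1of2 f t y = dk (x + t *: v - y) * g y.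
  by rewrite partial1of2E; have [_ ->] := linef y t.
have I0 : `]-1, 1[%classic (0 : R) by rewrite /= in_itv/= ltrN10 ltr01.
have G0 y : 0 <= C' * `|g y| by rewrite mulr_ge0// (le_trans _ (dkC 0)).
have iG : mu.-integrable setT (EFin \o (fun y => C' * `|g y|)).
  by apply: integrable_EFinZ => //; exact: integrable_norm.
have Gub t y : `]-1, 1[%classic t -> setT y -> `|partial1of2 f t y| <= C' * `|g y|.
  by move=> _ _; rewrite d1 normrM ler_wpM2r.
have D1 := @differentiation_under_integral _ _ _ mu f setT measurableT 0 (-1) 1
  I0 int_f df _ G0 iG Gub.
have D2 := @derivable_under_integral _ _ _ mu f setT measurableT 0 (-1) 1
  I0 int_f df _ G0 iG Gub.
have E : (fun h : R => h^-1 *: ((conv k g (h *: v + x) : R^o) - conv k g x)) =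
    (fun h : R => h^-1 *: (((\int[mu]_y f (h *: 1 + 0) y) : R^o) - \int[mu]_y f 0 y)).
  apply/funext => h; congr (_ *: (_ - _)); apply: eq_Rintegral => y _.
    by rewrite /f addr0 [h *: 1]mulr1 [h *: v + x]addrC.
  by rewrite /f scale0r addr0.
apply: DeriveDef; first by rewrite /derivable E.
rewrite /derive E -[LHS]/('D_1 (fun t => \int[mu]_y f t y) 0) -derive1E D1.
by apply: eq_Rintegral => y _; rewrite d1 scale0r addr0.
Qed.

Lemma conv_duality w : mu.-integrable setT (EFin \o w) ->
  \int[mu]_x (w x * conv k g x) = \int[mu]_y (g y * conv (fun z => k (- z)) w y).
Proof.
move=> iw; have mg := integrable_measurable ig; have mw := integrable_measurable iw.
pose F (p : V * V) : \bar R := (w p.1 * (k (p.1 - p.2) * g p.2))%:E.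
have mF : measurable_fun setT F.
  apply/measurable_EFinP; apply: measurable_funM.
    exact: (measurableT_comp mw measurable_fst).
  apply: measurable_funM.
    apply: measurableT_comp => //; apply: measurable_subrV.
    - exact: measurable_fst.
    - exact: measurable_snd.
  exact: (measurableT_comp mg measurable_snd).
have iF : (lebesgue_rV m \x lebesgue_rV m)%E.-integrable setT F.
  apply/integrable12ltyP => //.
  apply: (@le_lt_trans _ _ (\int[mu]_x ((`|w x| * (C * \int[mu]_y `|g y|))%:E))%E).
    apply: ge0_le_integral => //.
    - by move=> x _; apply: integral_ge0.
    - apply: (measurable_fun_fubini_tonelli_F (abse \o F)).
        exact: measurableT_comp.
      by move=> p; exact: abse_ge0.
    - by apply/measurable_EFinP; apply: measurable_funM => //; exact: measurableT_comp.
    - move=> x _.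
      have iCg : mu.-integrable setT (EFin \o (fun y => `|w x| * (C * `|g y|))).
        by do 2 (apply: integrable_EFinZ => //); exact: integrable_norm.
      apply: (@le_trans _ _ (\int[mu]_y (`|w x| * (C * `|g y|))%:E)%E).
        apply: ge0_le_integral => //.
        + apply: measurableT_comp => //.
          apply/measurable_EFinP; apply: measurable_funM => /=; first exact: measurable_cst.
          by apply: measurable_funM => //; exact: mkx.
        + by case/integrableP: iCg.
        + by move=> y _; rewrite lee_fin !normrM ler_wpM2l// ler_wpM2r.
      rewrite -[X in (X <= _)%E]fineK; last exact: (integrable_fin_num _ iCg).
      rewrite lee_fin -/(Rintegral _ _ _) RintegralZl//; last first.
        by apply: integrable_EFinZ => //; exact: integrable_norm.
      by rewrite RintegralZl//; exact: integrable_norm.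
  rewrite -ge0_fin_numE; last first.
    by apply: integral_ge0 => x _; rewrite lee_fin !mulr_ge0// ?(le_trans _ (kC 0))// Rintegral_ge0.
  apply: integrable_fin_num => //.
  under eq_fun do rewrite mulrC.
  by apply: integrable_EFinZ => //; exact: integrable_norm.
have := Fubini iF.
have E1 : (\int[mu]_x \int[mu]_y F (x, y))%E = (\int[mu]_x (w x * conv k g x)%:E)%E.
  apply: eq_integral => x _.
  rewrite (_ : (fun y => F (x, y)) = EFin \o (fun y => w x * (k (x - y) * g y))) //.
  rewrite -[LHS]fineK; last first.
    apply: integrable_fin_num => //; apply: integrable_EFinZ => //.
    exact: conv_integrable.
  congr EFin; rewrite -/(Rintegral _ _ _) RintegralZl//.
  exact: conv_integrable.
have E2 : (\int[mu]_y \int[mu]_x F (x, y))%E =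
    (\int[mu]_y (g y * conv (fun z => k (- z)) w y)%:E)%E.
  apply: eq_integral => y _.
  have i1 : mu.-integrable setT (EFin \o (fun x => k (- (y - x)) * w x)).
    apply: (@integrable_bounded_mul _ _ _ _ _ _ _ _ C) => //.
    by apply: measurableT_comp => //; apply: measurable_opprV; apply: measurable_subrV.
  rewrite (_ : (fun x => F (x, y)) = EFin \o (fun x => g y * (k (- (y - x)) * w x))); last first.
    by apply/funext => x; rewrite /F/= opprB; congr EFin; lra.
  rewrite -[LHS]fineK; last first.
    by apply: integrable_fin_num => //; apply: integrable_EFinZ.
  by congr EFin; rewrite -/(Rintegral _ _ _) RintegralZl.
by rewrite /= E1 E2 => h; rewrite /Rintegral h.
Qed.

Lemma conv_neq0 (e : R) x : (forall z, k z != 0 -> ball 0 e z) ->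
  conv k g x != 0 -> exists2 y, g y != 0 & ball x e y.
Proof.
move=> hk; apply: contra_neqP => /forall2NP h.
rewrite /conv (_ : (fun y => _) = cst 0).
  by rewrite /Rintegral integral0.
apply/funext => y; apply/eqP; rewrite mulf_eq0.
have [ge|] := h y; first by move/negP: ge; rewrite negbK => ->; rewrite orbT.
apply: contra_notT; rewrite negb_or => /andP[/hk + _].
rewrite -!ball_normE/= sub0r normrN; exact.
Qed.

End conv_lemmas.
End convolution.

Section mollification.
Context {R : realType} {m : nat}.
Local Notation mu := (lebesgue_rV m).
Local Notation V := 'rV[R]_m.
Local Notation e_ i := (delta_mx 0 i : V).
Implicit Types (f g k : V -> R) (x y v : V) (e : R) (E F U : set V).

Definition mass e : R := \int[mu]_x kern e x.

Lemma kern_measurable e : measurable_fun setT (kern e : V -> R).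
Proof. by apply: continuous_measurable_rV; exact: kern_continuous. Qed.

Lemma kern_norm e x : `|kern e x| <= 1.
Proof. by rewrite ger0_norm ?kern_ge0 ?kern_le1. Qed.

Lemma kern_integrable e : 0 < e -> mu.-integrable setT (EFin \o kern e).
Proof.
move=> e0; apply: (bounded_bsupp_integrable (kern_measurable e) (kern_norm e)).
exists e => x /(kern_supp e0); rewrite -ball_normE/= sub0r normrN.
exact: ltW.
Qed.

Lemma Rintegral_indic E : measurable E ->
  \int[mu]_x \1_E x = fine (mu E).
Proof. by move=> mE; rewrite /Rintegral integral_indic// setIT. Qed.

(** On the Euclidean ball of radius [e / 2] the kernel is at least (1 - 1/4)^2. The order e^m makes
    the mass comparable with the volume of a cube of radius [e]. *)
Lemma mass_ge e : 0 < e -> 9 / 16 * (e / m.+1%:R) ^+ m <= mass e.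
Proof.
move=> e0; have e20 : 0 < e / 2 by rewrite divr_gt0.
have mB := measurable_eball (0 : V) (e / 2).
have /andP[b1 b2] := lebesgue_eball_bounds (0 : V) e20.
have Bfin : (mu (eball (0 : V) (e / 2)) < +oo)%E by rewrite (le_lt_trans b2) ?ltry.
have iB := integrable_indic_lty mB Bfin.
apply: (@le_trans _ _ (\int[mu]_x (9 / 16 * \1_(eball (0 : V) (e / 2)) x))).
  rewrite RintegralZl// Rintegral_indic// ler_pM2l; last by lra.
  rewrite -lee_fin fineK ?ge0_fin_numE//; apply: le_trans b1.
  rewrite lee_fin (_ : e / 2 / m.+1%:R *+ 2 = e / m.+1%:R)//.
  by rewrite mulr2n -mulrDl -splitr.
apply: le_Rintegral => //.
- exact: integrable_EFinZ.
- exact: kern_integrable.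
- move=> x _; rewrite indicE; have [/set_mem xB|_] := boolP (x \in _); last first.
    by rewrite mulr0 kern_ge0.
  rewrite mulr1 /kern.
  have xe : dotr x x / e ^+ 2 <= 1 / 4.
    rewrite ler_pdivrMr ?exprn_gt0// -sqr_enorm.
    have : enorm x < e / 2 by move: xB; rewrite /eball/= subr0.
    have := enorm_ge0 x; nra.
  have -> : Num.max 0 (1 - dotr x x / e ^+ 2) = 1 - dotr x x / e ^+ 2.
    by apply/max_idPr; lra.
  nra.
Qed.

Lemma mass_gt0 e : 0 < e -> 0 < mass e.
Proof.
move=> e0; apply: lt_le_trans (mass_ge e0).
by rewrite mulr_gt0 ?exprn_gt0 ?divr_gt0.
Qed.

Definition rho e x : R := (mass e)^-1 * kern e x.
Definition drho e v x : R := (mass e)^-1 * dkern e v x.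

Section scale.
Variables (e : R) (e0 : 0 < e).

Let M0 : 0 <= (mass e)^-1. Proof. by rewrite invr_ge0 ltW ?mass_gt0. Qed.

Lemma rho_ge0 x : 0 <= rho e x.
Proof. by rewrite mulr_ge0 ?kern_ge0. Qed.

Lemma rho_norm x : `|rho e x| <= (mass e)^-1.
Proof. by rewrite ger0_norm ?rho_ge0// ler_piMr ?kern_le1. Qed.

Lemma drho_norm v x : `|drho e v x| <= (mass e)^-1 * (4 / e * enorm v).
Proof. by rewrite normrM ger0_norm// ler_wpM2l// dkern_bound. Qed.

Lemma rho_continuous : continuous (rho e).
Proof.
move=> x; apply: (@continuousM _ _ (cst (mass e)^-1) (kern e)).
  exact: cst_continuous.
exact: kern_continuous.
Qed.

Lemma drho_continuous v : continuous (drho e v).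
Proof.
move=> x; apply: (@continuousM _ _ (cst (mass e)^-1) (dkern e v)).
  exact: cst_continuous.
exact: dkern_continuous.
Qed.

Lemma is_derive_rho x v : is_derive x v (rho e) (drho e v x).
Proof. exact: (is_deriveZ _ (is_derive_kern e x v)). Qed.

Lemma rhoN x : rho e (- x) = rho e x. Proof. by rewrite /rho kernN. Qed.

Lemma drhoN v x : drho e v (- x) = - drho e v x.
Proof. by rewrite /drho dkernN mulrN. Qed.

Lemma rho_supp x : rho e x != 0 -> ball 0 e x.
Proof. by rewrite mulf_eq0 negb_or => /andP[_]; exact: kern_supp. Qed.

Lemma rho_shift_integrable x : mu.-integrable setT (EFin \o (fun y => rho e (x - y))).
Proof.
have -> : (fun y => rho e (x - y)) = fun y => rho e (y + - x).
  by apply/funext => y; rewrite -rhoN opprB.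
apply: (integrable_shift (- x) (f := EFin \o rho e)).
by apply: integrable_EFinZ => //; exact: kern_integrable.
Qed.

Lemma rho_int1 x : \int[mu]_y rho e (x - y) = 1.
Proof.
transitivity (\int[mu]_y rho e (y + - x)).
  by apply: eq_Rintegral => y _; rewrite -rhoN opprB.
rewrite /Rintegral (integral_shift (- x) (f := EFin \o rho e)); last first.
  apply/measurable_EFinP; apply: continuous_measurable_rV.
  exact: rho_continuous.
rewrite -/(Rintegral _ _ _) RintegralZl//; last exact: kern_integrable.
by rewrite mulVf// gt_eqF ?mass_gt0.
Qed.

Lemma C1_moll g : mu.-integrable setT (EFin \o g) -> C1 (conv (rho e) g).
Proof.
move=> ig i; have H x := conv_is_derive rho_continuous rho_norm ig
  (@drho_continuous (e_ i)) (drho_norm (e_ i)) (fun x => is_derive_rho x (e_ i)) x.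
split=> [x|]; first by have [] := H x.
rewrite (_ : 'D_(e_ i) _ = conv (drho e (e_ i)) g).
  exact: (conv_continuous (@drho_continuous _) (drho_norm _) ig).
by apply/funext => x; have [_] := H x.
Qed.

Lemma derive_moll g i x : mu.-integrable setT (EFin \o g) ->
  'D_(e_ i) (conv (rho e) g) x = conv (drho e (e_ i)) g x.
Proof.
move=> ig; have [_ //] := conv_is_derive rho_continuous rho_norm ig
  (@drho_continuous (e_ i)) (drho_norm (e_ i)) (fun x => is_derive_rho x (e_ i)) x.
Qed.

Lemma rho_indic_integrable E x : measurable E ->
  mu.-integrable setT (EFin \o (fun y => rho e (x - y) * \1_E y)).
Proof.
move=> mE; under eq_fun do rewrite mulrC.
apply: (@integrable_bounded_mul _ _ _ _ _ _ _ _ 1) => //.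
  by move=> y _; rewrite indicE; case: (_ \in _); rewrite ?normr1 ?normr0.
exact: rho_shift_integrable.
Qed.

Lemma moll_indic_bounds E x : measurable E -> 0 <= conv (rho e) \1_E x <= 1.
Proof.
move=> mE; apply/andP; split.
  by apply: Rintegral_ge0 => y _; rewrite mulr_ge0 ?rho_ge0.
rewrite -(rho_int1 x); apply: le_Rintegral => //.
- exact: rho_indic_integrable.
- exact: rho_shift_integrable.
- by move=> y _; rewrite ler_piMr ?rho_ge0// indicE; case: (_ \in _).
Qed.

Lemma moll_indic_le E x : measurable E ->
  conv (rho e) \1_E x <= (mass e)^-1 * fine (mu (E `&` ball x e)).
Proof.
move=> mE; have mEb : measurable (E `&` ball x e).
  by apply: measurableI => //; exact: measurable_ball_rV.
have Ebfin : (mu (E `&` ball x e) < +oo)%E.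
  apply: (@le_lt_trans _ _ (mu (ball x e))).
    by apply: le_measure; rewrite ?inE; [exact: mEb|exact: measurable_ball_rV|exact: subIsetr].
  by rewrite [ltLHS]lebesgue_rV_ball ?ltry.
rewrite -Rintegral_indic// -RintegralZl//; last exact: integrable_indic_lty.
apply: le_Rintegral => //.
- exact: rho_indic_integrable.
- by apply: integrable_EFinZ => //; exact: integrable_indic_lty.
- move=> y _; rewrite !indicE in_setI.
  have [_|] := boolP (y \in E); last by rewrite mulr0 mulr0.
  rewrite mulr1 /=; have [r0|/rho_supp hb] := eqVneq (rho e (x - y)) 0.
    by rewrite r0 mulr_ge0.
  rewrite mem_set ?mulr1; first by rewrite (le_trans (ler_norm _))// rho_norm.
  by move: hb; rewrite -!ball_normE/= sub0r normrN.
Qed.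

Definition mollv (w : V -> V) x : V := \row_j conv (rho e) (fun y => w y 0 j) x.

Section vector_field.
Variables (w : V -> V) (mw : measurable_fun setT w) (w1 : forall x, enorm (w x) <= 1).
Hypothesis bw : exists M : R, forall x, w x != 0 -> `|x| <= M.

Let iw j : mu.-integrable setT (EFin \o (fun x => w x 0 j)).
Proof.
apply: (@bounded_bsupp_integrable _ _ _ 1).
- exact: (measurableT_comp (measurable_coord j) mw).
- by move=> x; apply: le_trans (w1 x); exact: enorm_coord.
- have [M hM] := bw; exists M => x wx; apply: hM.
  by apply: contra_neq wx => ->; rewrite mxE.
Qed.

(** Convexity by duality: the average is paired with itself, and Cauchy-Schwarz is applied under the
    integral sign. *)
Lemma mollv_enorm x : enorm (mollv w x) <= 1.
Proof.
set xi := mollv w x.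
have [xi0|xi0] := eqVneq (enorm xi) 0; first by rewrite xi0 ler01.
have xp : 0 < enorm xi by rewrite lt_neqAle eq_sym xi0 enorm_ge0.
rewrite -(ler_pM2r xp) mul1r -expr2 sqr_enorm.
have irw j := conv_integrable rho_continuous rho_norm (iw j) x.
have -> : dotr xi xi = \int[mu]_y (\sum_j xi 0 j * (rho e (x - y) * w y 0 j)).
  rewrite Rintegral_sum// => [|j]; last exact: integrable_EFinZ.
  by apply: eq_bigr => j _; rewrite RintegralZl// {2}/xi mxE.
have -> : enorm xi = \int[mu]_y (enorm xi * rho e (x - y)).
  by rewrite RintegralZl ?rho_int1 ?mulr1//; exact: rho_shift_integrable.
apply: le_Rintegral => //.
- by apply: integrable_EFin_sum => // j; exact: integrable_EFinZ.
- by apply: integrable_EFinZ => //; exact: rho_shift_integrable.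
- move=> y _.
  have -> : \sum_j xi 0 j * (rho e (x - y) * w y 0 j) = rho e (x - y) * dotr xi (w y).
    by rewrite mulr_sumr; apply: eq_bigr => j _; rewrite mulrCA.
  rewrite mulrC ler_wpM2r ?rho_ge0// (le_trans (cauchy_schwarz _ _))//.
  by rewrite ler_piMr ?enorm_ge0.
Qed.

(** Mollifying enlarges the support by [e]; of the margin [e + e], the other [e] is left as the
    margin of the new field. *)
Lemma mollv_tfield U : (forall x, w x != 0 -> ball x (e + e) `<=` U) ->
  tfield U (mollv w).
Proof.
move=> wU.
have supp x : mollv w x != 0 -> exists2 y, w y != 0 & ball x e y.
  move=> hx; have [j hj] : exists j, mollv w x 0 j != 0.
    apply: contrapT => /forallNP nh; move/eqP : hx; apply; apply/rowP => j.
    by rewrite [RHS]mxE; apply: contrapT => /eqP; exact: nh.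
  move: hj; rewrite mxE => hj.
  have [y wy xy] := conv_neq0 rho_supp hj.
  by exists y => //; apply: contra_neq wy => ->; rewrite mxE.
split.
- move=> j; rewrite (_ : (fun x => _) = conv (rho e) (fun y => w y 0 j)); last first.
    by apply/funext => x; rewrite mxE.
  exact: C1_moll.
- have [M hM] := bw; exists (M + e) => x /supp[y wy xy].
  rewrite -(subrK y x) addrC (le_trans (ler_normD _ _))// lerD ?hM//.
  by move: xy; rewrite -ball_normE/= => /ltW.
- exists e => // x /supp[y wy xy] z xz; apply: (wU y wy).
  by apply: ball_triangle xz; exact: ball_sym.
- exact: mollv_enorm.
Qed.

(** The mollifier moves from the field to the set, so that a perimeter bound can be tested with
    merely measurable, even discontinuous, fields [w]. The right-hand side is minus the integral of
    [w] against the gradient of the mollified indicator; the sign comes from the oddness of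
    [drho]. *)
Lemma pairing_mollv F : measurable F -> (mu F < +oo)%E ->
  pairing F (mollv w) =
  - \int[mu]_x (\sum_i w x 0 i * conv (drho e (e_ i)) \1_F x).
Proof.
move=> mF Foo; have iF := integrable_indic_lty mF Foo.
have E : divergence (mollv w) = fun x => \sum_i conv (drho e (e_ i)) (fun y => w y 0 i) x.
  apply/funext => x; rewrite divergenceE => [|j].
    apply: eq_bigr => i _; rewrite -derive_moll//; congr ('D_ _ _ _).
    by apply/funext => y; rewrite mxE.
  rewrite (_ : (fun x => _) = conv (rho e) (fun y => w y 0 j)); last first.
    by apply/funext => y; rewrite mxE.
  exact: C1_moll.
have bnd (g : V -> R) C (Cg : forall x, `|g x| <= C) (h : V -> R) i :
    mu.-integrable setT (EFin \o g) -> mu.-integrable setT (EFin \o h) ->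
    mu.-integrable setT (EFin \o (fun x => g x * conv (drho e (e_ i)) h x)).
  move=> ig ih; under eq_fun do rewrite mulrC.
  apply: (@integrable_bounded_mul _ _ _ _ _ _ _ _
    ((mass e)^-1 * (4 / e * enorm (e_ i)) * \int[mu]_y `|h y|)) => //.
    apply: continuous_measurable_rV.
    exact: (conv_continuous (@drho_continuous _) (drho_norm _) ih).
  move=> x _; apply: (le_trans (le_normr_Rintegral _ _)) => //.
    exact: (conv_integrable (@drho_continuous _) (drho_norm _) ih).
  rewrite -RintegralZl//; last exact: integrable_norm.
  apply: le_Rintegral => //.
  - apply: integrable_norm => //.
    exact: (conv_integrable (@drho_continuous _) (drho_norm _) ih).
  - by apply: integrable_EFinZ => //; exact: integrable_norm.
  - by move=> y _; rewrite normrM ler_wpM2r// drho_norm.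
have F1 x : `|\1_F x| <= (1 : R).
  by rewrite indicE; case: (_ \in _); rewrite ?normr1 ?normr0.
rewrite /pairing E Rintegral_mkcond.
transitivity (\int[mu]_x (\sum_i \1_F x * conv (drho e (e_ i)) (fun y => w y 0 i) x)).
  apply: eq_Rintegral => x _; rewrite patchE indicE -mulr_sumr.
  by case: ifP => _; rewrite ?mul1r ?mul0r.
rewrite Rintegral_sum//; last by move=> i; apply: (bnd \1_F 1 F1 (fun y => w y 0 i) i iF (iw i)).
rewrite Rintegral_sum//; last first.
  by move=> i; apply: (bnd _ 1) => // x; apply: le_trans (w1 x); exact: enorm_coord.
rewrite -sumrN; apply: eq_bigr => i _.
rewrite (conv_duality (@drho_continuous _) (drho_norm _) (iw i) iF).
rewrite -mulN1r -RintegralZl//; last first.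
  by apply: (bnd _ 1) => // x; apply: le_trans (w1 x); exact: enorm_coord.
apply: eq_Rintegral => x _; rewrite mulrCA mulN1r; congr (_ * _).
rewrite -mulN1r -RintegralZl//; last first.
  exact: (conv_integrable (@drho_continuous _) (drho_norm _) iF).
by apply: eq_Rintegral => y _; rewrite drhoN mulN1r mulNr.
Qed.

End vector_field.
End scale.

Definition scale_seq (n : nat) : R := n.+1%:R^-1.

Lemma scale_seq_gt0 n : 0 < scale_seq n. Proof. by rewrite invr_gt0. Qed.

(** The mollified value is at most the density of [E] in the cube of radius [e], up to a factor
    depending on [m] only, by [moll_indic_le] and [mass_ge]. *)
Lemma conv_rho_cvg0 E x : measurable E -> density0 E x ->
  conv (rho (scale_seq n)) \1_E x @[n --> \oo] --> (0 : R).
Proof.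
move=> mE dE; apply/cvgr0Pnorm_le => d d0.
have M0 : 0 < (2 * m.+1%:R) ^+ m :> R by rewrite exprn_gt0// mulr_gt0.
have d'0 : 0 < d * (9 / 16) / (2 * m.+1%:R) ^+ m.
  by rewrite divr_gt0// mulr_gt0//; lra.
have [r0 r00 h] := dE _ d'0.
near=> n.
have er0 : scale_seq n < r0.
  by near: n; exact: (near_infty_natSinv_lt (PosNum r00)).
set e := scale_seq n in er0 *.
have e0 : 0 < e by exact: scale_seq_gt0.
have /andP[c0 _] := moll_indic_bounds e0 x mE.
rewrite ger0_norm// (le_trans (moll_indic_le e0 x mE))//.
rewrite ler_pdivrMl ?mass_gt0//.
have er : 0 < e < r0.
  by rewrite e0.
apply: (@le_trans _ _ (d * (9 / 16) / (2 * m.+1%:R) ^+ m * (e *+ 2) ^+ m)).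
  rewrite -lee_fin fineK; first exact: h.
  by rewrite ge0_fin_numE// (le_lt_trans (h _ er))// ltry.
rewrite [leRHS]mulrC.
apply: (@le_trans _ _ (d * (9 / 16 * (e / m.+1%:R) ^+ m))); last first.
  by rewrite ler_pM2l// mass_ge.
have -> : e *+ 2 = 2 * e by rewrite mulr_natl.
rewrite !exprMn exprVn [X in _ <= X]mulrA.
rewrite [leLHS]mulrAC -mulrA -mulf_div divff ?gt_eqF ?exprn_gt0// mul1r.
by rewrite !exprVn.
Unshelve. all: by end_near. Qed.

Lemma conv_rho_cvg E x : measurable E ->
  (E x -> density0 (~` E) x) /\ (~ E x -> density0 E x) ->
  conv (rho (scale_seq n)) \1_E x @[n --> \oo] --> (\1_E x : R).
Proof.
move=> mE [h1 h2]; rewrite indicE; have [/set_mem Ex|nEx] := boolP (x \in E); last first.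
  by apply: conv_rho_cvg0 => //; apply: h2 => /mem_set Ex; rewrite Ex in nEx.
have mC := measurableC mE.
have E1 n : conv (rho (scale_seq n)) \1_E x = 1 - conv (rho (scale_seq n)) \1_(~` E) x.
  have e0 := scale_seq_gt0 n.
  rewrite -(rho_int1 e0 x) /conv -RintegralB//; last 2 first.
  - exact: rho_shift_integrable.
  - exact: rho_indic_integrable.
  apply: eq_Rintegral => y _; rewrite !indicE in_setC.
  by case: (y \in E); rewrite ?mulr1 ?mulr0 ?subr0 ?subrr.
have : (fun n => (1 : R) - conv (rho (scale_seq n)) \1_(~` E) x) @ \oo --> (1 - 0 : R).
  by apply: (@cvgB _ R^o); [exact: cvg_cst|apply: conv_rho_cvg0 => //; exact: h1].
by rewrite subr0; under eq_fun do rewrite -E1.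
Qed.

Lemma ae_conv_rho_cvg E : measurable E ->
  {ae mu, forall x, conv (rho (scale_seq n)) \1_E x @[n --> \oo] --> (\1_E x : R)}.
Proof.
move=> mE; apply: negligibleS (density_theorem mE) => x /= hx h.
by apply: hx; exact: conv_rho_cvg.
Qed.

(** The shift [a] is there for the translation estimate; the null set where mollification fails to
    converge is shifted with it. *)
Lemma moll_weak_cvg E g (a : V) : measurable E -> mu.-integrable setT (EFin \o g) ->
  (mu E < +oo)%E ->
  \int[mu]_x (g x * conv (rho (scale_seq n)) \1_E (x + a)) @[n --> \oo] -->
  \int[mu]_x (g x * \1_E (x + a)).
Proof.
move=> mE ig Eoo; have mg := integrable_measurable ig.
have iE := integrable_indic_lty mE Eoo.
apply: (@dominated_cvg_Rintegral _ _ _ _ _ measurableT _ _ (fun x => `|g x|)).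
- move=> n; apply: measurable_funM => //.
  apply: measurableT_comp; last exact: measurable_shift.
  apply: continuous_measurable_rV; apply: (conv_continuous _ _ iE).
  + exact: rho_continuous.
  + by apply: rho_norm; exact: scale_seq_gt0.
- apply: measurable_funM => //; apply: measurableT_comp => //.
  exact: measurable_shift.
- have [N [mN N0 hN]] := ae_conv_rho_cvg mE.
  exists ((fun x => x + a) @^-1` N); split.
  + by apply: measurable_preimage => //; exact: measurable_shift.
  + exact: (etrans (lebesgue_rV_shift a mN) N0).
  + move=> x /= hx; apply: hN => /= h; apply: hx => _.
    by apply: cvgM => //; exact: cvg_cst.
- exact: integrable_norm.
- move=> n x _; rewrite normrM ler_piMr//.
  have /andP[c0 c1] := moll_indic_bounds (scale_seq_gt0 n) (x + a) mE.
  by rewrite ger0_norm.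
Qed.

End mollification.

(** * Submodularity, translation, localisation and cutting of the perimeter *)

Section perimeter_inequalities.
Context {R : realType} {m : nat}.
Local Notation mu := (lebesgue_rV m).
Local Notation V := 'rV[R]_m.
Local Notation e_ i := (delta_mx 0 i : V).
Implicit Types (f g eta : V -> R) (x y v : V) (phi psi : V -> V) (E F U : set V).

(** A real bound on all pairings stands for the extended-real perimeter, which turns the estimates
    below into inequalities between reals. *)
Definition per_bound E U (p : R) := forall phi, tfield U phi -> pairing E phi <= p.

Lemma pairing_indic E phi : pairing E phi = \int[mu]_x (\1_E x * divergence phi x).
Proof.
rewrite /pairing Rintegral_mkcond; apply: eq_Rintegral => x _.
by rewrite patchE indicE; case: ifP; rewrite ?mul1r ?mul0r.
Qed.

Lemma indic_norm E x : `|\1_E x| <= (1 : R).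
Proof. by rewrite indicE; case: (_ \in _); rewrite ?normr1 ?normr0. Qed.

Lemma integrable_indic_mul E f : measurable E -> mu.-integrable setT (EFin \o f) ->
  mu.-integrable setT (EFin \o (fun x => \1_E x * f x)).
Proof.
move=> mE; apply: (@integrable_bounded_mul _ _ _ _ _ measurableT _ _ 1) => // x _.
exact: indic_norm.
Qed.

Lemma is_derive_Rintegral_line g f (df : V -> R) (xi : V) (C C' : R) :
  mu.-integrable setT (EFin \o g) -> continuous f -> (forall x, `|f x| <= C) ->
  (forall x, is_derive x xi f (df x)) -> (forall x, `|df x| <= C') ->
  forall t : R, is_derive t 1 (fun t : R => \int[mu]_x (g x * f (x + t *: xi)))
    (\int[mu]_x (g x * df (x + t *: xi))).
Proof.
move=> ig cf fC hf dfC t.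
pose h (s : R) x := g x * f (x + s *: xi).
have mg := integrable_measurable ig.
have line x (s : R) : is_derive s 1 (h^~ x) (g x * df (x + s *: xi)).
  have ls : is_derive s 1 (fun s : R => f (x + s *: xi)) (df (x + s *: xi)).
    by have [dd <-] := hf (x + s *: xi); exact: is_derive_line.
  rewrite (_ : h^~ x = cst (g x) * (fun s : R => f (x + s *: xi))) //.
  by apply: is_derive_eq; rewrite scaler0 addr0.
have int_h s : `](t - 1), (t + 1)[%classic s -> mu.-integrable setT (EFin \o h s).
  move=> _; rewrite (_ : h s = fun x => f (x + s *: xi) * g x); last first.
    by apply/funext => x; exact: mulrC.
  apply: (@integrable_bounded_mul _ _ _ _ _ measurableT _ _ C) => //.
  apply: measurableT_comp; last exact: measurable_shift.
  exact: continuous_measurable_rV.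
have dh s x : `](t - 1), (t + 1)[%classic s -> setT x -> derivable (h ^~ x) s 1.
  by move=> _ _; have [] := line x s.
have d1 s x : partial1of2 h s x = g x * df (x + s *: xi).
  by rewrite partial1of2E; have [_ ->] := line x s.
have It : `](t - 1), (t + 1)[%classic (t : R).
  by rewrite /= in_itv/= ltrBlDr ltrDl ltr01.
have G0 x : 0 <= C' * `|g x| by rewrite mulr_ge0// (le_trans _ (dfC 0)).
have iG : mu.-integrable setT (EFin \o (fun x => C' * `|g x|)).
  by apply: integrable_EFinZ => //; exact: integrable_norm.
have Gub s x : `](t - 1), (t + 1)[%classic s -> setT x -> `|partial1of2 h s x| <= C' * `|g x|.
  by move=> _ _; rewrite d1 normrM mulrC ler_wpM2r.
have D1 := @differentiation_under_integral _ _ _ mu h setT measurableT t (t - 1) (t + 1)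
  It int_h dh _ G0 iG Gub.
have D2 := @derivable_under_integral _ _ _ mu h setT measurableT t (t - 1) (t + 1)
  It int_h dh _ G0 iG Gub.
apply: DeriveDef => //; rewrite -derive1E D1.
by apply: eq_Rintegral => x _; rewrite d1.
Qed.

(** The integral of the translates of [f] along [e_ i] is constant; its derivative at 0, taken under
    the integral sign, is the left-hand side. The indicator of [B] is an integrable weight that
    equals 1 on the supports of all translates by less than 1. *)
Lemma Rintegral_derive0 f i : C1 f -> bsupp f -> \int[mu]_x 'D_(e_ i) f x = 0.
Proof.
move=> cf bf; have [df cdf] := cf i; have [M hM] := bf.
have cof := C1_continuous cf.
have [C C0 fC] := continuous_bsupp_bounded cof bf.
have [C' C'0 dfC] := continuous_bsupp_bounded cdf (C1_bsupp_derive i bf).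
pose B := [set x : V | `|x| <= M + 1].
have mB : measurable B.
  by apply: measurable_le_set => //; apply: continuous_measurable_rV => x; exact: norm_continuous.
have iB := integrable_indic_lty mB (lebesgue_rV_bounded_lty (M + 1)).
have hd x : is_derive x (e_ i) f ('D_(e_ i) f x) by apply: DeriveDef.
have := is_derive_Rintegral_line iB cof fC hd dfC 0.
set q := fun t : R => _; move=> [dq q'].
have e1 : `|e_ i| <= 1.
  rewrite [leLHS]mx_normrE; apply: bigmax_le => [|[a b] _ /=]; first exact: ler01.
  by rewrite mxE; case: (_ && _); rewrite ?normr1 ?normr0.
have qcst (t : R) : `|t| < 1 -> q t = \int[mu]_x f x.
  move=> t1; rewrite /q /Rintegral -[in RHS](integral_shift (t *: e_ i) (f := EFin \o f)); last first.
    by apply/measurable_EFinP; exact: continuous_measurable_rV.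
  congr fine; apply: eq_integral => x _ /=; congr EFin.
  have [->|fx] := eqVneq (f (x + t *: e_ i)) 0; first by rewrite mulr0.
  rewrite indicE mem_set ?mul1r// /B/=.
  rewrite -[x](addrK (t *: e_ i)) (le_trans (ler_normB _ _))// lerD ?hM//.
  by rewrite normrZ mulr_ile1// ltW.
have : 'D_1 q 0 = 0.
  rewrite (@near_eq_derive _ _ _ _ (cst (\int[mu]_x f x))) ?derive_cst//.
  apply/nbhs_ballP; exists 1 => //= t; rewrite -ball_normE/= sub0r normrN => t1.
  exact: qcst.
rewrite q' => <-; apply: eq_Rintegral => x _; rewrite scale0r addr0.
have [->|dx] := eqVneq ('D_(e_ i) f x) 0; first by rewrite mulr0.
rewrite indicE mem_set ?mul1r// /B/=.
apply: contraTT dx; rewrite -ltNge => xM; rewrite negbK; apply/eqP.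
rewrite (@near_eq_derive _ _ _ _ (cst 0)) ?derive_cst//.
apply/nbhs_ballP; exists 1 => //= y; rewrite -ball_normE/= => xy.
have [->//|/hM yM] := eqVneq (f y) 0; exfalso.
have h : `|x| <= `|y| + `|x - y| by rewrite -{1}(subrK y x) addrC ler_normD.
by lra.
Qed.

Section convex_combination.
Variables (U : set V) (phi psi : V -> V) (eta : V -> R).
Hypotheses (tphi : tfield U phi) (tpsi : tfield U psi) (ceta : C1 eta)
  (eta01 : forall x, 0 <= eta x <= 1).

Let c1phi j : C1 (fun x => phi x 0 j). Proof. by case: tphi. Qed.
Let c1psi j : C1 (fun x => psi x 0 j). Proof. by case: tpsi. Qed.

(** Convexity keeps the norm at most 1, so two fields can be glued along any cutoff; the price is
    the gradient term of [divergence_cut_field]. *)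
Definition cut_field x : V := eta x *: phi x + (1 - eta x) *: psi x.

Let cutE j : (fun x => cut_field x 0 j) =
  (eta \* (fun x => phi x 0 j)) \+ ((fun x => 1 - eta x) \* (fun x => psi x 0 j)).
Proof. by apply/funext => x; rewrite !mxE. Qed.

Lemma cut_field_C1 j : C1 (fun x => cut_field x 0 j).
Proof.
rewrite cutE; apply: C1D; apply: C1M => //.
exact: (C1B (C1_cst 1)).
Qed.

Lemma cut_field_tfield : tfield U cut_field.
Proof.
have [_ [M hM] [d d0 hd] n1] := tphi.
have [_ [M' hM'] [d' d'0 hd'] n1'] := tpsi.
have supp x : cut_field x != 0 -> phi x != 0 \/ psi x != 0.
  have [px|] := eqVneq (phi x) 0; last by left.
  have [qx|] := eqVneq (psi x) 0; last by right.
  by rewrite /cut_field px qx !scaler0 addr0 eqxx.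
split.
- exact: cut_field_C1.
- exists (Num.max M M') => x /supp[/hM|/hM'] h; rewrite le_max h//.
  by rewrite orbT.
- exists (Num.min d d'); first by rewrite lt_min d0.
  move=> x /supp[/hd|/hd'] h; apply: subset_trans h; apply: le_ball.
    by rewrite ge_min lexx.
  by rewrite ge_min lexx orbT.
- by move=> x; apply: enorm_convex.
Qed.

Lemma divergence_cut_field x : divergence cut_field x =
  eta x * divergence phi x + (1 - eta x) * divergence psi x +
  \sum_i (phi x 0 i - psi x 0 i) * 'D_(e_ i) eta x.
Proof.
rewrite !divergenceE//; last exact: cut_field_C1.
rewrite !mulr_sumr -!big_split/=; apply: eq_bigr => i _.
have dphi y : derivable (fun y => phi y 0 i) y (e_ i) by have [] := c1phi i i.
have dpsi y : derivable (fun y => psi y 0 i) y (e_ i) by have [] := c1psi i i.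
have deta y : derivable eta y (e_ i) by have [] := ceta i.
have d1eta y : derivable (fun x => 1 - eta x) y (e_ i).
  by have [] := C1B (C1_cst 1) ceta i.
rewrite cutE [LHS]deriveD; [|exact: derivableM|exact: derivableM].
rewrite [X in X + _]deriveM// [X in _ + X]deriveM//.
have -> : 'D_(e_ i) (fun x => 1 - eta x) x = - 'D_(e_ i) eta x.
  have [_ H] := @is_deriveB _ _ R^o (cst (1 : R)) eta x (e_ i) 0 ('D_(e_ i) eta x)
    (is_derive_cst _ _ _) (DeriveDef (deta x) erefl).
  by rewrite sub0r in H.
rewrite /GRing.scale/=; lra.
Qed.

End convex_combination.

Lemma grad_pairing_integrable phi U eta i : tfield U phi -> C1 eta ->
  mu.-integrable setT (EFin \o (fun x => phi x 0 i * 'D_(e_ i) eta x)).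
Proof.
move=> tphi ceta; apply: continuous_bsupp_integrable.
  move=> x; apply: (@continuousM _ _ (fun x => phi x 0 i) ('D_(e_ i) eta)).
    by apply: C1_continuous; case: tphi.
  by have [_] := ceta i; apply.
by apply: bsuppMl; exact: (tfield_bsupp tphi).
Qed.

Lemma eta_divergence_integrable phi U eta : tfield U phi -> continuous eta ->
  mu.-integrable setT (EFin \o (fun x => eta x * divergence phi x)).
Proof.
move=> tphi ceta; apply: continuous_bsupp_integrable.
  move=> x; apply: (@continuousM _ _ eta (divergence phi)); first exact: ceta.
  exact: (divergence_continuous tphi).
by apply: bsuppMr; exact: (divergence_bsupp tphi).
Qed.

Lemma continuous_onem eta : continuous eta -> continuous (fun x => 1 - eta x).
Proof.
by move=> ce x; apply: (@continuousB _ R^o _ (cst 1) eta); [exact: cst_continuous|exact: ce].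
Qed.

(* With [eta] the mollified indicator of [F], the gradient terms on [E] and the
   one produced by integrating [F_n div psi] by parts combine into the pairing
   of [grad F_n] with the field equal to [phi] on [E] and to [psi] off [E]. *)
Lemma perimeter_submodular E F U phi psi (p q : R) :
  measurable E -> measurable F -> (mu F < +oo)%E ->
  per_bound E U p -> per_bound F U q -> tfield U phi -> tfield U psi ->
  pairing (E `&` F) phi + pairing (E `|` F) psi <= p + q.
Proof.
move=> mE mF Foo pE pF tphi tpsi.
have iF := integrable_indic_lty mF Foo.
have [c1phi [M hM] [d d0 hd] n1] := tphi.
have [c1psi [M' hM'] [d' d'0 hd'] n1'] := tpsi.
(* [w] may jump across the boundary of [E]; only its mollification is tested against [F]. *)
pose w x : V := if x \in E then phi x else psi x.
have mw : measurable_fun setT w.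
  apply: measurable_fun_rV => j.
  have -> : (fun x => w x 0 j) = (fun x => \1_E x * phi x 0 j + (1 - \1_E x) * psi x 0 j).
    apply/funext => x; rewrite /w indicE; case: ifP => _.
      by rewrite subrr mul0r mul1r addr0.
    by rewrite subr0 mul0r mul1r add0r.
  by apply: measurable_funD; apply: measurable_funM => //;
    [exact: C1_measurable|exact: measurable_funB|exact: C1_measurable].
have w1 x : enorm (w x) <= 1 by rewrite /w; case: ifP.
have bw : exists N : R, forall x, w x != 0 -> `|x| <= N.
  exists (Num.max M M') => x; rewrite /w; case: ifP => _.
    by move=> /hM h; rewrite le_max h.
  by move=> /hM' h; rewrite le_max h orbT.
pose Fn n := conv (rho (scale_seq n)) (\1_F : V -> R).
have c1F n : C1 (Fn n) by apply: C1_moll => //; exact: scale_seq_gt0.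
have F01 n x : 0 <= Fn n x <= 1 by apply: moll_indic_bounds => //; exact: scale_seq_gt0.
(* With [\1_F] in place of [Fn n] this is the left-hand side, because the indicator of the union is
   the sum of the two indicators minus their product. *)
pose S n := \int[mu]_x ((\1_E x * (divergence phi x - divergence psi x) + divergence psi x) * Fn n x)
   + \int[mu]_x (\1_E x * divergence psi x).
have ig : mu.-integrable setT (EFin \o (fun x =>
    \1_E x * (divergence phi x - divergence psi x) + divergence psi x)).
  apply: integrable_EFinD => //; last exact: (divergence_integrable tpsi).
  apply: integrable_indic_mul => //.
  by apply: integrable_EFinB => //; [exact: (divergence_integrable tphi)|exact: (divergence_integrable tpsi)].
have Scvg : S n @[n --> \oo] --> pairing (E `&` F) phi + pairing (E `|` F) psi.
  have := @moll_weak_cvg _ _ _ _ 0 mF ig Foo.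
  under eq_fun do under eq_Rintegral do rewrite addr0.
  under [X in _ --> X -> _]eq_Rintegral do rewrite addr0.
  move=> h.
  have -> : pairing (E `&` F) phi + pairing (E `|` F) psi =
    \int[mu]_x ((\1_E x * (divergence phi x - divergence psi x) + divergence psi x) * \1_F x)
    + \int[mu]_x (\1_E x * divergence psi x).
    rewrite !pairing_indic -!RintegralD//.
    - apply: eq_Rintegral => x _; rewrite !indicE in_setI in_setU.
      by case: (x \in E); case: (x \in F) => /=; lra.
    - apply: integrable_indic_mul; first exact: measurableI.
      exact: (divergence_integrable tphi).
    - apply: integrable_indic_mul; first exact: measurableU.
      exact: (divergence_integrable tpsi).
    - by under eq_fun do rewrite mulrC; exact: integrable_indic_mul.
    - by apply: integrable_indic_mul => //; exact: (divergence_integrable tpsi).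
  by apply: (@cvgD _ R^o); [exact: h|exact: cvg_cst].
rewrite -(cvg_lim _ Scvg)//.
apply: limr_le; first by apply/cvg_ex; eexists; exact: Scvg.
have dd0 : 0 < Num.min d d' / 2 by rewrite divr_gt0// lt_min d0.
near=> n.
have en : scale_seq n < Num.min d d' / 2.
  by near: n; exact: (near_infty_natSinv_lt (PosNum dd0)).
have e0 := @scale_seq_gt0 R n.
have marg x : w x != 0 -> ball x (scale_seq n + scale_seq n) `<=` U.
  have [ed ed'] : scale_seq n + scale_seq n <= d /\ scale_seq n + scale_seq n <= d'.
    have : scale_seq n + scale_seq n <= Num.min d d' by lra.
    by rewrite le_min => /andP.
  rewrite /w; case: ifP => _.
    by move=> /hd h; apply: subset_trans h; exact: le_ball.
  by move=> /hd' h; apply: subset_trans h; exact: le_ball.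
have hq := pF _ (mollv_tfield e0 mw w1 bw marg).
rewrite (pairing_mollv e0 mw w1 bw mF Foo) in hq.
have hp := pE _ (cut_field_tfield tphi tpsi (c1F n) (F01 n)).
rewrite pairing_indic in hp.
(* The gradient terms of [hp] and [hq] leave minus the integral of [psi] against the gradient of
   [Fn n] over the whole space; this identity trades it for the integral of [Fn n] times
   [divergence psi]. *)
have ibp : \int[mu]_x (\sum_i 'D_(e_ i) (fun x => Fn n x * psi x 0 i) x) = 0.
  have c1p i : C1 (fun x => Fn n x * psi x 0 i) by apply: C1M.
  have bp i : bsupp (fun x => Fn n x * psi x 0 i).
    by apply: bsuppMr; exact: (tfield_bsupp tpsi).
  rewrite Rintegral_sum//; last first.
    move=> i; apply: continuous_bsupp_integrable; first by have [_] := c1p i i.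
    by apply: C1_bsupp_derive; exact: bp.
  by apply: big1 => i _; apply: Rintegral_derive0.
have iib : mu.-integrable setT (EFin \o (fun x => \sum_i 'D_(e_ i) (fun x => Fn n x * psi x 0 i) x)).
  have c1p i : C1 (fun x => Fn n x * psi x 0 i) by apply: C1M.
  apply: integrable_EFin_sum => // i.
  apply: continuous_bsupp_integrable; first by have [_] := c1p i i.
  apply: C1_bsupp_derive; apply: bsuppMr; exact: (tfield_bsupp tpsi).
have iw : mu.-integrable setT (EFin \o (fun x => \sum_i w x 0 i * conv (drho (scale_seq n) (e_ i)) \1_F x)).
  apply: integrable_EFin_sum => // i.
  have -> : (fun x => w x 0 i * conv (drho (scale_seq n) (e_ i)) \1_F x) =
    (fun x => \1_E x * (phi x 0 i * 'D_(e_ i) (Fn n) x)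
       + (1 - \1_E x) * (psi x 0 i * 'D_(e_ i) (Fn n) x)).
    apply/funext => x; rewrite derive_moll// /w indicE; case: ifP => _.
      by rewrite subrr mul0r mul1r addr0.
    by rewrite subr0 mul0r mul1r add0r.
  apply: integrable_EFinD => //.
    by apply: integrable_indic_mul => //; exact: (grad_pairing_integrable _ tphi).
  apply: (@integrable_bounded_mul _ _ _ _ _ measurableT _ _ 1) => //.
  - exact: measurable_funB.
  - by move=> x _; rewrite indicE; case: (_ \in _); rewrite ?subrr ?subr0 ?normr1 ?normr0.
  - exact: (grad_pairing_integrable _ tpsi).
have icut : mu.-integrable setT (EFin \o (fun x => \1_E x * divergence (cut_field phi psi (Fn n)) x)).
  apply: integrable_indic_mul => //.
  exact: (divergence_integrable (cut_field_tfield tphi tpsi (c1F n) (F01 n))).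
rewrite /S -RintegralD//; last 2 first.
- under eq_fun do rewrite mulrC.
  apply: (@integrable_bounded_mul _ _ _ _ _ measurableT _ _ 1) => //.
    exact: C1_measurable.
  by move=> x _; have /andP[f0 f1] := F01 n x; rewrite ger0_norm.
- by apply: integrable_indic_mul => //; exact: (divergence_integrable tpsi).
apply: le_trans (lerD hp hq).
rewrite -mulN1r -RintegralZl// -RintegralD//; last exact: integrable_EFinZ.
rewrite -[leRHS]addr0 -[X in _ <= _ + X]ibp -RintegralD//; last first.
  by apply: integrable_EFinD => //; exact: integrable_EFinZ.
rewrite le_eqVlt; apply/orP; left; apply/eqP; apply: eq_Rintegral => x _.
rewrite (divergence_cut_field tphi tpsi (c1F n)).
have -> : \sum_i 'D_(e_ i) (fun x => Fn n x * psi x 0 i) x =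
    Fn n x * divergence psi x + \sum_i psi x 0 i * 'D_(e_ i) (Fn n) x.
  rewrite divergenceE// mulr_sumr -big_split/=; apply: eq_bigr => i _.
  have dF : derivable (Fn n) x (e_ i) by have [] := c1F n i.
  have dpsi : derivable (fun x => psi x 0 i) x (e_ i) by have [] := c1psi i i.
  by rewrite [LHS]deriveM.
have -> : \sum_i (phi x 0 i - psi x 0 i) * 'D_(e_ i) (Fn n) x =
    \sum_i phi x 0 i * 'D_(e_ i) (Fn n) x - \sum_i psi x 0 i * 'D_(e_ i) (Fn n) x.
  by rewrite -sumrB; apply: eq_bigr => i _; rewrite mulrBl.
have -> : \sum_i w x 0 i * conv (drho (scale_seq n) (e_ i)) \1_F x =
    \1_E x * (\sum_i phi x 0 i * 'D_(e_ i) (Fn n) x)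
    + (1 - \1_E x) * \sum_i psi x 0 i * 'D_(e_ i) (Fn n) x.
  rewrite !mulr_sumr -big_split/=; apply: eq_bigr => i _.
  rewrite derive_moll// /w indicE; case: ifP => _.
    by rewrite subrr mul0r mul1r addr0.
  by rewrite subr0 mul0r mul1r add0r.
lra.
Unshelve. all: by end_near. Qed.

End perimeter_inequalities.

Section perimeter_tools.
Context {R : realType} {m : nat}.
Local Notation mu := (lebesgue_rV m).
Local Notation V := 'rV[R]_m.
Local Notation e_ i := (delta_mx 0 i : V).
Implicit Types (f g eta : V -> R) (x y v : V) (phi psi : V -> V) (E F U : set V).

Lemma per_bound_ge0 E U (p : R) : per_bound E U p -> 0 <= p.
Proof. by move=> h; have := h _ (tfield0 U); rewrite pairing0. Qed.

Lemma conv_norm k g (C : R) x : continuous k -> (forall x, `|k x| <= C) ->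
  mu.-integrable setT (EFin \o g) ->
  `|conv k g x| <= C * \int[mu]_y `|g y|.
Proof.
move=> ck kC ig; have ik := conv_integrable ck kC ig x.
apply: (le_trans (le_normr_Rintegral _ ik)) => //.
rewrite -RintegralZl//; last exact: integrable_norm.
apply: le_Rintegral => //.
- exact: integrable_norm.
- by apply: integrable_EFinZ => //; exact: integrable_norm.
- by move=> y _; rewrite normrM ler_wpM2r.
Qed.

Lemma conv_drho_sum (e : R) (xi : V) g x : 0 < e -> mu.-integrable setT (EFin \o g) ->
  conv (drho e xi) g x = \sum_i xi 0 i * conv (drho e (e_ i)) g x.
Proof.
move=> e0 ig.
have ii i := conv_integrable (@drho_continuous _ _ e (e_ i)) (drho_norm e0 (e_ i)) ig x.
transitivity (\int[mu]_y (\sum_i xi 0 i * (drho e (e_ i) (x - y) * g y))).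
  apply: eq_Rintegral => y _.
  transitivity ((\sum_i xi 0 i * drho e (e_ i) (x - y)) * g y).
    congr (_ * _); rewrite /drho /dkern.
    transitivity ((@mass R m e)^-1 * (- (4 / e ^+ 2) *
       Num.max 0 (1 - dotr (x - y) (x - y) / e ^+ 2)) * dotr (x - y) xi).
      by rewrite !mulrA.
    rewrite mulr_sumr; apply: eq_bigr => i _.
    have -> : dotr (x - y) (e_ i) = (x - y) 0 i.
      rewrite /dotr (bigD1 i)//= big1 ?addr0 => [|j ji]; rewrite !mxE eqxx/=.
        by rewrite eqxx mulr1.
      by rewrite (negPf ji) mulr0.
    rewrite [xi 0 i * _]mulrC !mulrA.
    by rewrite -!mulrA; congr (_ * (_ * (_ * (_ * _)))); rewrite mulrC.
  by rewrite mulr_suml; apply: eq_bigr => i _; rewrite mulrA.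
rewrite Rintegral_sum// => [|i]; last exact: integrable_EFinZ.
by apply: eq_bigr => i _; rewrite RintegralZl.
Qed.

(** For the mollified set, the integral is the increment of a differentiable function of [t] between
    0 and 1. By the mean value theorem it is a derivative at some [t], which is [enorm xi] times the
    pairing of [E] with a test field parallel to [xi]. *)
Lemma perimeter_translation E U (p d : R) g (xi : V) :
  measurable E -> (mu E < +oo)%E -> per_bound E U p ->
  measurable_fun setT g -> (forall x, `|g x| <= 1) -> bsupp g -> 0 < d ->
  (forall x, g x != 0 -> forall t : R, 0 <= t <= 1 -> ball (x + t *: xi) d `<=` U) ->
  \int[mu]_x (g x * (\1_E (x + xi) - \1_E x)) <= enorm xi * p.
Proof.
move=> mE Eoo pE mg g1 bg d0 hU; have p0 := per_bound_ge0 pE.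
have ig := bounded_bsupp_integrable mg g1 bg.
have iE := integrable_indic_lty mE Eoo.
have [xi0|xi0] := eqVneq (enorm xi) 0.
  rewrite (enorm_eq0 xi0) enorm0 mul0r.
  under eq_Rintegral do rewrite addr0 subrr mulr0.
  by rewrite /Rintegral integral0.
have xip : 0 < enorm xi by rewrite lt_neqAle eq_sym xi0 enorm_ge0.
pose Fn n := conv (rho (scale_seq n)) (\1_E : V -> R).
have igE a : mu.-integrable setT (EFin \o (fun x => g x * \1_E (x + a))).
  under eq_fun do rewrite mulrC.
  apply: (@integrable_bounded_mul _ _ _ _ _ measurableT _ _ 1) => // [|x _].
    by apply: measurableT_comp => //; exact: measurable_shift.
  exact: indic_norm.
have cv : \int[mu]_x (g x * Fn n (x + xi)) - \int[mu]_x (g x * Fn n (x + 0))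
    @[n --> \oo] --> \int[mu]_x (g x * (\1_E (x + xi) - \1_E x)).
  have -> : \int[mu]_x (g x * (\1_E (x + xi) - \1_E x)) =
      \int[mu]_x (g x * \1_E (x + xi)) - \int[mu]_x (g x * \1_E (x + 0)).
    rewrite -RintegralB//; apply: eq_Rintegral => x _.
    by rewrite addr0 mulrBr.
  apply: (@cvgB _ R^o); exact: moll_weak_cvg.
rewrite -(cvg_lim _ cv)//; apply: limr_le.
  by apply/cvg_ex; eexists; exact: cv.
have d20 : 0 < d / 2 by rewrite divr_gt0.
near=> n.
have en : scale_seq n < d / 2.
  by near: n; exact: (near_infty_natSinv_lt (PosNum d20)).
have e0 := @scale_seq_gt0 R n.
pose e : R := scale_seq n; pose dF := conv (drho e xi) (\1_E : V -> R).
have dFn x : is_derive x xi (Fn n) (dF x).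
  exact: (conv_is_derive (@rho_continuous _ _ e) (rho_norm e0) iE
    (@drho_continuous _ _ e xi) (drho_norm e0 xi) (fun x => is_derive_rho e x xi)).
have cFn : continuous (Fn n).
  exact: (conv_continuous (@rho_continuous _ _ e) (rho_norm e0) iE).
have Fn1 x : `|Fn n x| <= 1.
  by have /andP[h0 h1] := moll_indic_bounds e0 x mE; rewrite ger0_norm.
have dFC x := conv_norm x (@drho_continuous _ _ e xi) (drho_norm e0 xi) iE.
have dq := is_derive_Rintegral_line ig cFn Fn1 dFn dFC.
pose q (t : R) := \int[mu]_x (g x * Fn n (x + t *: xi)).
pose q' (t : R) := \int[mu]_x (g x * dF (x + t *: xi)).
have cq : continuous q.
  move=> s; apply: differentiable_continuous.
  by apply/derivable1_diffP; have [] := dq s.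
have [t tI] := @MVT_segment _ q q' 0 1 ler01 (fun s _ => dq s) (continuous_subspaceT cq).
rewrite subr0 mulr1 /q scale1r scale0r => ->.
move: tI; rewrite in_itv/= => t01.
(* The sign cancels that of [pairing_mollv]. The support is that of [g] moved by [t *: xi] with [t]
   unknown, whence a margin along the whole segment. *)
pose w x : V := (- ((enorm xi)^-1 * g (x - t *: xi))) *: xi.
have mgt : measurable_fun setT (fun x => g (x - t *: xi)).
  by apply: measurableT_comp => //; exact: measurable_shift.
have mw : measurable_fun setT w.
  apply: measurable_scalerV => //; apply: measurableT_comp => //.
  exact: measurable_funM.
have w1 x : enorm (w x) <= 1.
  rewrite enormZ normrN normrM gtr0_norm ?invr_gt0// mulrAC mulVf// mul1r.
  exact: g1.
have wg x : w x != 0 -> g (x - t *: xi) != 0.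
  by apply: contra_neq => g0; rewrite /w g0 mulr0 oppr0 scale0r.
have bw : exists M : R, forall x, w x != 0 -> `|x| <= M.
  have [M hM] := bg; exists (M + `|t *: xi|) => x /wg /hM h.
  by rewrite -{1}(subrK (t *: xi) x) (le_trans (ler_normD _ _))// lerD2r.
have marg x : w x != 0 -> ball x (e + e) `<=` U.
  move=> /wg h; have := hU _ h t t01; rewrite subrK; apply: subset_trans.
  by apply: le_ball; rewrite /e; lra.
have := pE _ (mollv_tfield e0 mw w1 bw marg).
rewrite (pairing_mollv e0 mw w1 bw mE Eoo) => hp.
have -> : q' t = \int[mu]_x (g (x - t *: xi) * dF x).
  have mf : measurable_fun setT (EFin \o (fun x => g (x - t *: xi) * dF x)).
    apply/measurable_EFinP; apply: measurable_funM => //.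
    apply: continuous_measurable_rV.
    exact: (conv_continuous (@drho_continuous _ _ e xi) (drho_norm e0 xi) iE).
  rewrite /Rintegral -[in RHS](integral_shift (t *: xi) mf); congr fine.
  by apply: eq_integral => x _ /=; rewrite addrK.
have igd : mu.-integrable setT (EFin \o (fun x => g (x - t *: xi) * dF x)).
  under eq_fun do rewrite mulrC.
  apply: (@integrable_bounded_mul _ _ _ _ _ measurableT _ _ _ _ (fun x _ => dFC x)).
    apply: continuous_measurable_rV.
    exact: (conv_continuous (@drho_continuous _ _ e xi) (drho_norm e0 xi) iE).
  apply: (bounded_bsupp_integrable mgt (fun x => g1 _)).
  have [M hM] := bg; exists (M + `|t *: xi|) => x /hM h.
  by rewrite -{1}(subrK (t *: xi) x) (le_trans (ler_normD _ _))// lerD2r.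
rewrite -ler_pdivrMl// -RintegralZl//.
apply: le_trans hp.
rewrite -mulN1r -RintegralZl//; last first.
  have -> : (fun x => \sum_i w x 0 i * conv (drho (scale_seq n) (e_ i)) \1_E x) =
      (fun x => - (enorm xi)^-1 * (g (x - t *: xi) * dF x)).
    apply/funext => x; rewrite /dF conv_drho_sum// !mulr_sumr; apply: eq_bigr => i _.
    by rewrite mxE -mulNr !mulrA.
  exact: integrable_EFinZ.
rewrite le_eqVlt; apply/orP; left; apply/eqP; apply: eq_Rintegral => x _.
rewrite /dF conv_drho_sum// !mulr_sumr; apply: eq_bigr => i _.
by rewrite mxE mulN1r -!mulNr opprK !mulrA.
Unshelve. all: by end_near. Qed.

Lemma pairingD E U U' phi psi : measurable E -> tfield U phi -> tfield U' psi ->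
  pairing E (fun x => phi x + psi x) = pairing E phi + pairing E psi.
Proof.
move=> mE tphi tpsi.
have [c1 _ _ _] := tphi; have [c1' _ _ _] := tpsi.
rewrite /pairing -RintegralD//; last 2 first.
- exact: integrableS (divergence_integrable tphi).
- exact: integrableS (divergence_integrable tpsi).
have cE i : (fun x => (phi x + psi x) 0 i) = (fun x => phi x 0 i) \+ (fun x => psi x 0 i).
  by apply/funext => x; rewrite mxE.
apply: eq_Rintegral => x _; rewrite !divergenceE//; last first.
  by move=> j; rewrite cE; exact: C1D.
rewrite -big_split/=; apply: eq_bigr => i _; rewrite cE [LHS]deriveD//.
  by have [] := c1 i i.
by have [] := c1' i i.
Qed.

(** Fields with supports in disjoint sets can be added without the norm exceeding 1. *)
Lemma per_bound_split E U U1 U2 phi psi (p : R) : measurable E ->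
  U1 `<=` U -> U2 `<=` U -> U1 `&` U2 = set0 -> per_bound E U p ->
  tfield U1 phi -> tfield U2 psi -> pairing E phi + pairing E psi <= p.
Proof.
move=> mE s1 s2 dis pE tphi tpsi; rewrite -(pairingD mE tphi tpsi); apply: pE.
have [c1 [M hM] [d d0 hd] n1] := tphi; have [c1' [M' hM'] [d' d'0 hd'] n1'] := tpsi.
have supp x : phi x + psi x != 0 -> phi x != 0 \/ psi x != 0.
  have [px|] := eqVneq (phi x) 0; last by left.
  by rewrite px add0r; right.
split.
- move=> j; have -> : (fun x => (phi x + psi x) 0 j) = (fun x => phi x 0 j) \+ (fun x => psi x 0 j).
    by apply/funext => x; rewrite mxE.
  exact: C1D.
- exists (Num.max M M') => x /supp[/hM|/hM'] h; rewrite le_max h//.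
  by rewrite orbT.
- exists (Num.min d d'); first by rewrite lt_min d0.
  move=> x /supp[/hd|/hd'] h.
    by apply: (subset_trans _ s1); apply: subset_trans h; apply: le_ball; rewrite ge_min lexx.
  by apply: (subset_trans _ s2); apply: subset_trans h; apply: le_ball; rewrite ge_min lexx orbT.
- move=> x; have [px|px] := eqVneq (phi x) 0; first by rewrite px add0r.
  have [qx|qx] := eqVneq (psi x) 0; first by rewrite qx addr0.
  have : (U1 `&` U2) x by split; [apply: (hd x px)|apply: (hd' x qx)]; exact: ballxx.
  by rewrite dis.
Qed.

Lemma tfieldS U U' phi : U `<=` U' -> tfield U phi -> tfield U' phi.
Proof.
move=> UU' [c1 b [d d0 hd] n1]; split => //; exists d => // x px.
by apply: subset_trans UU'; exact: hd.
Qed.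

Lemma per_boundS E U U' (p : R) : U `<=` U' -> per_bound E U' p -> per_bound E U p.
Proof. by move=> UU' pE phi tphi; apply: pE; exact: tfieldS tphi. Qed.

Lemma pairing_cvg (E_ : (set V)^nat) E U phi : tfield U phi ->
  (forall k, measurable (E_ k)) -> measurable E ->
  (forall x, (\1_(E_ k) x : R) @[k --> \oo] --> (\1_E x : R)) ->
  pairing (E_ k) phi @[k --> \oo] --> pairing E phi.
Proof.
move=> tphi mE_ mE cvgE; rewrite pairing_indic.
under eq_fun do rewrite pairing_indic.
have mdiv := divergence_measurable tphi.
apply: (@dominated_cvg_Rintegral _ _ _ _ _ measurableT _ _ (fun x => `|divergence phi x|)).
- by move=> k; apply: measurable_funM.
- exact: measurable_funM.
- by apply: aeW => x _; apply: cvgM; [exact: cvgE|exact: cvg_cst].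
- by apply: integrable_norm => //; exact: (divergence_integrable tphi).
- by move=> k x _; rewrite normrM ler_piMl// indic_norm.
Qed.

(** The gradient term of the glued field costs at most [s] on [A]. For lateral cuts [A] is an
    annulus; for horizontal cuts it is empty, since the gradient term then has a favourable sign. *)
Lemma cut_perimeter E U A phi psi eta (p s : R) : measurable E -> measurable A ->
  (mu (E `&` A) < +oo)%E -> per_bound E U p -> tfield U phi -> tfield U psi ->
  C1 eta -> (forall x, 0 <= eta x <= 1) ->
  (forall x, - (s * \1_A x) <= \sum_i (phi x 0 i - psi x 0 i) * 'D_(e_ i) eta x) ->
  \int[mu]_x (\1_E x * (eta x * divergence phi x + (1 - eta x) * divergence psi x))
    <= p + s * fine (mu (E `&` A)).
Proof.
move=> mE mA EAoo pE tphi tpsi ceta eta01 hs.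
have tcut := cut_field_tfield tphi tpsi ceta eta01.
have := pE _ tcut; rewrite pairing_indic => hp.
apply: le_trans (lerD hp (lexx _)).
have mEA : measurable (E `&` A) by exact: measurableI.
rewrite -Rintegral_indic// -RintegralZl//; last exact: integrable_indic_lty.
have icut : mu.-integrable setT (EFin \o (fun x => \1_E x * divergence (cut_field phi psi eta) x)).
  by apply: integrable_indic_mul => //; exact: (divergence_integrable tcut).
have iEA : mu.-integrable setT (EFin \o (fun x => s * \1_(E `&` A) x)).
  by apply: integrable_EFinZ => //; exact: integrable_indic_lty.
rewrite -RintegralD//; apply: le_Rintegral => //.
- apply: integrable_indic_mul => //; apply: integrable_EFinD => //.
    exact: (eta_divergence_integrable tphi (C1_continuous ceta)).
  exact: (eta_divergence_integrable tpsi (continuous_onem (C1_continuous ceta))).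
- exact: integrable_EFinD.
- move=> x _; rewrite (divergence_cut_field tphi tpsi ceta) !indicE in_setI.
  have := hs x; rewrite indicE.
  by case: (x \in E) => /=; rewrite ?mul1r ?mul0r ?mulr0 ?addr0//; lra.
Qed.

End perimeter_tools.

(** * Vertical slices, jumps on lines and the trace on the boundary *)

Section line_jumps.
Context {R : realType}.
Local Notation lam := (@lebesgue_measure R).
Implicit Types (A : set R).

Lemma lebesgue_itv_lty (a b : R) (A : set (measurableTypeR R)) : measurable A ->
  (lam (A `&` `[a, b[) < +oo)%E.
Proof.
move=> mA; apply: (@le_lt_trans _ _ (lam `[a, b[%classic)).
  apply: le_measure; rewrite ?inE; [exact: measurableI|exact: measurable_itv|exact: subIsetr].
by rewrite lebesgue_measure_itv/=; case: ifP => _; rewrite ?ltry// -EFinB ltry.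
Qed.

Lemma itv_add (A : set (measurableTypeR R)) (a b c : R) : measurable A -> a <= b -> b <= c ->
  lam (A `&` `[a, c[) = (lam (A `&` `[a, b[) + lam (A `&` `[b, c[))%E.
Proof.
move=> mA ab bc; rewrite -measureU.
- congr (lam _); rewrite -setIUr; congr (_ `&` _); apply/seteqP; split => t /=.
    rewrite !in_itv/= => /andP[at_ tc]; have [tb|bt] := ltP t b; first by left; rewrite at_.
    by right; rewrite tc.
  rewrite !in_itv/= => -[/andP[h1 h2]|/andP[h1 h2]].
    by rewrite h1 (lt_le_trans h2 bc).
  by rewrite (le_trans ab h1) h2.
- exact: measurableI.
- exact: measurableI.
- rewrite -subset0 => t [[_ +] [_]] /=; rewrite !in_itv/= => /andP[_ tb] /andP[bt _].
  by move: (lt_le_trans tb bt); rewrite ltxx.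
Qed.

Definition jumps A (h a b : R) : set R := [set t | a <= t < b /\ (A t <> A (t + h))].

Lemma jumps_measurable (A : set (measurableTypeR R)) h a b : measurable A ->
  measurable (jumps A h a b : set (measurableTypeR R)).
Proof.
move=> mA.
have mS : measurable ((fun t : R => t + h) @^-1` A : set (measurableTypeR R)).
  by apply: measurable_preimage => //; exact: measurable_funD.
rewrite (_ : jumps A h a b = `[a, b[%classic `&`
   ((A `\` ((fun t : R => t + h) @^-1` A)) `|` (((fun t : R => t + h) @^-1` A) `\` A))).
  by apply: measurableI => //; apply: measurableU; exact: measurableD.
apply/seteqP; split => t /=; rewrite in_itv/=.
  move=> [tab hne]; split => //.
  have [At|nAt] := pselect (A t); have [Ath|nAth] := pselect (A (t + h)).
  - by case: hne; apply/propext; split.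
  - by left.
  - by right.
  - by case: hne; apply/propext; split.
by move=> [tab [[h1 h2]|[h1 h2]]]; split => // E; [apply: h2; rewrite -E|apply: h2; rewrite E].
Qed.

(** Removing from the interval between [a - r] and [b + r] the window about [b], or the one about
    [a], leaves two intervals that are translates by [2 * r]. Their masses in [A] differ by at most
    the measure of the jumps with this step, hence so do the masses of the windows. *)
Lemma itv_jump (A : set (measurableTypeR R)) (a b r : R) : measurable A -> 0 < r -> a <= b ->
  (lam (A `&` ball a r) <= lam (A `&` ball b r) + lam (jumps A (2 * r) (a - r) (b - r)))%E /\
  (lam (A `&` ball b r) <= lam (A `&` ball a r) + lam (jumps A (2 * r) (a - r) (b - r)))%E.
Proof.
move=> mA r0 ab.
set J := jumps _ _ _ _.
have mJ : measurable (J : set (measurableTypeR R)) by exact: jumps_measurable.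
have bE (c : R) : lam (A `&` ball c r) = lam (A `&` `[c - r, c + r[).
  apply/eqP; rewrite eq_le; apply/andP; split.
    apply: le_measure; rewrite ?inE.
    - by apply: measurableI => //; exact: measurable_ball.
    - exact: measurableI.
    - apply: setIS => t; rewrite /ball/= in_itv/= ltr_distlC => /andP[h1 h2].
      by rewrite (ltW h1).
  rewrite -[X in (_ <= X)%E]adde0 -(lebesgue_measure_set1 (c - r)).
  apply: (le_trans _ (measureU2 _ _ _)).
  - apply: le_measure; rewrite ?inE.
    + exact: measurableI.
    + by apply: measurableU; [apply: measurableI => //; exact: measurable_ball|exact: measurable_set1].
    + move=> t [At]; rewrite /= in_itv/= => /andP[h1 h2].
      have [tc|tc] := eqVneq t (c - r); first by right.
      by left; split=> //; rewrite /ball/= ltr_distlC h2 andbT lt_neqAle eq_sym tc h1.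
  - by apply: measurableI => //; exact: measurable_ball.
  - exact: measurable_set1.
have shift : lam (A `&` `[a + r, b + r[) =
    lam ((fun t : R => t + 2 * r) @^-1` (A `&` `[a + r, b + r[)).
  by rewrite lebesgue_measure_shift//; exact: measurableI.
have mP : measurable ((fun t : R => t + 2 * r) @^-1` (A `&` `[a + r, b + r[) : set (measurableTypeR R)).
  by apply: measurable_preimage; [exact: measurable_funD|exact: measurableI].
have mQ : measurable (A `&` `[a - r, b - r[ : set (measurableTypeR R)) by exact: measurableI.
have s1 : (lam (A `&` `[(a + r)%R, (b + r)%R[) <= lam (A `&` `[(a - r)%R, (b - r)%R[) + lam J)%E.
  rewrite shift; apply: (le_trans _ (measureU2 _ mQ mJ)).
  apply: le_measure; rewrite ?inE//; first exact: measurableU.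
  move=> t [/= At]; rewrite in_itv/= => /andP[h1 h2].
  have tI : a - r <= t < b - r by apply/andP; split; lra.
  have [At0|nAt] := pselect (A t); first by left; split => //; rewrite /= in_itv.
  by right; split => // E; apply: nAt; rewrite E.
have s2 : (lam (A `&` `[(a - r)%R, (b - r)%R[) <= lam (A `&` `[(a + r)%R, (b + r)%R[) + lam J)%E.
  rewrite shift; apply: (le_trans _ (measureU2 _ mP mJ)).
  apply: le_measure; rewrite ?inE//; first exact: measurableU.
  move=> t [/= At]; rewrite in_itv/= => tI.
  have [At0|nAt] := pselect (A (t + 2 * r)).
    by left; split => //=; rewrite in_itv/=; case/andP: tI => *; apply/andP; split; lra.
  by right; split => // E; apply: nAt; rewrite -E.
have e1 := @itv_add A (a - r) (a + r) (b + r) mA ltac:(lra) ltac:(lra).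
have e2 := @itv_add A (a - r) (b - r) (b + r) mA ltac:(lra) ltac:(lra).
have fin (X : set (measurableTypeR R)) : (lam X < +oo)%E -> exists x : R, lam X = x%:E.
  by move=> h; exists (fine (lam X)); rewrite fineK// ge0_fin_numE.
have Jfin : (lam J < +oo)%E.
  apply: (@le_lt_trans _ _ (lam (setT `&` `[(a - r)%R, (b - r)%R[))); last exact: lebesgue_itv_lty.
  apply: le_measure; rewrite ?inE//; first exact: measurableI.
  by move=> t [h _]; split => //=; rewrite in_itv.
have [x1 h1] := fin _ (lebesgue_itv_lty (a - r) (a + r) mA).
have [x2 h2] := fin _ (lebesgue_itv_lty (a + r) (b + r) mA).
have [x3 h3] := fin _ (lebesgue_itv_lty (a - r) (b - r) mA).
have [x4 h4] := fin _ (lebesgue_itv_lty (b - r) (b + r) mA).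
have [x5 h5] := fin _ (lebesgue_itv_lty (a - r) (b + r) mA).
have [j hj] := fin _ Jfin.
rewrite !bE h1 h4 hj -!EFinD !lee_fin.
move: s1 s2; rewrite h2 h3 hj -!EFinD !lee_fin => s1 s2.
move: e1 e2; rewrite h1 h2 h3 h4 h5 -!EFinD => -[e1] [e2].
split; lra.
Qed.

(* At a density point of [A] and a density point of its complement the averages
   over short intervals are close to 1 and to 0, so that the jumps between them
   have almost full measure [2 r]. *)
Lemma nonconstant_jumps (A : set (measurableTypeR R)) (s : R) : measurable A -> 0 < s ->
  (0 < lam (A `&` `]0%R, s[))%E -> (lam (A `&` `]0%R, s[) < s%:E)%E ->
  \forall h \near 0^'+, ((h / 2)%:E <= lam (jumps A h h (s - 2 * h)))%E.
Proof.
move=> mA s0 A0 As.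
pose I : set (measurableTypeR R) := `]0, s[%classic.
have mI : measurable I by exact: measurable_itv.
have [N [mN N0 hN]] := lebesgue_density mA.
have dens t : ~ N t -> (lam (A `&` ball t r) / lam (ball t r))%E @[r --> 0^'+] --> (\1_A t)%:E.
  by move=> nNt; apply: contrapT => h; apply: nNt; apply: hN.
have lI : lam I = s%:E by rewrite /I lebesgue_measure_itv/= lte_fin s0 sube0.
have mAI : measurable (A `&` I) by exact: measurableI.
have [a [Aa Ia nNa]] : exists a, [/\ A a, I a & ~ N a].
  apply: contrapT => /forallNP h; move: A0; rewrite ltNge => /negP; apply.
  rewrite -N0; apply: le_measure; rewrite ?inE//.
  by move=> t [At It]; apply: contrapT => nNt; apply: (h t).
have [b [nAb Ib nNb]] : exists b, [/\ ~ A b, I b & ~ N b].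
  apply: contrapT => /forallNP h; move: As; rewrite ltNge => /negP; apply.
  rewrite -lI -[X in (_ <= X)%E]adde0 -N0; apply: (le_trans _ (measureU2 _ mAI mN)).
  apply: le_measure; rewrite ?inE//; first exact: measurableU.
  move=> t It; have [At|nAt] := pselect (A t); first by left.
  by right; apply: contrapT => nNt; apply: (h t).
have da := dens a nNa; have db := dens b nNb.
rewrite indicE mem_set//= in da; rewrite indicE memNset//= in db.
have fin (X : set (measurableTypeR R)) : (lam X < +oo)%E -> exists x : R, lam X = x%:E.
  by move=> h; exists (fine (lam X)); rewrite fineK// ge0_fin_numE.
have ballfin (c r : R) : 0 < r -> exists x : R, lam (A `&` ball c r) = x%:E.
  move=> r0; apply: fin; apply: (@le_lt_trans _ _ (lam (ball c r))).
    by apply: le_measure; rewrite ?inE; [apply: measurableI => //; exact: measurable_ball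
      |exact: measurable_ball|exact: subIsetr].
  by rewrite lebesgue_measure_ball ?ltW// ltry.
have ratio (c r x : R) : 0 < r -> lam (A `&` ball c r) = x%:E ->
    (lam (A `&` ball c r) * (lam (ball c r))^-1)%E = (x / (r *+ 2))%:E.
  move=> r0 ->; rewrite lebesgue_measure_ball ?ltW// inver.
  by rewrite gt_eqF ?mulrn_wgt0// EFinM.
(* Averages above 3/4 and below 1/4 over windows of length [2 * r = h] differ in mass by more than
   [h / 2]. *)
have [ra /= ra0 ha] : \forall r \near 0^'+, ((3 / 4 : R)%:E < lam (A `&` ball a r) * (lam (ball a r))^-1)%E.
  by apply: (da (fun u => (3 / 4 : R)%:E < u)%E); apply: open_ereal_gt'; rewrite lte_fin/=; lra.
have [rb /= rb0 hb] : \forall r \near 0^'+, (lam (A `&` ball b r) * (lam (ball b r))^-1 < (1 / 4 : R)%:E)%E.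
  by apply: (db (fun u => u < (1 / 4 : R)%:E)%E); apply: open_ereal_lt'; rewrite lte_fin/=; lra.
move: Ia Ib; rewrite /I/= !in_itv/= => /andP[a0 sa] /andP[b0 sb].
pose e := Num.min (Num.min ra rb) (Num.min (Num.min a b) (Num.min (s - a) (s - b))) / 4.
have [m0 [k1 [k2 [k3 [k4 [k5 k6]]]]]] : 0 < e /\ e * 4 <= ra /\ e * 4 <= rb /\ e * 4 <= a /\ e * 4 <= b /\
    e * 4 <= s - a /\ e * 4 <= s - b.
  rewrite /e divfK//; split; last by rewrite !ge_min !lexx ?orbT.
  by rewrite divr_gt0// !lt_min ra0 rb0 a0 b0 !subr_gt0 sa sb.
exists e => //= h /=; rewrite sub0r normrN => he h0; rewrite gtr0_norm// in he.
pose r := h / 2; have r0 : 0 < r by rewrite divr_gt0.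
have hr : h = 2 * r by rewrite mulrC divfK.
have [xa hxa] := ballfin a r r0; have [xb hxb] := ballfin b r r0.
have := ha r; rewrite /= sub0r normrN gtr0_norm// (ratio _ _ _ r0 hxa) lte_fin.
move=> /(_ ltac:(lra) r0); rewrite ltr_pdivlMr ?mulrn_wgt0// => ua.
have := hb r; rewrite /= sub0r normrN gtr0_norm// (ratio _ _ _ r0 hxb) lte_fin.
move=> /(_ ltac:(lra) r0); rewrite ltr_pdivrMr ?mulrn_wgt0// => ub.
have sub (c d : R) : c \in [:: a; b] -> d \in [:: a; b] ->
    (lam (jumps A (2 * r) (c - r) (d - r)) <= lam (jumps A h h (s - 2 * h)))%E.
  move=> hc hd; apply: le_measure; rewrite ?inE; try exact: jumps_measurable.
  move=> t [/andP[t1 t2] ht]; split; last by rewrite hr.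
  have [ec ed] : e * 4 <= c /\ e * 4 <= s - d.
    by move: hc hd; rewrite !inE => /orP[]/eqP-> /orP[]/eqP->.
  by apply/andP; split; lra.
have fJ (c d : R) : (lam (jumps A (2 * r) (c - r) (d - r)) < +oo)%E.
  apply: (@le_lt_trans _ _ (lam (setT `&` `[c - r, d - r[))); last exact: lebesgue_itv_lty.
  apply: le_measure; rewrite ?inE.
  - exact: jumps_measurable.
  - exact: measurableI.
  - by move=> t [hh _]; split => //=; rewrite in_itv.
have [ab|ba] := leP a b.
- have [+ _] := itv_jump mA r0 ab.
  have [x hx] := fin _ (fJ a b).
  rewrite hxa hxb hx -EFinD lee_fin => H.
  apply: le_trans (sub a b _ _); rewrite ?inE ?eqxx ?orbT//.
  by rewrite hx lee_fin; lra.
- have [_ +] := itv_jump mA r0 (ltW ba).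
  have [x hx] := fin _ (fJ b a).
  rewrite hxa hxb hx -EFinD lee_fin => H.
  apply: le_trans (sub b a _ _); rewrite ?inE ?eqxx ?orbT//.
  by rewrite hx lee_fin; lra.
Qed.

End line_jumps.

Section translation.
Context {R : realType} {m : nat}.
Local Notation mu := (lebesgue_rV m).
Local Notation V := 'rV[R]_m.
Implicit Types (x y : V) (E U : set V) (g : V -> R).

Lemma cvg_le_near (u : nat -> R) (l c : R) : u k @[k --> \oo] --> l ->
  (\forall k \near \oo, u k <= c) -> l <= c.
Proof.
by move=> ul h; rewrite -(cvg_lim _ ul)//; apply: limr_le => //; apply/cvg_ex; exists l.
Qed.

Lemma measurable_norm_le (M : R) : measurable [set x : V | `|x| <= M].
Proof.
apply: measurable_le_set; last exact: measurable_cst.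
by apply: continuous_measurable_rV => x; exact: norm_continuous.
Qed.

Let segment_margin U (xi : V) (d : R) : measurable
  [set x | forall t : R, 0 <= t <= 1 -> ball (x + t *: xi) d `<=` U].
Proof.
rewrite -[X in measurable X]setCK; apply: measurableC; apply: open_measurable_rV.
rewrite openE => x /= /existsNP[t /not_implyP[t01 /existsNP[z /not_implyP[xz nUz]]]].
have xz' : nbhs x [set x' | ball (x' + t *: xi) d z].
  have oB : open [set x' : V | ball z d (x' + t *: xi)].
    apply: (@open_comp _ _ (fun x1 : V => x1 + t *: xi) (ball z d)); last first.
      exact: ball_open.
    move=> y _; apply: (@continuousD R V V id (cst (t *: xi))); [exact: id|exact: cst_continuous].
  have Bx : ball z d (x + t *: xi) by exact: ball_sym.
  have := open_nbhs_nbhs (conj oB Bx : open_nbhs x _).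
  by apply: filterS => y; exact: ball_sym.
apply: filterS xz' => y yz; apply/existsNP; exists t; apply/not_implyP.
by split => //; apply/existsNP; exists z; apply/not_implyP.
Qed.

(** Truncating [g] to bounded points whose whole segment has margin [k.+1%:R^-1] in [U] restores the
    hypotheses of [perimeter_translation]. Each segment is compact, hence kept for large [k], and
    dominated convergence removes the truncation. *)
Lemma perimeter_translation_open E U (p : R) g (xi : V) : open U ->
  measurable E -> (mu E < +oo)%E -> per_bound E U p ->
  measurable_fun setT g -> (forall x, `|g x| <= 1) ->
  (forall x, g x != 0 -> forall t : R, 0 <= t <= 1 -> U (x + t *: xi)) ->
  \int[mu]_x (g x * (\1_E (x + xi) - \1_E x)) <= enorm xi * p.
Proof.
move=> oU mE fE Ep mg g1 gU.
pose M (k : nat) : set V := [set x : V | `|x| <= k%:R] `&`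
  [set x | forall t : R, 0 <= t <= 1 -> ball (x + t *: xi) k.+1%:R^-1 `<=` U].
have mM k : measurable (M k).
  by apply: measurableI; [exact: measurable_norm_le|exact: segment_margin].
have gM k x : g x * \1_(M k) x != 0 -> M k x.
  rewrite indicE; case: (boolP (x \in M k)) => [/set_mem//|_].
  by rewrite mulr0 eqxx.
have mS : measurable_fun setT (fun x => \1_E (x + xi) : R).
  by apply: measurableT_comp => //; exact: measurable_shift.
have iE := integrable_indic_lty mE fE.
have iS : mu.-integrable setT (EFin \o (fun x => \1_E (x + xi) : R)).
  exact: (integrable_shift xi iE).
pose u k x := g x * \1_(M k) x * (\1_E (x + xi) - \1_E x).
have cv : \int[mu]_x u k x @[k --> \oo] --> \int[mu]_x (g x * (\1_E (x + xi) - \1_E x)).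
  apply: (@dominated_cvg_Rintegral _ _ _ _ _ measurableT _ _ (fun x => \1_E (x + xi) + \1_E x)).
  - by move=> k; apply: measurable_funM; [exact: measurable_funM|exact: measurable_funB].
  - by apply: measurable_funM => //; exact: measurable_funB.
  - apply: aeW => x _; have [gx|gx] := eqVneq (g x) 0.
      by rewrite /u gx !mul0r; under eq_fun do rewrite !mul0r; exact: cvg_cst.
    apply: cvg_near_cst.
    pose K := (fun t : R => x + t *: xi) @` `[0, 1]%classic.
    have cK : compact K.
      apply: continuous_compact; last exact: segment_compact.
      apply: continuous_subspaceT => t; apply: cvgD; first exact: cvg_cst.
      exact: scalel_continuous.
    have [d d0 hd] : exists2 d : R, 0 < d & forall x, K x -> ball x d `<=` U.
      by apply: compact_margin => // _ [t /= t01 <-]; apply: gU => //; rewrite in_itv in t01.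
    near=> k; rewrite /u indicE mem_set ?mulr1//; split => /=.
      by near: k; exact: nbhs_infty_ger.
    move=> t t01; apply: (subset_trans _ (hd _ _)); last by exists t => //=; rewrite in_itv.
    apply: le_ball; apply: ltW; near: k; exact: near_infty_natSinv_lt (PosNum d0).
  - exact: integrable_EFinD.
  - move=> k x _; rewrite /u !normrM.
    apply: (@le_trans _ _ (1 * 1 * `|\1_E (x + xi) - \1_E x|)).
      by rewrite ler_wpM2r// ler_pM// indic_norm.
    rewrite !mul1r (le_trans (ler_normB _ _))//.
    by rewrite !ger0_norm.
apply: (cvg_le_near cv); apply: nearW => k.
apply: (@perimeter_translation _ _ E U p k.+1%:R^-1 (fun x => g x * \1_(M k) x)) => //.
- exact: measurable_funM.
- by move=> x; rewrite normrM -[leRHS]mulr1 ler_pM// indic_norm.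
- by exists k%:R => x /gM[].
- by move=> x /gM[_ h] t t01; exact: h.
Unshelve. all: by end_near. Qed.

End translation.

Section slices.
Context {R : realType} {n : nat}.
Local Notation mu := (lebesgue_rV n.+1).
Local Notation nu := (lebesgue_rV n).
Local Notation lam := (@lebesgue_measure R).
Local Notation V := 'rV[R]_n.+1.
Local Notation Y := 'rV[R]_n.
Implicit Types (x : V) (y : Y) (A E U : set V) (b : Y -> R).

Definition elast : V := rcons_rV 0 1.
Definition upper (s : R) : set V := [set x | s < height x].
(** Half-open, so that consecutive strips tile and translate into each other; [slab] is open, as a
    domain for test fields. *)
Definition strip (a c : R) : set V := [set x | a < height x <= c].
Definition slab (s : R) : set V := [set x | 0 < height x < s].
Definition slice A y : set (measurableTypeR R) := [set t | A (rcons_rV y t)].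

Lemma height_elast x h : height (x + h *: elast) = height x + h.
Proof. by rewrite /height !mxE unlift_none/= mulr1. Qed.

Lemma horiz_elast x h : horiz (x + h *: elast) = horiz x.
Proof. by apply/rowP => i; rewrite !mxE liftK/= mxE mulr0 addr0. Qed.

Lemma enorm_elast : enorm elast = 1.
Proof.
rewrite /enorm big_ord_recr/= big1 => [|i _].
  by rewrite add0r mxE unlift_none/= expr1n sqrtr1.
rewrite mxE; have -> : widen_ord (leqnSn n) i = lift ord_max i.
  by apply: val_inj; rewrite /= /bump leqNgt ltn_ord.
by rewrite liftK/= mxE expr0n.
Qed.

Lemma rcons_elast y t h : rcons_rV y t + h *: elast = rcons_rV y (t + h).
Proof. by rewrite -[LHS]rcons_rVK horiz_elast height_elast horizK heightK. Qed.

Lemma height_continuous : continuous (height : V -> R).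
Proof. by move=> x; exact: coord_continuous. Qed.

Lemma upper_open s : open (upper s).
Proof.
by apply: (@open_comp _ _ (height : V -> R) [set r | s < r]); [move=> x _; exact: height_continuous|exact: open_gt].
Qed.

Lemma slab_open s : open (slab s).
Proof.
rewrite (_ : slab s = upper 0 `&` [set x | height x < s]).
  apply: openI; first exact: upper_open.
  by apply: (@open_comp _ _ (height : V -> R) [set r | r < s]); [move=> x _; exact: height_continuous|exact: open_lt].
by apply/seteqP; split => x /=; [move=> /andP[]|move=> [? ?]; apply/andP].
Qed.

Lemma measurable_upper s : measurable (upper s).
Proof. by apply: open_measurable_rV; exact: upper_open. Qed.

Lemma measurable_strip a c : measurable (strip a c).
Proof.
rewrite (_ : strip a c = upper a `\` upper c).
  by apply: measurableD; exact: measurable_upper.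
apply/seteqP; split => x; rewrite /strip /upper/= leNgt.
  by move=> /andP[? /negP].
by move=> [? /negP ?]; apply/andP.
Qed.

Lemma measurable_slice A y : measurable A -> measurable (slice A y).
Proof.
move=> mA; apply: measurable_preimage mA.
apply: measurable_fun_rV => j; case: (unliftP ord_max j) => [i ->|->].
  by rewrite (_ : (fun _ => _) = cst (y 0 i))//; apply/funext => t; rewrite mxE liftK.
by rewrite (_ : (fun _ => _) = id)//; apply/funext => t; rewrite mxE unlift_none.
Qed.

Let xsec A y : xsection ((fun p : Y * measurableTypeR R => rcons_rV p.1 p.2) @^-1` A) y = slice A y.
Proof. by apply/seteqP; split => t /=; rewrite /xsection/= inE. Qed.

Let mpre A : measurable A ->
  measurable ((fun p : Y * measurableTypeR R => rcons_rV p.1 p.2) @^-1` A).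
Proof. by move=> mA; apply: measurable_preimage => //; exact: measurable_rcons_rV. Qed.

Lemma lebesgue_slice A : mu A = (\int[nu]_y lam (slice A y))%E.
Proof. by rewrite lebesgue_rVS /product_measure1/=; under eq_integral do rewrite xsec. Qed.

Lemma measurable_lebesgue_slice A : measurable A -> measurable_fun setT (fun y => lam (slice A y)).
Proof.
move=> mA; have := measurable_fun_xsection lam (mpre mA).
by rewrite (_ : _ \o _ = fun y => lam (slice A y))//; apply/funext => y /=; rewrite xsec.
Qed.

Lemma slice_strip_le A c y : measurable A -> 0 <= c ->
  (lam (slice (A `&` strip 0 c) y) <= c%:E)%E.
Proof.
move=> mA c0; apply: (@le_trans _ _ (lam `]0%R, c]%classic)).
  apply: le_measure; rewrite ?inE.
  - by apply: measurable_slice; apply: measurableI => //; exact: measurable_strip.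
  - exact: measurable_itv.
  - by move=> t [_]; rewrite /strip/= heightK in_itv.
by rewrite lebesgue_measure_itv/= lte_fin; case: ifP; rewrite ?sube0// lee_fin.
Qed.

(** For [E] of finite perimeter and almost every [y], this is 0 or [c] as soon as [c] is small,
    according to the trace. *)
Definition depth E c y : R := fine (lam (slice (E `&` strip 0 c) y)).

Lemma depthK E c y : measurable E -> 0 <= c ->
  (depth E c y)%:E = lam (slice (E `&` strip 0 c) y).
Proof.
move=> mE c0; rewrite fineK// ge0_fin_numE//.
exact: le_lt_trans (slice_strip_le y mE c0) (ltry _).
Qed.

Lemma measurable_depth E c : measurable E -> measurable_fun setT (depth E c).
Proof.
move=> mE; apply: measurableT_comp; first exact: fine_measurable.
by apply: measurable_lebesgue_slice; apply: measurableI => //; exact: measurable_strip.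
Qed.

Lemma integrable_depth E c : measurable E -> (mu E < +oo)%E -> 0 <= c ->
  nu.-integrable setT (EFin \o depth E c).
Proof.
move=> mE fE c0; apply/integrableP; split; first by apply/measurable_EFinP; exact: measurable_depth.
under eq_integral => y _ do rewrite /= ger0_norm ?fine_ge0// (depthK y mE c0).
rewrite -lebesgue_slice; apply: le_lt_trans fE; apply: le_measure; rewrite ?inE//.
by apply: measurableI => //; exact: measurable_strip.
Qed.

Lemma Rintegral_depth E c b : measurable E -> (mu E < +oo)%E -> 0 <= c ->
  measurable_fun setT b -> (forall y, `|b y| <= 1) ->
  \int[mu]_x (b (horiz x) * \1_(E `&` strip 0 c) x) = \int[nu]_y (b y * depth E c y).
Proof.
move=> mE fE c0 mb b1.
have mEs : measurable (E `&` strip 0 c) by apply: measurableI => //; exact: measurable_strip.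
have fEs : (mu (E `&` strip 0 c) < +oo)%E.
  by apply: le_lt_trans fE; apply: le_measure; rewrite ?inE.
rewrite /Rintegral integral_rVS; last first.
  apply: (@integrable_bounded_mul _ _ _ _ _ measurableT _ _ 1) => //.
    by apply: measurableT_comp => //; exact: measurable_horiz.
  exact: integrable_indic_lty.
congr fine; apply: eq_integral => y _.
have e t : \1_(E `&` strip 0 c) (rcons_rV y t) = \1_(slice (E `&` strip 0 c) y) t :> R.
  by rewrite !indicE; congr (_%:R); apply/idP/idP; rewrite !inE.
under eq_integral => t _ do rewrite horizK EFinM e.
rewrite integralZl//; last first.
  apply: integrable_indic_lty; first exact: measurable_slice.
  exact: le_lt_trans (slice_strip_le y mE c0) (ltry _).
by rewrite EFinM (depthK y mE c0) integral_indic ?setIT//; exact: measurable_slice.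
Qed.

End slices.

Section perimeter_real.
Context {R : realType} {m : nat}.
Local Notation mu := (lebesgue_rV m).
Local Notation V := 'rV[R]_m.
Implicit Types (E U : set V).

(** Meaningful only together with some [per_bound E U p], since the real [sup] of an unbounded set
    is a default value. *)
Definition per E U : R := sup [set pairing E phi | phi in tfield U].

Let per_has_sup E U p : per_bound E U p -> has_sup [set pairing E phi | phi in tfield U].
Proof.
move=> h; split; first by exists (pairing E (fun=> 0)), (fun=> 0) => //; exact: tfield0.
by exists p => _ [phi tphi <-]; exact: h.
Qed.

Lemma per_ub E U p : per_bound E U p -> per_bound E U (per E U).
Proof.
move=> h phi tphi; apply: ub_le_sup; first exact: (per_has_sup h).2.
by exists phi.
Qed.

Lemma per_le E U p : per_bound E U p -> per E U <= p.
Proof.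
move=> h; apply: ge_sup; first exact: (per_has_sup h).1.
by move=> _ [phi tphi <-]; exact: h.
Qed.

Lemma per_approx E U p (e : R) : per_bound E U p -> 0 < e ->
  exists2 phi, tfield U phi & per E U - e < pairing E phi.
Proof.
move=> h e0; have [_ [phi tphi <-] hphi] := sup_adherent e0 (per_has_sup h).
by exists phi.
Qed.

Lemma per_ge0 E U p : per_bound E U p -> 0 <= per E U.
Proof. by move=> h; apply: per_bound_ge0; exact: per_ub h. Qed.

Lemma perimeterE E U p : open U -> measurable E -> per_bound E U p ->
  perimeter E U = (per E U)%:E.
Proof.
move=> oU mE h; apply/eqP; rewrite eq_le; apply/andP; split.
  by apply/perimeter_leP => // phi tphi; rewrite lee_fin; exact: per_ub h _ tphi.
have : (perimeter E U <= (per E U)%:E)%E.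
  by apply/perimeter_leP => // phi tphi; rewrite lee_fin; exact: per_ub h _ tphi.
have := perimeter_ge0 oU mE; case eq: (perimeter E U) => [r| |]//= _ _.
rewrite lee_fin; apply: per_le => phi tphi.
have : (perimeter E U <= r%:E)%E by rewrite eq.
by move=> /(perimeter_leP _ oU mE) /(_ _ tphi); rewrite lee_fin.
Qed.

End perimeter_real.

Section fatou_bound.
Context d (T : measurableType d) (R : realType) (nu : {measure set T -> \bar R}).
Local Open Scope ereal_scope.

Let limn_einfE (u : (\bar R)^nat) : limn_einf u = ereal_sup (range (einfs u)).
Proof. by rewrite limn_einf_lim; apply/cvg_lim => //; exact: cvg_einfs_sup. Qed.

Lemma limn_einf_le (u : (\bar R)^nat) c : (forall k, u k <= c) -> limn_einf u <= c.
Proof.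
move=> h; rewrite limn_einfE; apply: ge_ereal_sup => _ [k _ <-].
by apply: le_trans (h k); apply: ereal_inf_lbound; exists k => //=.
Qed.

Lemma limn_einf_ge (u : (\bar R)^nat) c : (\forall k \near \oo, c <= u k) -> c <= limn_einf u.
Proof.
move=> [k _ hk]; rewrite limn_einfE; apply: (@le_trans _ _ (einfs u k)).
  by apply: le_ereal_inf_tmp => _ [j /= kj <-]; exact: hk.
by apply: ereal_sup_ubound; exists k.
Qed.

Lemma fatou_le (f_ : (T -> \bar R)^nat) (g : T -> \bar R) c :
  (forall k, measurable_fun setT (f_ k)) -> (forall k x, setT x -> 0 <= f_ k x) ->
  measurable_fun setT g -> (forall x, 0 <= g x) ->
  {ae nu, forall x, g x <= limn_einf (f_^~ x)} ->
  (forall k, \int[nu]_x f_ k x <= c) -> \int[nu]_x g x <= c.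
Proof.
move=> mf f0 mg g0 gf fc; have := fatou nu measurableT mf f0.
move=> h; apply: (le_trans _ (le_trans h (limn_einf_le fc))).
apply: ae_ge0_le_integral => //.
- by move=> x _; apply: limn_einf_ge; apply: nearW => k; exact: f0.
- rewrite (_ : (fun x => _) = (fun x => - limn_esup (fun k => - f_ k x))).
    apply: measurableT_comp => //; apply: measurable_fun_limn_esup => // k.
    exact: measurableT_comp.
  by apply/funext => x; rewrite -limn_einfN; congr limn_einf; apply/funext => k /=; rewrite oppeK.
- by apply: filterS gf => x h' _.
Qed.

End fatou_bound.

Section boundary_slices.
Context {R : realType} {n : nat}.
Local Notation mu := (lebesgue_rV n.+1).
Local Notation nu := (lebesgue_rV n).
Local Notation lam := (@lebesgue_measure R).
Local Notation V := 'rV[R]_n.+1.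
Local Notation Y := 'rV[R]_n.
Implicit Types (x : V) (y : Y) (A E U : set V) (b : Y -> R).

(** A field that is optimal up to [e] has its support at a positive distance from the boundary; a
    field supported in a thinner slab can be added to it, so it contributes at most [e]. *)
Lemma slab_small E p (e : R) : measurable E -> per_bound E halfspace p -> 0 < e ->
  exists2 s : R, 0 < s & per_bound E (slab s) e.
Proof.
move=> mE Ep e0; have [phi [c1 M [d d0 hd] n1] hphi] := per_approx Ep e0.
have up x : phi x != 0 -> d <= height x.
  move=> px; rewrite leNgt; apply/negP => xd.
  have := hd x px (x - height x *: elast).
  have xb : ball x d (x - height x *: elast).
    have [h0|h0] := ltP (height x) 0.
      by have := hd x px x (ballxx _ d0); rewrite /halfspace/= ltNge (ltW h0).
    apply: eball_sub_ball => //.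
    by rewrite /eball/= addrC addKr enormN enormZ enorm_elast mulr1 ger0_norm.
  by move=> /(_ xb); rewrite /halfspace/= -scaleNr height_elast subrr ltxx.
exists (d / 2) => [|psi tpsi]; first by rewrite divr_gt0.
have tphi : tfield (upper (d / 2)) phi.
  split=> //; exists (d / 2); first by rewrite divr_gt0.
  move=> x px z /ball_rVP[_ /(_ ord_max)]; have := up x px; rewrite /upper /height/= ltr_distl.
  by move=> ? /andP[? ?]; lra.
have : pairing E phi + pairing E psi <= per E halfspace.
  apply: (per_bound_split mE _ _ _ (per_ub Ep) tphi tpsi).
  - by move=> x; rewrite /upper /halfspace/= => h; apply: lt_trans h; rewrite divr_gt0.
  - by move=> x /andP[].
  - rewrite -subset0 => x [/= h /andP[_ h']].
    by move: (lt_trans h h'); rewrite ltxx.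
by rewrite ltrBlDr in hphi; move=> /le_lt_trans/(_ hphi); rewrite ltrD2l => /ltW.
Qed.

Section slab.
Variables (E : set V) (s p : R).
Hypotheses (mE : measurable E) (fE : (mu E < +oo)%E) (Ep : per_bound E (slab s) p).

Lemma vertical_translation (g : V -> R) (h : R) : 0 <= h -> measurable_fun setT g ->
  (forall x, `|g x| <= 1) -> (forall x, g x != 0 -> 0 < height x /\ height x + h < s) ->
  \int[mu]_x (g x * (\1_E (x + h *: elast) - \1_E x)) <= h * p.
Proof.
move=> h0 mg g1 gs; have -> : h * p = enorm (h *: elast : V) * p.
  by rewrite enormZ enorm_elast mulr1 ger0_norm.
apply: (@perimeter_translation_open _ _ E (slab s) p g (h *: elast)) => // [|x gx t /andP[t0 t1]].
  exact: slab_open.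
have [x0 xs] := gs x gx; rewrite scalerA /slab/= height_elast.
have : 0 <= t * h by rewrite mulr_ge0.
have : t * h <= h by rewrite ler_piMl.
by move=> ? ?; apply/andP; split; lra.
Qed.

Let mstrip a c : measurable (strip a c : set V) := measurable_strip a c.

Let ib b a c : measurable_fun setT b -> (forall y, `|b y| <= 1) ->
  mu.-integrable setT (EFin \o (fun x => b (horiz x) * \1_(E `&` strip a c) x)).
Proof.
move=> mb b1; apply: (@integrable_bounded_mul _ _ _ _ _ measurableT _ _ 1) => //.
  by apply: measurableT_comp => //; exact: measurable_horiz.
apply: integrable_indic_lty; first exact: measurableI.
by apply: le_lt_trans fE; apply: le_measure; rewrite ?inE//; exact: measurableI.
Qed.

(** The strip from [h] to [c + h] is the strip from 0 to [c] moved up by [h], and moving it costs at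
    most [h * p]. *)
Let depth_step b (h c : R) : measurable_fun setT b -> (forall y, `|b y| <= 1) ->
  0 < h -> 0 < c -> c + h < s ->
  \int[nu]_y (b y * depth E (c + h) y) <=
  \int[nu]_y (b y * depth E h y) + \int[nu]_y (b y * depth E c y) + h * p.
Proof.
move=> mb b1 h0 c0 chs; rewrite -!Rintegral_depth//; try lra.
pose g x := b (horiz x) * \1_(strip 0 c) x.
have gb x : `|g x| <= 1.
  by rewrite normrM -[leRHS]mulr1 ler_pM// indic_norm.
have mg : measurable_fun setT g.
  apply: measurable_funM; last exact: measurable_indic.
  by apply: measurableT_comp => //; exact: measurable_horiz.
have gs x : g x != 0 -> 0 < height x /\ height x + h < s.
  rewrite /g indicE; case: (boolP (x \in strip 0 c)) => [/set_mem/andP[? ?] _|_].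
    by split => //; lra.
  by rewrite mulr0 eqxx.
have := vertical_translation (ltW h0) mg gb gs.
have -> : (fun x => g x * (\1_E (x + h *: elast) - \1_E x)) = (fun x =>
   b (horiz (x + h *: elast)) * \1_(E `&` strip h (c + h)) (x + h *: elast)
   - b (horiz x) * \1_(E `&` strip 0 c) x).
  apply/funext => x; rewrite horiz_elast /g -!mulrA -mulrBr; congr (_ * _).
  rewrite !indicE !in_setI.
  have -> : (x + h *: elast \in strip h (c + h)) = (x \in strip 0 c).
    by apply/idP/idP; rewrite !inE /strip/= height_elast => /andP[? ?]; apply/andP; split; lra.
  by case: (x \in strip 0 c); rewrite ?andbF ?andbT ?mul0r ?mul1r ?subrr.
have ish := integrable_shift (h *: elast) (ib h (c + h) mb b1).
rewrite RintegralB//; last exact: ib.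
have -> : \int[mu]_x (b (horiz (x + h *: elast)) * \1_(E `&` strip h (c + h)) (x + h *: elast)) =
  \int[mu]_x (b (horiz x) * \1_(E `&` strip h (c + h)) x).
  congr fine; apply: (integral_shift (h *: elast) (f := fun x => (b (horiz x) * \1_(E `&` strip h (c + h)) x)%:E)).
  by have /integrableP[] := ib h (c + h) mb b1.
have -> : (fun x => b (horiz x) * \1_(E `&` strip 0 (c + h)) x) = (fun x =>
  b (horiz x) * \1_(E `&` strip 0 h) x + b (horiz x) * \1_(E `&` strip h (c + h)) x).
  apply/funext => x; rewrite -mulrDr; congr (_ * _); rewrite !indicE !in_setI.
  case: (x \in E) => /=; last by rewrite addr0.
  have sE (a d : R) : (x \in strip a d) = (a < height x <= d).
    by apply/idP/idP; rewrite inE.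
  rewrite -natrD !sE; congr (_%:R); have [xh|xh] := leP (height x) h.
    by rewrite (le_trans xh) ?addn0// lerDr ltW.
  by rewrite (lt_trans h0 xh).
rewrite RintegralD//; try exact: ib.
by move=> ?; lra.
Qed.

Let depth_windows b (h : R) k : measurable_fun setT b -> (forall y, `|b y| <= 1) ->
  0 < h -> k.+1%:R * h < s ->
  \int[nu]_y (b y * depth E (k.+1%:R * h) y) <=
  k.+1%:R * \int[nu]_y (b y * depth E h y) + k%:R * h * p.
Proof.
move=> mb b1 h0; elim: k => [|k IH] ks.
  by rewrite !mul1r !mul0r addr0.
have e : k.+2%:R * h = k.+1%:R * h + h by rewrite -natr1 mulrDl mul1r.
have hk : k.+1%:R * h < s by rewrite e in ks; lra.
have {IH} := IH hk; rewrite e in ks *.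
have := depth_step mb b1 h0 (mulr_gt0 (ltr0Sn _ k) h0) ks.
move: (\int[nu]_y (b y * depth E (k.+1%:R * h + h) y)) => a2.
move: (\int[nu]_y (b y * depth E (k.+1%:R * h) y)) => a1.
move: (\int[nu]_y (b y * depth E h y)) => a0.
rewrite -[k.+2]addn1 -[k.+1]addn1 !natrD; move: (k%:R) => K.
by move=> h1 h2; have : (K + 1) * h * p = K * h * p + h * p; [lra|move=> ->; lra].
Qed.

(** The weight in [depth_windows] is chosen as the sign of the integrand, which turns a signed
    estimate into one for the absolute value. *)
Lemma depth_scaling (h : R) k : 0 < h -> k.+1%:R * h < s ->
  \int[nu]_y `|depth E (k.+1%:R * h) y - k.+1%:R * depth E h y| <= k%:R * h * p.
Proof.
move=> h0 ks; pose d y := depth E (k.+1%:R * h) y - k.+1%:R * depth E h y.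
have kh0 : 0 <= k.+1%:R * h by rewrite mulr_ge0// ltW.
have md : measurable_fun setT d.
  apply: measurable_funB; first exact: measurable_depth.
  by apply: measurable_funM => //; exact: measurable_depth.
pose b y : R := 2 * \1_[set y | 0 <= d y] y - 1.
have mb : measurable_fun setT b.
  apply: measurable_funB => //; apply: measurable_funM => //.
  by apply: measurable_indic; apply: measurable_le_set.
have bE y : b y = if 0 <= d y then 1 else -1.
  rewrite /b indicE; have -> : (y \in [set y | 0 <= d y]) = (0 <= d y).
    by apply/idP/idP; rewrite inE.
  by case: ifP => _; rewrite /=; lra.
have b1 y : `|b y| <= 1 by rewrite bE; case: ifP; rewrite ?normrN normr1.
have i1 := integrable_depth mE fE kh0.
have i2 := integrable_depth mE fE (ltW h0).
have ib1 : nu.-integrable setT (EFin \o (fun y => b y * depth E (k.+1%:R * h) y)).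
  exact: (@integrable_bounded_mul _ _ _ _ _ measurableT _ _ 1).
have ib2 : nu.-integrable setT (EFin \o (fun y => b y * depth E h y)).
  exact: (@integrable_bounded_mul _ _ _ _ _ measurableT _ _ 1).
rewrite (_ : (fun y => _) = (fun y => b y * depth E (k.+1%:R * h) y - k.+1%:R * (b y * depth E h y))).
  rewrite RintegralB//; last exact: integrable_EFinZ.
  rewrite RintegralZl//.
  have := depth_windows mb b1 h0 ks.
  by move=> ?; lra.
apply/funext => y; rewrite mulrCA -mulrBr -/(d y) bE.
case: ifP => [d0|/negbT]; first by rewrite mul1r ger0_norm.
by rewrite -ltNge mulN1r => /ltr0_norm.
Qed.

(** A slice that is neither null nor full jumps, at every small step [h], on a set of length at
    least [h / 2] by [nonconstant_jumps]. The total volume of jumps is at most [h * p] by the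
    translation estimate; division by [h] and Fatou's lemma give the factor 2. *)
Lemma nonconstant_slices : 0 < s ->
  (nu [set y | 0 < lam (slice (E `&` slab s) y) /\ lam (slice (E `&` slab s) y) < s%:E] <= (2 * p)%:E)%E.
Proof.
move=> s0; set N := [set y | _].
have mslab : measurable (slab s : set V) by apply: open_measurable_rV; exact: slab_open.
have mEs : measurable (E `&` slab s) by exact: measurableI.
have mf : measurable_fun setT (fun y => lam (slice (E `&` slab s) y)) by exact: measurable_lebesgue_slice.
have mN : measurable N.
  rewrite (_ : N = [set y | (0 < lam (slice (E `&` slab s) y))%E] `&`
      [set y | (lam (slice (E `&` slab s) y) < s%:E)%E])//.
  apply: measurableI; rewrite -[X in measurable X]setTI.
  - exact: emeasurable_fun_o_infty.
  - exact: emeasurable_fun_infty_o.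
pose h (k : nat) : R := k.+1%:R^-1.
have h0 k : 0 < h k by rewrite invr_gt0.
pose Sh k : set V := [set x | E (x + h k *: elast)].
pose W k : set V := [set x | h k <= height x /\ height x < s - 2 * h k] `&`
  ((E `\` Sh k) `|` (Sh k `\` E)).
have mS k : measurable (Sh k).
  by apply: measurable_preimage mE; exact: measurable_shift.
have mW k : measurable (W k).
  apply: measurableI; last by apply: measurableU; exact: measurableD.
  rewrite (_ : [set x | _] = [set x | h k <= height x] `&` [set x | height x < s - 2 * h k])//.
  by apply: measurableI; [apply: measurable_le_set|apply: measurable_lt_set] => //; exact: measurable_height.
have Wle k : (mu (W k) <= (h k * p)%:E)%E.
  (* The second factor is the sign of the jump, so that the integrand of the translation estimate
     becomes the indicator of [W k]. *)
  pose g x : R := \1_(W k) x * (1 - 2 * \1_E x).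
  have gb x : `|g x| <= 1.
    rewrite normrM -[leRHS]mulr1 ler_pM ?indic_norm//.
    by rewrite indicE; case: (_ \in _) => /=; rewrite ler_norml; apply/andP; split; lra.
  have mg : measurable_fun setT g.
    apply: measurable_funM => //; apply: measurable_funB => //; exact: measurable_funM.
  have gs x : g x != 0 -> 0 < height x /\ height x + h k < s.
    rewrite /g indicE; case: (boolP (x \in W k)) => [/set_mem[[h1 h2] _] _|_].
      by have := h0 k; split; lra.
    by rewrite mul0r eqxx.
  have := vertical_translation (ltW (h0 k)) mg gb gs.
  have -> : (fun x => g x * (\1_E (x + h k *: elast) - \1_E x)) = \1_(W k).
    apply/funext => x; rewrite /g; have [/set_mem Wx|nW] := boolP (x \in W k).
      case: (Wx) => _ [[Ex nEx]|[Ex nEx]]; rewrite !indicE (mem_set Wx).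
        by rewrite (mem_set Ex) (memNset (nEx : ~ E (x + _)))/=; lra.
      by rewrite (mem_set (Ex : E (x + _))) (memNset nEx)/=; lra.
    by rewrite !indicE (negbTE nW) !mul0r.
  have fW : (mu (W k) < +oo)%E.
    have fS : (mu (E `|` Sh k) < +oo)%E.
      apply: (@le_lt_trans _ _ (mu E + mu (Sh k))%E).
        exact: measureU2.
      by rewrite (lebesgue_rV_shift (h k *: elast) mE) lte_add_pinfty.
    apply: le_lt_trans fS; apply: le_measure; rewrite ?inE//; first exact: measurableU.
    by move=> x [_ [[? _]|[? _]]]; [left|right].
  rewrite Rintegral_indic// => H.
  by rewrite -[leLHS]fineK ?ge0_fin_numE// lee_fin.
pose f k y : \bar R := ((h k)^-1%:E * lam (slice (W k) y))%E.
have mfk k : measurable_fun setT (f k).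
  by apply: emeasurable_funM => //; exact: measurable_lebesgue_slice.
have f0 k y : setT y -> (0 <= f k y)%E.
  by move=> _; apply: mule_ge0 => //; rewrite lee_fin invr_ge0; exact: ltW.
have int_f k : (\int[nu]_y f k y <= p%:E)%E.
  rewrite ge0_integralZl//; [|exact: measurable_lebesgue_slice|by rewrite lee_fin invr_ge0 ltW].
  rewrite -lebesgue_slice -[p](@mulKf _ (h k)) ?gt_eqF// EFinM.
  by apply: lee_wpmul2l; rewrite ?lee_fin ?invr_ge0 ?(ltW (h0 k)).
have mN1 : measurable_fun setT (fun y => 1 / 2 * \1_N y : R) by exact: measurable_funM.
have mN2 : measurable_fun setT (fun y => (1 / 2 * \1_N y)%:E) := (measurable_EFinP _ _).2 mN1.
have : (\int[nu]_y (1 / 2 * \1_N y)%:E <= p%:E)%E.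
  apply: (fatou_le mfk f0 mN2) int_f.
    by move=> y; rewrite lee_fin mulr_ge0//; lra.
  apply: aeW => y; rewrite indicE; case: (boolP (y \in N)) => [/set_mem[N1 N2]|_]; last first.
    rewrite mulr0; apply: limn_einf_ge; apply: nearW => k; exact: f0.
  apply: limn_einf_ge.
  have mEy : measurable (slice E y) by exact: measurable_slice.
  have eS : slice (E `&` slab s) y = slice E y `&` `]0%R, s[.
    by apply/seteqP; split => t /=; rewrite /slice /slab/= heightK in_itv.
  rewrite eS in N1 N2; have [d /= d0 hd] := nonconstant_jumps mEy s0 N1 N2.
  near=> k; rewrite mulr1 /f -lee_pdivrMl ?invr_gt0// invrK -EFinM.
  have := hd (h k); rewrite /= sub0r normrN gtr0_norm// => /(_ _ (h0 k)).
  have hkd : h k < d by near: k; exact: near_infty_natSinv_lt (PosNum d0).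
  move=> /(_ hkd); rewrite mul1r => /le_trans; apply.
  apply: le_measure; rewrite ?inE; [exact: jumps_measurable|exact: measurable_slice|].
  move=> t [/andP[t1 t2] ht]; split => /=; first by rewrite heightK.
  rewrite /slice/= in ht *; have [e1|e1] := pselect (E (rcons_rV y t));
    have [e2|e2] := pselect (E (rcons_rV y (t + h k))).
  - by case: ht; apply/propext.
  - by left; split => //=; rewrite /Sh/= rcons_elast.
  - by right; split => //=; rewrite /Sh/= rcons_elast.
  - by case: ht; apply/propext; split.
under eq_integral do rewrite EFinM.
rewrite ge0_integralZl//; last exact: (measurable_EFinP _ _).2 (measurable_indic mN).
rewrite integral_indic// setIT => hN.
have : (2%:E * ((1 / 2)%:E * nu N) <= 2%:E * p%:E)%E by rewrite lee_pmul2l.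
by rewrite muleA -EFinM mul1r divff// mul1e.
Unshelve. all: by end_near. Qed.

End slab.
End boundary_slices.

Lemma integrable_cst_lty d (T : measurableType d) (R : realType)
  (nu : {measure set T -> \bar R}) (A : set T) (c : R) : measurable A ->
  (nu A < +oo)%E -> nu.-integrable A (EFin \o cst c).
Proof.
move=> mA fA; apply/integrableP; split.
  exact: (measurable_EFinP _ _).2 (measurable_cst c).
rewrite (eq_integral (cst `|c|%:E))// integral_cst//.
by rewrite lte_mul_pinfty// lee_fin.
Qed.

Section trace_set.
Context {R : realType} {n : nat}.
Local Notation mu := (lebesgue_rV n.+1).
Local Notation nu := (lebesgue_rV n).
Local Notation lam := (@lebesgue_measure R).
Local Notation V := 'rV[R]_n.+1.
Local Notation Y := 'rV[R]_n.
Implicit Types (x : V) (y : Y) (A E U X : set V) (b : Y -> R).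

Definition void_near X k : set Y := [set y | lam (slice (X `&` slab k.+1%:R^-1) y) = 0%E].

(* The base points over which [E] fills a short vertical segment, up to a null set. *)
Definition trset E : set Y := \bigcup_k void_near (~` E) k.

Lemma measurable_slab s : measurable (slab s : set V).
Proof. by apply: open_measurable_rV; exact: slab_open. Qed.

Lemma measurable_void_near X k : measurable X -> measurable (void_near X k).
Proof.
move=> mX; pose f y := lam (slice (X `&` slab k.+1%:R^-1) y).
have mf : measurable_fun setT f.
  by apply: measurable_lebesgue_slice; apply: measurableI => //; exact: measurable_slab.
have := emeasurable_fun_infty_c measurableT mf 0%E; rewrite setTI.
congr (measurable _); apply/seteqP; split => y /=; rewrite /void_near/=.
  by move=> h; apply/eqP; rewrite eq_le h/= measure_ge0.
by rewrite /f => ->.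
Qed.

Lemma measurable_trset E : measurable E -> measurable (trset E).
Proof.
move=> mE; apply: bigcupT_measurable => k; apply: measurable_void_near.
exact: measurableC.
Qed.

Lemma void_nearS X k j : measurable X -> (k <= j)%N -> void_near X k `<=` void_near X j.
Proof.
move=> mX kj y h; apply/eqP; rewrite eq_le measure_ge0 andbT -h.
apply: le_measure; rewrite ?inE; try by apply: measurable_slice; apply: measurableI => //; exact: measurable_slab.
move=> t [Xt /andP[h0 h1]]; split => //; apply/andP; split => //; apply: lt_le_trans h1 _.
by rewrite lef_pV2 ?posrE// ler_nat.
Qed.

Lemma void_depth X k y c : measurable X -> void_near X k y -> c < k.+1%:R^-1 ->
  depth X c y = 0.
Proof.
move=> mX h ck; rewrite /depth (_ : lam _ = 0%E)//.
apply/eqP; rewrite eq_le measure_ge0 andbT -h; apply: le_measure; rewrite ?inE.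
- by apply: measurable_slice; apply: measurableI => //; exact: measurable_strip.
- by apply: measurable_slice; apply: measurableI => //; exact: measurable_slab.
- move=> t [Xt /andP[h0 h1]]; split => //; apply/andP; split => //.
  exact: le_lt_trans h1 ck.
Qed.

Lemma depthC E c y : measurable E -> 0 <= c -> depth E c y + depth (~` E) c y = c.
Proof.
move=> mE c0; apply: EFin_inj; rewrite EFinD !depthK//; last exact: measurableC.
rewrite -measureU.
- transitivity (lam `]0%R, c]%classic); last first.
    by rewrite lebesgue_measure_itv/= lte_fin; case: ltgtP c0 => // [_|<-] _; rewrite ?sube0.
  congr (lam _); apply/seteqP; split => t /=.
    by move=> [[_]|[_]]; rewrite /strip/= heightK in_itv.
  rewrite in_itv/= => tc; have [Et|nEt] := pselect (E (rcons_rV y t)).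
    by left; split => //; rewrite /strip/= heightK.
  by right; split => //; rewrite /strip/= heightK.
- by apply: measurable_slice; apply: measurableI => //; exact: measurable_strip.
- by apply: measurable_slice; apply: measurableI; [exact: measurableC|exact: measurable_strip].
- by rewrite -subset0 => t [[h _] [h' _]].
Qed.

Lemma void_disjoint E k j y : measurable E -> void_near E k y -> void_near (~` E) j y -> False.
Proof.
move=> mE h1 h2; pose i := maxn k j; pose c : R := i.+1%:R^-1 / 2.
have i0 : 0 < i.+1%:R^-1 :> R by rewrite invr_gt0.
have c0 : 0 < c by rewrite divr_gt0.
have ci : c < i.+1%:R^-1 by rewrite /c ltr_pdivrMr// ltr_pMr// ltr1n.
have mC := measurableC mE.
have := depthC y mE (ltW c0).
rewrite (void_depth mE (void_nearS mE (leq_maxl k j) h1) ci).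
rewrite (void_depth mC (void_nearS mC (leq_maxr k j) h2) ci).
by move=> ?; lra.
Qed.

(** The base points whose slice in a thin slab is neither null nor full have measure at most twice
    the perimeter in that slab, which tends to 0 by [slab_small]; so the points that are bad at
    every scale form a null set. *)
Lemma void_dichotomy E p : measurable E -> (mu E < +oo)%E -> per_bound E halfspace p ->
  {ae nu, forall y, exists k, void_near E k y \/ void_near (~` E) k y}.
Proof.
move=> mE fE Ep.
pose N k : set Y := [set y | (0 < lam (slice (E `&` slab k.+1%:R^-1) y))%E /\
  (lam (slice (E `&` slab k.+1%:R^-1) y) < k.+1%:R^-1%:E)%E].
have mEs k : measurable (E `&` slab k.+1%:R^-1).
  by apply: measurableI => //; exact: measurable_slab.
have mN k : measurable (N k).
  have mf := measurable_lebesgue_slice (mEs k).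
  rewrite (_ : N k = [set y | (0 < lam (slice (E `&` slab k.+1%:R^-1) y))%E] `&`
      [set y | (lam (slice (E `&` slab k.+1%:R^-1) y) < k.+1%:R^-1%:E)%E])//.
  apply: measurableI; rewrite -[X in measurable X]setTI.
  - exact: emeasurable_fun_o_infty.
  - exact: emeasurable_fun_infty_o.
exists (\bigcap_k N k); split; first exact: bigcapT_measurable.
- apply/eqP; rewrite eq_le measure_ge0 andbT; apply/lee_addgt0Pr => e e0; rewrite add0e.
  have e20 : 0 < e / 2 by rewrite divr_gt0.
  have [s s0 hs] := slab_small mE Ep e20.
  have [k _ /(_ k (leqnn k)) /= ke] := near_infty_natSinv_lt (PosNum s0).
  have hk : per_bound E (slab k.+1%:R^-1) (e / 2).
    apply: per_boundS hs => x /andP[h0 h1]; apply/andP; split => //.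
    exact: lt_trans h1 ke.
  apply: (@le_trans _ _ (nu (N k))).
    apply: le_measure; rewrite ?inE//; first exact: bigcapT_measurable.
    by move=> y h; exact: h.
  have := nonconstant_slices mE fE hk _; rewrite mulrC divfK// => -> //.
- move=> y hy k _; apply: contrapT => nN; apply: hy; exists k.
  have mC := measurableC mE; have k0 : 0 < k.+1%:R^-1 :> R by rewrite invr_gt0.
  have [l0|l0] := eqVneq (lam (slice (E `&` slab k.+1%:R^-1) y)) 0%E; first by left.
  right; rewrite /void_near/=.
  have lk : (k.+1%:R^-1%:E <= lam (slice (E `&` slab k.+1%:R^-1) y))%E.
    by rewrite leNgt; apply/negP => h; apply: nN; split => //; rewrite lt_neqAle eq_sym l0 measure_ge0.
  have : (lam (slice (E `&` slab k.+1%:R^-1) y) + lam (slice (~` E `&` slab k.+1%:R^-1) y) = k.+1%:R^-1%:E)%E.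
    rewrite -measureU.
    + transitivity (lam `]0%R, k.+1%:R^-1[%classic); last first.
        by rewrite lebesgue_measure_itv/= lte_fin k0 sube0.
      congr (lam _); apply/seteqP; split => t /=.
        by move=> [[_]|[_]]; rewrite /slab/= heightK in_itv.
      rewrite in_itv/= => tc; have [Et|nEt] := pselect (E (rcons_rV y t)).
        by left; split => //; rewrite /slab/= heightK.
      by right; split => //; rewrite /slab/= heightK.
    + exact: measurable_slice.
    + by apply: measurable_slice; apply: measurableI => //; exact: measurable_slab.
    + by rewrite -subset0 => t [[h _] [h' _]].
  have v0 : (0 <= lam (slice (~` E `&` slab k.+1%:R^-1) y))%E by exact: measure_ge0.
  move: v0 lk.
  case: (lam (slice (E `&` _) y)) => [u| |]//; case: (lam (slice (~` E `&` _) y)) => [v| |]//.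
  rewrite !lee_fin -EFinD; move: (k.+1%:R^-1) => q v0 uk [uv]; congr (_%:E); lra.
Qed.

Lemma Rintegral_le_integral d (T : measurableType d) (nu' : {measure set T -> \bar R}) (f : T -> R) (c : R) :
  nu'.-integrable setT (EFin \o f) -> \int[nu']_x f x <= c -> (\int[nu']_x (f x)%:E <= c%:E)%E.
Proof. by move=> i h; rewrite -[leLHS]fineK ?lee_fin//; exact: integrable_fin_num. Qed.

(** In [depth_scaling] the step is taken to be [c / k.+1%:R]. For almost every [y] the scaled depth
    equals [c * \1_(trset E) y] from some [k] on, and Fatou's lemma passes to the limit. *)
Lemma depth_trset E s p c : measurable E -> (mu E < +oo)%E -> per_bound E (slab s) p ->
  {ae nu, forall y, exists k, void_near E k y \/ void_near (~` E) k y} ->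
  0 < c -> c < s ->
  (\int[nu]_y `|depth E c y - c * \1_(trset E) y|%:E <= (c * p)%:E)%E.
Proof.
move=> mE fE Ep dich c0 cs; have p0 := per_bound_ge0 Ep.
have mC := measurableC mE.
pose h k : R := c / k.+1%:R.
have h0 k : 0 < h k by rewrite divr_gt0.
have hk k : k.+1%:R * h k = c by rewrite /h mulrC divfK.
pose f k y : R := `|depth E c y - k.+1%:R * depth E (h k) y|.
have mf k : measurable_fun setT (f k).
  apply: measurableT_comp => //; apply: measurable_funB; first exact: measurable_depth.
  by apply: measurable_funM => //; exact: measurable_depth.
have mg : measurable_fun setT (fun y => `|depth E c y - c * \1_(trset E) y|).
  apply: measurableT_comp => //; apply: measurable_funB; first exact: measurable_depth.
  by apply: measurable_funM => //; apply: measurable_indic; exact: measurable_trset.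
apply: (@fatou_le _ _ _ nu (fun k y => (f k y)%:E)).
- by move=> k; exact: (measurable_EFinP _ _).2 (mf k).
- by move=> k y _; rewrite lee_fin normr_ge0.
- exact: (measurable_EFinP _ _).2 mg.
- by move=> y; rewrite lee_fin.
- apply: filterS dich => y [j hj]; apply: limn_einf_ge.
  near=> k.
  have hkj : h k < j.+1%:R^-1.
    have : k.+1%:R^-1 < j.+1%:R^-1 / c.
      by near: k; apply: (near_infty_natSinv_lt (PosNum (divr_gt0 _ c0))); rewrite invr_gt0.
    by rewrite /h ltr_pdivlMr// mulrC.
  rewrite lee_fin /f; suff -> : c * \1_(trset E) y = k.+1%:R * depth E (h k) y by [].
  case: hj => hj.
    rewrite (void_depth mE hj hkj) mulr0 indicE memNset ?mulr0// => -[i _ hi].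
    exact: void_disjoint mE hj hi.
  have := depthC y mE (ltW (h0 k)); rewrite (void_depth mC hj hkj) addr0 => ->.
  by rewrite hk indicE mem_set ?mulr1//; exists j.
- move=> k; apply: Rintegral_le_integral.
    apply: integrable_norm => //; apply: integrable_EFinB => //; first exact: (integrable_depth mE fE (ltW c0)).
    by apply: integrable_EFinZ => //; exact: (integrable_depth mE fE (ltW (h0 k))).
  have := depth_scaling mE fE Ep (h0 k); move=> /(_ k); rewrite hk => /(_ cs) H.
  apply: (le_trans H); rewrite ler_wpM2r// /h mulrCA ler_piMr ?(ltW c0)//.
  by rewrite ler_pdivrMr// mul1r ler_nat.
Unshelve. all: by end_near. Qed.

Lemma integrable_trset E p : measurable E -> (mu E < +oo)%E -> per_bound E halfspace p ->
  (nu (trset E) < +oo)%E.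
Proof.
move=> mE fE Ep; have dich := void_dichotomy mE fE Ep.
have Ep2 : per_bound E (slab 2) p by apply: per_boundS Ep => x /andP[].
have := depth_trset mE fE Ep2 dich ltr01 ltac:(lra).
have i1 := integrable_depth mE fE ler01.
have mT := measurable_trset mE.
have md : measurable_fun setT (depth E 1) by exact: measurable_depth.
move=> H; rewrite -[X in nu X]setIT -integral_indic//.
apply: (@le_lt_trans _ _ (\int[nu]_y ((depth E 1 y)%:E + `|depth E 1 y - 1 * \1_(trset E) y|%:E))%E).
  apply: ge0_le_integral => //.
  - by apply: (measurable_EFinP _ _).2; exact: measurable_indic.
  - apply: emeasurable_funD; apply: (measurable_EFinP _ _).2 => //.
    apply: measurableT_comp => //; apply: measurable_funB => //.
    by apply: measurable_funM => //; exact: measurable_indic.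
  - move=> y _; rewrite -EFinD lee_fin mul1r -lerBlDl distrC ler_normr.
    by apply/orP; left.
rewrite ge0_integralD//.
- rewrite lte_add_pinfty//; last exact: le_lt_trans H (ltry _).
  have /integrableP[_] := i1; apply: le_lt_trans; apply: ge0_le_integral => //.
  + by move=> y _; rewrite lee_fin fine_ge0.
  + exact: (measurable_EFinP _ _).2 md.
  + by apply: measurableT_comp => //; exact: (measurable_EFinP _ _).2 md.
  + by move=> y _; rewrite lee_fin ler_norm.
- by move=> y _; rewrite lee_fin fine_ge0.
- exact: (measurable_EFinP _ _).2 md.
- apply: (measurable_EFinP _ _).2; apply: measurableT_comp => //; apply: measurable_funB => //.
  by apply: measurable_funM => //; exact: measurable_indic.
Qed.

Let hball y r : set V := halfspace `&` eball (rcons_rV y 0) r.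

Let mHB y r : measurable (hball y r).
Proof. by apply: measurableI; [exact: measurable_upper|exact: measurable_eball]. Qed.

Let HB_sub y r x : 0 < r -> hball y r x -> 0 < height x < r /\ ball y r (horiz x).
Proof.
move=> r0 [x0 /(eball_sub_ball r0) /ball_rVP[_ h]]; split.
  rewrite x0/=; have := h ord_max; rewrite -/(height _) heightK sub0r normrN.
  exact: le_lt_trans (ler_norm _).
apply/ball_rVP; split => // j; have := h (lift ord_max j).
by rewrite !mxE liftK.
Qed.

Let HB_ge y r : 0 < r -> (((r / n.+2%:R) ^+ n.+1)%:E <= mu (hball y r))%E.
Proof.
move=> r0; pose q := r / n.+2%:R / 2.
have q0 : 0 < q by rewrite !divr_gt0.
have -> : r / n.+2%:R = q *+ 2 by rewrite /q mulr2n -splitr.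
rewrite -(lebesgue_rV_ball (rcons_rV y q) q0); apply: le_measure; rewrite ?inE.
- exact: measurable_ball_rV.
- exact: mHB.
- move=> x /ball_rVP[_ h]; have hq : `|q - height x| < q by have := h ord_max; rewrite -/(height _) heightK.
  split; first by move: hq; rewrite ltr_distlC /halfspace/= => /andP[? ?]; lra.
  have -> : r = n.+2%:R * (q * 2) by rewrite /q divfK// mulrC divfK.
  apply: ball_sub_eball; first by rewrite mulr_gt0.
  apply/ball_rVP; split => [|j]; first by rewrite mulr_gt0.
  have [j' ->|->] := unliftP ord_max j.
    have := h (lift ord_max j'); rewrite !mxE liftK/= => hh; apply: lt_trans hh _.
    by lra.
  rewrite -!/(height _) heightK sub0r normrN.
  by move: hq; rewrite ltr_distlC => /andP[? ?]; rewrite ltr_norml; apply/andP; split; lra.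
Qed.

Let HB_lt y r : 0 < r -> (mu (hball y r) < +oo)%E.
Proof.
move=> r0; have /andP[_ h] := lebesgue_eball_bounds (rcons_rV y 0) r0.
apply: (le_lt_trans _ (le_lt_trans h (ltry _))).
by apply: le_measure; rewrite ?inE; [exact: mHB|exact: measurable_eball|exact: subIsetr].
Qed.

(** Above [void_near X k] a half-ball of radius below [k.+1%:R^-1] meets [X] in a null set. The
    other base points have density 0 at [y], and the height is at most [r], so the volume is small
    compared with r^(n+1). *)
Let halfball_average X k y : measurable X -> density0 (~` void_near X k) y ->
  r ^- n.+1 * fine (mu (hball y r `&` X)) @[r --> 0^'+] --> (0 : R).
Proof.
move=> mX dX; apply/cvgrPdist_le => e e0.
have e2 : 0 < e / 2 ^+ n by rewrite divr_gt0// exprn_gt0.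
have [r0 r00 hr0] := dX _ e2.
have k0 : 0 < k.+1%:R^-1 :> R by rewrite invr_gt0.
near=> r.
have rp : 0 < r by near: r; exact: nbhs_right_gt.
have rr0 : r < r0 by near: r; exact: nbhs_right_lt.
have rk : r < k.+1%:R^-1 by near: r; exact: nbhs_right_lt.
have mZ : measurable (~` void_near X k) by apply: measurableC; exact: measurable_void_near.
have mHX : measurable (hball y r `&` X) by exact: measurableI.
have le1 : (mu (hball y r `&` X) <= r%:E * nu (~` void_near X k `&` ball y r))%E.
  rewrite lebesgue_slice -[X in nu X]setIT -integral_indic//; last first.
    by apply: measurableI => //; exact: measurable_ball_rV.
  rewrite -ge0_integralZl//; [|by apply: (measurable_EFinP _ _).2; apply: measurable_indic;
     apply: measurableI => //; exact: measurable_ball_rV|by rewrite lee_fin ltW].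
  apply: ge0_le_integral => //.
  - exact: measurable_lebesgue_slice.
  - apply: emeasurable_funM => //; apply: (measurable_EFinP _ _).2; apply: measurable_indic.
    by apply: measurableI => //; exact: measurable_ball_rV.
  - move=> z _; have [Zz|nZz] := boolP (z \in ~` void_near X k `&` ball y r).
      rewrite indicE Zz mule1; apply: le_trans (slice_strip_le z mX (ltW rp)).
      apply: le_measure; rewrite ?inE.
      + exact: measurable_slice.
      + by apply: measurable_slice; apply: measurableI => //; exact: measurable_strip.
      + move=> t [/(HB_sub rp)[/andP[h1 h2] _] Xt]; split => //.
        by apply/andP; split => //; exact: ltW.
    rewrite indicE (negbTE nZz) mule0.
    have [bz|nbz] := pselect (ball y r z).
      have vz : void_near X k z.
        by apply: contrapT => nv; move/negP : nZz; apply; rewrite inE.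
      rewrite -[leRHS]vz; apply: le_measure; rewrite ?inE.
      + exact: measurable_slice.
      + by apply: measurable_slice; apply: measurableI => //; exact: measurable_slab.
      + move=> t [/(HB_sub rp)[/andP[h1 h2] _] Xt]; split => //.
        by apply/andP; split => //; exact: lt_trans h2 rk.
    rewrite (_ : slice _ _ = set0) ?measure0// -subset0 => t [/(HB_sub rp)[_ +] _].
    by rewrite horizK.
have le2 : (mu (hball y r `&` X) <= (e * r ^+ n.+1)%:E)%E.
  apply: (le_trans le1); apply: (@le_trans _ _ (r%:E * (e / 2 ^+ n * (r *+ 2) ^+ n)%:E)%E).
    by apply: lee_wpmul2l; [rewrite lee_fin ltW|apply: hr0; rewrite rp].
  have e1 : (r *+ 2) ^+ n = 2 ^+ n * r ^+ n by rewrite -exprMn mulr_natl.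
  by rewrite -EFinM lee_fin e1 exprS (mulrA (e / _)) divfK ?expf_neq0// mulrCA.
have f1 : fine (mu (hball y r `&` X)) <= e * r ^+ n.+1.
  rewrite -lee_fin fineK// ge0_fin_numE//; exact: le_lt_trans le2 (ltry _).
rewrite sub0r normrN ger0_norm; last by rewrite mulr_ge0// ?invr_ge0 ?exprn_ge0 ?fine_ge0// ltW.
by rewrite mulrC ler_pdivrMr// exprn_gt0.
Unshelve. all: by end_near. Qed.

(** [b] tells whether the complement of [E] or [E] itself is void near [y]. Since [trace] is defined
    by [get], uniqueness of the limit is needed as well: a second limit [l] would force the distance
    from [l] to [b%:R], times the volume of a half-ball of order r^(n+1), to be small compared with
    r^(n+1). *)
Lemma trace_indicE E y (b : bool) k : measurable E ->
  density0 (~` void_near (if b then ~` E else E) k) y -> trace (\1_E) y = b%:R.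
Proof.
move=> mE dE; set X := if b then _ else _ in dE.
have mX : measurable X by rewrite /X; case: (b) => //; exact: measurableC.
pose S : set R := [set l : R | (fun r => r ^- n.+1 *
       \int[mu]_(x in hball y r) `|\1_E x - l|) @ 0^'+ --> (0 : R)].
have iHB l r : 0 < r -> mu.-integrable (hball y r) (EFin \o (fun x => `|\1_E x - l|)).
  move=> r0; apply: (@le_integrable _ _ _ mu _ (mHB y r) _ (EFin \o cst (1 + `|l|))).
  - apply: (measurable_EFinP _ _).2; apply: measurableT_comp => //.
    by apply: measurable_funB => //; exact: measurable_indic.
  - move=> x _; rewrite /= lee_fin normr_id [leRHS]ger0_norm ?addr_ge0//.
    by rewrite (le_trans (ler_normB _ _))// lerD2r indic_norm.
  - by apply: integrable_cst_lty => //; exact: HB_lt.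
have Sb : S b%:R.
  have := halfball_average mX dE.
  apply: cvg_trans; apply: near_eq_cvg; near=> r.
  congr (_ * _).
  rewrite (_ : (fun x => `|\1_E x - b%:R|) = (\1_X : V -> R)); last first.
    apply/funext => x; rewrite /X !indicE; case: (b) => /=.
      rewrite in_setC; case: (x \in E); rewrite /= ?subrr ?normr0// sub0r normrN normr1//.
    by rewrite subr0; case: (x \in E); rewrite ?normr0 ?normr1.
  by rewrite /Rintegral integral_indic// setIC.
have uniq l : S l -> l = b%:R.
  move=> Sl; apply: contrapT => /eqP lb.
  have d0 : 0 < `|l - b%:R| by rewrite normr_gt0 subr_eq0.
  pose c : R := n.+2%:R^-1 ^+ n.+1.
  have c0 : 0 < c by rewrite exprn_gt0// invr_gt0.
  pose F l r := r ^- n.+1 * \int[mu]_(x in hball y r) `|\1_E x - l|.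
  have SS : F l r + F b%:R r @[r --> 0^'+] --> (0 : R).
    by rewrite -[X in _ --> X](addr0 0); exact: cvgD Sl Sb.
  move/cvgrPdist_lt : SS => HS.
  have [r0 /= r00 hr0] := HS _ (mulr_gt0 d0 c0).
  pose r := r0 / 2; have rp : 0 < r by rewrite divr_gt0.
  have := hr0 r; rewrite /= sub0r normrN gtr0_norm// => /(_ _ rp).
  have rr0 : r < r0 by rewrite /r; lra.
  move=> /(_ rr0); apply/negP; rewrite -leNgt sub0r normrN.
  rewrite /F -mulrDr.
  set I := (\int[mu]_(x in hball y r) `|\1_E x - l| + \int[mu]_(x in hball y r) `|\1_E x - b%:R|).
  have hI : `|l - b%:R| * (r / n.+2%:R) ^+ n.+1 <= I.
    rewrite /I -RintegralD; [|by []|exact: iHB|exact: iHB].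
    apply: (@le_trans _ _ (\int[mu]_(x in hball y r) cst `|l - b%:R| x)).
      rewrite Rintegral_cst// ler_wpM2l// -lee_fin fineK ?HB_ge//.
      by rewrite ge0_fin_numE// HB_lt.
    apply: le_Rintegral => //.
    - by apply: integrable_cst_lty => //; exact: HB_lt.
    - by apply: integrable_EFinD => //; exact: iHB.
    - move=> x _ /=; rewrite (_ : l - b%:R = - ((\1_E x - l) - (\1_E x - b%:R))); last by lra.
      by rewrite normrN ler_normB.
  have I0 : 0 <= I by apply: le_trans hI; rewrite mulr_ge0// exprn_ge0// divr_ge0// ltW.
  rewrite [leRHS]ger0_norm; last by rewrite mulr_ge0// invr_ge0 exprn_ge0// ltW.
  rewrite [leRHS]mulrC ler_pdivlMr ?exprn_gt0//; apply: le_trans hI.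
  by rewrite -mulrA ler_wpM2l// /c -exprMn [_ * r]mulrC.
by rewrite /trace; apply: uniq; apply: (@getPex _ S); exists b%:R.
Unshelve. all: by end_near. Qed.

(** Almost every [y] lies in some set [void_near] of [E] or of its complement, and is a density
    point of it. *)
Lemma trace_trset E p : measurable E -> (mu E < +oo)%E -> per_bound E halfspace p ->
  {ae nu, forall y, trace (\1_E) y = \1_(trset E) y}.
Proof.
move=> mE fE Ep; have mC := measurableC mE.
have dens (X : set V) : measurable X -> {ae nu, forall y, forall k, void_near X k y -> density0 (~` void_near X k) y}.
  move=> mX; have := @negligible_bigcup _ _ _ nu _ (fun k => density_theorem (measurable_void_near k mX)).
  apply: negligibleS => y /= /existsNP[k /not_implyP[h1 h2]]; exists k => //.
  by move=> [h3 _]; apply: h2; exact: h3.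
apply: filterS3 (void_dichotomy mE fE Ep) (dens _ mE) (dens _ mC) => y [k [hk|hk]] d1 d2.
- rewrite (@trace_indicE E y false k mE (d1 _ hk)) indicE memNset// => -[j _ hj].
  exact: void_disjoint mE hk hj.
- by rewrite (@trace_indicE E y true k mE (d2 _ hk)) indicE mem_set//; exists k.
Qed.

End trace_set.

Section integral_negligible.
Context d (T : measurableType d) (R : realType) (nu : {measure set T -> \bar R}).
Local Open Scope ereal_scope.
Import HBNNSimple.

(** A simple function below [f], set to 0 on [N], keeps its integral and lies below [g]. The result
    is applied to [trace], whose measurability is not established. *)
Let ge0_integral_le (f g : T -> \bar R) (N : set T) : measurable N -> nu N = 0 ->
  (forall x, 0 <= f x) -> (forall x, 0 <= g x) -> (forall x, ~ N x -> f x = g x) ->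
  \int[nu]_x f x <= \int[nu]_x g x.
Proof.
move=> mN N0 f0 g0 fg; rewrite !ge0_integralTE//.
apply: ge_ereal_sup => _ [h /= hf <-].
have mNC := measurableC mN.
pose h' := mul_nnsfun h (indic_nnsfun R mNC).
have <- : sintegral nu h' = sintegral nu h.
  have nE (k : {nnsfun T >-> R}) : sintegral nu k = \int[nu]_x (k x)%:E.
    by rewrite integral_nnsfun// patch_setT.
  rewrite !nE; apply: ae_eq_integral => //.
  - exact/measurable_EFinP.
  - exact/measurable_EFinP.
  - exists N; split => // x /= nh; apply: contrapT => nN; apply: nh => _.
    by rewrite /= mindicE mem_set// mulr1.
apply: ereal_sup_ubound; exists h' => //= x; rewrite mindicE.
have [Nx|nNx] := pselect (N x).
  by rewrite memNset ?mulr0//; exact.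
by rewrite mem_set// mulr1 -fg.
Qed.

(* The library's analogue assumes both functions measurable; here [f] need not be. *)
Lemma ae_eq_integral_l (f g : T -> \bar R) :
  {ae nu, forall x, f x = g x} -> \int[nu]_x f x = \int[nu]_x g x.
Proof.
move=> [N [mN N0 hN]]; rewrite integralE [RHS]integralE.
have fg x : ~ N x -> f x = g x.
  by move=> nN; apply: contrapT => h; apply: nN; exact: hN.
by congr (_ - _); apply/eqP; rewrite eq_le; apply/andP; split;
  apply: (ge0_integral_le mN N0) => // x nN; rewrite ?funeposE ?funenegE (fg x nN).
Qed.

End integral_negligible.

(** * The capillary energy and its approximation away from the boundary *)

Section capillary_core.
Context {R : realType} {n : nat}.
Local Notation mu := (lebesgue_rV n.+1).
Local Notation nu := (lebesgue_rV n).
Local Notation V := 'rV[R]_n.+1.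
Local Notation Y := 'rV[R]_n.
Implicit Types (x : V) (y : Y) (A E F U : set V).

Definition good E := [/\ measurable E, (mu E < +oo)%E & exists p, per_bound E halfspace p].

Lemma good_per E : good E -> per_bound E halfspace (per E halfspace).
Proof. by move=> [_ _ [p Ep]]; exact: per_ub Ep. Qed.

Lemma good_perU E U : good E -> U `<=` halfspace -> per_bound E U (per E U).
Proof. by move=> gE UH; apply: per_ub; apply: per_boundS UH (good_per gE). Qed.

Lemma upper_halfspace (s : R) : 0 <= s -> upper s `<=` (halfspace : set V).
Proof. by move=> s0 x; rewrite /upper /halfspace/=; exact: le_lt_trans. Qed.

Lemma slab_halfspace (s : R) : slab s `<=` (halfspace : set V).
Proof. by move=> x /andP[]. Qed.

Lemma per_superadditive E U U1 U2 : measurable E -> U1 `<=` U -> U2 `<=` U ->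
  U1 `&` U2 = set0 -> (exists p, per_bound E U p) -> per E U1 + per E U2 <= per E U.
Proof.
move=> mE U1U U2U U12 [p Ep]; apply/ler_addgt0Pr => e e0.
have e2 : 0 < e / 2 by rewrite divr_gt0.
have [phi tphi hphi] := per_approx (per_boundS U1U Ep) e2.
have [psi tpsi hpsi] := per_approx (per_boundS U2U Ep) e2.
have := per_bound_split mE U1U U2U U12 (per_ub Ep) tphi tpsi.
move: (pairing E phi) (pairing E psi) (per E U) (per E U1) (per E U2) hphi hpsi => a1 a2 a3 a4 a5 ? ? ?.
lra.
Qed.

Lemma tfield_lift U phi : U `<=` halfspace -> tfield U phi ->
  exists2 d : R, 0 < d & forall s, s < d -> tfield (upper s) (phi : V -> V).
Proof.
move=> UH [c1 M [d d0 hd] n1].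
have up x : phi x != 0 -> d <= height x.
  move=> px; rewrite leNgt; apply/negP => xd.
  have xb : ball x d (x - height x *: elast).
    have [h0|h0] := ltP (height x) 0.
      by have := UH _ (hd x px x (ballxx _ d0)); rewrite /halfspace/= ltNge (ltW h0).
    apply: eball_sub_ball => //.
    by rewrite /eball/= addrC addKr enormN enormZ enorm_elast mulr1 ger0_norm.
  by have := UH _ (hd x px _ xb); rewrite /halfspace/= -scaleNr height_elast subrr ltxx.
exists d => // s sd; split=> //; exists (d - s); first by rewrite subr_gt0.
move=> x px z /ball_rVP[_ /(_ ord_max)]; have := up x px; rewrite /upper /height/= ltr_distl.
by move=> ? /andP[? ?]; lra.
Qed.

Lemma per_submodular E F U p q : measurable E -> measurable F -> (mu F < +oo)%E ->
  per_bound E U p -> per_bound F U q ->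
  [/\ per_bound (E `&` F) U (p + q), per_bound (E `|` F) U (p + q) &
   per (E `&` F) U + per (E `|` F) U <= per E U + per F U].
Proof.
move=> mE mF fF Ep Fq.
have h1 : per_bound (E `&` F) U (p + q).
  move=> phi tphi; have := perimeter_submodular mE mF fF Ep Fq tphi (@tfield0 _ _ U).
  by rewrite pairing0 addr0.
have h2 : per_bound (E `|` F) U (p + q).
  move=> phi tphi; have := perimeter_submodular mE mF fF Ep Fq (@tfield0 _ _ U) tphi.
  by rewrite pairing0 add0r.
split=> //; apply/ler_addgt0Pr => e e0; have e2 : 0 < e / 2 by rewrite divr_gt0.
have [phi tphi hphi] := per_approx h1 e2; have [psi tpsi hpsi] := per_approx h2 e2.
have := perimeter_submodular mE mF fF (per_ub Ep) (per_ub Fq) tphi tpsi.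
move: hphi hpsi; move: (pairing _ phi) (pairing _ psi) (per (_ `&` _) U) (per (_ `|` _) U).
move=> a b c d ? ? ?; lra.
Qed.

Lemma good_setI E F : good E -> good F -> good (E `&` F).
Proof.
move=> [mE fE [p Ep]] [mF fF [q Fq]]; split; first exact: measurableI.
  by apply: le_lt_trans fE; apply: le_measure; rewrite ?inE//; exact: measurableI.
by exists (p + q); have [] := per_submodular mE mF fF Ep Fq.
Qed.

Lemma good_setU E F : good E -> good F -> good (E `|` F).
Proof.
move=> [mE fE [p Ep]] [mF fF [q Fq]]; split; first exact: measurableU.
  by apply: (le_lt_trans (measureU2 _ mE mF)); rewrite lte_add_pinfty.
by exists (p + q); have [] := per_submodular mE mF fF Ep Fq.
Qed.

(** [depth_trset] on a tall slab: the integral of the depth is at most the volume of [E], which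
    dividing by a large [c] makes smaller than [e], and the perimeter is left. *)
Lemma nu_trset E : good E -> fine (nu (trset E)) <= per E halfspace.
Proof.
move=> gE; have [mE fE [p Ep]] := gE; have dich := void_dichotomy mE fE Ep.
have fT := integrable_trset mE fE Ep; have mT := measurable_trset mE.
apply/ler_addgt0Pr => e e0.
have vE0 : 0 <= fine (mu E) by rewrite fine_ge0.
pose c := (fine (mu E) + 1) / e.
have c0 : 0 < c by rewrite divr_gt0// ltr_pwDr.
have bc : per_bound E (slab (c + 1)) (per E halfspace).
  by apply: per_boundS (good_per gE); exact: slab_halfspace.
have := depth_trset mE fE bc dich c0 ltac:(lra).
have i1 := integrable_depth mE fE (ltW c0).
have i2 : nu.-integrable setT (EFin \o (fun y => c * \1_(trset E) y)).
  by apply: integrable_EFinZ => //; exact: integrable_indic_lty.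
have i3 : nu.-integrable setT (EFin \o (fun y => `|depth E c y - c * \1_(trset E) y|)).
  by apply: integrable_norm => //; exact: integrable_EFinB.
rewrite -[X in (X <= _)%E -> _]fineK; last exact: integrable_fin_num i3.
rewrite lee_fin -/(Rintegral _ _ _) => H.
have h1 : c * fine (nu (trset E)) <= \int[nu]_y (depth E c y + `|depth E c y - c * \1_(trset E) y|).
  rewrite -Rintegral_indic// -RintegralZl//; last exact: integrable_indic_lty.
  apply: le_Rintegral => //; first exact: integrable_EFinD.
  by move=> y _; rewrite -lerBlDl distrC ler_norm.
rewrite RintegralD// in h1.
have h2 : \int[nu]_y depth E c y <= fine (mu E).
  have mEs : measurable (E `&` strip 0 c) by apply: measurableI => //; exact: measurable_strip.
  have le2 : (mu (E `&` strip 0 c) <= mu E)%E by apply: le_measure; rewrite ?inE.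
  rewrite /Rintegral (eq_integral (fun y => lebesgue_measure (slice (E `&` strip 0 c) y))).
    rewrite -lebesgue_slice fine_le// ge0_fin_numE//; exact: le_lt_trans le2 fE.
  by move=> y _; rewrite depthK// ltW.
have : c * fine (nu (trset E)) <= c * (per E halfspace + e).
  apply: (le_trans h1); rewrite mulrDr addrC lerD//; apply: (le_trans h2).
  by rewrite /c divfK ?gt_eqF// lerDl.
by rewrite ler_pM2l.
Qed.

Section fixed_weight.
Variable b : Y -> R.
Hypotheses (mb : measurable_fun setT b) (b1 : forall y, `|b y| <= 1).

Definition capJ E : R := per E halfspace - \int[nu]_y (b y * \1_(trset E) y).

(** The trace integral replaced by a volume average: unlike the trace, it is modular in [E], ignores
    null sets and passes to dominated limits. *)
Definition adhesion s E : R := s^-1 * \int[mu]_x (b (horiz x) * \1_(E `&` strip 0 s) x).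

(** The perimeter below [2 * s] is set aside to pay for the error of [adhesion]. The factor 2 makes
    the strip of height [s] strictly lower than the slab, as [depth_trset] requires. *)
Definition capS s E : R := per E (upper (2 * s)) - adhesion s E.

Lemma integrable_adhesion s E : measurable E -> (mu E < +oo)%E ->
  mu.-integrable setT (EFin \o (fun x => b (horiz x) * \1_(E `&` strip 0 s) x)).
Proof.
move=> mE fE; have mEs : measurable (E `&` strip 0 s) by apply: measurableI => //; exact: measurable_strip.
apply: (@integrable_bounded_mul _ _ _ _ _ measurableT _ _ 1) => //.
  by apply: measurableT_comp => //; exact: measurable_horiz.
by apply: integrable_indic_lty => //; apply: le_lt_trans fE; apply: le_measure; rewrite ?inE.
Qed.

Lemma integrable_weight_trset E : good E -> nu.-integrable setT (EFin \o (fun y => b y * \1_(trset E) y)).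
Proof.
move=> [mE fE [p Ep]]; apply: (@integrable_bounded_mul _ _ _ _ _ measurableT _ _ 1) => //.
by apply: integrable_indic_lty; [exact: measurable_trset|exact: integrable_trset Ep].
Qed.

Lemma adhesion_bound E s p : good E -> 0 < s -> per_bound E (slab (2 * s)) p ->
  `|adhesion s E - \int[nu]_y (b y * \1_(trset E) y)| <= p.
Proof.
move=> gE s0 Es; have [mE fE [q Eq]] := gE; have dich := void_dichotomy mE fE Eq.
have mT := measurable_trset mE; have fT := integrable_trset mE fE Eq.
have := depth_trset mE fE Es dich s0 ltac:(lra).
have i1 := integrable_depth mE fE (ltW s0).
have i2 : nu.-integrable setT (EFin \o (fun y => s * \1_(trset E) y)).
  by apply: integrable_EFinZ => //; exact: integrable_indic_lty.
have i3 : nu.-integrable setT (EFin \o (fun y => `|depth E s y - s * \1_(trset E) y|)).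
  by apply: integrable_norm => //; exact: integrable_EFinB.
rewrite -[X in (X <= _)%E -> _]fineK; last exact: integrable_fin_num i3.
rewrite lee_fin -/(Rintegral _ _ _) => H.
have ib : nu.-integrable setT (EFin \o (fun y => b y * (depth E s y - s * \1_(trset E) y))).
  by apply: (@integrable_bounded_mul _ _ _ _ _ measurableT _ _ 1) => //; exact: integrable_EFinB.
have ibd : nu.-integrable setT (EFin \o (fun y => b y * depth E s y)).
  exact: (@integrable_bounded_mul _ _ _ _ _ measurableT _ _ 1).
have e : s * (adhesion s E - \int[nu]_y (b y * \1_(trset E) y)) =
    \int[nu]_y (b y * (depth E s y - s * \1_(trset E) y)).
  rewrite /adhesion Rintegral_depth ?(ltW s0)// mulrBr mulVKf ?gt_eqF//.
  rewrite -RintegralZl//; last exact: integrable_weight_trset.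
  rewrite -RintegralB//; last by apply: integrable_EFinZ => //; exact: integrable_weight_trset.
  by apply: eq_Rintegral => y _; rewrite mulrBr [in LHS]mulrCA.
rewrite -(ler_pM2l s0) -[s in s * `|_|]gtr0_norm// -normrM e.
apply: (le_trans (le_normr_Rintegral _ ib)) => //.
apply: le_trans H; apply: le_Rintegral => //; first exact: integrable_norm.
by move=> y _; rewrite normrM ler_piMl.
Qed.

(** The slab and the region above it are disjoint, so their perimeters add up to at most the whole,
    and the share of the slab bounds the error of [adhesion]. *)
Lemma capS_le s E : good E -> 0 < s -> capS s E <= capJ E.
Proof.
move=> gE s0; have [mE fE [p Ep]] := gE.
have ha := adhesion_bound gE s0 (good_perU gE (@slab_halfspace (2 * s))).
have : per E (upper (2 * s)) + per E (slab (2 * s)) <= per E halfspace.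
  apply: per_superadditive => //.
  - by apply: upper_halfspace; rewrite mulr_ge0// ltW.
  - exact: slab_halfspace.
  - by rewrite -subset0 => x [/= h /andP[_ h']]; move: (lt_trans h h'); rewrite ltxx.
  - by exists p.
move: ha; rewrite /capS /capJ ler_norml => /andP[].
move: (per E halfspace) (per E (upper _)) (per E (slab _)) (adhesion _ _) (Rintegral _ _ _) => a1 a2 a3 a4 a5 ? ? ?.
lra.
Qed.

(** A nearly optimal field has its support above some height [d], so for [2 * s < d] it is
    admissible in [upper (2 * s)]; by [slab_small] the error of [adhesion] is small too. *)
Lemma capS_near E (e : R) : good E -> 0 < e -> \forall s \near 0^'+, capJ E <= capS s E + e.
Proof.
move=> gE e0; have [mE fE [p Ep]] := gE; have e2 : 0 < e / 2 by rewrite divr_gt0.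
have [phi tphi hphi] := per_approx (good_per gE) e2.
have [d d0 hd] := tfield_lift (@subset_refl _ halfspace) tphi.
have [s1 s10 hs1] := slab_small mE Ep e2.
near=> s.
have s0 : 0 < s by near: s; exact: nbhs_right_gt.
have sd : 2 * s < d by rewrite mulrC -ltr_pdivlMr//; near: s; apply: nbhs_right_lt; rewrite divr_gt0.
have ss1 : 2 * s < s1 by rewrite mulrC -ltr_pdivlMr//; near: s; apply: nbhs_right_lt; rewrite divr_gt0.
have U0 : upper (2 * s) `<=` (halfspace : set V) by apply: upper_halfspace; rewrite mulr_ge0// ltW.
have h1 : pairing E phi <= per E (upper (2 * s)) by apply: (good_perU gE U0); exact: hd.
have Es : per_bound E (slab (2 * s)) (e / 2).
  by apply: per_boundS hs1 => x /andP[x0 x1]; apply/andP; split => //; exact: lt_trans x1 ss1.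
have := adhesion_bound gE s0 Es; rewrite /capS /capJ ler_norml => /andP[].
move: hphi h1.
move: (per E halfspace) (per E (upper _)) (pairing _ _) (adhesion _ _) (Rintegral _ _ _) => a1 a2 a3 a4 a5 ? ? ? ?.
lra.
Unshelve. all: by end_near. Qed.

Lemma capJ_le E : good E -> capJ E <= 2 * per E halfspace.
Proof.
move=> gE; have [mE fE [p Ep]] := gE; have fT := integrable_trset mE fE Ep.
have mT := measurable_trset mE.
have := nu_trset gE; have : - (\int[nu]_y (b y * \1_(trset E) y)) <= fine (nu (trset E)).
  rewrite -Rintegral_indic// -mulN1r -RintegralZl//; last exact: integrable_weight_trset.
  apply: le_Rintegral => //.
  - by apply: integrable_EFinZ => //; exact: integrable_weight_trset.
  - exact: integrable_indic_lty.
  - move=> y _; rewrite mulrA ler_piMl// mulN1r.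
    by have := b1 y; rewrite ler_norml => /andP[? ?]; lra.
rewrite /capJ; move: (per _ _) (Rintegral _ _ _) (fine _) => a1 a2 a3 ? ?; lra.
Qed.

(** Coercivity: by [nu_trset] the adhesion term absorbs at most the fraction [1 - 2 * kappa] of the
    perimeter. *)
Lemma capJ_ge E kappa : good E -> 0 < kappa <= 1 / 2 -> (forall y, b y <= 1 - 2 * kappa) ->
  2 * kappa * per E halfspace <= capJ E.
Proof.
move=> gE /andP[k0 k1] bk; have [mE fE [p Ep]] := gE; have fT := integrable_trset mE fE Ep.
have mT := measurable_trset mE.
have iI : nu.-integrable setT (EFin \o (\1_(trset E) : Y -> R)) by exact: integrable_indic_lty.
have : \int[nu]_y (b y * \1_(trset E) y) <= (1 - 2 * kappa) * fine (nu (trset E)).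
  rewrite -Rintegral_indic// -RintegralZl//.
  apply: le_Rintegral => //; first exact: integrable_weight_trset.
  - exact: integrable_EFinZ.
  - by move=> y _; rewrite ler_wpM2r.
have h : (1 - 2 * kappa) * fine (nu (trset E)) <= per E halfspace - 2 * kappa * per E halfspace.
  apply: (@le_trans _ _ ((1 - 2 * kappa) * per E halfspace)); last by rewrite mulrBl mul1r.
  by apply: ler_wpM2l (nu_trset gE); lra.
move: h; rewrite /capJ.
move: (2 * kappa * per E halfspace) (_ * fine _) (per _ _) (Rintegral _ _ _) => a1 a2 a3 a4 ? ?.
lra.
Qed.

(** At one [s] common to the four sets the perimeter is submodular and [adhesion] is modular; the
    intersection and the union are each approximated up to [e / 2]. *)
Lemma capJ_submodular E F : good E -> good F ->
  capJ (E `&` F) + capJ (E `|` F) <= capJ E + capJ F.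
Proof.
move=> gE gF; apply/ler_addgt0Pr => e e0; have e2 : 0 < e / 2 by rewrite divr_gt0.
have gI := good_setI gE gF; have gU := good_setU gE gF.
suff [s [s0 hI hU]] : exists s : R, [/\ 0 < s, capJ (E `&` F) <= capS s (E `&` F) + e / 2 &
    capJ (E `|` F) <= capS s (E `|` F) + e / 2].
  have hE := capS_le gE s0; have hF := capS_le gF s0.
  have [mE fE [p Ep]] := gE; have [mF fF [q Fq]] := gF.
  have U0 : upper (2 * s) `<=` (halfspace : set V) by apply: upper_halfspace; rewrite mulr_ge0// ltW.
  have [_ _] := per_submodular mE mF fF (good_perU gE U0) (good_perU gF U0).
  have : adhesion s (E `&` F) + adhesion s (E `|` F) = adhesion s E + adhesion s F.
    rewrite /adhesion -!mulrDr; congr (_ * _).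
    have [mI fI _] := gI; have [mU fU _] := gU.
    rewrite -!RintegralD//; try exact: integrable_adhesion.
    apply: eq_Rintegral => x _; rewrite -!mulrDr; congr (_ * _).
    rewrite !indicE !in_setI in_setU.
    by case: (x \in E); case: (x \in F); rewrite /= ?addr0 ?add0r// addrC.
  move: hI hU hE hF; rewrite /capS.
  move: (capJ E) (capJ F) (capJ (_ `&` _)) (capJ (_ `|` _)) => c1 c2 c3 c4.
  move: (per E _) (per F _) (per (_ `&` _) _) (per (_ `|` _) _) => p1 p2 p3 p4.
  move: (adhesion _ E) (adhesion _ F) (adhesion _ (_ `&` _)) (adhesion _ (_ `|` _)) => a1 a2 a3 a4.
  move=> ? ? ? ? ? ?; lra.
have := filter_ex (filterI (filterI (capS_near gI e2) (capS_near gU e2)) (nbhs_right_gt (0 : R))).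
by move=> [s [[h1 h2] h3]]; exists s; split.
Qed.

End fixed_weight.

Lemma capillaryE (beta b : Y -> R) E : measurable_fun setT b -> (forall y, `|b y| <= 1) -> good E ->
  {ae nu, forall y, beta y = b y} -> capillary beta E = (capJ b E)%:E.
Proof.
move=> mb b1 gE hb; have [mE fE [p Ep]] := gE.
have oH : open (halfspace : set V) := @upper_open R n 0.
rewrite /capillary (perimeterE oH mE Ep) /capJ EFinB; congr (_ - _)%E.
rewrite (@ae_eq_integral_l _ _ _ nu _ (fun y => (b y * \1_(trset E) y)%:E)).
  rewrite fineK//; exact: integrable_fin_num (integrable_weight_trset mb b1 gE).
by apply: filterS2 hb (trace_trset mE fE Ep) => y -> ->.
Qed.

End capillary_core.

(** * Smooth cutoffs and the isoperimetric inequality *)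

Section smooth_step.
Context {R : realType}.
Implicit Types t d : R.

(** A piecewise quadratic rise from 0 to 1 over the unit interval, with slope at most 2, reached at
    1/2. *)
Definition step t : R :=
  2 * (Num.max 0 t ^+ 2 - 2 * Num.max 0 (t - 1 / 2) ^+ 2 + Num.max 0 (t - 1) ^+ 2).

Definition dstep t : R :=
  4 * (Num.max 0 t - 2 * Num.max 0 (t - 1 / 2) + Num.max 0 (t - 1)).

Lemma step_bounds t : 0 <= step t <= 1.
Proof.
rewrite /step; have [h1|h1] := leP 0 t; have [h2|h2] := leP 0 (t - 1 / 2);
  have [h3|h3] := leP 0 (t - 1); apply/andP; split; nra.
Qed.

Lemma dstep_bounds t : 0 <= dstep t <= 2.
Proof.
rewrite /dstep; have [h1|h1] := leP 0 t; have [h2|h2] := leP 0 (t - 1 / 2);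
  have [h3|h3] := leP 0 (t - 1); apply/andP; split; lra.
Qed.

Lemma step_le0 t : t <= 0 -> step t = 0 /\ dstep t = 0.
Proof.
move=> t0; rewrite /step /dstep !max_l//; lra.
Qed.

Lemma step_ge1 t : 1 <= t -> step t = 1 /\ dstep t = 0.
Proof.
move=> t0; rewrite /step /dstep !max_r//; lra.
Qed.

(** The constant is [2 * (1 + 2 + 1)], one use of [sqpos_bound] for each of the three kinks. *)
Lemma step_quadratic t d : `|step (t + d) - step t - d * dstep t| <= 8 * d ^+ 2.
Proof.
have := sqpos_bound t d; have := sqpos_bound (t - 1 / 2) d; have := sqpos_bound (t - 1) d.
rewrite !(addrAC _ (- _) d) /step /dstep !ler_norml => /andP[? ?] /andP[? ?] /andP[? ?].
by apply/andP; split; lra.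
Qed.

Lemma dstep_continuous : continuous dstep.
Proof.
have pc c : continuous (fun t : R => Num.max 0 (t - c)).
  move=> t; apply: (@continuous_max _ _ (cst 0) (fun t => t - c)).
    exact: cst_continuous.
  by apply: (@continuousB _ R^o); [exact: id|exact: cst_continuous].
have p0 : continuous (fun t : R => Num.max 0 t).
  by have := pc 0; under eq_fun do rewrite subr0.
move=> t; rewrite /dstep; apply: (@continuousM _ _ (cst 4)
  (fun t : R => Num.max 0 t - 2 * Num.max 0 (t - 1 / 2) + Num.max 0 (t - 1))).
  exact: cst_continuous.
apply: (@continuousD _ R^o _ (fun t : R => Num.max 0 t - 2 * Num.max 0 (t - 1 / 2))
  (fun t : R => Num.max 0 (t - 1))); last exact: pc.
apply: (@continuousB _ R^o _ (fun t : R => Num.max 0 t) (fun t : R => 2 * Num.max 0 (t - 1 / 2))).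
  exact: p0.
by apply: (@continuousM _ _ (cst 2) (fun t : R => Num.max 0 (t - 1 / 2))); [exact: cst_continuous|exact: pc].
Qed.

Context {m : nat}.
Local Notation V := 'rV[R]_m.
Local Notation e_ i := (delta_mx 0 i : V).
Implicit Types (q : V -> R) (x v : V).

Lemma is_derive_step q x v (dq K : R) :
  (forall h : R, `|q (x + h *: v) - q x - h * dq| <= K * h ^+ 2) ->
  is_derive x v (step \o q) (dstep (q x) * dq).
Proof.
move=> H; have K0 : 0 <= K.
  by have := H 1; rewrite expr1n mulr1; exact: le_trans.
apply: (@is_derive_quadratic _ _ _ _ _ _ (8 * (`|dq| + K) ^+ 2 + 2 * K)) => h h1.
set dl := q (x + h *: v) - q x.
have dlE : q (x + h *: v) = q x + dl by rewrite /dl; lra.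
have hd : `|dl - h * dq| <= K * h ^+ 2 by exact: H.
have hh : h ^+ 2 <= `|h|.
  by rewrite -real_normK ?num_real// expr2 ler_piMr.
have dlb : `|dl| <= `|h| * (`|dq| + K).
  rewrite -[dl](subrK (h * dq)) (le_trans (ler_normD _ _))// mulrDr addrC lerD//.
    by rewrite normrM.
  by apply: (le_trans hd); rewrite mulrC ler_wpM2r.
have dl2 : dl ^+ 2 <= h ^+ 2 * (`|dq| + K) ^+ 2.
  rewrite -real_normK ?num_real// -[h ^+ 2]real_normK ?num_real// -exprMn.
  by rewrite lerXn2r ?nnegrE// mulr_ge0// addr_ge0.
have := step_quadratic (q x) dl; have /andP[s0 s2] := dstep_bounds (q x).
rewrite /= dlE.
have e1 : `|dstep (q x) * (dl - h * dq)| <= 2 * (K * h ^+ 2).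
  by rewrite normrM ler_pM// ger0_norm.
move=> e2.
rewrite (_ : _ - _ - h * _ = (step (q x + dl) - step (q x) - dl * dstep (q x)) + dstep (q x) * (dl - h * dq)); last first.
  by rewrite mulrBr mulrCA (mulrC dl); lra.
apply: (le_trans (ler_normD _ _)); apply: (le_trans (lerD e2 e1)).
by lra.
Qed.

(** Meant for [q] a polynomial of degree at most 2, such as a height or a squared radius, where the
    remainder is known exactly. *)
Lemma C1_step q (dq : 'I_m -> V -> R) (K : 'I_m -> R) : continuous q ->
  (forall i, continuous (dq i)) ->
  (forall i x (h : R), `|q (x + h *: e_ i) - q x - h * dq i x| <= K i * h ^+ 2) ->
  C1 (step \o q) /\ forall i x, 'D_(e_ i) (step \o q) x = dstep (q x) * dq i x.
Proof.
move=> cq cdq H.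
have D i x : is_derive x (e_ i) (step \o q) (dstep (q x) * dq i x) by exact: is_derive_step (H i x).
have DE i x : 'D_(e_ i) (step \o q) x = dstep (q x) * dq i x by apply: derive_val.
split=> // i; split=> [x|]; first by have [] := D i x.
rewrite (_ : 'D_(e_ i) _ = (dstep \o q) \* dq i); last by apply/funext => x; exact: DE.
move=> x; apply: continuousM; last exact: cdq.
by apply: continuous_comp; [exact: cq|exact: dstep_continuous].
Qed.

End smooth_step.

Section isoperimetric.
Context {R : realType} {n : nat}.
Local Notation mu := (lebesgue_rV n.+1).
Local Notation V := 'rV[R]_n.+1.
Implicit Types (x h : V) (E : set V).

Let overlap E h := mu (E `&` [set x | E (x + h)]).

Let overlapE E h : measurable E ->
  overlap E h = (\int[mu]_x (\1_E x * \1_E (x + h))%:E)%E.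
Proof.
move=> mE; have mS : measurable [set x | E (x + h)] by apply: measurable_preimage mE; exact: measurable_shift.
rewrite /overlap -[X in mu X]setIT -integral_indic//; last exact: measurableI.
apply: eq_integral => x _; rewrite !indicE in_setI.
rewrite (_ : (x \in [set x | E (x + h)]) = (x + h \in E)).
  by case: (x \in E); case: (x + h \in E); rewrite /= ?mulr1 ?mulr0 ?mul0r.
by apply/idP/idP; rewrite !inE.
Qed.

Let measurable_overlap E : measurable E -> measurable_fun setT (overlap E).
Proof.
move=> mE; pose f (z : V * V) : \bar R := (\1_E z.2 * \1_E (z.2 + z.1))%:E.
rewrite (_ : overlap E = fun h => (\int[mu]_x f (h, x))%E); last first.
  by apply/funext => h; rewrite overlapE.
apply: measurable_fun_fubini_tonelli_F => //; last by move=> z; rewrite lee_fin mulr_ge0.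
apply: (measurable_EFinP _ _).2; apply: measurable_funM.
  by apply: measurableT_comp; [exact: measurable_indic|exact: measurable_snd].
apply: measurableT_comp; first exact: measurable_indic.
by apply: measurable_addrV; [exact: measurable_snd|exact: measurable_fst].
Qed.

(** By Tonelli: for a fixed [x] in [E], the vectors [h] with [x + h] in [E] fill exactly the volume
    of [E]. *)
Let overlap_average E (Q : set V) : measurable E -> measurable Q ->
  (\int[mu]_(h in Q) overlap E h <= mu E * mu E)%E.
Proof.
move=> mE mQ.
pose f (z : V * V) : \bar R := (\1_Q z.1 * (\1_E z.2 * \1_E (z.2 + z.1)))%:E.
have mf : measurable_fun setT f.
  apply: (measurable_EFinP _ _).2; apply: measurable_funM.
    by apply: measurableT_comp; [exact: measurable_indic|exact: measurable_fst].
  apply: measurable_funM.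
    by apply: measurableT_comp; [exact: measurable_indic|exact: measurable_snd].
  apply: measurableT_comp; first exact: measurable_indic.
  by apply: measurable_addrV; [exact: measurable_snd|exact: measurable_fst].
have f0 z : (0 <= f z)%E by rewrite lee_fin !mulr_ge0.
have mS h : measurable [set x | E (x + h)] by apply: measurable_preimage mE; exact: measurable_shift.
have := @fubini_tonelli _ _ _ _ _ mu mu f mf f0.
have -> : (\int[mu]_h \int[mu]_x f (h, x) = \int[mu]_(h in Q) overlap E h)%E.
  rewrite [RHS]integral_mkcond epatch_indic; apply: eq_integral => h _ /=.
  rewrite /f/= muleC; under eq_integral do rewrite EFinM.
  rewrite ge0_integralZl//; last first.
    apply: (measurable_EFinP _ _).2; apply: measurable_funM; first exact: measurable_indic.
    by apply: measurableT_comp; [exact: measurable_indic|exact: measurable_shift].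
  by rewrite overlapE.
move=> ->; apply: (@le_trans _ _ (\int[mu]_x ((\1_E x)%:E * mu E))%E).
  apply: ge0_le_integral => //.
  - by move=> x _; apply: integral_ge0.
  - exact: measurable_fun_fubini_tonelli_G.
  - apply: emeasurable_funM => //; apply: (measurable_EFinP _ _).2; exact: measurable_indic.
  - move=> x _; rewrite /f/=.
    apply: (@le_trans _ _ (\int[mu]_h ((\1_E x)%:E * (\1_E (h + x))%:E))%E).
      apply: ge0_le_integral => //.
      + apply: (measurable_EFinP _ _).2; apply: measurable_funM; first exact: measurable_indic.
        apply: measurable_funM => //; under eq_fun do rewrite addrC.
        by apply: measurableT_comp; [exact: measurable_indic|exact: measurable_shift].
      + apply: (measurable_EFinP _ _).2; apply: measurable_funM => //.
        by apply: measurableT_comp; [exact: measurable_indic|exact: measurable_shift].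
      + by move=> h _; rewrite -EFinM lee_fin addrC ler_piMl ?mulr_ge0// indicE; case: (_ \in _).
    rewrite ge0_integralZl//; last first.
      apply: (measurable_EFinP _ _).2.
      by apply: measurableT_comp; [exact: measurable_indic|exact: measurable_shift].
    rewrite (ge0_integral_shift x (f := fun x => (\1_E x)%:E)) ?integral_indic ?setIT//.
    exact: (measurable_EFinP _ _).2 (measurable_indic mE).
rewrite ge0_integralZr//; last exact: (measurable_EFinP _ _).2 (measurable_indic mE).
by rewrite integral_indic// setIT.
Qed.

(** Some translation by a vector of length of order [L] moves about half of [E] off itself, and the
    translation estimate bounds the volume so moved by that length times the perimeter. *)
Lemma isoperimetric E p (L : R) : measurable E -> E `<=` halfspace -> (mu E < +oo)%E ->
  per_bound E halfspace p -> 0 < L -> L ^+ n.+1 = 2 * fine (mu E) ->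
  fine (mu E) <= L * Num.sqrt n.+4%:R * p.
Proof.
move=> mE EH fE Ep L0 LE.
have [v vdef] : exists v : R, v = fine (mu E) by eexists.
rewrite -vdef in LE *.
have p0 := per_bound_ge0 Ep.
have v0 : 0 < v by rewrite -(@pmulr_rgt0 _ 2)// -LE exprn_gt0.
have vE : mu E = v%:E by rewrite vdef fineK// ge0_fin_numE.
have L2 : 0 < L / 2 by rewrite divr_gt0.
(* All vectors of this cube point upwards, so segments from [E] stay in the half-space and the
   relative perimeter suffices. Its volume is twice that of [E], which makes the mean overlap at
   most half the volume of [E]. *)
pose Q := ball (rcons_rV 0 (L / 2) : V) (L / 2).
have muQ : mu Q = (2 * v)%:E by rewrite lebesgue_rV_ball// mulr2n -splitr LE.
have mQ : measurable Q by exact: measurable_ball_rV.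
have mS h : measurable [set x | E (x + h)] by apply: measurable_preimage mE; exact: measurable_shift.
have mO h : measurable (E `&` [set x | E (x + h)]) by exact: measurableI.
have fO h : (overlap E h < +oo)%E.
  by apply: le_lt_trans fE; apply: le_measure; rewrite ?inE.
apply/ler_addgt0Pr => e e0.
have [h Qh hh] : exists2 h, Q h & fine (overlap E h) <= v / 2 + e / 2.
  apply: contrapT => /forallPNP no.
  have := overlap_average mE mQ; apply/negP; rewrite -ltNge vE -EFinM.
  apply: (@lt_le_trans _ _ (\int[mu]_(h in Q) (cst (v / 2 + e / 2)%:E h))%E).
    rewrite (_ : (\int[mu]_(h in Q) _)%E = ((v / 2 + e / 2)%:E * mu Q)%E); last exact: integral_cst.
    by rewrite muQ -EFinM lte_fin; have := mulr_gt0 e0 v0; lra.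
  apply: ge0_le_integral => //.
  - by move=> h _; rewrite lee_fin addr_ge0// divr_ge0// ltW.
  - by apply: measurable_funTS; exact: measurable_overlap.
  - move=> h Qh; rewrite -[leRHS]fineK ?ge0_fin_numE// lee_fin.
    by have /negP := no h Qh; rewrite -ltNge => /ltW.
have /ball_rVP[_ hc] := Qh.
have ht : 0 < height h < L.
  have := hc ord_max; rewrite -!/(height _) heightK ltr_distlC => /andP[? ?]; apply/andP; split; lra.
(* [n] coordinates are at most [L / 2] and the height is at most [L]; the squares sum up to [L ^+ 2]
   times n/4 + 1. *)
have hn : enorm h <= L * Num.sqrt n.+4%:R / 2.
  rewrite -(@ler_sqr _ (enorm h)) ?nnegrE ?enorm_ge0//; last by rewrite !mulr_ge0 ?sqrtr_ge0// ltW.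
  rewrite sqr_enorm /dotr big_ord_recr/= !exprMn sqr_sqrtr//.
  have -> : \sum_(i < n) h 0 (widen_ord (leqnSn n) i) * h 0 (widen_ord (leqnSn n) i) =
     \sum_(i < n) h 0 (lift ord_max i) * h 0 (lift ord_max i).
    apply: eq_bigr => i _; have -> // : widen_ord (leqnSn n) i = lift ord_max i.
    by apply: val_inj; rewrite /= /bump leqNgt ltn_ord.
  have s1 : \sum_(i < n) h 0 (lift ord_max i) * h 0 (lift ord_max i) <= \sum_(i < n) (L / 2) ^+ 2.
    apply: ler_sum => i _; have := hc (lift ord_max i); rewrite !mxE liftK/= mxE sub0r normrN => hi.
    rewrite -expr2 -real_normK ?num_real// lerXn2r ?nnegrE ?(ltW L2)//; exact: ltW.
  rewrite sumr_const card_ord in s1.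
  have s2 : h 0 ord_max * h 0 ord_max <= L ^+ 2.
    rewrite expr2; case/andP: ht; rewrite /height => a1 a2; apply: ler_pM; exact: ltW.
  apply: (le_trans (lerD s1 s2)).
  by rewrite -(mulr_natr _ n) exprMn -[n.+4]addn4 natrD; move: (n%:R) => k; lra.
have tr := @perimeter_translation_open _ _ E halfspace p (fun x => - \1_E x) h (@upper_open R n 0) mE fE Ep.
have : \int[mu]_x (- \1_E x * (\1_E (x + h) - \1_E x)) <= enorm h * p.
  apply: tr.
  - by apply: measurableT_comp => //; exact: measurable_indic.
  - by move=> x; rewrite normrN indic_norm.
  - move=> x; rewrite oppr_eq0 indicE; case: (boolP (x \in E)) => [/set_mem Ex _|_]; last by rewrite eqxx.
    move=> t /andP[t0 t1]; have := EH x Ex; rewrite /halfspace/= /height !mxE => hx.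
    by rewrite ltr_pwDl// mulr_ge0// ltW//; case/andP: ht.
have -> : (fun x => - \1_E x * (\1_E (x + h) - \1_E x)) =
    (fun x => \1_E x - \1_(E `&` [set x | E (x + h)]) x : R).
  apply/funext => x; rewrite !indicE in_setI.
  rewrite (_ : (x \in [set x | E (x + h)]) = (x + h \in E)); last by apply/idP/idP; rewrite !inE.
  by case: (x \in E); case: (x + h \in E) => /=; lra.
rewrite RintegralB//; [|exact: integrable_indic_lty|by apply: integrable_indic_lty => //; exact: fO].
rewrite !Rintegral_indic// -vdef => H.
have H2 : enorm h * p <= L * Num.sqrt n.+4%:R / 2 * p by rewrite ler_wpM2r.
move: hh H H2; rewrite /overlap; move: (fine _) => o ? ? ?; lra.
Qed.

End isoperimetric.

(** * Cuts by vertical cylinders and by horizontal planes *)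

Section cuts.
Context {R : realType} {n : nat}.
Local Notation mu := (lebesgue_rV n.+1).
Local Notation V := 'rV[R]_n.+1.
Local Notation e_ i := (delta_mx 0 i : V).
Implicit Types (x v : V) (E U : set V).

(** The horizontal projection is kept in [V], so that it can be paired with test fields by
    [dotr]. *)
Let hz x : V := rcons_rV (horiz x) 0.

Let hz_lin x v (h : R) : hz (x + h *: v) = hz x + h *: hz v.
Proof.
by apply/rowP => j; rewrite !mxE; case: unliftP => [j' _|_] /=; rewrite ?mxE// mulr0 addr0.
Qed.

Let enorm_hz x : enorm (hz x) = enorm (horiz x).
Proof.
rewrite /enorm big_ord_recr/= [X in _ + X](_ : _ = 0) ?addr0; last first.
  by rewrite mxE unlift_none/= expr0n.
congr (Num.sqrt _); apply: eq_bigr => i _.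
have -> : widen_ord (leqnSn n) i = lift ord_max i.
  by apply: val_inj; rewrite /= /bump leqNgt ltn_ord.
by rewrite mxE liftK.
Qed.

Let hz_delta i j : hz (e_ i) 0 j = ((j == i) && (j != ord_max))%:R.
Proof.
rewrite mxE; case: unliftP => [j' ->|->] /=; last by rewrite eqxx andbF.
by rewrite !mxE eqxx/= (eq_sym _ ord_max) neq_lift andbT.
Qed.

Let dotr_hz x i : dotr (hz x) (hz (e_ i)) = hz x 0 i.
Proof.
rewrite /dotr (bigD1 i)//= big1 => [|j ji]; last by rewrite hz_delta (negbTE ji) mulr0.
rewrite addr0 hz_delta eqxx/=; case: eqVneq => [->|_]; last by rewrite mulr1.
by rewrite mulr0 mxE unlift_none.
Qed.

Let dotr_hz_delta i : dotr (hz (e_ i)) (hz (e_ i)) <= 1.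
Proof. by rewrite dotr_hz hz_delta; case: (_ && _). Qed.

Let hz_continuous i : continuous (fun x => hz x 0 i).
Proof.
case: (unliftP ord_max i) => [j ->|->].
  rewrite (_ : (fun x => _) = (fun x : V => x 0 (lift ord_max j))); first exact: coord_continuous.
  by apply/funext => x; rewrite !mxE liftK/= mxE.
rewrite (_ : (fun x => _) = cst 0); first by move=> x; exact: cst_continuous.
by apply/funext => x; rewrite mxE unlift_none.
Qed.

Definition annulus (r e : R) : set V := [set x | r < enorm (horiz x) <= r + e].

(** A function of the squared radius, to which [C1_step] applies without square roots. Its slope is
    at most [4 * (r + e) / W], slightly above 2/e; two unit fields differ by at most 2, and [r >= 1]
    with [e <= 1 / 10] keeps the product below 42/10 over [e]. *)
Lemma lateral_cutoff (r e : R) : 1 <= r -> 0 < e <= 1 / 10 -> exists eta : V -> R,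
  [/\ C1 eta, forall x, 0 <= eta x <= 1, forall x, enorm (horiz x) <= r -> eta x = 1,
   forall x, r + e <= enorm (horiz x) -> eta x = 0 &
   forall x (w w' : V), enorm w <= 1 -> enorm w' <= 1 ->
    - (42 / 10 / e * \1_(annulus r e) x) <=
    \sum_i (w 0 i - w' 0 i) * 'D_(e_ i) eta x].
Proof.
move=> r1 /andP[e0 e1].
(* [W] is [(r + e) ^+ 2 - r ^+ 2], so that [q] runs from 0 to 1 across the annulus. *)
pose W := e * (2 * r + e).
have W0 : 0 < W by rewrite mulr_gt0//; lra.
pose q x := (dotr (hz x) (hz x) - r ^+ 2) / W.
pose dq (i : 'I_n.+1) x := 2 * hz x 0 i / W.
have cq : continuous q.
  move=> x; apply: (@continuousM _ _ (fun x => dotr (hz x) (hz x) - r ^+ 2) (cst W^-1)); last exact: cst_continuous.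
  apply: (@continuousB _ R^o _ (fun x => dotr (hz x) (hz x)) (cst (r ^+ 2))); last exact: cst_continuous.
  rewrite /dotr; apply: continuous_big => [|i _]; first exact: (@add_continuous R^o).
  by move=> y; apply: (@continuousM _ _ (fun x => hz x 0 i) (fun x => hz x 0 i)); exact: hz_continuous.
have cdq i : continuous (dq i).
  move=> x; apply: (@continuousM _ _ (fun x => 2 * hz x 0 i) (cst W^-1)); last exact: cst_continuous.
  by apply: (@continuousM _ _ (cst 2) (fun x => hz x 0 i)); [exact: cst_continuous|exact: hz_continuous].
have quad i x (h : R) : `|q (x + h *: e_ i) - q x - h * dq i x| <= W^-1 * h ^+ 2.
  have -> : q (x + h *: e_ i) - q x - h * dq i x = h ^+ 2 * dotr (hz (e_ i)) (hz (e_ i)) / W.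
    rewrite /q /dq hz_lin dotrDl !dotrDr !dotrZl !dotrZr (dotrC (hz (e_ i)) (hz x)) dotr_hz.
    by move: (dotr (hz x) (hz x)) (dotr (hz (e_ i)) (hz (e_ i))) (hz x 0 i) (W^-1) => a b c d; lra.
  rewrite ger0_norm; last by rewrite divr_ge0 ?(ltW W0)// mulr_ge0 ?sqr_ge0 ?dotr_ge0.
  rewrite mulrC ler_wpM2l ?invr_ge0 ?(ltW W0)// -[leRHS]mulr1.
  by apply: ler_wpM2l; rewrite ?sqr_ge0 ?dotr_hz_delta.
have [cs Ds] := C1_step cq cdq quad.
have C1eta : C1 (fun x => 1 - (step \o q) x) by exact: (C1B (C1_cst 1) cs).
have Deta i x : 'D_(e_ i) (fun x => 1 - (step \o q) x) x = - (dstep (q x) * dq i x).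
  have [dst _] := cs i.
  have [_ H] := @is_deriveB _ _ R^o (cst (1 : R)) (step \o q) x (e_ i) 0 ('D_(e_ i) (step \o q) x)
    (is_derive_cst _ _ _) (DeriveDef (dst x) erefl).
  by rewrite sub0r Ds in H.
have qE x : q x = (enorm (horiz x) ^+ 2 - r ^+ 2) / W by rewrite /q -sqr_enorm enorm_hz.
have q_le0 x : enorm (horiz x) <= r -> q x <= 0.
  move=> h; rewrite qE pmulr_lle0 ?invr_gt0// subr_le0.
  by rewrite lerXn2r ?nnegrE ?enorm_ge0//; lra.
have q_ge1 x : r + e <= enorm (horiz x) -> 1 <= q x.
  move=> h; rewrite qE ler_pdivlMr// mul1r /W.
  have : (r + e) ^+ 2 <= enorm (horiz x) ^+ 2 by rewrite lerXn2r ?nnegrE ?enorm_ge0//; lra.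
  by lra.
exists (fun x => 1 - (step \o q) x); split => //.
- by move=> x /=; have /andP[? ?] := step_bounds (q x); apply/andP; split; lra.
- by move=> x /q_le0/step_le0[h _] /=; rewrite h subr0.
- by move=> x /q_ge1/step_ge1[h _] /=; rewrite h subrr.
- move=> x w w' w1 w1'.
  have -> : \sum_i (w 0 i - w' 0 i) * 'D_(e_ i) (fun x => 1 - (step \o q) x) x =
     - (2 * dstep (q x) / W * dotr (w - w') (hz x)).
    rewrite /dotr mulr_sumr -sumrN; apply: eq_bigr => i _; rewrite Deta /dq !mxE.
    by move: (hz x 0 i) (dstep _) (W^-1) => a b c; lra.
  rewrite lerN2 indicE; have /andP[d0 d2] := dstep_bounds (q x).
  have [hA|hA] := boolP (x \in _).
    rewrite mulr1; move/set_mem : hA => /= /andP[hr hre].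
    have hdot : dotr (w - w') (hz x) <= 2 * (r + e).
      apply: (le_trans (cauchy_schwarz _ _)); rewrite enorm_hz.
      apply: ler_pM => //; rewrite ?enorm_ge0//.
      by apply: (le_trans (ler_enormD _ _)); rewrite enormN; lra.
    apply: (@le_trans _ _ (2 * 2 / W * (2 * (r + e)))).
      have [h0|h0] := leP 0 (dotr (w - w') (hz x)).
        apply: ler_pM => //; first by apply: divr_ge0; [exact: mulr_ge0|exact: ltW].
        by rewrite ler_wpM2r ?invr_ge0 ?(ltW W0)// ler_wpM2l.
      apply: (@le_trans _ _ 0).
        by apply: mulr_ge0_le0; [apply: divr_ge0; [exact: mulr_ge0|exact: ltW]|exact: ltW].
      by apply: mulr_ge0; [apply: divr_ge0; [lra|exact: ltW]|lra].
    pose Y := 2 * r + e; have Y0 : Y != 0 by rewrite gt_eqF// /Y; lra.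
    have -> : 42 / 10 / e = 42 / 10 * Y / W.
      by rewrite /W -/Y invfM [e^-1 * _]mulrC mulrA mulfK.
    by rewrite [leLHS]mulrAC ler_wpM2r ?invr_ge0 ?(ltW W0)// /Y; lra.
  rewrite mulr0.
  suff -> : dstep (q x) = 0 by rewrite mulr0 !mul0r.
  have [h|h] := leP (enorm (horiz x)) r; first by have [_] := step_le0 (q_le0 x h).
  have [h'|h'] := leP (r + e) (enorm (horiz x)); first by have [_] := step_ge1 (q_ge1 x h').
  by exfalso; move/negP : hA; apply; rewrite inE /annulus/= h ltW.
Qed.

Lemma measurable_enorm_horiz : measurable_fun setT (fun x : V => enorm (horiz x)).
Proof. by apply: measurable_enorm; exact: measurable_horiz. Qed.

Definition tube (r : R) : set V := [set x | enorm (horiz x) <= r].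

Lemma measurable_tube r : measurable (tube r).
Proof. by apply: measurable_le_set; [exact: measurable_enorm_horiz|exact: measurable_cst]. Qed.

Lemma cut_pairing_cvg E U C (eta : nat -> V -> R) phi psi (c : R) : measurable E -> measurable C ->
  tfield U phi -> tfield U psi -> (forall k, C1 (eta k)) -> (forall k x, 0 <= eta k x <= 1) ->
  (forall x, eta k x @[k --> \oo] --> (\1_C x : R)) ->
  (forall e, 0 < e -> \forall k \near \oo,
    \int[mu]_x (\1_E x * (eta k x * divergence phi x + (1 - eta k x) * divergence psi x)) <= c + e) ->
  pairing (E `&` C) phi + pairing (E `\` C) psi <= c.
Proof.
move=> mE mC tphi tpsi ceta eta01 ec H.
have i1 := divergence_integrable tphi; have i2 := divergence_integrable tpsi.
have m1 := divergence_measurable tphi; have m2 := divergence_measurable tpsi.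
have mEC : measurable (E `&` C) by exact: measurableI.
have mED : measurable (E `\` C) by exact: measurableD.
have cv : \int[mu]_x (\1_E x * (eta k x * divergence phi x + (1 - eta k x) * divergence psi x)) @[k --> \oo] -->
   \int[mu]_x (\1_E x * (\1_C x * divergence phi x + (1 - \1_C x) * divergence psi x)).
  apply: (@dominated_cvg_Rintegral _ _ _ _ _ measurableT _ _ (fun x => `|divergence phi x| + `|divergence psi x|)).
  - move=> k; apply: measurable_funM; first exact: measurable_indic.
    have me := C1_measurable (ceta k).
    by apply: measurable_funD; apply: measurable_funM => //; exact: measurable_funB.
  - apply: measurable_funM; first exact: measurable_indic.
    by apply: measurable_funD; apply: measurable_funM => //; apply: measurable_funB => //; exact: measurable_indic.
  - apply: aeW => x _; apply: cvgM; first exact: cvg_cst.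
    apply: cvgD; apply: cvgM; [exact: ec|exact: cvg_cst| |exact: cvg_cst].
    by apply: cvgB; [exact: cvg_cst|exact: ec].
  - by apply: integrable_EFinD => //; apply: integrable_norm.
  - move=> k x _; rewrite normrM; apply: (@le_trans _ _ (1 * `|eta k x * divergence phi x + (1 - eta k x) * divergence psi x|)).
      by rewrite ler_wpM2r// indic_norm.
    rewrite mul1r (le_trans (ler_normD _ _))// !normrM; have /andP[h0 h1] := eta01 k x.
    by apply: lerD; rewrite ler_piMl// ger0_norm//; lra.
have -> : pairing (E `&` C) phi + pairing (E `\` C) psi =
   \int[mu]_x (\1_E x * (\1_C x * divergence phi x + (1 - \1_C x) * divergence psi x)).
  rewrite !pairing_indic -RintegralD//; [|exact: integrable_indic_mul|exact: integrable_indic_mul].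
  apply: eq_Rintegral => x _; rewrite !indicE in_setD in_setI.
  by case: (x \in E); case: (x \in C) => /=; lra.
by apply/ler_addgt0Pr => e e0; apply: (cvg_le_near cv); exact: H.
Qed.

(* The hypothesis says that [M] bounds the lower right derivative of [- |E \ tube r|]. *)
Lemma lateral_cut E U phi psi (p r M : R) : measurable E -> (mu E < +oo)%E ->
  per_bound E U p -> tfield U phi -> tfield U psi -> 1 <= r ->
  (forall e0 : R, 0 < e0 -> exists e : R, [/\ 0 < e, e < e0 &
     fine (mu (E `&` annulus r e)) <= M * e]) ->
  pairing (E `&` tube r) phi + pairing (E `\` tube r) psi <= p + 42 / 10 * M.
Proof.
move=> mE fE Ep tphi tpsi r1 HM.
(* The offset 10 keeps the widths at most [1 / 10], as [lateral_cutoff] demands, while they tend to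
   0. *)
have /choice[e he] : forall k : nat, exists e : R, [/\ 0 < e, e < (k + 10)%:R^-1 &
     fine (mu (E `&` annulus r e)) <= M * e].
  by move=> k; apply: HM; rewrite invr_gt0 ltr0n addn_gt0 orbT.
have e10 k : 0 < e k <= 1 / 10.
  have [e0 ek _] := he k; rewrite e0/= div1r; apply: (le_trans (ltW ek)).
  by rewrite lef_pV2 ?posrE ?ltr0n ?addn_gt0 ?orbT// ler_nat leq_addl.
have /choice[eta heta] := fun k => lateral_cutoff r1 (e10 k).
have mA k : measurable (annulus r (e k)).
  rewrite (_ : annulus _ _ = tube (r + e k) `\` tube r).
    by apply: measurableD; exact: measurable_tube.
  apply/seteqP; split => x; rewrite /annulus /tube/= ltNge.
    by move=> /andP[/negP].
  by move=> [h /negP h']; rewrite h' h.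
apply: (@cut_pairing_cvg E U (tube r) eta phi psi _ mE (measurable_tube r) tphi tpsi).
- by move=> k; have [] := heta k.
- by move=> k; have [] := heta k.
- move=> x; have [h|h] := leP (enorm (horiz x)) r.
    rewrite indicE mem_set//; apply: cvg_near_cst; apply: nearW => k.
    by have [_ _ h1 _ _] := heta k; exact: h1.
  rewrite indicE memNset; last by rewrite /tube/= leNgt h.
  apply: cvg_near_cst.
  have d0 : 0 < enorm (horiz x) - r by rewrite subr_gt0.
  near=> k; have [_ _ _ h1 _] := heta k; apply: h1.
  have [_ ek _] := he k.
  have : k.+1%:R^-1 < enorm (horiz x) - r by near: k; exact: near_infty_natSinv_lt (PosNum d0).
  have : (k + 10)%:R^-1 <= k.+1%:R^-1 :> R.
    by rewrite lef_pV2 ?posrE ?ltr0n ?addn_gt0 ?orbT// ler_nat -addn1 leq_add2l.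
  by move=> h2 h3; rewrite -lerBrDl; exact: ltW (lt_trans (lt_le_trans ek h2) h3).
- move=> e' e'0; apply: nearW => k; have [c1 h01 _ _ hs] := heta k.
  have [n1 n1'] : (forall x, enorm (phi x) <= 1) /\ (forall x, enorm (psi x) <= 1).
    by case: tphi; case: tpsi.
  have fEA : (mu (E `&` annulus r (e k)) < +oo)%E.
    by apply: le_lt_trans fE; apply: le_measure; rewrite ?inE//; exact: measurableI.
  have := @cut_perimeter _ _ E U _ phi psi (eta k) p _ mE (mA k) fEA Ep tphi tpsi c1 h01
    (fun x => hs x _ _ (n1 x) (n1' x)).
  move=> /le_trans; apply.
  have [e0 _ hM] := he k.
  rewrite -addrA lerD2l; apply: (@le_trans _ _ (42 / 10 / e k * (M * e k))).
    by rewrite ler_wpM2l// divr_ge0// ltW.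
  rewrite -mulrA (mulrCA _ M) mulVf ?gt_eqF// mulr1; lra.
Unshelve. all: by end_near. Qed.

Lemma height_cutoff (a e : R) : 0 < e ->
  let s x := step ((height x - a) / e) in
  C1 s /\ forall i x, 'D_(e_ i) s x = dstep ((height x - a) / e) * (elast 0 i / e).
Proof.
move=> e0; pose q x : R := (height x - a) / e.
apply: (@C1_step _ _ q (fun i _ => elast 0 i / e) (fun=> 0)).
- move=> x; apply: (@continuousM _ _ (fun x => height x - a) (cst e^-1)); last exact: cst_continuous.
  by apply: (@continuousB _ R^o _ height (cst a)); [exact: height_continuous|exact: cst_continuous].
- by move=> i x; exact: cst_continuous.
- move=> i x h; rewrite mul0r (_ : _ - _ - _ = 0) ?normr0//.
  have -> : elast 0 i = (i == ord_max)%:R :> R.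
    rewrite mxE; case: unliftP => [j ->|->] /=; rewrite ?eqxx// mxE.
    by rewrite eq_sym eq_liftF.
  rewrite /q /height !mxE eqxx/= eq_sym; move: (_%:R) (e^-1) => u v; lra.
Qed.

Lemma sum_elast (w : V) : \sum_i w 0 i * elast 0 i = height w.
Proof.
rewrite (bigD1 ord_max)//= mxE unlift_none/= mulr1 big1 ?addr0// => i im.
rewrite mxE; case: unliftP im => [j ->|->] /=; last by rewrite eqxx.
by rewrite mxE mulr0.
Qed.

Lemma height_le_enorm (w : V) : `|height w| <= enorm w.
Proof. exact: enorm_coord. Qed.

(** A field on the whole space is cut off near the boundary plane. The loss is the slope of the
    cutoff times the volume of a thin strip, which is proportional to its height, so it stays
    bounded by [8 * P]. This makes [fine (perimeter E0 setT)] in [R0_of] a genuine perimeter. *)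
Lemma per_bound_full E : good E -> E `<=` halfspace -> exists p, per_bound E setT p.
Proof.
move=> gE EH; have [mE fE [p Ep]] := gE; have P0 := per_ge0 Ep.
set P := per E halfspace in P0.
(* For the weight 1, [adhesion] is the volume of the strip divided by [s]. It differs from the
   measure of the trace set by at most [P], and that measure is at most [P] as well. *)
have strip_le (s : R) : 0 < s -> fine (mu (E `&` strip 0 s)) <= 2 * P * s.
  move=> s0.
  have m1 : measurable_fun setT (cst 1 : 'rV[R]_n -> R) by exact: measurable_cst.
  have b1 : forall y : 'rV[R]_n, `|cst 1 y| <= 1 :> R by move=> y; rewrite normr1.
  have := adhesion_bound m1 b1 gE s0 (per_boundS (@slab_halfspace _ _ (2 * s)) (good_per gE)).
  have := nu_trset gE; rewrite -/P /adhesion.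
  have -> : \int[mu]_x (cst 1 (horiz x) * \1_(E `&` strip 0 s) x) = fine (mu (E `&` strip 0 s)).
    rewrite -Rintegral_indic; last by apply: measurableI => //; exact: measurable_strip.
    by apply: eq_Rintegral => x _; rewrite mul1r.
  have -> : \int[lebesgue_rV n]_y (cst 1 y * \1_(trset E) y) = fine (lebesgue_rV n (trset E)).
    rewrite -Rintegral_indic; last exact: measurable_trset.
    by apply: eq_Rintegral => x _; rewrite mul1r.
  move=> h1; rewrite ler_norml => /andP[_ h2].
  rewrite -ler_pdivrMr// mulrC; lra.
exists (9 * P) => phi tphi.
pose d (k : nat) : R := k.+1%:R^-1; have d0 k : 0 < d k by rewrite invr_gt0.
pose eta k x : R := step ((height x - d k) / d k).
have c1eta k : C1 (eta k) by have [] := @height_cutoff (d k) (d k) (d0 k).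
have Deta k i x : 'D_(e_ i) (eta k) x = dstep ((height x - d k) / d k) * (elast 0 i / d k).
  by have [_] := @height_cutoff (d k) (d k) (d0 k).
have eta01 k x : 0 <= eta k x <= 1 by exact: step_bounds.
have t0 : tfield setT (fun=> 0 : V) by exact: tfield0.
have n1 : forall x, enorm (phi x) <= 1 by case: tphi.
have eta_pos k x : eta k x != 0 -> d k < height x.
  rewrite ltNge; apply: contraNN => h; apply/eqP; rewrite /eta.
  by have [] := @step_le0 _ ((height x - d k) / d k) _; rewrite // pmulr_lle0 ?invr_gt0// subr_le0.
have tcut k : tfield halfspace (cut_field phi (fun=> 0) (eta k)).
  have [h1 [M h2] _ h4] := cut_field_tfield tphi t0 (c1eta k) (eta01 k).
  split => //; first by exists M.
  exists (d k) => // x; rewrite /cut_field scaler0 addr0 scaler_eq0 negb_or => /andP[/eta_pos hx _].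
  move=> z /ball_rVP[_ /(_ ord_max)]; rewrite /halfspace/= -!/(height _) ltr_distl => /andP[? ?]; lra.
suff : pairing (E `&` halfspace) phi + pairing (E `\` halfspace) (fun=> 0) <= 9 * P.
  rewrite pairing0 addr0 (_ : E `&` halfspace = E)//.
  by apply/seteqP; split => [x []//|x Ex]; split => //; exact: EH.
apply: (@cut_pairing_cvg E setT halfspace eta phi (fun=> 0) _ mE (measurable_upper 0) tphi t0 c1eta eta01).
- move=> x; have [h|h] := ltP 0 (height x).
    rewrite indicE mem_set//; apply: cvg_near_cst.
    have h2 : 0 < height x / 2 by rewrite divr_gt0.
    near=> k.
    have hk : d k < height x / 2 by near: k; exact: near_infty_natSinv_lt (PosNum h2).
    by have [] := @step_ge1 _ ((height x - d k) / d k) _; rewrite // ler_pdivlMr// mul1r; lra.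
  rewrite indicE memNset; last by rewrite /halfspace/= ltNge h.
  apply: cvg_near_cst; apply: nearW => k.
  have [] := @step_le0 _ ((height x - d k) / d k) _; rewrite // pmulr_lle0 ?invr_gt0// subr_le0.
  by apply: (le_trans h); exact: ltW.
- move=> e e0; apply: nearW => k; apply: ler_wpDr; first exact: ltW.
  have := good_per gE (tcut k); rewrite -/P pairing_indic => hP.
  have mEs : measurable (E `&` strip 0 (2 * d k)) by apply: measurableI => //; exact: measurable_strip.
  have fEs : (mu (E `&` strip 0 (2 * d k)) < +oo)%E.
    by apply: le_lt_trans fE; apply: le_measure; rewrite ?inE.
  have iI : mu.-integrable setT (EFin \o (fun x => 2 / d k * \1_(E `&` strip 0 (2 * d k)) x)).
    by apply: integrable_EFinZ => //; exact: integrable_indic_lty.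
  have icut : mu.-integrable setT (EFin \o (fun x => \1_E x * divergence (cut_field phi (fun=> 0) (eta k)) x)).
    by apply: integrable_indic_mul => //; exact: (divergence_integrable (tcut k)).
  have dk2 : 0 < 2 * d k by rewrite mulr_gt0.
  have hS : 2 / d k * fine (mu (E `&` strip 0 (2 * d k))) <= 8 * P.
    apply: (@le_trans _ _ (2 / d k * (2 * P * (2 * d k)))).
      by apply: ler_wpM2l (strip_le _ dk2); rewrite divr_ge0// ltW.
    have aux (a c : R) : 2 / a * (2 * c * (2 * a)) = 8 * c * (a / a) by lra.
    rewrite aux.
    by rewrite divff ?gt_eqF// mulr1.
  apply: (@le_trans _ _ (P + 8 * P)); last by lra.
  apply: le_trans (lerD hP hS).
  rewrite -Rintegral_indic// -RintegralZl//; last exact: integrable_indic_lty.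
  rewrite -RintegralD//; apply: le_Rintegral => //.
  + apply: integrable_indic_mul => //; apply: integrable_EFinD => //.
      exact: (eta_divergence_integrable tphi (C1_continuous (c1eta k))).
    exact: (eta_divergence_integrable t0 (continuous_onem (C1_continuous (c1eta k)))).
  + exact: integrable_EFinD.
  + move=> x _; rewrite (divergence_cut_field tphi t0 (c1eta k)).
    have -> : \sum_i (phi x 0 i - (0 : V) 0 i) * 'D_(e_ i) (eta k) x =
        dstep ((height x - d k) / d k) / d k * height (phi x).
      rewrite -(sum_elast (phi x)) mulr_sumr; apply: eq_bigr => i _; rewrite Deta mxE.
      have aux (a b c f : R) : (c - 0) * (a * (f * b)) = a * b * (c * f) by lra.
      exact: aux.
    rewrite !indicE in_setI; case: (x \in E) => /=; last by rewrite !mul0r mulr0 addr0.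
    set X := (X in 1 * X <= _); rewrite [leLHS]mul1r mul1r -addrA lerDl.
    have /andP[s0 s2] := dstep_bounds ((height x - d k) / d k).
    have hphi : -1 <= height (phi x).
      by have := le_trans (height_le_enorm (phi x)) (n1 x); rewrite ler_norml => /andP[].
    have dV : 0 < (d k)^-1 by rewrite invr_gt0.
    have [hs|hs] := boolP (x \in strip 0 (2 * d k)).
      have aux (a b c : R) : 0 <= a -> a <= 2 -> -1 <= b -> 0 < c -> 0 <= a * c * b + 2 * c.
        move=> a0 a2 b1' c0.
        have h1 : 0 <= a * c * (b + 1) by rewrite !mulr_ge0 ?(ltW c0)//; lra.
        have h2 : 0 <= (2 - a) * c by rewrite mulr_ge0 ?(ltW c0)//; lra.
        by lra.
      by rewrite /= mulr1; exact: aux.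
    rewrite mulr0 addr0; suff -> : dstep ((height x - d k) / d k) = 0 by rewrite !mul0r.
    have [h|h] := leP (height x) 0.
      suff /step_le0[] : (height x - d k) / d k <= 0 by [].
      by rewrite pmulr_lle0 ?invr_gt0// subr_le0 (le_trans h)// (ltW (d0 k)).
    have [h'|h'] := leP (height x) (2 * d k).
      by exfalso; move/negP : hs; apply; rewrite inE /strip/= h h'.
    suff /step_ge1[] : 1 <= (height x - d k) / d k by [].
    by rewrite ler_pdivlMr// mul1r; lra.
Unshelve. all: by end_near. Qed.

End cuts.

Lemma cut_arith (R : realType) (a b p k m e : R) : a + b <= p -> - (k * m) <= b -> k * m <= e -> a <= p + e.
Proof. by move=> *; lra. Qed.

Section height_cut.
Context {R : realType} {n : nat}.
Local Notation mu := (lebesgue_rV n.+1).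
Local Notation V := 'rV[R]_n.+1.
Local Notation e_ i := (delta_mx 0 i : V).
Implicit Types (x v : V) (E U : set V).

(** [z] is 1 where [enorm x <= K] and 0 where [2 * K <= enorm x], with a slope of order 1/K. *)
Let plateau (K : R) : 0 < K -> let z x := step (2 - dotr x x / K ^+ 2) in
  C1 z /\ forall i x, 'D_(e_ i) z x = dstep (2 - dotr x x / K ^+ 2) * (- (2 * x 0 i / K ^+ 2)).
Proof.
move=> K0; pose q x : R := 2 - dotr x x / K ^+ 2.
have K2 : 0 < (K ^+ 2)^-1 by rewrite invr_gt0 exprn_gt0.
have dd i : dotr (e_ i) (e_ i) <= 1.
  by rewrite /dotr (bigD1 i)//= big1 => [|j ji]; rewrite !mxE ?eqxx/= ?(negbTE ji) ?mulr0 ?addr0 ?mulr1.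
have dx x i : dotr x (e_ i) = x 0 i.
  rewrite /dotr (bigD1 i)//= big1 => [|j ji]; rewrite !mxE ?eqxx/= ?(negbTE ji) ?mulr0 ?addr0 ?mulr1//.
apply: (@C1_step _ _ q (fun i x => - (2 * x 0 i / K ^+ 2)) (fun=> (K ^+ 2)^-1)).
- move=> x; apply: (@continuousB _ R^o _ (cst 2) (fun x => dotr x x / K ^+ 2)); first exact: cst_continuous.
  apply: (@continuousM _ _ (fun x => dotr x x) (cst (K ^+ 2)^-1)); last exact: cst_continuous.
  exact: sqdotr_continuous.
- move=> i x; apply: (@continuousN _ R^o _ (fun x : V => 2 * x 0 i / K ^+ 2)).
  apply: (@continuousM _ _ (fun x : V => 2 * x 0 i) (cst (K ^+ 2)^-1)); last exact: cst_continuous.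
  by apply: (@continuousM _ _ (cst 2) (fun x : V => x 0 i)); [exact: cst_continuous|exact: coord_continuous].
- move=> i x h.
  have -> : q (x + h *: e_ i) - q x - h * - (2 * x 0 i / K ^+ 2) = - (h ^+ 2 * dotr (e_ i) (e_ i) / K ^+ 2).
    rewrite /q dotrDl !dotrDr !dotrZl !dotrZr (dotrC (e_ i) x) dx.
    by move: (dotr x x) (dotr (e_ i) (e_ i)) (x 0 i) ((K ^+ 2)^-1) => a b c f; lra.
  rewrite normrN ger0_norm; last by rewrite mulr_ge0 ?(ltW K2)// mulr_ge0 ?sqr_ge0 ?dotr_ge0.
  rewrite mulrC ler_wpM2l ?(ltW K2)// -[leRHS]mulr1.
  by apply: ler_wpM2l; rewrite ?sqr_ge0.
Qed.

Definition below (h : R) : set V := [set x | height x <= h].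

Lemma measurable_below h : measurable (below h).
Proof. by apply: measurable_le_set; [exact: measurable_height|exact: measurable_cst]. Qed.

(* Above height [h] the test field is replaced by a slowly decaying vertical one,
   which points out of [below h] and has almost no divergence there. *)
Lemma height_cut E (s h p : R) : 0 <= s -> s < h -> measurable E -> (mu E < +oo)%E ->
  per_bound E (upper s) p -> per_bound (E `&` below h) (upper s) p.
Proof.
move=> s0 sh mE fE Ep phi tphi.
have [_ [M hM] _ n1] := tphi.
have v0 : 0 <= fine (mu E) by rewrite fine_ge0.
apply/ler_addgt0Pr => e e0.
(* The first summand puts the support of [phi] inside the plateau; the second makes [8 / K] times
   the volume of [E] at most [e]. *)
pose K := Num.sqrt n.+1%:R * Num.max 0 M + 8 * (fine (mu E) + 1) / e + 1.
have K1 : 0 < 8 * (fine (mu E) + 1) / e by rewrite divr_gt0// mulr_gt0// ltr_pwDr.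
have K2 : 0 <= Num.sqrt n.+1%:R * Num.max 0 M by rewrite mulr_ge0 ?sqrtr_ge0// le_max lexx.
have K0 : 0 < K by rewrite /K; lra.
have KM x : phi x != 0 -> enorm x <= K.
  move=> /hM xM; apply: (@le_trans _ _ (Num.sqrt n.+1%:R * Num.max 0 M)); last by rewrite /K; lra.
  apply: enorm_le; first by rewrite le_max lexx.
  move=> i; rewrite le_max; apply/orP; right; apply: le_trans xM.
  rewrite [`|x|]mx_normrE; apply: le_trans (le_bigmax _ _ (ord0, i)) => /=; by rewrite ord1.
have Ke : 8 / K * fine (mu E) <= e.
  rewrite mulrAC ler_pdivrMr// mulrC.
  have : e * (8 * (fine (mu E) + 1) / e) = 8 * (fine (mu E) + 1) by rewrite mulrC divfK ?gt_eqF.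
  have : 0 <= e * (Num.sqrt n.+1%:R * Num.max 0 M + 1) by rewrite mulr_ge0 ?ltW//; lra.
  rewrite /K !mulrDr mulr1; lra.
(* One third of the gap is the margin of [psi] above [s], the next is the rise of [S1]; from
   [s + 2 * w] on, in particular at [h], [S1] equals 1. *)
pose w := (h - s) / 3; have w0 : 0 < w by rewrite divr_gt0// subr_gt0.
have hw : h = s + 3 * w by rewrite /w; lra.
pose S1 x : R := step ((height x - (s + w)) / w).
pose Z x : R := step (2 - dotr x x / K ^+ 2).
have [c1S DS] := @height_cutoff R n (s + w) w w0; have [c1Z DZ] := plateau K0.
pose zeta x := S1 x * Z x.
have c1zeta : C1 zeta by exact: (C1M c1S c1Z).
have zeta01 x : 0 <= zeta x <= 1.
  have /andP[a1 a2] := step_bounds ((height x - (s + w)) / w).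
  have /andP[b1 b2] := step_bounds (2 - dotr x x / K ^+ 2).
  by rewrite /zeta mulr_ge0//= mulr_ile1.
have Zx x : 2 * K <= enorm x -> step (2 - dotr x x / K ^+ 2) = 0 /\ dstep (2 - dotr x x / K ^+ 2) = 0.
  move=> hx; apply: step_le0; rewrite subr_le0 ler_pdivlMr ?exprn_gt0// -sqr_enorm.
  have : (2 * K) ^+ 2 <= enorm x ^+ 2 by rewrite lerXn2r ?nnegrE ?enorm_ge0// mulr_ge0// ltW.
  by have := exprn_gt0 2 K0; rewrite exprMn; lra.
pose psi x : V := zeta x *: elast.
have psiE j : (fun x => psi x 0 j) = (fun x => elast 0 j * zeta x).
  by apply/funext => x; rewrite mxE mulrC.
have tpsi : tfield (upper s) psi.
  split.
  - by move=> j; rewrite psiE; exact: C1Z.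
  - exists (2 * K) => x; rewrite /psi scaler_eq0 negb_or => /andP[zx _].
    apply: (le_trans (norm_le_enorm x)); rewrite leNgt; apply: contraNN zx => /ltW/Zx[h0 _].
    by rewrite /zeta /Z h0 mulr0.
  - exists w => // x; rewrite /psi scaler_eq0 negb_or => /andP[zx _].
    have hx : s + w < height x.
      rewrite ltNge; apply: contraNN zx => hx; rewrite /zeta /S1.
      have [-> _] : step ((height x - (s + w)) / w) = 0 /\ dstep ((height x - (s + w)) / w) = 0.
        by apply: step_le0; rewrite pmulr_lle0 ?invr_gt0// subr_le0.
      by rewrite mul0r.
    move=> z /ball_rVP[_ /(_ ord_max)]; rewrite /upper/= -!/(height _) ltr_distl => /andP[? ?]; lra.
  - move=> x; rewrite /psi enormZ enorm_elast mulr1; have /andP[? ?] := zeta01 x.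
    by rewrite ger0_norm.
have S1x x : h <= height x -> step ((height x - (s + w)) / w) = 1 /\ dstep ((height x - (s + w)) / w) = 0.
  by move=> hx; apply: step_ge1; rewrite ler_pdivlMr// mul1r; lra.
(* Above [h] only the plateau varies. Its vertical slope is at most [4 / K ^+ 2] times the height,
   and the height is at most [2 * K] where the slope is not 0. *)
have divpsi x : h <= height x -> - (8 / K) <= divergence psi x.
  move=> hx; have [e1 e2] := S1x x hx.
  rewrite divergenceE; last by move=> j; rewrite psiE; exact: C1Z.
  have -> : \sum_i 'D_(e_ i) (fun y => psi y 0 i) x =
     \sum_i (- (2 / K ^+ 2 * dstep (2 - dotr x x / K ^+ 2)) * x 0 i) * elast 0 i.
    apply: eq_bigr => i _; rewrite psiE.
    have dS : derivable S1 x (e_ i) by have [] := c1S i.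
    have dZ : derivable Z x (e_ i) := (c1Z i).1 x.
    have dz : derivable zeta x (e_ i) := (c1zeta i).1 x.
    have -> : 'D_(e_ i) (fun x => elast 0 i * zeta x) x = elast 0 i * 'D_(e_ i) zeta x.
      exact: (deriveZ (elast 0 i) dz).
    have -> : 'D_(e_ i) zeta x = S1 x * 'D_(e_ i) Z x + Z x * 'D_(e_ i) S1 x.
      exact: (deriveM dS dZ).
    rewrite DZ DS e2 /S1 e1.
    have aux (a b c f g v : R) : c * (1 * (a * - (2 * b * f)) + g * (0 * v)) = - (2 * f * a) * b * c by lra.
    exact: aux.
  have -> : \sum_i (- (2 / K ^+ 2 * dstep (2 - dotr x x / K ^+ 2)) * x 0 i) * elast 0 i =
     - (2 / K ^+ 2 * dstep (2 - dotr x x / K ^+ 2)) * height x.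
    by rewrite -sum_elast mulr_sumr; apply: eq_bigr => i _; exact: esym (mulrA _ _ _).
  have [hx2|/ltW hx2] := leP (2 * K) (enorm x).
    by rewrite (Zx x hx2).2 mulr0 oppr0 mul0r oppr_le0 divr_ge0// ltW.
  rewrite mulNr lerN2.
  have hh : height x <= 2 * K by apply: (le_trans _ (le_trans (height_le_enorm x) hx2)); exact: ler_norm.
  have h0 : 0 <= height x by lra.
  have /andP[d0 d2] := dstep_bounds (2 - dotr x x / K ^+ 2).
  apply: (@le_trans _ _ (2 / K ^+ 2 * 2 * (2 * K))).
    apply: ler_pM => //; first by rewrite mulr_ge0// divr_ge0// sqr_ge0.
    by rewrite ler_wpM2l// divr_ge0// sqr_ge0.
  rewrite (_ : 2 / K ^+ 2 * 2 * (2 * K) = 8 * (K / K ^+ 2)); last by move: (K ^+ 2)^-1 => u; lra.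
  rewrite (_ : K / K ^+ 2 = K^-1)// expr2 invfM mulrA divff ?gt_eqF// mul1r//.
pose d (k : nat) : R := k.+1%:R^-1; have dk0 k : 0 < d k by rewrite invr_gt0.
pose eta k x : R := 1 - step ((height x - h) / d k).
have c1eta k : C1 (eta k).
  by have [c1 _] := @height_cutoff R n h (d k) (dk0 k); exact: (C1B (C1_cst 1) c1).
have Deta k i x : 'D_(e_ i) (eta k) x = - (dstep ((height x - h) / d k) * (elast 0 i / d k)).
  have [c1 D1] := @height_cutoff R n h (d k) (dk0 k); have [dst _] := c1 i.
  have [_ H] := @is_deriveB _ _ R^o (cst (1 : R)) (fun x => step ((height x - h) / d k)) x (e_ i) 0 _
    (is_derive_cst _ _ _) (DeriveDef (dst x) erefl).
  by rewrite sub0r D1 in H.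
have eta01 k x : 0 <= eta k x <= 1.
  by rewrite /eta; have /andP[? ?] := step_bounds ((height x - h) / d k); apply/andP; split; lra.
have cut : pairing (E `&` below h) phi + pairing (E `\` below h) psi <= p.
  apply: (@cut_pairing_cvg R n E (upper s) (below h) eta phi psi _ mE (measurable_below h) tphi tpsi c1eta eta01).
  - move=> x; have [hx|hx] := leP (height x) h.
      rewrite indicE mem_set//; apply: cvg_near_cst; apply: nearW => k.
      rewrite /eta; have [-> _] : step ((height x - h) / d k) = 0 /\ dstep ((height x - h) / d k) = 0.
        by apply: step_le0; rewrite pmulr_lle0 ?invr_gt0// subr_le0.
      by rewrite subr0.
    rewrite indicE memNset; last by rewrite /below/= leNgt hx.
    have hx0 : 0 < height x - h by rewrite subr_gt0.
    apply: cvg_near_cst; near=> k.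
    have hk : d k < height x - h by near: k; exact: near_infty_natSinv_lt (PosNum hx0).
    rewrite /eta; have [-> _] : step ((height x - h) / d k) = 1 /\ dstep ((height x - h) / d k) = 0.
      by apply: step_ge1; rewrite ler_pdivlMr// mul1r ltW.
    by rewrite subrr.
  - move=> e' e'0; apply: nearW => k.
    have f0 : (mu (E `&` set0) < +oo)%E by rewrite setI0 measure0.
    have := @cut_perimeter _ _ E (upper s) set0 phi psi (eta k) p 0 mE measurable0 f0 Ep tphi tpsi
      (c1eta k) (eta01 k) _.
    rewrite mul0r addr0 => H; apply: (@le_trans _ _ p); last by rewrite lerDl ltW.
    apply: H => x; rewrite mul0r oppr0.
    (* Above [h], where [eta k] decreases, [psi] is the unit vertical vector wherever [phi] is not
       0, and [height (phi x)] is at most 1; hence the gradient term is nonnegative. *)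
    have -> : \sum_i (phi x 0 i - psi x 0 i) * 'D_(e_ i) (eta k) x =
        dstep ((height x - h) / d k) / d k * (zeta x - height (phi x)).
      have -> : zeta x - height (phi x) = height (psi x - phi x).
        by rewrite /psi /height !mxE unlift_none/= mulr1.
      rewrite -(sum_elast (psi x - phi x)) mulr_sumr; apply: eq_bigr => i _; rewrite Deta !mxE.
      have aux (a b c f g : R) : (c - g) * - (a * (f * b)) = a * b * ((g - c) * f) by lra.
      exact: aux.
    have /andP[d0 d2] := dstep_bounds ((height x - h) / d k).
    have [hx|hx] := leP (height x) h.
      have [_ ->] : step ((height x - h) / d k) = 0 /\ dstep ((height x - h) / d k) = 0.
        by apply: step_le0; rewrite pmulr_lle0 ?invr_gt0// subr_le0.
      by rewrite !mul0r.
    apply: mulr_ge0; first by rewrite divr_ge0// ltW.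
    rewrite subr_ge0; have [px|px] := eqVneq (phi x) 0.
      by rewrite px /height mxE; have /andP[] := zeta01 x.
    apply: (@le_trans _ _ 1).
      by have := le_trans (height_le_enorm (phi x)) (n1 x); rewrite ler_norml => /andP[].
    rewrite /zeta /S1 (S1x x (ltW hx)).1 mul1r /Z.
    have [-> //] : step (2 - dotr x x / K ^+ 2) = 1 /\ dstep (2 - dotr x x / K ^+ 2) = 0.
    apply: step_ge1.
    have : dotr x x / K ^+ 2 <= 1.
      rewrite ler_pdivrMr ?exprn_gt0// mul1r -sqr_enorm.
      by rewrite lerXn2r ?nnegrE ?enorm_ge0 ?(ltW K0)//; exact: KM.
    by lra.
have mD : measurable (E `\` below h) by apply: measurableD => //; exact: measurable_below.
have fD : (mu (E `\` below h) < +oo)%E by apply: le_lt_trans fE; apply: le_measure; rewrite ?inE.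
have low : - (8 / K * fine (mu E)) <= pairing (E `\` below h) psi.
  apply: (@le_trans _ _ (- (8 / K) * fine (mu (E `\` below h)))).
    rewrite mulNr lerN2 ler_wpM2l ?divr_ge0 ?(ltW K0)// fine_le ?ge0_fin_numE//.
    by apply: le_measure; rewrite ?inE.
  rewrite -Rintegral_indic// -RintegralZl//; last exact: integrable_indic_lty.
  rewrite pairing_indic; apply: le_Rintegral => //.
  - by apply: integrable_EFinZ => //; exact: integrable_indic_lty.
  - by apply: integrable_indic_mul => //; exact: (divergence_integrable tpsi).
  - move=> x _; rewrite mulrC indicE; have [/set_mem[_ hx]|_] := boolP (x \in _); last by rewrite !mul0r.
    by rewrite !mul1r divpsi// ltW// ltNge; apply/negP.
exact: (cut_arith cut low Ke).
Unshelve. all: by end_near. Qed.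

End height_cut.

(** * Decay to zero in finite length, and the numerical bound for the radius *)

Section decay.
Context {R : realType}.

(* Real induction: the set of [u] with [g (r0 + u) <= g r0 - q u] is closed under
   suprema because [g] is nonincreasing. *)
Lemma dini_decay (g : R -> R) (r0 q T : R) : 0 < q -> 0 <= T ->
  (forall r s, r0 <= r -> r <= s -> g s <= g r) -> (forall r, 0 <= g r) ->
  (forall r, r0 <= r -> 0 < g r -> exists2 e0 : R, 0 < e0 &
     forall e, 0 < e -> e < e0 -> g (r + e) <= g r - q * e) ->
  g r0 <= q * T -> g (r0 + T) = 0.
Proof.
move=> q0 T0 mono g0 step gT; apply: contrapT => /eqP gn0.
have gp : 0 < g (r0 + T) by rewrite lt_neqAle eq_sym gn0 g0.
pose S : set R := [set u | 0 <= u <= T /\ g (r0 + u) <= g r0 - q * u].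
have S0 : S 0 by split; rewrite ?lexx ?T0// addr0 mulr0 subr0.
have hS : has_sup S by split; [exists 0|exists T => u [/andP[]]].
pose u := sup S.
have u0 : 0 <= u by apply: ub_le_sup => //; exact: hS.2.
have uT : u <= T by apply: ge_sup; [exact: hS.1|move=> v [/andP[]]].
have Su : S u.
  split; first by rewrite u0 uT.
  apply/ler_addgt0Pr => e e0; have eq0 : 0 < e / q by rewrite divr_gt0.
  have [v Sv uv] := sup_adherent eq0 hS.
  have vu : v <= u by apply: ub_le_sup => //; exact: hS.2.
  have [/andP[v0 _] hv] := Sv.
  have h1 : g (r0 + u) <= g (r0 + v) by apply: mono; lra.
  have h2 : q * (u - e / q) < q * v by rewrite ltr_pM2l.
  rewrite mulrBr mulrCA divff ?gt_eqF// mulr1 in h2.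
  by lra.
have [uT'|Tu] := ltP u T; last first.
  have uE : u = T by apply/eqP; rewrite eq_le uT Tu.
  by have [_] := Su; rewrite uE; lra.
have gu : 0 < g (r0 + u) by apply: (lt_le_trans gp); apply: mono; lra.
have [|e0 e00 he] := step (r0 + u) _ gu; first by rewrite lerDl.
pose e := Num.min e0 (T - u) / 2.
have [ep [ee eT]] : 0 < e /\ e < e0 /\ u + e <= T.
  have m0 : 0 < Num.min e0 (T - u) by rewrite lt_min e00 subr_gt0.
  have m1 : Num.min e0 (T - u) <= e0 by rewrite ge_min lexx.
  have m2 : Num.min e0 (T - u) <= T - u by rewrite ge_min lexx orbT.
  by rewrite /e; split; [|split]; lra.
have : S (u + e).
  split; first by rewrite eT andbT; lra.
  have := he e ep ee; rewrite -addrA; have [_] := Su; rewrite mulrDr; lra.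
move=> /(ub_le_sup hS.2); rewrite -/u; lra.
Qed.

Lemma pow_diff_le (m : nat) (a b : R) : 0 <= b -> b <= a ->
  a ^+ m.+1 - b ^+ m.+1 <= m.+1%:R * a ^+ m * (a - b).
Proof.
move=> b0 ba; have a0 := le_trans b0 ba.
elim: m => [|m IH]; first by rewrite !expr1 expr0 mul1r mul1r.
have h : b ^+ m.+1 <= a ^+ m.+1 by rewrite lerXn2r.
rewrite exprS [b ^+ _]exprS.
have -> : a * a ^+ m.+1 - b * b ^+ m.+1 = a * (a ^+ m.+1 - b ^+ m.+1) + (a - b) * b ^+ m.+1 by lra.
have h1 : a * (a ^+ m.+1 - b ^+ m.+1) <= m.+1%:R * a ^+ m.+1 * (a - b).
  apply: (le_trans (ler_wpM2l a0 IH)); rewrite [X in _ <= _ * X * _]exprS.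
  by rewrite le_eqVlt; apply/orP; left; apply/eqP; lra.
have h2 : (a - b) * b ^+ m.+1 <= a ^+ m.+1 * (a - b).
  by rewrite mulrC ler_wpM2r// subr_ge0.
apply: (le_trans (lerD h1 h2)).
by rewrite -[m.+2]addn1 natrD !mulrDl mul1r.
Qed.

Definition rt (m : nat) (v : R) : R := v `^ m%:R^-1.

Lemma rt_ge0 m v : 0 <= rt m v. Proof. exact: powR_ge0. Qed.

Lemma rtK m v : (0 < m)%N -> 0 <= v -> rt m v ^+ m = v.
Proof.
by move=> m0 v0; rewrite -powR_mulrn ?rt_ge0// -powRrM mulVf ?powRr1// pnatr_eq0 -lt0n.
Qed.

Lemma rt_le m u v : 0 <= u -> u <= v -> rt m u <= rt m v.
Proof. by move=> u0 uv; rewrite /rt ge0_ler_powR ?nnegrE ?invr_ge0// (le_trans u0). Qed.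

(** Everything is reduced to powers of 2 by [n.+1 <= 2 ^ n] and [n.+4 <= 5 / 2 * 2 ^ n]. The base
    left over, 441/40, is the square of 21/10 times 5/2, and 23 times it is below 256. The exponents
    then compare as 3n with 3n^2. *)
Let numeric n : (1 <= n)%N ->
  (21 / 10 * n.+1%:R) ^+ (2 * n.+1) * n.+4%:R ^+ n.+3 * 4 ^+ 2 <=
  ((8 : R) ^+ (n ^ 2 + n + 1)) ^+ 2 * (4 ^+ n) ^+ 2.
Proof.
move=> n1; set N := n.+1.
have n1R : 1 <= n%:R :> R by rewrite ler1n.
have h1 : N%:R <= 2 ^+ n :> R by rewrite -natrX ler_nat; exact: ltn_expl.
have h2 : n.+4%:R <= 5 / 2 * 2 ^+ n :> R.
  elim: n n1 {N h1 n1R} => // -[|k] IH _; first by rewrite expr1; lra.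
  rewrite exprS -[k.+2.+4]addn1 natrD; have := IH isT.
  have : 1 <= 2 ^+ k.+1 :> R by rewrite exprn_ege1//; lra.
  move: (2 ^+ k.+1) (k.+1.+4%:R) => u v ? ?; lra.
have N0 : 0 <= N%:R :> R by []; have N40 : 0 <= n.+4%:R :> R by [].
have p0 : 0 <= 2 ^+ n :> R by rewrite exprn_ge0.
apply: (@le_trans _ _ ((21 / 10 * 2 ^+ n) ^+ (2 * N) * (5 / 2 * 2 ^+ n) ^+ n.+3 * 4 ^+ 2)).
  rewrite ler_wpM2r ?exprn_ge0//; apply: ler_pM; rewrite ?exprn_ge0 ?mulr_ge0//; try lra.
  - by rewrite lerXn2r ?nnegrE ?mulr_ge0//; lra.
  - by rewrite lerXn2r ?nnegrE ?mulr_ge0//; lra.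
have -> : (21 / 10 * 2 ^+ n) ^+ (2 * N) * (5 / 2 * 2 ^+ n) ^+ n.+3 * 4 ^+ 2 =
   (441 / 40) ^+ N * 100 * (2 : R) ^+ (n * (2 * N) + n * n.+3).
  have x1 : (21 / 10 * 2 ^+ n) ^+ (2 * N) = ((21 / 10) ^+ 2) ^+ N * (2 : R) ^+ (n * (2 * N)).
    by rewrite exprMn (exprM (21 / 10)) -(exprM 2).
  have x2 : (5 / 2 * 2 ^+ n) ^+ n.+3 = (5 / 2) ^+ N * (25 / 4) * (2 : R) ^+ (n * n.+3).
    rewrite exprMn -exprM; congr (_ * _); rewrite -(addn2 n.+1) exprD; congr (_ * _).
    by lra.
  have x3 : (441 / 40) ^+ N = ((21 / 10) ^+ 2) ^+ N * (5 / 2) ^+ N :> R.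
    by rewrite -exprMn; congr (_ ^+ N); lra.
  rewrite x1 x2 x3 exprD.
  have aux (a b c d : R) : a * c * (b * (25 / 4) * d) * 4 ^+ 2 = a * b * 100 * (c * d) by lra.
  exact: aux.
have h3 : (441 / 40) ^+ N * 100 <= 2 ^+ (8 * N) / 4 :> R.
  have h4 : 400 <= 23 ^+ N :> R.
    apply: (@le_trans _ _ (23 ^+ 2)); first lra.
    by rewrite ler_eXn2l ?ltr1n.
  have h5 : (441 / 40) ^+ N * 23 ^+ N <= 2 ^+ (8 * N) :> R.
    rewrite exprM -exprMn lerXn2r ?nnegrE; lra.
  have h6 : 0 <= (441 / 40) ^+ N :> R by rewrite exprn_ge0//; lra.
  have := ler_wpM2l h6 h4; move: h5; move: (_ ^+ N) (23 ^+ N) (2 ^+ _) => a b c ? ?; lra.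
have p2 : 0 <= (2 : R) ^+ (n * (2 * N) + n * n.+3) by rewrite exprn_ge0.
apply: (le_trans (ler_wpM2r p2 h3)).
have -> : ((8 : R) ^+ (n ^ 2 + n + 1)) ^+ 2 * (4 ^+ n) ^+ 2 =
    2 ^+ (6 * (n ^ 2 + n + 1) + 4 * n + 2) / 4.
  have e8 : (8 : R) = 2 ^+ 3 by lra.
  have e4 : (4 : R) = 2 ^+ 2 by lra.
  rewrite [in LHS]e8 [in LHS]e4 -!exprM exprD exprD.
  rewrite (_ : 3 * ((n ^ 2 + n + 1) * 2) = 6 * (n ^ 2 + n + 1))%N; last by rewrite mulnCA [RHS]mulnC.
  rewrite (_ : 2 * (n * 2) = 4 * n)%N; last by rewrite mulnCA [RHS]mulnC.
  have aux (a b : R) : a * b = a * b * 2 ^+ 2 / 4 by lra.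
  exact: aux.
rewrite mulrAC -exprD ler_wpM2r ?invr_ge0// ler_eXn2l ?ltr1n//.
rewrite -(ler_nat R) !natrD !natrM ?natrX /N -[n.+3]addn3 -[n.+1]addn1 !natrD.
move: n1R; move: (n%:R : R) => y y1; have : 0 <= y * (y - 1) by rewrite mulr_ge0//; lra.
by lra.
Qed.

(** If [T] reached both terms [A] and [B] of the maximum, [T ^+ n.+1] would be at least
    [A * B ^+ n]. This product has the powers of [x] and [kappa] that occur in the upper bound for
    [T ^+ n.+1]: [x] through [A], and [kappa] through [kappa^-1 + 2], which strictly exceeds
    [kappa^-1]. The numerical factor is left to [numeric]. *)
Lemma radius_bound n (kappa x g0 C : R) : (1 <= n)%N -> 0 < kappa -> 0 <= x -> 0 <= g0 -> 0 <= C ->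
  (C ^+ n.+1) ^+ 2 = 4 * n.+4%:R ^+ n.+1 -> g0 ^+ n <= C * x ->
  21 / 10 * n.+1%:R * C * g0 / kappa <
  Num.max (8 ^+ (n ^ 2 + n + 1) * x `^ (n.+1%:R / n%:R)) (4 * mu_of n kappa).
Proof.
move=> n1 k0 x0 g00 C0 HC hg.
have n0 : (n%:R : R) != 0 by rewrite pnatr_eq0 -lt0n.
have n1R : 1 <= n%:R :> R by rewrite ler1n.
set T := _ / kappa.
have pw y : 0 <= y -> y `^ (n.+1%:R / n%:R) = rt n y ^+ n.+1.
  by move=> y0; rewrite mulrC powRrM powR_mulrn ?powR_ge0.
pose k1 := rt n (kappa^-1 + 2).
have kV : 0 < kappa^-1 by rewrite invr_gt0.
have kk : kappa^-1 < k1 ^+ n.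
  by rewrite /k1 rtK ?addr_ge0 ?(ltW kV)// ltrDl.
have k10 : 0 < k1.
  have k1n := rt_ge0 n (kappa^-1 + 2); rewrite lt_neqAle eq_sym k1n andbT; apply/eqP => h.
  by move: kk; rewrite h expr0n gtn_eqF//= => /(lt_trans kV); rewrite ltxx.
rewrite /mu_of pw// pw ?addr_ge0 ?(ltW kV)// -/k1.
set xi := rt n x; have xi0 : 0 <= xi by exact: rt_ge0.
have xiE : xi ^+ n = x by rewrite /xi rtK.
have Bp : 0 < 4 * k1 ^+ n.+1 by rewrite mulr_gt0// exprn_gt0.
rewrite lt_max; apply/orP; have [xi00|xin] := eqVneq xi 0.
  right; apply: le_lt_trans Bp; rewrite /T; suff -> : g0 = 0 by rewrite mulr0 mul0r.
  have : g0 ^+ n = 0.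
    apply/eqP; rewrite eq_le exprn_ge0// andbT (le_trans hg)// -xiE xi00 expr0n gtn_eqF//.
    by rewrite mulr0.
  by move/eqP; rewrite expf_eq0 => /andP[_ /eqP].
have xip : 0 < xi by rewrite lt_neqAle eq_sym xin.
apply: contrapT => /not_orP[/negP]; rewrite -leNgt => hA /negP; rewrite -leNgt => hB.
set a8 := (8 ^+ _ : R) in hA.
have a80 : 0 < a8 by rewrite exprn_gt0.
set A := a8 * _ in hA; set B := 4 * _ in hB Bp.
have A0 : 0 < A by rewrite mulr_gt0// exprn_gt0.
have T0 : 0 < T by exact: lt_le_trans A0 hA.
(* The exponent [n] brings in the bound for [T ^+ n], and the factor 2 the squared form [HC] of the
   constant [C]. *)
have c1 : (A * B ^+ n) ^+ (2 * n) <= (T ^+ n.+1) ^+ (2 * n).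
  rewrite lerXn2r ?nnegrE ?exprn_ge0 ?(ltW T0)//.
    by rewrite mulr_ge0 ?exprn_ge0 ?(ltW A0) ?(ltW Bp).
  by rewrite exprS ler_pM ?exprn_ge0 ?(ltW A0) ?(ltW Bp)// lerXn2r ?nnegrE ?(ltW T0) ?(ltW Bp).
pose q : R := 21 / 10 * n.+1%:R.
have q0 : 0 < q by rewrite mulr_gt0//; lra.
have c2 : T ^+ n <= (q * C / kappa) ^+ n * (C * x).
  rewrite /T -/q (_ : q * C * g0 / kappa = q * C / kappa * g0); last by rewrite mulrAC.
  by rewrite exprMn ler_wpM2l// exprn_ge0// divr_ge0 ?(ltW k0)// mulr_ge0 ?(ltW q0).
have c3 : (T ^+ n.+1) ^+ (2 * n) <= ((q * C / kappa) ^+ n * (C * x)) ^+ (2 * n.+1).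
  rewrite -exprM (_ : n.+1 * (2 * n) = n * (2 * n.+1))%N; last by rewrite mulnCA (mulnC n.+1) mulnCA.
  by rewrite exprM lerXn2r ?nnegrE ?exprn_ge0 ?(ltW T0)// (le_trans _ c2)// exprn_ge0// ltW.
have := le_trans c1 c3; apply/negP; rewrite -ltNge.
pose W : R := 4 * n.+4%:R ^+ n.+1; have W0 : 0 <= W by rewrite mulr_ge0// exprn_ge0.
have CW : C ^+ (2 * n.+1) = W by rewrite mulnC exprM.
have -> : ((q * C / kappa) ^+ n * (C * x)) ^+ (2 * n.+1) =
   (q ^+ (2 * n.+1)) ^+ n * W ^+ n.+1 * (xi ^+ (2 * n.+1)) ^+ n * (kappa^-1 ^+ (2 * n.+1)) ^+ n.
  have xe : x ^+ (2 * n.+1) = (xi ^+ (2 * n.+1)) ^+ n by rewrite -xiE -!exprM mulnC.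
  have ye : ((q * C / kappa) ^+ n) ^+ (2 * n.+1) = ((q * C / kappa) ^+ (2 * n.+1)) ^+ n.
    by rewrite -!exprM mulnC.
  have y2 : (q * C / kappa) ^+ (2 * n.+1) = q ^+ (2 * n.+1) * W * kappa^-1 ^+ (2 * n.+1).
    by rewrite -CW -!exprMn.
  have z2 : (C * x) ^+ (2 * n.+1) = W * (xi ^+ (2 * n.+1)) ^+ n by rewrite -CW -xe -exprMn.
  rewrite exprMn ye y2 z2 2!exprMn [W ^+ n.+1]exprS.
  have aux (a b c d e : R) : a * b * c * (d * e) = a * (d * b) * e * c by lra.
  exact: aux.
have -> : (A * B ^+ n) ^+ (2 * n) = (a8 ^+ 2 * (4 ^+ n) ^+ 2) ^+ n *
   (xi ^+ (2 * n.+1)) ^+ n * ((k1 ^+ n) ^+ (2 * n.+1)) ^+ n.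
  have eA : A ^+ 2 = a8 ^+ 2 * xi ^+ (2 * n.+1) by rewrite /A exprMn -(exprM xi) (mulnC n.+1).
  have eB : (B ^+ n) ^+ 2 = (4 ^+ n) ^+ 2 * (k1 ^+ n) ^+ (2 * n.+1).
    by rewrite /B 2!exprMn -!(exprM k1) (mulnC n.+1 n) -mulnA (mulnC n.+1 2).
  have aux (a b c d : R) : ((a * b) * (c * d)) ^+ n = (a * c) ^+ n * b ^+ n * d ^+ n.
    by rewrite -!exprMn; congr (_ ^+ n); lra.
  have aux2 (a b : R) : (a * b) ^+ 2 = a ^+ 2 * b ^+ 2 by rewrite exprMn.
  rewrite exprM aux2 eA eB; exact: aux.
have num : (q ^+ (2 * n.+1)) ^+ n * W ^+ n.+1 <= (a8 ^+ 2 * (4 ^+ n) ^+ 2) ^+ n.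
  apply: (@le_trans _ _ ((q ^+ (2 * n.+1) * n.+4%:R ^+ n.+3 * 4 ^+ 2) ^+ n)); last first.
    apply: lerXn2r; last exact: numeric.
    - rewrite nnegrE; apply: mulr_ge0; last exact: exprn_ge0.
      by apply: mulr_ge0; apply: exprn_ge0 => //; exact: ltW.
    - by rewrite nnegrE; apply: mulr_ge0; apply: exprn_ge0; [exact: ltW|exact: exprn_ge0].
  have aux (a b c : R) : (a * b * c) ^+ n = a ^+ n * (b ^+ n * c ^+ n) by rewrite 2!exprMn mulrA.
  have WE : W ^+ n.+1 = n.+4%:R ^+ (n.+1 * n.+1) * 4 ^+ n.+1 by rewrite /W exprMn mulrC -exprM.
  rewrite aux; apply: ler_wpM2l; first by apply: exprn_ge0; apply: exprn_ge0; exact: ltW.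
  rewrite WE -(exprM n.+4%:R) -(exprM 4).
  apply: ler_pM; rewrite ?exprn_ge0//.
    rewrite ler_eXn2l ?ltr1n// -(ler_nat R) !natrM -[n.+3]addn3 -[n.+1]addn1 !natrD.
    by move: n1R; move: (n%:R : R) => y y1; lra.
  rewrite ler_eXn2l ?ltr1n// -(ler_nat R) !natrM -[n.+1]addn1 !natrD.
  by move: n1R; move: (n%:R : R) => y y1; lra.
apply: (@le_lt_trans _ _ ((a8 ^+ 2 * (4 ^+ n) ^+ 2) ^+ n * (xi ^+ (2 * n.+1)) ^+ n * (kappa^-1 ^+ (2 * n.+1)) ^+ n)).
  by rewrite ler_wpM2r ?exprn_ge0 ?(ltW kV)// ler_wpM2r ?exprn_ge0.
rewrite ltr_pM2l; last by rewrite !mulr_gt0 ?exprn_gt0// mulr_gt0 ?exprn_gt0.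
rewrite ltrXn2r -?lt0n// ?exprn_ge0 ?(ltW kV) ?(ltW k10)// ltrXn2r// ?(ltW kV) ?exprn_ge0 ?(ltW k10)//.
Qed.

End decay.

(** * Cuts of the capillary energy and lateral decay *)

Section linear_arithmetic.
Context {R : realType}.
Implicit Types a b c d e f m p q r s x y z : R.

Lemma ler_halves a b c d f m e : c - e / 2 < a -> d - e / 2 < b -> a + b <= f + m ->
  c + d <= f + m + e.
Proof. by move=> *; lra. Qed.

Lemma ler_split_halves a b c p q r x y z m e : a <= p - x + e / 2 -> b <= q - y + e / 2 ->
  r - z <= c -> p + q <= r + m -> x + y = z -> a + b <= c + m + e.
Proof. by move=> *; lra. Qed.

Lemma ler_chain a c p q x z e : a <= p - x + e -> q - z <= c -> p <= q -> x = z -> a <= c + e.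
Proof. by move=> *; lra. Qed.

Lemma decay_rearrange c p q x y z : c / 2 * (2 * p * q) <= c / 2 * (42 / 10 * (x * z * y)) ->
  p * (c * q) <= 21 / 10 * x * c * z * y.
Proof. by move=> *; lra. Qed.

Lemma mulr_rearrange a b c d : a * b * c * d = b * (c * a * d).
Proof. by lra. Qed.

End linear_arithmetic.

Section capillary_cuts.
Context {R : realType} {n : nat}.
Local Notation mu := (lebesgue_rV n.+1).
Local Notation nu := (lebesgue_rV n).
Local Notation V := 'rV[R]_n.+1.
Local Notation Y := 'rV[R]_n.
Implicit Types (x : V) (y : Y) (E F U : set V).

(** The hypothesis of [lateral_cut]. Its failure at [r] says that every short annulus holds more
    than [M] times its width, which is what [dini_decay] feeds on. *)
Definition slow_decay E (r M : R) := forall e0 : R, 0 < e0 -> exists e : R,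
  [/\ 0 < e, e < e0 & fine (mu (E `&` annulus r e)) <= M * e].

Lemma per_lateral E U (p r M : R) : measurable E -> (mu E < +oo)%E -> per_bound E U p ->
  1 <= r -> slow_decay E r M ->
  [/\ exists q, per_bound (E `&` tube r) U q, exists q, per_bound (E `\` tube r) U q &
   per (E `&` tube r) U + per (E `\` tube r) U <= per E U + 42 / 10 * M].
Proof.
move=> mE fE Ep r1 HM.
have h1 : per_bound (E `&` tube r) U (p + 42 / 10 * M).
  move=> phi tphi; have := lateral_cut mE fE Ep tphi (@tfield0 _ _ U) r1 HM.
  by rewrite pairing0 addr0.
have h2 : per_bound (E `\` tube r) U (p + 42 / 10 * M).
  move=> phi tphi; have := lateral_cut mE fE Ep (@tfield0 _ _ U) tphi r1 HM.
  by rewrite pairing0 add0r.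
split; [by eexists; exact: h1|by eexists; exact: h2|].
apply/ler_addgt0Pr => e e0; have e2 : 0 < e / 2 by rewrite divr_gt0.
have [phi tphi hphi] := per_approx h1 e2; have [psi tpsi hpsi] := per_approx h2 e2.
have := lateral_cut mE fE (per_ub Ep) tphi tpsi r1 HM.
exact: ler_halves hphi hpsi.
Qed.

Variable b : Y -> R.
Hypotheses (mb : measurable_fun setT b) (b1 : forall y, `|b y| <= 1).

(** As in [capJ_submodular], all energies are compared at one small [s], where [adhesion] is
    additive over the two pieces. *)
Lemma capJ_lateral E (r M : R) : good E -> 1 <= r -> slow_decay E r M ->
  [/\ good (E `&` tube r), good (E `\` tube r) &
   capJ b (E `&` tube r) + capJ b (E `\` tube r) <= capJ b E + 42 / 10 * M].
Proof.
move=> gE r1 HM; have [mE fE [p Ep]] := gE.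
have mI : measurable (E `&` tube r) by apply: measurableI => //; exact: measurable_tube.
have mD : measurable (E `\` tube r) by apply: measurableD => //; exact: measurable_tube.
have [hI hD _] := per_lateral mE fE Ep r1 HM.
have gI : good (E `&` tube r).
  split => //; apply: le_lt_trans fE; by apply: le_measure; rewrite ?inE.
have gD : good (E `\` tube r).
  split => //; apply: le_lt_trans fE; by apply: le_measure; rewrite ?inE.
split => //; apply/ler_addgt0Pr => e e0; have e2 : 0 < e / 2 by rewrite divr_gt0.
have := filter_ex (filterI (filterI (capS_near mb b1 gI e2) (capS_near mb b1 gD e2)) (nbhs_right_gt (0 : R))).
move=> [s [[hs1 hs2] s0]].
have hE := capS_le mb b1 gE s0.
have U0 : upper (2 * s) `<=` (halfspace : set V).
  by apply: upper_halfspace; apply: mulr_ge0 => //; exact: ltW.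
have [_ _ hp] := per_lateral mE fE (good_perU gE U0) r1 HM.
have ha : adhesion b s (E `&` tube r) + adhesion b s (E `\` tube r) = adhesion b s E.
  have [_ fI _] := gI; have [_ fD _] := gD.
  rewrite /adhesion -!mulrDr; congr (_ * _).
  rewrite -!RintegralD//; try exact: integrable_adhesion.
  apply: eq_Rintegral => x _; rewrite -!mulrDr; congr (_ * _).
  rewrite !indicE !in_setI ?in_setD ?in_setC.
  by case: (x \in E); case: (x \in tube r); rewrite /= ?addr0 ?add0r.
move: hs1 hs2 hE hp ha; rewrite /capS.
exact: ler_split_halves.
Qed.

(** For [2 * s < h] the strip of [adhesion] lies below the cut, and [height_cut] applies in
    [upper (2 * s)]. *)
Lemma capJ_below E (h : R) : good E -> 0 < h ->
  good (E `&` below h) /\ capJ b (E `&` below h) <= capJ b E.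
Proof.
move=> gE h0; have [mE fE [p Ep]] := gE.
have mI : measurable (E `&` below h) by apply: measurableI => //; exact: measurable_below.
have gI : good (E `&` below h).
  split => //; first by apply: le_lt_trans fE; apply: le_measure; rewrite ?inE.
  by exists p; exact: (height_cut (lexx 0) h0 mE fE Ep).
split => //; apply/ler_addgt0Pr => e e0.
have h2 : 0 < h / 2 by rewrite divr_gt0.
have := filter_ex (filterI (filterI (capS_near mb b1 gI e0) (nbhs_right_lt h2)) (nbhs_right_gt (0 : R))).
move=> [s [[hs1 sh] s0]]; have hE := capS_le mb b1 gE s0.
have s20 : 0 <= 2 * s by apply: mulr_ge0 => //; exact: ltW.
have s2h : 2 * s < h by rewrite mulrC -ltr_pdivlMr.
have U0 : upper (2 * s) `<=` (halfspace : set V) by exact: upper_halfspace.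
have hp : per (E `&` below h) (upper (2 * s)) <= per E (upper (2 * s)).
  by apply: per_le; apply: (height_cut s20 s2h mE fE); exact: good_perU gE U0.
have ha : adhesion b s (E `&` below h) = adhesion b s E.
  rewrite /adhesion; congr (_ * Rintegral _ _ _); apply/funext => x; congr (_ * _).
  congr (\1_ _ x); apply/seteqP; split => z [Ez /andP[z0 zs]].
    by split; [case: Ez|apply/andP].
  split; last by apply/andP.
  split => //; rewrite /below/=; apply: (le_trans zs); have : s < h by apply: (lt_trans sh); rewrite ltr_pdivrMr// mulr_natr mulr2n ltrDl.
  exact: ltW.
move: hs1 hE hp ha; rewrite /capS.
exact: ler_chain.
Qed.

(** The constant of [isoperimetric] when [L] is the root of twice the volume and the root of the
    volume is divided out. *)
Definition isoC : R := Num.sqrt n.+4%:R * rt n.+1 2.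

Lemma isoC_gt0 : 0 < isoC.
Proof.
apply: mulr_gt0; first by rewrite sqrtr_gt0.
by rewrite /rt powR_gt0.
Qed.

Lemma isoC_pow : (isoC ^+ n.+1) ^+ 2 = 4 * n.+4%:R ^+ n.+1.
Proof.
rewrite /isoC exprMn rtK// exprMn -exprM mulnC exprM sqr_sqrtr//.
by rewrite mulrC [2 ^+ 2]expr2 -natrM.
Qed.

Lemma isoperimetric_rt E : (1 <= n)%N -> good E -> E `<=` halfspace ->
  rt n.+1 (fine (mu E)) ^+ n <= isoC * per E halfspace.
Proof.
move=> n1 gE EH; have [mE fE [p Ep]] := gE; have P0 := per_ge0 Ep.
set v := fine (mu E); have v0 : 0 <= v by rewrite fine_ge0.
set g := rt n.+1 v; have g0 : 0 <= g by exact: rt_ge0.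
have gv : g ^+ n.+1 = v by rewrite /g rtK.
have [->|gn0] := eqVneq g 0.
  by rewrite expr0n gtn_eqF// mulr_ge0// ltW// isoC_gt0.
have gp : 0 < g by rewrite lt_neqAle eq_sym gn0.
have r2 : 0 < rt n.+1 (2 : R) by exact: powR_gt0.
have := @isoperimetric _ _ E _ (rt n.+1 2 * g) mE EH fE (good_per gE) (mulr_gt0 r2 gp).
rewrite exprMn gv rtK// => /(_ erefl); rewrite -/v -[X in X <= _]gv exprS => H.
rewrite -(ler_pM2l gp); apply: (le_trans H); rewrite /isoC.
by rewrite mulr_rearrange.
Qed.

Let excess E r := fine (mu (E `\` tube r)).

(** Either all short annuli at [r] hold more than [M] times their width, and then the root [g]
    decreases at rate [q]; or a cheap cut exists, and minimality, coercivity and the isoperimetric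
    inequality give [kappa <= w * q]. The constant 21/10 in [w] is 42/10 divided by the 2 of the
    coercivity bound. *)
Lemma lateral_decay E (kappa r0 T : R) : (1 <= n)%N -> good E -> E `<=` halfspace ->
  0 < kappa <= 1 / 2 -> (forall y, b y <= 1 - 2 * kappa) -> 1 <= r0 ->
  (forall r, r0 <= r -> good (E `&` tube r) -> capJ b E <= capJ b (E `&` tube r)) ->
  21 / 10 * n.+1%:R * isoC * rt n.+1 (fine (mu E)) / kappa < T ->
  mu (E `\` tube (r0 + T)) = 0%E.
Proof.
move=> n1 gE EH hk bk r01 Emin hT; have [mE fE [p Ep]] := gE.
have /andP[k0 k1] := hk.
have C0 := isoC_gt0.
have mD r : measurable (E `\` tube r) by apply: measurableD => //; exact: measurable_tube.
have fD r : (mu (E `\` tube r) < +oo)%E.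
  by apply: le_lt_trans fE; apply: le_measure; rewrite ?inE.
pose g r := rt n.+1 (excess E r).
have ex0 r : 0 <= excess E r by rewrite /excess fine_ge0.
have gE' r : g r ^+ n.+1 = excess E r by rewrite /g rtK.
have exmono r s : r <= s -> excess E s <= excess E r.
  move=> rs; apply: fine_le; rewrite ?ge0_fin_numE//; apply: le_measure; rewrite ?inE//.
  by move=> x [Ex nx]; split => // h; apply: nx; exact: le_trans h rs.
have gmono r s : r0 <= r -> r <= s -> g s <= g r by move=> _ rs; apply: rt_le => //; exact: exmono.
set g0 := rt n.+1 (fine (mu E)) in hT.
have g00 : 0 <= g0 by exact: rt_ge0.
have gg0 : g r0 <= g0.
  apply: rt_le => //; apply: fine_le; rewrite ?ge0_fin_numE//.
  by apply: le_measure; rewrite ?inE.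
pose w : R := 21 / 10 * n.+1%:R * isoC.
have w0 : 0 < w by apply: mulr_gt0 => //; apply: mulr_gt0 => //; exact: divr_gt0.
pose Q := kappa / w; have Q0 : 0 < Q by rewrite divr_gt0.
have T0 : 0 < T.
  by apply: le_lt_trans hT; apply: divr_ge0; [apply: mulr_ge0 => //; exact: ltW|exact: ltW].
have QT : g0 < Q * T.
  move: hT; rewrite -/w ltr_pdivrMr// => h.
  by rewrite /Q mulrAC ltr_pdivlMr// [g0 * _]mulrC [kappa * _]mulrC.
(* A rate strictly below [Q = kappa / w], which refutes the slow case, and still large enough to
   bring [g0] down to 0 within the length [T]. *)
pose q := (g0 + Q * T) / 2 / T.
have qT : q * T = (g0 + Q * T) / 2 by rewrite /q divfK ?gt_eqF.
have g0qT : g0 <= q * T by rewrite qT ler_pdivlMr// mulr_natr mulr2n lerD2l ltW.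
have q0 : 0 < q by rewrite /q divr_gt0// divr_gt0//; apply: ltr_wpDl => //; exact: mulr_gt0.
have qQ : q < Q by rewrite /q ltr_pdivrMr// ltr_pdivrMr// mulr_natr mulr2n ltrD2r.
have step r : r0 <= r -> 0 < g r -> exists2 e0 : R, 0 < e0 &
     forall e, 0 < e -> e < e0 -> g (r + e) <= g r - q * e.
  (* This [M] is the rate at which [g r ^+ n.+1] decreases when [g] decreases at rate [q]. *)
  move=> rr0 gr0; pose M := n.+1%:R * q * g r ^+ n.
  have gn0 : 0 < g r ^+ n by rewrite exprn_gt0.
  have [HM|] := pselect (slow_decay E r M); last first.
    move=> /existsNP[e0 /not_implyP[e00 /forallNP h]]; exists e0 => // e ep ee.
    have drop : M * e < fine (mu (E `&` annulus r e)).
      by rewrite ltNge; apply/negP => hh; apply: (h e); split.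
    have mA : measurable (E `&` annulus r e).
      rewrite (_ : E `&` annulus r e = (E `\` tube r) `\` (E `\` tube (r + e))).
        by apply: measurableD; exact: mD.
      apply/seteqP; split => x; rewrite /annulus /tube/= ltNge.
        by move=> [Ex /andP[/negP h1 h2]]; split => // -[_]; apply.
      move=> [[Ex /negP h1] h2]; split => //; rewrite h1/=.
      by apply: contrapT => h3; apply: h2; split.
    have fA : (mu (E `&` annulus r e) < +oo)%E.
      by apply: le_lt_trans fE; apply: le_measure; rewrite ?inE.
    have split_ : excess E r = fine (mu (E `&` annulus r e)) + excess E (r + e).
      rewrite /excess -fineD ?ge0_fin_numE//; congr fine; rewrite -measureU//.
        congr (mu _); apply/seteqP; split => x; rewrite /annulus /tube/= ltNge.
          move=> [Ex /negP h1]; have [h2|h2] := pselect (enorm (horiz x) <= r + e).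
            by left; rewrite h1 h2.
          by right.
        move=> [[Ex /andP[/negP h1 _]]|[Ex h1]]; first by split.
        by split => // h2; apply: h1; apply: (le_trans h2); rewrite lerDl ltW.
      rewrite -subset0 => x [[_ /andP[_ h1]] [_ h2]]; exact: h2.
    have re : r <= r + e by rewrite lerDl ltW.
    have hpow : g r ^+ n.+1 - g (r + e) ^+ n.+1 <= n.+1%:R * g r ^+ n * (g r - g (r + e)).
      exact: pow_diff_le (rt_ge0 _ _) (gmono _ _ rr0 re).
    have hd : fine (mu (E `&` annulus r e)) = g r ^+ n.+1 - g (r + e) ^+ n.+1.
      exact: (etrans (canRL (addrK _) (esym split_))
        (congr2 (fun u v => u - v) (esym (gE' r)) (esym (gE' (r + e))))).
    have hlt : n.+1%:R * g r ^+ n * (q * e) < n.+1%:R * g r ^+ n * (g r - g (r + e)).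
      by apply: lt_le_trans hpow; rewrite -hd; apply: le_lt_trans drop; rewrite /M -!mulrA (mulrCA (g r ^+ n)) (mulrC (g r ^+ n)) !mulrA (mulrAC _ e).
    rewrite ltr_pM2l in hlt; last by apply: mulr_gt0.
    by rewrite lerBrDr addrC -lerBrDr; exact: ltW.
  exfalso.
  have [gI gD hJ] := capJ_lateral gE (le_trans r01 rr0) HM.
  have hmin := Emin r rr0 gI.
  have hDH : E `\` tube r `<=` halfspace by move=> x [/EH].
  have hge := capJ_ge mb b1 gD hk bk.
  have hiso := isoperimetric_rt n1 gD hDH; rewrite -/(excess E r) -/(g r) in hiso.
  have h1 : 2 * kappa * per (E `\` tube r) halfspace <= 42 / 10 * M.
    by apply: (le_trans hge); rewrite -(lerD2l (capJ b (E `&` tube r))) (le_trans hJ)// lerD2r.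
  have h2 : kappa * g r ^+ n <= w * q * g r ^+ n.
    apply: (@le_trans _ _ (kappa * (isoC * per (E `\` tube r) halfspace))); first by rewrite ler_pM2l.
    have : isoC / 2 * (2 * kappa * per (E `\` tube r) halfspace) <= isoC / 2 * (42 / 10 * M).
      by apply: ler_wpM2l => //; apply: divr_ge0 => //; exact: ltW.
    by rewrite /M /w; exact: decay_rearrange.
  rewrite ler_pM2r// in h2; have : w * q < w * Q by rewrite ltr_pM2l.
  rewrite /Q (mulrC w (kappa / w)) divfK ?gt_eqF// => /(le_lt_trans h2).
  by rewrite ltxx.
have gT := dini_decay q0 (ltW T0) gmono (fun r => rt_ge0 _ _) step (le_trans gg0 g0qT).
have ex : excess E (r0 + T) = 0 by apply: (etrans (esym (gE' _))); rewrite gT expr0n.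
rewrite -[LHS]fineK; last by rewrite ge0_fin_numE.
exact: (congr1 EFin ex).
Qed.

End capillary_cuts.

(** * Null modifications, density-one representatives and the distance to the frontier *)

Section representatives.
Context {R : realType} {n : nat}.
Local Notation mu := (lebesgue_rV n.+1).
Local Notation nu := (lebesgue_rV n).
Local Notation V := 'rV[R]_n.+1.
Local Notation Y := 'rV[R]_n.
Implicit Types (x : V) (y : Y) (E F U : set V).

Definition null_diff E F := mu (E `\` F) = 0%E /\ mu (F `\` E) = 0%E.

Lemma ae_indic E F : measurable E -> measurable F -> null_diff E F ->
  {ae mu, forall x, \1_E x = \1_F x :> R}.
Proof.
move=> mE mF [h1 h2]; exists ((E `\` F) `|` (F `\` E)); split.
- by apply: measurableU; exact: measurableD.
- by rewrite measureU0//; exact: measurableD.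
- move=> x /= nh; have [Ex|nEx] := pselect (E x); have [Fx|nFx] := pselect (F x).
  + by exfalso; apply: nh; rewrite !indicE !mem_set.
  + by left.
  + by right.
  + by exfalso; apply: nh; rewrite !indicE !memNset.
Qed.

Lemma Rintegral_mul_ae E F (f : V -> R) : measurable E -> measurable F -> null_diff E F ->
  measurable_fun setT f -> \int[mu]_x (f x * \1_E x) = \int[mu]_x (f x * \1_F x).
Proof.
move=> mE mF EF mf; congr fine; apply: ae_eq_integral => //.
- by apply: (measurable_EFinP _ _).2; apply: measurable_funM => //; exact: measurable_indic.
- by apply: (measurable_EFinP _ _).2; apply: measurable_funM => //; exact: measurable_indic.
- by apply: filterS (ae_indic mE mF EF) => x h _; rewrite h.
Qed.

Lemma pairing_ae E F U phi : measurable E -> measurable F -> null_diff E F -> tfield U phi ->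
  pairing E phi = pairing F phi.
Proof.
move=> mE mF EF tphi; rewrite !pairing_indic.
under eq_Rintegral do rewrite mulrC; under [RHS]eq_Rintegral do rewrite mulrC.
by apply: Rintegral_mul_ae => //; exact: (divergence_measurable tphi).
Qed.

Lemma per_ae E F U : measurable E -> measurable F -> null_diff E F -> per E U = per F U.
Proof.
move=> mE mF EF; congr sup; apply/seteqP; split => _ [phi tphi <-]; exists phi => //.
  by rewrite (pairing_ae mE mF EF tphi).
by rewrite (pairing_ae mE mF EF tphi).
Qed.

Lemma mu_null_diff E F : measurable E -> measurable F -> null_diff E F -> mu E = mu F.
Proof.
move=> mE mF EF; have := ae_indic mE mF EF => h.
rewrite -[E in LHS]setIT -[F in RHS]setIT -!integral_indic//; apply: ae_eq_integral => //.
- exact: (measurable_EFinP _ _).2 (measurable_indic mE).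
- exact: (measurable_EFinP _ _).2 (measurable_indic mF).
- by apply: filterS h => x h _; rewrite h.
Qed.

Lemma good_ae E F : good E -> measurable F -> null_diff E F -> good F.
Proof.
move=> [mE fE [p Ep]] mF EF; split => //; first by rewrite -(mu_null_diff mE mF EF).
by exists p => phi tphi; rewrite -(pairing_ae mE mF EF tphi); exact: Ep.
Qed.

(** The two energies are compared through [capS], which consists of volume integrals and therefore
    ignores null sets. *)
Lemma capJ_ae (b : Y -> R) E F : measurable_fun setT b -> (forall y, `|b y| <= 1) ->
  good E -> good F -> null_diff E F -> capJ b E = capJ b F.
Proof.
move=> mb b1 gE gF EF.
suff H A B : good A -> good B -> null_diff A B -> capJ b A <= capJ b B.
  by apply/eqP; rewrite eq_le !H//; case: EF.
move=> gA gB AB; apply/ler_addgt0Pr => e e0.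
have := filter_ex (filterI (capS_near mb b1 gA e0) (nbhs_right_gt (0 : R))).
move=> [s [hA s0]]; have hB := capS_le mb b1 gB s0.
have [mA _ _] := gA; have [mB _ _] := gB.
have mf : measurable_fun setT (fun x : V => b (horiz x) * \1_(strip 0 s) x).
  apply: measurable_funM; last by apply: measurable_indic; exact: measurable_strip.
  by apply: measurableT_comp => //; exact: measurable_horiz.
have : adhesion b s A = adhesion b s B.
  rewrite /adhesion; congr (_ * _).
  have eX (X : set V) : (fun x : V => b (horiz x) * \1_(X `&` strip 0 s) x) =
      (fun x => (b (horiz x) * \1_(strip 0 s) x) * \1_X x).
    apply/funext => x; rewrite -mulrA; congr (_ * _); rewrite !indicE in_setI.
    by case: (x \in X); case: (x \in _); rewrite /= ?mulr1 ?mulr0.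
  by rewrite !eX; exact: Rintegral_mul_ae.
move: hA hB; rewrite /capS (per_ae _ mA mB AB).
have aux (a c p q r : R) : a <= p - q + e -> p - r <= c -> q = r -> a <= c + e by lra.
exact: aux.
Qed.

Lemma good_of_BVset F : BVset halfspace F -> [/\ good F, F `<=` halfspace & density_points F = F].
Proof.
move=> [mF FH [iF bvF] dF]; split => //; split => //.
- have /integrableP[_] := iF; apply: le_lt_trans.
  rewrite (eq_integral (fun x => (\1_F x)%:E)); last by move=> x _; rewrite /= ger0_norm.
  rewrite integral_indic//; last exact: (@measurable_upper R n 0).
  by rewrite (_ : F `&` halfspace = F)//; apply/seteqP; split => [x []//|x Fx]; split => //; exact: FH.
- have oH : open (halfspace : set V) := @upper_open R n 0.
  have := perimeter_ge0 oH mF; move: bvF; rewrite -/(perimeter F halfspace).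
  case eq : (perimeter F halfspace) => [r| |]// _ _.
  exists r => phi tphi; rewrite -lee_fin; apply: ((perimeter_leP r%:E oH mF).1 _ phi tphi).
  by rewrite eq.
Qed.

(** At a point of height at most 0, the cubes of half the size hanging below it miss the half-space,
    so [density_points_meet] applies. *)
Lemma density_points_halfspace F : measurable F -> F `<=` halfspace ->
  density_points F `<=` halfspace.
Proof.
move=> mF FH x dx; rewrite /halfspace/= ltNge; apply/negP => hx.
apply: (@density_points_meet _ _ F x (- (1 / 2) *: elast) 1 mF ltr01 _ _ dx).
- move=> r /andP[r0 _]; rewrite (_ : _ `&` _ = set0) ?measure0// -subset0 => z [/FH z0 /ball_rVP[_ /(_ ord_max)]].
  move: z0; rewrite /halfspace/= => z0; rewrite -!/(height _) scalerA height_elast ltr_distlC => /andP[_ h].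
  by lra.
- apply: (le_trans (norm_le_enorm _)); rewrite enormZ enorm_elast mulr1 normrN ger0_norm//; lra.
Qed.

Lemma density_null_diff F : measurable F -> null_diff F (density_points F).
Proof. exact: density_points_ae. Qed.

Lemma good_density F : good F -> good (density_points F).
Proof.
move=> gF; have [mF _ _] := gF; apply: (good_ae gF); first exact: measurable_density_points.
exact: density_null_diff.
Qed.

Lemma BVset_density F : good F -> F `<=` halfspace -> BVset halfspace (density_points F).
Proof.
move=> gF FH; have [mF _ _] := gF; have [mD fD [p Dp]] := good_density gF.
have oH : open (halfspace : set V) := @upper_open R n 0.
split.
- exact: mD.
- exact: density_points_halfspace.
- split; first by apply: (integrableS measurableT) => //; [exact: (@measurable_upper R n 0)|exact: integrable_indic_lty].
  by rewrite -/(perimeter _ halfspace) (perimeterE oH mD Dp) ltry.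
- exact: density_pointsK.
Qed.

Section distance.
Variable A : set V.
Hypothesis A0 : A !=set0.

Lemma edist_lb x (y : V) : A y -> Defs.edist x A <= enorm (x - y).
Proof.
move=> Ay; apply: ge_inf; last by exists y.
by exists 0 => _ [z _ <-]; exact: enorm_ge0.
Qed.

Lemma edist_ge x (c : R) : (forall y : V, A y -> c <= enorm (x - y)) -> c <= Defs.edist x A.
Proof.
move=> h; apply: lb_le_inf; last by move=> _ [y Ay <-]; exact: h.
by case: A0 => y Ay; exists (enorm (x - y)), y.
Qed.

Lemma edist_lip x z : Defs.edist x A <= Defs.edist z A + enorm (x - z).
Proof.
rewrite -lerBlDr; apply: edist_ge => y Ay; rewrite lerBlDr.
apply: (le_trans (edist_lb x Ay)); rewrite (_ : x - y = (z - y) + (x - z)); first exact: ler_enormD.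
by rewrite [RHS]addrC addrA subrK.
Qed.

Lemma measurable_edist : measurable_fun setT (fun x => Defs.edist x A).
Proof.
apply: continuous_measurable_rV => x; apply/(@cvgrPdist_le _ _ _ (nbhs x)) => e e0.
have s0 : 0 < Num.sqrt n.+1%:R + 1 :> R by rewrite ltr_wpDl ?sqrtr_ge0.
near=> z.
have xz : `|x - z| <= e / (Num.sqrt n.+1%:R + 1).
  near: z; apply/nbhs_ballP; exists (e / (Num.sqrt n.+1%:R + 1)) => /=; first by rewrite divr_gt0.
  by move=> z; rewrite -ball_normE/=; exact: ltW.
have ez : enorm (x - z) <= e.
  apply: (@le_trans _ _ (Num.sqrt n.+1%:R * `|x - z|)).
    apply: enorm_le => // i; rewrite [`|x - z|]mx_normrE.
    by apply: le_trans (le_bigmax _ _ (ord0, i)) => /=; rewrite ord1.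
  apply: (@le_trans _ _ ((Num.sqrt n.+1%:R + 1) * (e / (Num.sqrt n.+1%:R + 1)))).
    by apply: ler_pM; rewrite ?sqrtr_ge0// lerDl.
  by rewrite mulrC divfK ?gt_eqF.
rewrite ler_norml; have := edist_lip x z; have := edist_lip z x; rewrite (enormB z x) => h1 h2.
by apply/andP; split; lra.
Unshelve. all: by end_near. Qed.

Lemma edist_ge0 x : 0 <= Defs.edist x A.
Proof. by apply: edist_ge => y _; exact: enorm_ge0. Qed.

End distance.

(** On the upward ray from a point of [F], the last point of the closure is a frontier point, still
    in the half-space. Without such a point [dist_bdry] would be the default value of [inf] on the
    empty set. *)
Lemma frontier_nonempty F : F !=set0 -> F `<=` halfspace -> bounded_set F ->
  (halfspace `&` frontier F) !=set0.
Proof.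
move=> [x Fx] FH [M [_ /(_ (M + 1))]]; rewrite ltrDl => /(_ ltr01) hM.
pose S := [set t : R | 0 <= t /\ closure F (x + t *: elast)].
have S0 : S 0 by split => //; rewrite scale0r addr0; exact: subset_closure.
have hx (y : V) : F y -> height y <= M + 1.
  by move=> /hM hy; apply: (le_trans _ hy); apply: le_trans (ler_norm _) _;
    rewrite [`|y|]mx_normrE; apply: le_trans (le_bigmax _ _ (ord0, ord_max)).
have cF (y : V) : closure F y -> height y <= M + 1.
  move=> cy; rewrite leNgt; apply/negP => hy.
  have yM : 0 < height y - (M + 1) by rewrite subr_gt0.
  have [z [Fz /ball_rVP[_ /(_ ord_max)]]] := cy (ball y (height y - (M + 1))) (nbhsx_ballx _ _ yM).
  by have := hx z Fz; rewrite -!/(height _) ltr_distlC => ? /andP[? ?]; lra.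
have hS : has_sup S.
  split; [by exists 0|exists (M + 1 - height x) => t [_ /cF]].
  by rewrite height_elast; lra.
pose T := sup S; have T0 : 0 <= T by apply: ub_le_sup => //; exact: hS.2.
have x0 : 0 < height x by exact: FH.
exists (x + T *: elast); split; first by rewrite /halfspace/= height_elast ltr_pwDl.
split.
- move=> B /nbhs_ballP[e /= e0 eB].
  have e2 : 0 < e / 2 by rewrite divr_gt0.
  have [t [t0 ct] tT] := sup_adherent e2 hS; rewrite -/T in tT.
  have tle : t <= T by apply: ub_le_sup; [exact: hS.2|].
  have nb : nbhs (x + t *: elast) B.
    apply/nbhs_ballP; exists (e / 2) => //= z xz; apply: eB; rewrite (splitr e).
    apply: ball_triangle xz; apply: eball_sub_ball => //.
    rewrite /eball/= opprD addrACA subrr add0r -scalerBl enormZ enorm_elast mulr1.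
    by rewrite distrC ger0_norm ?subr_ge0// ltrBlDr addrC -ltrBlDr.
  by have [z] := ct B nb; exists z.
- rewrite /interior/= => /nbhs_ballP[e /= e0 eF].
  have : S (T + e / 2).
    split; first by rewrite addr_ge0// divr_ge0// ltW.
    apply: subset_closure; apply: eF; apply: eball_sub_ball => //.
    rewrite /eball/= opprD addrACA subrr add0r -scalerBl [T + _]addrC addrK enormZ enorm_elast mulr1.
    rewrite ger0_norm; last by rewrite divr_ge0// ltW.
    by rewrite ltr_pdivrMr// ltr_pMr// ltr1n.
  by move=> /(ub_le_sup hS.2); rewrite -/T; lra.
Qed.

End representatives.

Section linear_arithmetic.
Context {R : realType}.
Implicit Types a b c d e i p q t u v w x y z : R.

Lemma union_arith a b c d i u v w x y z : a + u <= c -> b + v <= d -> i + w = u + v ->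
  x + y <= a + b -> z <= x + i -> y + w <= c + d - z.
Proof. by move=> *; lra. Qed.

Lemma penalty_arith a c e p q t u z : a + u <= c -> p - q <= a -> z <= p -> t - e < z - q ->
  u <= c - t + e.
Proof. by move=> *; lra. Qed.

Lemma limit_arith a c e p q u z : 0 < e -> a <= p - q + e / 4 -> p - e / 4 < z ->
  u <= c - (z - q) + e / 4 -> a + u <= c + e.
Proof. by move=> *; lra. Qed.

Lemma telescope_arith a b c : a + 2 * b - 2 * c + (a + c) - a = a + 2 * b - c.
Proof. by lra. Qed.

Lemma excess_arith a b u w : b <= a -> 0 <= w -> a + (u + w) <= b + u -> w = 0.
Proof. by move=> *; lra. Qed.

End linear_arithmetic.

(** * Existence of minimizers, and the comparison of a minimizer with its cuts *)

Section existence.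
Context {R : realType} {n : nat}.
Local Notation mu := (lebesgue_rV n.+1).
Local Notation V := 'rV[R]_n.+1.
Local Notation Y := 'rV[R]_n.
Implicit Types (x : V) (y : Y) (E F H : set V).
Variables (b : Y -> R) (kappa lambda : R) (d : V -> R) (E0 : set V).
Hypotheses (n1 : (1 <= n)%N) (mb : measurable_fun setT b) (b1 : forall y, `|b y| <= 1)
  (hk : 0 < kappa <= 1 / 2) (bk : forall y, b y <= 1 - 2 * kappa) (l0 : 0 <= lambda)
  (md : measurable_fun setT d) (d0 : forall x, 0 <= d x)
  (mE0 : measurable E0).

Definition penalty F : \bar R := (\int[mu]_x (lambda * (\1_(F `+` E0) x * d x))%:E)%E.

(** A real level bounds the functional, so that the extended-real penalty of every set in play is
    finite. *)
Definition cost F (c : R) := [/\ good F, F `<=` halfspace & ((capJ b F)%:E + penalty F <= c%:E)%E].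

Let mX F : measurable F -> measurable (F `+` E0).
Proof. by move=> mF; apply: measurableU; exact: measurableD. Qed.

Let mp F : measurable F -> measurable_fun setT (fun x => lambda * (\1_(F `+` E0) x * d x)).
Proof.
move=> mF; apply: measurable_funM => //; apply: measurable_funM => //.
by apply: measurable_indic; exact: mX.
Qed.

Let p0 F x : 0 <= lambda * (\1_(F `+` E0) x * d x).
Proof. by apply: mulr_ge0 => //; exact: mulr_ge0. Qed.

Lemma penalty_ge0 F : (0 <= penalty F)%E.
Proof. by apply: integral_ge0 => x _; rewrite lee_fin. Qed.

Let in_symdiff F x : (x \in F `+` E0) = (x \in F) (+) (x \in E0).
Proof.
apply/idP/idP.
  rewrite inE => -[[Fx nE]|[Ex nF]]; first by rewrite (mem_set Fx) (memNset nE).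
  by rewrite (memNset nF) (mem_set Ex).
rewrite inE; have [/set_mem Fx|/negP nF] := boolP (x \in F).
  have [//|/negP nE] := boolP (x \in E0); left; split => // Ex.
  by apply: nE; rewrite inE.
have [/set_mem Ex|//] := boolP (x \in E0); right; split => // Fx.
by apply: nF; rewrite inE.
Qed.

(** Pointwise, the integrand depends on the set only through the membership of [x], and the
    intersection and the union have together the same two membership values as [E] and [F]. *)
Lemma penalty_modular E F : measurable E -> measurable F ->
  (penalty (E `&` F) + penalty (E `|` F) = penalty E + penalty F)%E.
Proof.
move=> mE mF.
have m1 := (measurable_EFinP _ _).2 (mp (measurableI _ _ mE mF)).
have m2 := (measurable_EFinP _ _).2 (mp (measurableU _ _ mE mF)).
have m3 := (measurable_EFinP _ _).2 (mp mE); have m4 := (measurable_EFinP _ _).2 (mp mF).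
have q0 G x : [set: V] x -> (0 <= (lambda * (\1_(G `+` E0) x * d x))%:E)%E.
  by move=> _; rewrite lee_fin.
rewrite /penalty -ge0_integralD//; [|exact: q0|exact: q0].
rewrite -ge0_integralD//; [|exact: q0|exact: q0].
apply: eq_integral => x _; rewrite -!EFinD -!mulrDr -!mulrDl; congr (lambda * (_ * _))%:E.
rewrite !indicE !in_symdiff in_setI in_setU.
by case: (x \in E); case: (x \in F); case: (x \in E0); rewrite /= ?addr0 ?add0r.
Qed.

Lemma capJ_ge0 F : good F -> 0 <= capJ b F.
Proof.
move=> gF; apply: le_trans (capJ_ge mb b1 gF hk bk).
by rewrite mulr_ge0 ?(per_ge0 (good_per gF))// mulr_ge0//; case/andP: hk => /ltW.
Qed.

Let penalty_fin F c : cost F c -> exists2 u : R, penalty F = u%:E & 0 <= u /\ capJ b F + u <= c.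
Proof.
move=> [_ _ h]; have := penalty_ge0 F; move: h.
case: (penalty F) => [u| |]// h h0; exists u => //; split; rewrite -lee_fin//.
Qed.

Lemma cost_per F c : cost F c -> per_bound F halfspace (c / (2 * kappa)).
Proof.
move=> cF; have [u _ [u0 hu]] := penalty_fin cF; have [gF _ _] := cF.
have k2 : 0 < 2 * kappa by apply: mulr_gt0 => //; case/andP: hk.
have hP : per F halfspace <= c / (2 * kappa).
  rewrite ler_pdivlMr// mulrC; apply: (le_trans (capJ_ge mb b1 gF hk bk)).
  by apply: le_trans hu; rewrite lerDl.
by move=> phi tphi; apply: le_trans hP; exact: (good_per gF).
Qed.

(** A root of the volume above 1 is at most its [n]-th power, which [isoperimetric_rt] bounds; all
    that counts is uniformity over a sublevel. *)
Definition volume_cap (c : R) : R := Num.max 1 (isoC (R := R) (n := n) * (c / (2 * kappa))) ^+ n.+1.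

Lemma cost_volume F c : cost F c -> (mu F <= (volume_cap c)%:E)%E.
Proof.
move=> cF; have [gF FH _] := cF; have [mF fF _] := gF.
have hP := per_le (cost_per cF).
have iso := isoperimetric_rt n1 gF FH; have C0 := @isoC_gt0 R n.
rewrite -[leLHS]fineK ?ge0_fin_numE// lee_fin; set v := fine (mu F) in iso *.
have v0 : 0 <= v by rewrite fine_ge0.
rewrite -(rtK (m := n.+1) _ v0)// /volume_cap lerXn2r ?nnegrE ?rt_ge0 ?le_max ?ler01//.
have [h|h] := leP (rt n.+1 v) 1; first by [].
apply/orP; right; apply: (@le_trans _ _ (rt n.+1 v ^+ n)).
  by rewrite -{1}[rt _ _]expr1 ler_eXn2l.
by apply: (le_trans iso); rewrite ler_pM2l.
Qed.

(** The intersection costs at least [I], so by submodularity the excess of the union over [I] is at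
    most the sum of the two excesses. *)
Lemma cost_setU (I : R) E F c c' : (forall H a, cost H a -> I <= a) ->
  cost E c -> cost F c' -> cost (E `|` F) (c + c' - I).
Proof.
move=> HI cE cF; have [u uE [u0 hu]] := penalty_fin cE; have [v vE [v0 hv]] := penalty_fin cF.
have [gE EH _] := cE; have [gF FH _] := cF; have [mE _ _] := gE; have [mF _ _] := gF.
have gI := good_setI gE gF; have gU := good_setU gE gF.
split => //; first by move=> x [/EH|/FH].
have := penalty_modular mE mF; rewrite uE vE -EFinD.
have := penalty_ge0 (E `&` F); have := penalty_ge0 (E `|` F).
case eI : (penalty (E `&` F)) => [i| |]//; case eU : (penalty (E `|` F)) => [w| |]// _ _ [e].
have cI : cost (E `&` F) (capJ b (E `&` F) + i).
  by split => //; [move=> x [/EH]|rewrite eI].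
have := HI _ _ cI; have := capJ_submodular mb b1 gE gF; rewrite -EFinD lee_fin.
exact: (union_arith hu hv e).
Qed.

(** Lower semicontinuity: for fixed [s] and [phi], [pairing] minus [adhesion] lies below the energy
    and converges along the sequence. It thus bounds the penalties from above, and Fatou's lemma
    carries this bound to [E]. *)
Lemma cost_lim (E_ : (set V)^nat) E Z c : (forall k, cost (E_ k) c) -> measurable E ->
  E `<=` halfspace -> measurable Z -> (mu Z < +oo)%E -> (forall k, E_ k `<=` Z) -> E `<=` Z ->
  (forall x, \forall k \near \oo, \1_(E_ k) x = \1_E x :> R) -> cost E c.
Proof.
move=> cE_ mE EH mZ fZ EZ_ EZ conv.
have gE_ k : good (E_ k) by have [] := cE_ k.
have mE_ k : measurable (E_ k) by have [] := gE_ k.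
have cvI x : (\1_(E_ k) x : R) @[k --> \oo] --> (\1_E x : R).
  by apply: cvg_near_cst; exact: conv.
have Ep : per_bound E halfspace (c / (2 * kappa)).
  move=> phi tphi; apply: (cvg_le_near (pairing_cvg tphi mE_ mE cvI)).
  by apply: nearW => k; exact: (cost_per (cE_ k)).
have fE : (mu E < +oo)%E by apply: le_lt_trans fZ; apply: le_measure; rewrite ?inE.
have gE : good E by split => //; exists (c / (2 * kappa)).
split => //; apply/lee_addgt0Pr => e e0.
have e4 : 0 < e / 4 by rewrite divr_gt0.
have := filter_ex (filterI (capS_near mb b1 gE e4) (nbhs_right_gt (0 : R))).
move=> [s [hs s0]].
have U0 : upper (2 * s) `<=` (halfspace : set V).
  by apply: upper_halfspace; apply: mulr_ge0 => //; exact: ltW.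
have [phi tphi hphi] := per_approx (good_perU gE U0) e4.
pose r k := pairing (E_ k) phi - adhesion b s (E_ k).
have rcv : r k @[k --> \oo] --> pairing E phi - adhesion b s E.
  apply: cvgB; first exact: pairing_cvg tphi mE_ mE cvI.
  apply: cvgM; first exact: cvg_cst.
  have mbh : measurable_fun setT (fun x : V => b (horiz x)).
    by apply: measurableT_comp => //; exact: measurable_horiz.
  have ms := @measurable_strip R n 0 s.
  apply: (@dominated_cvg_Rintegral _ _ _ _ _ measurableT _ _ (\1_Z : V -> R)).
  - by move=> k; apply: measurable_funM => //; apply: measurable_indic; exact: measurableI.
  - by apply: measurable_funM => //; apply: measurable_indic; exact: measurableI.
  - apply: aeW => x _; apply: cvg_near_cst; apply: filterS (conv x) => k hx.
    congr (_ * _); move: hx; rewrite !indicE !in_setI.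
    case: (x \in E_ k); case: (x \in E) => //= /eqP; rewrite ?oner_eq0 // eq_sym oner_eq0 //.
  - exact: integrable_indic_lty.
  - move=> k x _; rewrite normrM; apply: (@le_trans _ _ (1 * \1_Z x)); last by rewrite mul1r.
    apply: ler_pM => //; rewrite !indicE in_setI ger0_norm// ler_nat.
    have [/set_mem/EZ_ Zx|_] := boolP (x \in E_ k); last by [].
    by rewrite (mem_set Zx); case: (_ \in _).
have [K _ hK] : \forall k \near \oo, pairing E phi - adhesion b s E - e / 4 < r k.
  by apply: (cvgr_gt _ rcv); rewrite gtrBl.
have pen k : (penalty (E_ (K + k)%N) <= (c - (pairing E phi - adhesion b s E) + e / 4)%:E)%E.
  have [u -> [u0 hu]] := penalty_fin (cE_ (K + k)%N); rewrite lee_fin.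
  have h1 := capS_le mb b1 (gE_ (K + k)%N) s0.
  have h2 : pairing (E_ (K + k)%N) phi <= per (E_ (K + k)%N) (upper (2 * s)).
    exact: (good_perU (gE_ _) U0).
  have h3 := hK (K + k)%N (leq_addr _ _).
  exact: (penalty_arith hu h1 h2 h3).
have : (penalty E <= (c - (pairing E phi - adhesion b s E) + e / 4)%:E)%E.
  apply: (fatou_le (fun k => (measurable_EFinP _ _).2 (mp (mE_ (K + k)%N)))) pen.
  - by move=> k x _; rewrite lee_fin.
  - exact: (measurable_EFinP _ _).2 (mp mE).
  - by move=> x; rewrite lee_fin.
  - apply: aeW => x; apply: limn_einf_ge; have [k0 _ hk0] := conv x.
    exists k0 => // k /= kk; rewrite lee_fin.
    have := hk0 (K + k)%N (leq_trans kk (leq_addl _ _)); rewrite /= !indicE !in_symdiff.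
    by case: (x \in E_ _); case: (x \in E) => //= /eqP; rewrite ?oner_eq0 // eq_sym oner_eq0.
have := penalty_ge0 E; case: (penalty E) => [u| |]// u0; rewrite -!EFinD !lee_fin.
exact: (limit_arith e0 hs hphi).
Qed.

Lemma minimizer_exists (c0 : R) : cost E0 c0 ->
  exists E, cost E c0 /\ forall H a, cost H a -> ((capJ b E)%:E + penalty E <= a%:E)%E.
Proof.
move=> cE0; pose S := [set a | exists H, cost H a].
have S0 : S c0 by exists E0.
have Slb : lbound S 0.
  move=> a [H cH]; have [u _ [u0 hu]] := penalty_fin cH; have [gH _ _] := cH.
  by apply: le_trans hu; apply: addr_ge0 => //; exact: capJ_ge0.
have hS : has_inf S by split; [exists c0|exists 0].
pose I := inf S.
have HI H a : cost H a -> I <= a by move=> cH; apply: ge_inf; [exact: hS.2|exists H].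
(* The allowed excesses must be summable, because they add up under unions. *)
pose h (k : nat) : R := (1 / 2) ^+ k.
have h0 k : 0 < h k by rewrite exprn_gt0// divr_gt0.
have hS2 k : h k = 2 * h k.+1 by rewrite /h exprS mulrA mul1r divff// mul1r.
have /choice[F hF] : forall k, exists F, cost F (I + h k).
  move=> k; have [a [F cF] ha] := inf_adherent (h0 k) hS.
  exists F; have [gF FH hc] := cF; split => //; apply: (le_trans hc).
  by rewrite lee_fin ltW.
pose Un m j : set V := [set x | exists2 i, (i <= j)%N & F (m + i)%N x].
have UnS m j : Un m j.+1 = Un m j `|` F (m + j.+1)%N.
  apply/seteqP; split => x.
    move=> [i]; rewrite leq_eqVlt => /orP[/eqP -> Fx|ij Fx]; first by right.
    by left; exists i.
  by move=> [[i ij Fx]|Fx]; [exists i => //; exact: leqW|exists j.+1].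
have Un0 m : Un m 0%N = F m.
  apply/seteqP; split => x.
    by move=> [i]; rewrite leqn0 => /eqP ->; rewrite addn0.
  by move=> Fx; exists 0%N; rewrite ?addn0.
(* The sum of the excesses from [h m] to [h (m + j)]. *)
have cU m j : cost (Un m j) (I + 2 * h m - h (m + j)%N).
  elim: j => [|j IH].
    rewrite Un0 addn0; have := hF m; rewrite (_ : I + 2 * h m - h m = I + h m)//.
    by rewrite mulr_natl mulr2n addrA addrK.
  rewrite UnS; have := cost_setU HI IH (hF (m + j.+1)%N).
  rewrite addnS (_ : I + 2 * h m - h (m + j)%N + (I + h (m + j).+1) - I = I + 2 * h m - h (m + j).+1)//.
  by rewrite (hS2 (m + j)%N) telescope_arith.
have cU' m j : cost (Un m j) (I + 2 * h m).
  have [gU UH hc] := cU m j; split => //; apply: (le_trans hc).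
  by rewrite lee_fin gerBl ltW.
have gF k : good (F k) by have [] := hF k.
have mF k : measurable (F k) by have [] := gF k.
have mU m j : measurable (Un m j) by have [[]] := cU m j.
pose W m : set V := \bigcup_j Un m j.
have mW m : measurable (W m) by exact: bigcupT_measurable.
have Unmono m : {homo Un m : i j / (i <= j)%N >-> (i <= j)%O}.
  by move=> i j ij; apply/subsetPset => x [k ki Fx]; exists k => //; exact: leq_trans ij.
(* The volume bound is uniform in [j], so the union of a whole tail has finite measure and can
   dominate in [cost_lim]. *)
have fW m : (mu (W m) < +oo)%E.
  apply: (@le_lt_trans _ _ (volume_cap (I + 2 * h m))%:E); last exact: ltry.
  have cvW := nondecreasing_cvg_mu (mu := mu) (mU m) (mW m) (Unmono m).
  rewrite -(cvg_lim _ cvW)//; apply: lime_le; first by apply/cvg_ex; eexists; exact: cvW.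
  by apply: nearW => j; exact: (cost_volume (cU' m j)).
have WH m : W m `<=` halfspace by move=> x [j _ [i _ Fx]]; have [_ FH _] := hF (m + i)%N; exact: FH.
have cW m : cost (W m) (I + 2 * h m).
  apply: (cost_lim (cU' m) (mW m) (@WH m) (mW m) (fW m)) => //.
  - by move=> k x Ux; exists k.
  - move=> x; have [[j _ Ux]|nW] := pselect (W m x).
      exists j => // k /= jk; rewrite !indicE (mem_set (_ : W m x)); last by exists j.
      by rewrite mem_set//; have /subsetPset := Unmono m _ _ jk; exact.
    by apply: nearW => k; rewrite !indicE (memNset nW) memNset// => Ux; apply: nW; exists k.
have Wmono m j : (m <= j)%N -> W j `<=` W m.
  move=> mj x [k _ [i _ Fx]]; exists (j - m + i)%N => //; exists (j - m + i)%N => //.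
  by rewrite addnA subnKC.
(* The upper limit of the sets [F k]: increasing limits give the [W m], a decreasing limit gives
   [E], and [cost_lim] is used once for each. *)
pose E := \bigcap_m W m.
have mE : measurable E by exact: bigcapT_measurable.
have cE M : cost E (I + 2 * h M).
  apply: (@cost_lim (fun k => W (M + k)%N) E (W M)) => //.
  - move=> k; have [gW WH' hc] := cW (M + k)%N; split => //; apply: (le_trans hc).
    rewrite lee_fin lerD2l ler_pM2l// /h exprD ler_piMr ?exprn_ge0 ?divr_ge0//.
    by rewrite exprn_ile1 ?divr_ge0//; lra.
  - by move=> x Ex; exact: (WH M x (Ex M Logic.I)).
  - by move=> k; apply: Wmono; exact: leq_addr.
  - by move=> x Ex; exact: Ex.
  - move=> x; have [Ex|nE] := pselect (E x).
      by apply: nearW => k; rewrite !indicE (mem_set Ex) mem_set//; exact: Ex.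
    have [m nW] : exists m, ~ W m x.
      by apply: contrapT => /forallNP hn; apply: nE => m _; exact: contrapT (hn m).
    exists m => // k /= mk; rewrite !indicE (memNset nE) memNset// => Wx; apply: nW.
    by apply: Wmono Wx; apply: (leq_trans mk); exact: leq_addl.
have hEI : ((capJ b E)%:E + penalty E <= I%:E)%E.
  apply/lee_addgt0Pr => e e0; rewrite -EFinD.
  have e2 : 0 < e / 2 by rewrite divr_gt0.
  have [M _ /(_ M (leqnn M)) hM] : \forall k \near \oo, h k < e / 2.
    have hc : h k @[k --> \oo] --> (0 : R) by apply: cvg_expr; rewrite ger0_norm; lra.
    exact: (cvgr_lt _ hc).
  have [_ _ hc] := cE M; apply: (le_trans hc); rewrite lee_fin lerD2l.
  by rewrite mulrC -ler_pdivlMr// ltW.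
exists E; split.
- have [gE EH _] := cE 0%N; split => //; apply: (le_trans hEI); rewrite lee_fin; exact: HI cE0.
- by move=> H a cH; apply: (le_trans hEI); rewrite lee_fin; exact: HI cH.
Qed.

Lemma penalty_ae E F : measurable E -> measurable F -> null_diff E F -> penalty E = penalty F.
Proof.
move=> mE mF EF; apply: ae_eq_integral => //.
- exact: (measurable_EFinP _ _).2 (mp mE).
- exact: (measurable_EFinP _ _).2 (mp mF).
- apply: filterS (ae_indic mE mF EF) => x; rewrite !indicE !in_symdiff => h _.
  by move: h; case: (x \in E); case: (x \in F) => //= /eqP; rewrite ?oner_eq0 // eq_sym oner_eq0.
Qed.

Lemma penalty_below E (h : R) : measurable E -> E0 `<=` below h -> penalty E =
  (penalty (E `&` below h) + \int[mu]_x (lambda * (\1_(E `\` below h) x * d x))%:E)%E.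
Proof.
move=> mE Eh; have mB := @measurable_below R n h.
have mI : measurable (E `&` below h) by exact: measurableI.
have mD : measurable (E `\` below h) by exact: measurableD.
have mDf : measurable_fun setT (fun x => lambda * (\1_(E `\` below h) x * d x)).
  by apply: measurable_funM => //; apply: measurable_funM => //; exact: measurable_indic.
rewrite /penalty -ge0_integralD//.
- apply: eq_integral => x _; rewrite -EFinD -mulrDr -mulrDl; congr (lambda * (_ * _))%:E.
  rewrite !indicE !in_symdiff in_setI in_setD.
  have h0 : x \in E0 -> x \in below h by move=> /set_mem/Eh/mem_set.
  move: h0; case: (x \in E); case: (x \in E0); case: (x \in below h) => //= h0;
    rewrite ?addr0 ?add0r//; by have := h0 isT.
- by move=> x _; rewrite lee_fin.
- exact: (measurable_EFinP _ _).2 (mp mI).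
- by move=> x _; rewrite lee_fin mulr_ge0// mulr_ge0.
- exact: (measurable_EFinP _ _).2 mDf.
Qed.

Lemma penalty_tube E (r : R) : measurable E -> E0 `<=` tube r ->
  (penalty (E `&` tube r) <= penalty E)%E.
Proof.
move=> mE Er; have mT := @measurable_tube R n r.
have mI : measurable (E `&` tube r) by exact: measurableI.
apply: ge0_le_integral => //.
- by move=> x _; rewrite lee_fin.
- exact: (measurable_EFinP _ _).2 (mp mI).
- exact: (measurable_EFinP _ _).2 (mp mE).
- move=> x _; rewrite lee_fin ler_wpM2l// ler_wpM2r//.
  rewrite !indicE !in_symdiff in_setI ler_nat.
  have h0 : x \in E0 -> x \in tube r by move=> /set_mem/Er/mem_set.
  move: h0; case: (x \in E); case: (x \in E0); case: (x \in tube r) => //= h0;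
    by have := h0 isT.
Qed.

Definition cost_minimal E := forall F, good F -> F `<=` halfspace ->
  ((capJ b E)%:E + penalty E <= (capJ b F)%:E + penalty F)%E.

(** As the energy does not increase under the cut, minimality forces the integral of [d] over the
    removed part to vanish; [d] is positive there, so the part is null. *)
Lemma minimal_height E c h : cost E c -> cost_minimal E -> E0 `<=` below h -> 0 < h ->
  0 < lambda -> (forall x, h < height x -> 0 < d x) -> mu (E `\` below h) = 0%E.
Proof.
move=> cE Emin Eh h0 lp dpos; have [gE EH _] := cE; have [mE _ _] := gE.
have mB := @measurable_below R n h.
have mD : measurable (E `\` below h) by exact: measurableD.
have mDf : measurable_fun setT (fun x => lambda * (\1_(E `\` below h) x * d x)).
  by apply: measurable_funM => //; apply: measurable_funM => //; exact: measurable_indic.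
have [gI hJ] := capJ_below mb b1 gE h0.
have := Emin _ gI (fun x h => EH x h.1); rewrite (penalty_below mE Eh).
have [u uE [u0 _]] := penalty_fin cE.
have := penalty_ge0 (E `&` below h).
have : (penalty (E `&` below h) <= penalty E)%E.
  by rewrite (penalty_below mE Eh) leeDl// integral_ge0// => x _; rewrite lee_fin mulr_ge0// mulr_ge0.
rewrite uE; case: (penalty (E `&` below h)) => [v| |]// _ _ hle.
have i0 : (\int[mu]_x (lambda * (\1_(E `\` below h) x * d x))%:E = 0)%E.
  move: hle; have : (0 <= \int[mu]_x (lambda * (\1_(E `\` below h) x * d x))%:E)%E.
    by apply: integral_ge0 => x _; rewrite lee_fin mulr_ge0// mulr_ge0.
  case: (\int[mu]_x _)%E => [w| |]//; rewrite -!EFinD !lee_fin => w0 hw; congr (_%:E).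
  exact: excess_arith hJ w0 hw.
have : (\int[mu]_x `|(lambda * (\1_(E `\` below h) x * d x))%:E| = 0)%E.
  rewrite -[RHS]i0; apply: eq_integral => x _; rewrite gee0_abs// lee_fin.
  by rewrite mulr_ge0// mulr_ge0.
move=> /(ae_eq_integral_abs mu measurableT ((measurable_EFinP _ _).2 mDf)) [N [mN N0 hN]].
apply/eqP; rewrite eq_le measure_ge0 andbT -N0; apply: le_measure; rewrite ?inE//.
move=> x Dx; apply: hN => /= /(_ I) [] /eqP; rewrite indicE (mem_set Dx) mul1r mulf_eq0.
have hx : h < height x by rewrite ltNge; apply/negP; exact: Dx.2.
by rewrite !gt_eqF// dpos.
Qed.

Lemma minimal_tube E c r : cost E c -> cost_minimal E -> E0 `<=` tube r ->
  good (E `&` tube r) -> capJ b E <= capJ b (E `&` tube r).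
Proof.
move=> cE Emin Er gI; have [gE EH _] := cE; have [mE _ _] := gE.
have := Emin _ gI (fun x h => EH x h.1).
have [u uE _] := penalty_fin cE; have := penalty_tube mE Er; rewrite uE => hp h.
have := le_trans h (leeD2l (capJ b (E `&` tube r))%:E hp).
by rewrite -!EFinD lee_fin lerD2r.
Qed.

End existence.

Lemma density_points_avoid {R : realType} {n : nat} (E : set 'rV[R]_n.+1) x (c : R) :
  measurable E -> 0 < c -> lebesgue_rV n.+1 (E `&` ball x c) = 0%E -> ~ density_points E x.
Proof.
move=> mE c0 h; apply: (@density_points_meet _ _ E x 0 c mE c0); last by rewrite normr0.
move=> r /andP[r0 rc]; rewrite scaler0 addr0; apply/eqP; rewrite eq_le measure_ge0 andbT -h.
apply: le_measure; rewrite ?inE; [by apply: measurableI => //; exact: measurable_ball_rV|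
  by apply: measurableI => //; exact: measurable_ball_rV|].
apply: setIS; apply: le_ball; rewrite ler_pdivrMr//; apply: (le_trans (ltW rc)).
by rewrite ler_pMr// ler1n.
Qed.

Lemma midf_lt1 (R : realType) (a b : R) : a < b -> a < (a + b) / 2.
Proof. by move=> *; lra. Qed.

Lemma midf_lt2 (R : realType) (a b : R) : a < b -> (a + b) / 2 < b.
Proof. by move=> *; lra. Qed.

Lemma perimeter_arith (R : realType) (k p a u c q t : R) : 2 * k * p <= a -> 0 <= u -> a + u <= c ->
  c <= 2 * q -> q <= t -> p * k <= t.
Proof. by move=> *; lra. Qed.

(** * Proof of existence and confinement *)

Section assembly.
Context {R : realType} {n : nat}.
Local Notation mu := (lebesgue_rV n.+1).
Local Notation nu := (lebesgue_rV n).
Local Notation V := 'rV[R]_n.+1.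
Local Notation Y := 'rV[R]_n.
Implicit Types (x : V) (E F : set V).

(** The bounds on [beta] hold almost everywhere only; the clamped weight satisfies them everywhere
    and has the same capillary energy. *)
Definition clamp (kappa : R) (beta : Y -> R) (y : Y) : R :=
  Num.max (-1) (Num.min (beta y) (1 - 2 * kappa)).

Lemma measurable_clamp kappa beta : measurable_fun setT beta ->
  measurable_fun setT (clamp kappa beta).
Proof.
move=> mb; apply: measurable_maxr; first exact: measurable_cst.
by apply: measurable_minr => //; exact: measurable_cst.
Qed.

Lemma clamp_bounds (kappa : R) (beta : Y -> R) : 0 < kappa <= 1 / 2 ->
  forall y, `|clamp kappa beta y| <= 1 /\ clamp kappa beta y <= 1 - 2 * kappa.
Proof.
move=> /andP[k0 k1] y; have h : clamp kappa beta y <= 1 - 2 * kappa.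
  by rewrite /clamp ge_max ge_min lexx orbT andbT; lra.
have h2 : -1 <= clamp kappa beta y by rewrite /clamp le_max lexx.
by split => //; rewrite ler_norml h2/=; apply: (le_trans h); lra.
Qed.

Lemma clamp_id (kappa : R) (beta : Y -> R) y : -1 <= beta y <= 1 - 2 * kappa ->
  beta y = clamp kappa beta y.
Proof. by move=> /andP[h1 h2]; rewrite /clamp min_l// max_r. Qed.

Lemma AfunE (beta b : Y -> R) (lambda : R) (E0 F : set V) : measurable_fun setT b ->
  (forall y, `|b y| <= 1) -> {ae nu, forall y, beta y = b y} -> 0 <= lambda ->
  measurable E0 -> measurable_fun setT (dist_bdry E0) -> (forall x, 0 <= dist_bdry E0 x) ->
  good F -> Afun beta F E0 lambda = ((capJ b F)%:E + penalty lambda (dist_bdry E0) E0 F)%E.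
Proof.
move=> mb b1 hb l0 mE0 md d0 gF; have [mF _ _] := gF.
have mX : measurable (F `+` E0) by apply: measurableU; exact: measurableD.
rewrite /Afun (capillaryE mb b1 gF hb); congr (_ + _)%E.
rewrite integral_mkcond epatch_indic /penalty -ge0_integralZl//.
- by apply: eq_integral => x _ /=; rewrite -!EFinM [_ * dist_bdry _ _]mulrC.
- apply: emeasurable_funM; apply: (measurable_EFinP _ _).2 => //; exact: measurable_indic.
- by move=> x _; rewrite /= -EFinM lee_fin mulr_ge0.
Qed.

Lemma bounded_height (E0 : set V) : bounded_set E0 -> E0 !=set0 ->
  has_sup [set height x | x in closure E0].
Proof.
move=> [M [_ /(_ (M + 1))]]; rewrite ltrDl => /(_ ltr01) hM [x0 Ex0].
split; first by exists (height x0), x0 => //; exact: subset_closure.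
exists (M + 1) => _ [y cy <-]; rewrite leNgt; apply/negP => hy.
have yM : 0 < height y - (M + 1) by rewrite subr_gt0.
have [z [Ez /ball_rVP[_ /(_ ord_max)]]] := cy (ball y (height y - (M + 1))) (nbhsx_ballx _ _ yM).
have : height z <= M + 1.
  apply: (le_trans _ (hM z Ez)); apply: (le_trans (ler_norm _)).
  by rewrite [`|z|]mx_normrE; apply: le_trans (le_bigmax _ _ (ord0, ord_max)).
by rewrite -!/(height _) ltr_distlC => ? /andP[? ?]; lra.
Qed.

Lemma dist_bdry_gt0 (E0 : set V) (h : R) x : (halfspace `&` frontier E0) !=set0 ->
  (forall y, closure E0 y -> height y <= h) -> h < height x -> 0 < dist_bdry E0 x.
Proof.
move=> A0 hc hx; apply: (@lt_le_trans _ _ (height x - h)); first by rewrite subr_gt0.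
apply: edist_ge => // y [_ [cy _]].
apply: (@le_trans _ _ (height (x - y))).
  by rewrite /height !mxE lerD2l lerN2; exact: hc.
by apply: (le_trans (ler_norm _)); exact: enorm_coord.
Qed.

(** The summand 1 in [H_of] leaves room for a unit cube about a point of height at least [1 + h];
    such a cube meets [E] in a null set, so its centre is not a density point. *)
Lemma null_above E (h : R) : measurable E -> density_points E = E ->
  mu (E `\` below h) = 0%E -> forall x, E x -> height x < 1 + h.
Proof.
move=> mE dE h0 x Ex; rewrite ltNge; apply/negP => hx; rewrite -dE in Ex.
apply: (density_points_avoid mE ltr01 _ Ex); apply/eqP; rewrite eq_le measure_ge0 andbT -h0.
apply: le_measure; rewrite ?inE.
- by apply: measurableI => //; exact: measurable_ball_rV.
- by apply: measurableD => //; exact: measurable_below.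
- move=> z [Ez /ball_rVP[_ /(_ ord_max)]]; rewrite -!/(height _) ltr_distlC => /andP[h1 h2].
  split => //; rewrite /below/= => h3.
  by have := lt_le_trans h1 h3; rewrite ltrBlDl ltNge hx.
Qed.

(** The gap between [r] and [s] leaves room for a cube, with its radius scaled to pass from the sup
    norm to the Euclidean one. *)
Lemma null_outside E (r s : R) : measurable E -> density_points E = E -> r < s ->
  mu (E `\` tube r) = 0%E -> forall x, E x -> enorm (horiz x) < s.
Proof.
move=> mE dE rs h0 x Ex; rewrite ltNge; apply/negP => hx; rewrite -dE in Ex.
have c0 : 0 < (s - r) / (Num.sqrt n%:R + 1) by rewrite divr_gt0 ?subr_gt0// ltr_wpDl ?sqrtr_ge0.
apply: (density_points_avoid mE c0 _ Ex); apply/eqP; rewrite eq_le measure_ge0 andbT -h0.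
apply: le_measure; rewrite ?inE.
- by apply: measurableI => //; exact: measurable_ball_rV.
- by apply: measurableD => //; exact: measurable_tube.
- move=> z [Ez /ball_rVP[_ hz]]; split => //; rewrite /tube/= => hr.
  have h1 : enorm (horiz x) <= enorm (horiz z) + enorm (horiz x - horiz z).
    rewrite (_ : enorm (horiz x) = enorm (horiz z + (horiz x - horiz z))); first exact: ler_enormD.
    by rewrite addrC subrK.
  have h2 : enorm (horiz x - horiz z) < s - r.
    apply: (@le_lt_trans _ _ (Num.sqrt n%:R * ((s - r) / (Num.sqrt n%:R + 1)))).
      apply: enorm_le; first exact: ltW.
      by move=> i; rewrite !mxE; apply: ltW; exact: hz.
    by rewrite mulrCA gtr_pMr ?subr_gt0// ltr_pdivrMr ?mul1r ?ltrDl// ltr_wpDl ?sqrtr_ge0.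
  by move: (le_lt_trans h1 (ler_ltD hr h2)); rewrite addrC subrK ltNge hx.
Qed.

End assembly.

Theorem theorem4p1 (R : realType) (n : nat) (hn : (1 <= n)%N)
    (E0 : set 'rV[R]_n.+1) (hE0 : BVset halfspace E0)
    (E0_nonempty : E0 !=set0) (E0_bounded : bounded_set E0)
    (kappa : R) (hkappa : 0 < kappa <= 1 / 2)
    (beta : 'rV[R]_n -> R) (hbeta : beta \in Lfun (lebesgue_rV n) +oo%E)
    (beta_bounds : {ae lebesgue_rV n, forall y, -1 <= beta y <= 1 - 2 * kappa})
    (lambda : R) (hlambda : 1 <= lambda)
    (D : R) (hD : 0 < D) (E0_cylinder : E0 `<=` cylinder D (H_of E0)) :
  (exists E, is_minimizer beta E0 lambda E) /\
  (forall E, is_minimizer beta E0 lambda E ->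
    E `<=` cylinder (R0_of kappa D E0) (H_of E0)).
Proof.
have [gE0 E0H dE0] := good_of_BVset hE0; have [mE0 fE0 _] := gE0.
have /andP[k0 k1] := hkappa.
have l0 : 0 < lambda by exact: lt_le_trans hlambda.
have A0 := frontier_nonempty E0_nonempty E0H E0_bounded.
have md : measurable_fun setT (dist_bdry E0) by exact: measurable_edist.
have d0 x : 0 <= dist_bdry E0 x by exact: edist_ge0.
have mbeta : measurable_fun setT beta.
  by have := sub_Lfun_mfun hbeta; rewrite inE.
pose b := clamp kappa beta.
have mb : measurable_fun setT b by exact: measurable_clamp.
have b1 y : `|b y| <= 1 by have [] := clamp_bounds beta hkappa y.
have bk y : b y <= 1 - 2 * kappa by have [] := clamp_bounds beta hkappa y.
have hb : {ae lebesgue_rV n, forall y, beta y = b y}.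
  by apply: filterS beta_bounds => y; exact: clamp_id.
pose J := capJ b; pose pen := penalty lambda (dist_bdry E0) E0.
have AE F : good F -> Afun beta F E0 lambda = ((J F)%:E + pen F)%E.
  exact: (AfunE mb b1 hb (ltW l0) mE0 md d0).
have pen0 : pen E0 = 0%E.
  rewrite /pen /penalty integral0_eq// => x _; rewrite indicE memNset ?mul0r ?mulr0//.
  by move=> [[? nE]|[? nE]]; exact: nE.
have cE0 : cost b lambda (dist_bdry E0) E0 E0 (J E0).
  by split => //; rewrite -/(pen E0) pen0 adde0.
have pge F : (0 <= pen F)%E by apply: integral_ge0 => x _; rewrite lee_fin mulr_ge0 ?(ltW l0)// mulr_ge0.
split.
  have [E [cE Emin]] := minimizer_exists hn mb b1 hkappa bk (ltW l0) md d0 mE0 cE0.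
  have [gE EH _] := cE; have [mE _ _] := gE; have gD := good_density gE.
  have ED := density_null_diff mE; have [mD _ _] := gD.
  exists (density_points E); split; first exact: BVset_density.
  move=> F /good_of_BVset[gF FH _]; rewrite !AE// /J -(capJ_ae mb b1 gE gD ED).
  rewrite /pen -(penalty_ae lambda md mE0 mE mD ED).
  have := pge F; rewrite /pen; case eF : (penalty _ _ _ F) => [u| |]// _; last by rewrite addey// leey.
  by rewrite -EFinD; apply: (Emin F); split => //; rewrite eF.
move=> E [bvE Emin]; have [gE EH dE] := good_of_BVset bvE; have [mE fE _] := gE.
have cE : cost b lambda (dist_bdry E0) E0 E (J E0).
  split => //; have := Emin _ hE0; rewrite !AE// pen0 adde0; exact.
(* Passing to density points extends minimality from density-one sets to all [good] subsets of the
   half-space, such as the cuts of [E]. *)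
have hmin : cost_minimal b lambda (dist_bdry E0) E0 E.
  move=> F gF FH; have [mF _ _] := gF; have gD := good_density gF.
  have FD := density_null_diff mF; have [mD _ _] := gD.
  have := Emin _ (BVset_density gF FH); rewrite !AE// /J -(capJ_ae mb b1 gF gD FD).
  by rewrite /pen -(penalty_ae lambda md mE0 mF mD FD).
have hS := bounded_height E0_bounded E0_nonempty.
pose h := sup [set height x | x in closure E0].
have hc y : closure E0 y -> height y <= h.
  by move=> cy; apply: ub_le_sup; [exact: hS.2|exists y].
have E0h : E0 `<=` below h by move=> x Ex; apply: hc; exact: subset_closure.
have h0 : 0 < h.
  by have [x Ex] := E0_nonempty; apply: lt_le_trans (E0H x Ex) (E0h x Ex).
have nullh := minimal_height mb b1 (ltW l0) md d0 mE0 cE hmin E0h h0 l0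
  (fun x => dist_bdry_gt0 A0 hc).
(* The summand 1 in [R0_of] provides the radius at least 1 that [lateral_cutoff] assumes. *)
have D1 : 1 <= D + 1 by rewrite lerDr ltW.
have E0t r : D + 1 <= r -> E0 `<=` tube r.
  move=> Dr x /E0_cylinder[+ _]; rewrite /eball/= subr0 => hx.
  by apply: (le_trans (ltW hx)); apply: le_trans Dr; rewrite lerDl.
have tmin r : D + 1 <= r -> good (E `&` tube r) -> J E <= J (E `&` tube r).
  by move=> Dr; exact: (minimal_tube (ltW l0) md d0 mE0 cE hmin (E0t r Dr)).
have [P0 hP0] := per_bound_full gE0 E0H.
have PE : fine (perimeter E0 setT) = per E0 setT by rewrite (perimeterE openT mE0 hP0).
(* [2 * kappa] times the perimeter of [E] is at most its energy, hence at most that of [E0], which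
   is at most twice the perimeter of [E0]. *)
have perE : per E halfspace <= per E0 setT / kappa.
  have [u _ [u0 hu]] : exists2 u, pen E = u%:E & 0 <= u /\ J E + u <= J E0.
    have [_ _] := cE; have := pge E; rewrite /pen; case: (penalty _ _ _ _) => [u| |]// u0 hu.
    by exists u => //; split; rewrite -lee_fin.
  have h1 := capJ_ge mb b1 gE hkappa bk; have h2 := capJ_le mb b1 gE0.
  have h3 : per E0 halfspace <= per E0 setT.
    by apply: per_le; apply: per_boundS (per_ub hP0).
  rewrite ler_pdivlMr//; exact: (perimeter_arith h1 u0 hu h2 h3).
have x0 : 0 <= fine (perimeter E0 setT) / kappa.
  by rewrite PE divr_ge0 ?(ltW k0)// (per_ge0 hP0).
have hiso := isoperimetric_rt hn gE EH.
have hg : rt n.+1 (fine (lebesgue_rV n.+1 E)) ^+ n <= isoC (R := R) (n := n) * (fine (perimeter E0 setT) / kappa).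
  by apply: (le_trans hiso); rewrite ler_pM2l ?isoC_gt0// PE.
have hR := radius_bound hn k0 x0 (rt_ge0 _ _) (ltW (@isoC_gt0 R n)) (@isoC_pow R n) hg.
pose M := Num.max (8 ^+ (n ^ 2 + n + 1) * (fine (perimeter E0 setT) / kappa) `^ (n.+1%:R / n%:R))
  (4 * mu_of n kappa).
(* The strictness of [radius_bound] is used twice: [lateral_decay] needs a length above the decay
   length, and [null_outside] a gap between [D + 1 + T] and the final radius. *)
have [T [T1 T2]] : exists T, 21 / 10 * n.+1%:R * isoC (R := R) (n := n) * rt n.+1 (fine (lebesgue_rV n.+1 E)) / kappa < T /\ T < M.
  by exists ((21 / 10 * n.+1%:R * isoC (R := R) (n := n) * rt n.+1 (fine (lebesgue_rV n.+1 E)) / kappa + M) / 2);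
    split; [exact: midf_lt1|exact: midf_lt2].
have nullT := lateral_decay mb b1 hn gE EH hkappa bk D1 tmin T1.
move=> x Ex; split.
  rewrite /eball/= subr0; apply: (null_outside mE dE _ nullT Ex).
  by rewrite /R0_of -/M ltrD2l.
by rewrite (EH x Ex) /H_of (null_above mE dE nullh Ex).
Qed.
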